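(* The simple objects of $\mathrm{Rep}^0\,V_1(\mathfrak{sl}(2|1))$ are of the form $\mathcal F(S)$, where $S$ is either $\widehat A_{n,\ell}$ for $n\in\frac12+\mathbb{Z}$, $\ell\in\mathbb{Z}\setminus\{0\}$ or $n\in\mathbb{Z}$, $\ell=0$, or $\widehat V_{n,e}$ for $n\in\mathbb{C}$, $e\in\mathbb{C}\setminus\mathbb{Z}$ such that $n+e\in\frac12+\mathbb{Z}$. For any simple $V_1(\mathfrak{gl}(1|1))$-module $S$ such that $\mathcal F(S)$ is an object of $\mathrm{Rep}^0\,V_1(\mathfrak{sl}(2|1))$, $\mathcal F(P_S)$ is a projective cover of $\mathcal F(S)$ in $\mathrm{Rep}^0\,V_1(\mathfrak{sl}(2|1))$, where $P_S$ is a projective cover of $S$ in $\mathcal O_1^{fin}$.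
   Context: **Algebra.** $\mathfrak{gl}(1|1)$ has even basis $N,E$ and odd basis $\psi^\pm$; nonzero brackets $[N,\psi^\pm]=\pm\psi^\pm$, $\{\psi^+,\psi^-\}=E$; invariant form $\kappa(N,E)=\kappa(E,N)=1$, $\kappa(\psi^+,\psi^-)=-\kappa(\psi^-,\psi^+)=1$, zero on other pairs of basis elements. $\widehat{\mathfrak{gl}(1|1)}$ is the affinization, $[a_r,b_s]=[a,b]_{r+s}+r\kappa(a,b)\delta_{r+s,0}\mathbf{k}$. $V_1(\mathfrak{gl}(1|1))$ is the level-$1$ module induced from the trivial $\mathfrak{gl}(1|1)$-module, a vertex operator superalgebra with conformal vector $\omega=\frac12(N_{-1}E_{-1}+E_{-1}N_{-1}-\psi^+_{-1}\psi^-_{-1}+\psi^-_{-1}\psi^+_{-1})\mathbf 1+\frac12E_{-1}^2\mathbf 1$. **Modules (level 1).** $V_{n,e}$ is the 2-dimensional Verma $\mathfrak{gl}(1|1)$-module with highest-weight vector $v$, $Nv=(n+\frac12)v$, $Ev=ev$, $\psi^+v=0$; $A_n$ is 1-dimensional with $N=n$, $E=\psi^\pm=0$. $\widehat V_{n,e}$ is the level-1 induced module from $V_{n,e}$ (irreducible iff $e\notin\mathbb Z$); $\widehat A_{n,0}$ is induced from $A_n$; for $\ell\in\mathbb{Z}\setminus\{0\}$, $\widehat A_{n,\ell}$ is the unique irreducible quotient of $\widehat V_{n,\ell}$. The simple (grading-restricted) $V_1(\mathfrak{gl}(1|1))$-modules are the $\widehat V_{n,e}$, $e\notin\mathbb{Z}$,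 and $\widehat A_{n,\ell}$, $\ell\in\mathbb{Z}$; each has a projective cover in $\mathcal O_1^{fin}$. **Categories.** $\mathcal O_1^{fin}$ is the supercategory of finite-length grading-restricted generalized $V_1(\mathfrak{gl}(1|1))$-modules on which $N_0,E_0$ act semisimply; it is a braided tensor supercategory with the vertex algebraic (Huang–Lepowsky–Zhang) tensor product $\boxtimes$ and twist $\theta=e^{2\pi iL_0}$. $\mathrm{Ind}(\mathcal O_1^{fin})$ is the category of generalized $V_1(\mathfrak{gl}(1|1))$-modules that are unions of submodules in $\mathcal O_1^{fin}$, with the extended braided tensor structure. **The extension.** $V_1(\mathfrak{sl}(2|1))$, the simple affine vertex operator superalgebra of $\mathfrak{sl}(2|1)$ at level $1$, is (a known result) a simple current extension $V_1(\mathfrak{sl}(2|1))=\bigoplus_{m\in\mathbb{Z}}\widehat A_{\varepsilon(m),m}$ of $V_1(\mathfrak{gl}(1|1))$, where $\varepsilon(m)=\frac12,0,-\frac12$ for $m>0,m=0,m<0$. Hence it is a supercommutative algebra $A$ in $\mathrm{Ind}(\mathcal O_1^{fin})$. $\mathrm{Rep}\,V_1(\mathfrak{sl}(2|1))$ is the category of objects $X$ of $\mathrm{Ind}(\mathcal O_1^{fin})$ with an associative unital even action $\mu_X:A\boxtimes X\to X$; $\mathrm{Rep}^0$ is the full subcategory of local ones, i.e. $\mu_X\circ\mathcal M_{A,X}=\mu_X$ with $\mathcal M$ the double braiding (equivalently, generalized $V_1(\mathfrak{sl}(2|1))$-modules lying in $\mathrm{Ind}(\mathcal O_1^{fin})$).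 $\mathcal F:\mathcal O_1^{fin}\to\mathrm{Rep}\,V_1(\mathfrak{sl}(2|1))$ is the induction functor $\mathcal F(W)=A\boxtimes W$. **Projective cover.** A projective cover of $S$ is a projective object $P$ with a surjection $\pi:P\to S$ such that for every surjection $q:Q\to S$ with $Q$ projective there is a surjection $\widetilde q:Q\to P$ with $q=\pi\circ\widetilde q$. *)

(* Defs.v *)
From HB Require Import structures.
From mathcomp Require Import all_boot all_order all_algebra.
From mathcomp Require Import boolp classical_sets fsbigop reals.
From mathcomp Require Import topology normedtype summability sequences.
From mathcomp Require Import exp trigo.
From mathcomp Require Import complex.

Set Implicit Arguments.
Unset Strict Implicit.
Unset Printing Implicit Defensive.

Import Order.TTheory GRing.Theory Num.Theory numFieldNormedType.Exports.
Local Open Scope classical_set_scope.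
Local Open Scope ring_scope.
Local Open Scope complex_scope.

(* The ground field is R[i], the complex numbers over R : realType.  Sums     *)
(* \sum_(j \in [set: T]) F j are sums over the support of F, which is finite  *)
(* in every use below (by truncation of the operators involved).              *)

Definition cexp (R : realType) (z : R[i]) : R[i] :=
  (expR (complex.Re z))%:C * (cos (complex.Im z) +i* sin (complex.Im z)).

Definition ipi (R : realType) : R[i] := 0 +i* pi.

Definition gbin (R : realType) (x : R[i]) (j : nat) : R[i] :=
  (\prod_(i < j) (x - i%:R)) / j`!%:R.

(* x is the sum of the (absolutely convergent) family f *)
Definition abs_sum (K : numFieldType) (I : choiceType) (f : I -> K) (x : K) :
    Prop :=
  partial_sum f @ totally --> x.

(* A Z/2-grading is encoded by its parity involution par: the even and odd    *)
(* parts are the eigenspaces of par for 1 and -1.                             *)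
Record superspace (R : realType) := Superspace {
  svect :> lmodType R[i];
  par : {linear svect -> svect};
  parK : involutive par }.

Definition homog (R : realType) (S : superspace R) (p : bool) (v : S) : Prop :=
  par S v = (-1) ^+ p *: v.

(* v |-> (-1)^(p |v|) v *)
Definition parX (R : realType) (S : superspace R) (p : bool) (v : S) : S :=
  if p then par S v else v.

Definition sum_of (R : realType) (M : lmodType R[i]) (P : M -> Prop) (v : M) :
    Prop :=
  exists s : seq M, (forall u, u \in s -> P u) /\ v = \sum_(u <- s) u.

Definition fin_span (R : realType) (M : lmodType R[i]) (P : M -> Prop) : Prop :=
  exists s : seq M, forall v, P v ->
    exists c : nat -> R[i], v = \sum_(i < size s) c i *: s`_i.

(* Y v n is the mode v_n in Y(v,x) = \sum_n v_n x^(-n-1).                     *)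
Record vosa_on (R : realType) (S : superspace R) := VosaOn {
  Y : S -> int -> {linear S -> S};
  vac : S;
  omega : S;
  Y_linear : forall n w, linear (fun v => Y v n w);
  Y_par : forall v n w, par S (Y v n w) = Y (par S v) n (par S w);
  vac_even : homog false vac;
  omega_even : homog false omega;
  Y_trunc : forall v w, exists n0 : int, forall n, n0 <= n -> Y v n w = 0;
  Y_vac : forall n w, Y vac n w = if n == -1 then w else 0;
  Y_creation : forall v, Y v (-1) vac = v;
  Y_creation0 : forall v n, 0 <= n -> Y v n vac = 0;
  (* coefficient form of the Jacobi identity *)
  Y_borcherds : forall p q (a b c : S) (m n k : int),
    homog p a -> homog q b ->
    \sum_(j \in [set: nat])
       gbin m%:~R j *: Y (Y a (n + j%:Z) b) (m + k - j%:Z) c =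
    \sum_(j \in [set: nat]) ((-1) ^+ j * gbin n%:~R j) *:
       (Y a (m + n - j%:Z) (Y b (k + j%:Z) c)
        - ((-1) ^+ (p && q) * (-1) ^ n) *:
            Y b (n + k - j%:Z) (Y a (m + j%:Z) c));
  Y_virasoro : exists cc : R[i], forall (m n : int) w,
    Y omega (m + 1) (Y omega (n + 1) w) - Y omega (n + 1) (Y omega (m + 1) w) =
    (m - n)%:~R *: Y omega (m + n + 1) w
    + (if m + n == 0 then cc * (m ^+ 3 - m)%:~R / 12%:R else 0) *: w;
  Y_translation : forall v n w,
    Y (Y omega 0 v) n w = - n%:~R *: Y v (n - 1) w;
  wt_int : forall v,
    sum_of (fun u => exists n : int, Y omega 1 u = n%:~R *: u) v;
  wt_fin : forall n : int, fin_span (fun u => Y omega 1 u = n%:~R *: u);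
  wt_bounded : exists n0 : int, forall (n : int) u,
    n < n0 -> Y omega 1 u = n%:~R *: u -> u = 0 }.

(* basis N, E, psi^+, psi^- *)
Inductive gl11 := glN | glE | psip | psim.

Definition glpar (a : gl11) : bool :=
  match a with glN | glE => false | psip | psim => true end.

(* [a, b] = (glbr a b).1 (glbr a b).2 *)
Definition glbr (R : realType) (a b : gl11) : R[i] * gl11 :=
  match a, b with
  | glN, psip => (1, psip)
  | psip, glN => (-1, psip)
  | glN, psim => (-1, psim)
  | psim, glN => (1, psim)
  | psip, psim | psim, psip => (1, glE)
  | _, _ => (0, glE)
  end.

Definition glform (R : realType) (a b : gl11) : R[i] :=
  match a, b with
  | glN, glE | glE, glN => 1
  | psip, psim => 1
  | psim, psip => -1
  | _, _ => 0
  end.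

Record glmod (R : realType) := Glmod {
  gspace :> superspace R;
  gact : gl11 -> {linear gspace -> gspace};
  gact_par : forall a u,
    par gspace (gact a u) = (-1) ^+ glpar a *: gact a (par gspace u);
  gact_br : forall a b u,
    gact a (gact b u) - (-1) ^+ (glpar a && glpar b) *: gact b (gact a u) =
    (glbr R a b).1 *: gact (glbr R a b).2 u }.

(* the one-dimensional module A_n, spanned by u *)
Definition is_A (R : realType) (n : R[i]) (U : glmod R) (u : U) : Prop :=
  [/\ u != 0, exists p, homog p u, forall w, exists c, w = c *: u,
      gact U glN u = n *: u &
      [/\ gact U glE u = 0, gact U psip u = 0 & gact U psim u = 0]].

(* the Verma module V_(n,e), with highest-weight vector v *)
Definition is_Verma (R : realType) (n e : R[i]) (U : glmod R) (v : U) : Prop :=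
  [/\ exists p, homog p v,
      gact U glN v = (n + 2%:R^-1) *: v, gact U glE v = e *: v,
      gact U psip v = 0 &
      (forall w, exists! c : R[i] * R[i],
         w = c.1 *: v + c.2 *: gact U psim v)].

(* an action of the affinization of gl(1|1) with k acting by 1; act a r = a_r *)
Definition level1 (R : realType) (M : superspace R)
    (act : gl11 -> int -> {linear M -> M}) : Prop :=
  (forall a r w, par M (act a r w) = (-1) ^+ glpar a *: act a r (par M w)) /\
  (forall a b r s w,
     act a r (act b s w) - (-1) ^+ (glpar a && glpar b) *: act b s (act a r w) =
     (glbr R a b).1 *: act (glbr R a b).2 (r + s) w
     + (if r + s == 0 then r%:~R * glform R a b else 0) *: w).

(* even gl(1|1)-maps into the vectors annihilated by a_r, r > 0 *)
Definition top_map (R : realType) (U : glmod R) (M : superspace R)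
    (act : gl11 -> int -> {linear M -> M}) (j : {linear U -> M}) : Prop :=
  [/\ forall u, par M (j u) = j (par U u),
      forall a u, j (gact U a u) = act a 0 (j u) &
      forall a (r : int) u, 0 < r -> act a r (j u) = 0].

Definition affine_map (R : realType) (M M' : superspace R)
    (act : gl11 -> int -> {linear M -> M})
    (act' : gl11 -> int -> {linear M' -> M'}) (F : {linear M -> M'}) : Prop :=
  (forall w, par M' (F w) = F (par M w)) /\
  (forall a r w, F (act a r w) = act' a r (F w)).

(* (M, act) is the level 1 module induced from U along j, where a_r, r > 0,   *)
(* annihilates U                                                              *)
Definition is_induced (R : realType) (U : glmod R) (M : superspace R)
    (act : gl11 -> int -> {linear M -> M}) (j : {linear U -> M}) : Prop :=
  [/\ level1 act, top_map act j &
      forall (M' : superspace R) (act' : gl11 -> int -> {linear M' -> M'}),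
        level1 act' -> forall f : {linear U -> M'}, top_map act' f ->
        exists F : {linear M -> M'},
          [/\ affine_map act act' F, forall u, F (j u) = f u &
              forall F' : {linear M -> M'}, affine_map act act' F' ->
                (forall u, F' (j u) = f u) -> F' =1 F]].

(* cur a is a_(-1) 1 *)
Record V1gl11 (R : realType) := V1Gl11 {
  Vs :> superspace R;
  Vv : vosa_on Vs;
  cur : gl11 -> Vs;
  V_induced : exists (U : glmod R) (u : U) (j : {linear U -> Vs}),
    [/\ is_A 0 u, is_induced (fun a r => Y Vv (cur a) r) j & j u = vac Vv];
  V_omega : omega Vv =
    2%:R^-1 *: (Y Vv (cur glN) (-1) (cur glE) + Y Vv (cur glE) (-1) (cur glN)
                - Y Vv (cur psip) (-1) (cur psim)
                + Y Vv (cur psim) (-1) (cur psip))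
    + 2%:R^-1 *: Y Vv (cur glE) (-1) (cur glE) }.

Record vmod (R : realType) (V : V1gl11 R) := Vmod {
  Ws :> superspace R;
  Yw : V -> int -> {linear Ws -> Ws};
  Yw_linear : forall n w, linear (fun v => Yw v n w);
  Yw_par : forall v n w, par Ws (Yw v n w) = Yw (par V v) n (par Ws w);
  Yw_trunc : forall v w, exists n0 : int, forall n, n0 <= n -> Yw v n w = 0;
  Yw_vac : forall n w, Yw (vac (Vv V)) n w = if n == -1 then w else 0;
  Yw_borcherds : forall p q (a b : V) (w : Ws) (m n k : int),
    homog p a -> homog q b ->
    \sum_(j \in [set: nat])
       gbin m%:~R j *: Yw (Y (Vv V) a (n + j%:Z) b) (m + k - j%:Z) w =
    \sum_(j \in [set: nat]) ((-1) ^+ j * gbin n%:~R j) *: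
       (Yw a (m + n - j%:Z) (Yw b (k + j%:Z) w)
        - ((-1) ^+ (p && q) * (-1) ^ n) *:
            Yw b (n + k - j%:Z) (Yw a (m + j%:Z) w)) }.

Definition adjoint (R : realType) (V : V1gl11 R) : vmod V :=
  @Vmod R V V (Y (Vv V)) (Y_linear (Vv V)) (Y_par (Vv V))
    (Y_trunc (Vv V)) (Y_vac (Vv V)) (@Y_borcherds R V (Vv V)).

Definition Lop (R : realType) (V : V1gl11 R) (W : vmod V) (n : int) :
  {linear W -> W} := Yw W (omega (Vv V)) (n + 1).

Definition curw (R : realType) (V : V1gl11 R) (W : vmod V) (a : gl11)
    (r : int) :
  {linear W -> W} := Yw W (cur V a) r.

Definition gen_wt (R : realType) (V : V1gl11 R) (W : vmod V) (h : R[i])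
    (w : W) : Prop :=
  exists k, iter k (fun u => Lop W 0 u - h *: u) w = 0.

Definition submod (R : realType) (V : V1gl11 R) (W : vmod V)
    (D : W -> Prop) : Prop :=
  [/\ D 0, forall c u w, D u -> D w -> D (c *: u + w),
      forall u, D u -> D (par W u) & forall v n u, D u -> D (Yw W v n u)].

Definition irreducible (R : realType) (V : V1gl11 R) (W : vmod V) : Prop :=
  (exists w : W, w != 0) /\
  (forall D : W -> Prop, submod D ->
     (forall w, D w -> w = 0) \/ (forall w, D w)).

Definition finite_length (R : realType) (V : V1gl11 R) (W : vmod V) : Prop :=
  exists (n : nat) (U : nat -> W -> Prop),
    [/\ forall i, submod (U i), forall w, U 0%N w -> w = 0, forall w, U n w,
        forall i w, U i w -> U i.+1 w &
        forall i (D : W -> Prop), submod D ->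
          (forall w, U i w -> D w) -> (forall w, D w -> U i.+1 w) ->
          (forall w, D w -> U i w) \/ (forall w, U i.+1 w -> D w)].

Definition grading_restricted (R : realType) (V : V1gl11 R) (W : vmod V) :
    Prop :=
  [/\ forall w : W, sum_of (fun u => exists h, gen_wt h u) w,
      forall h, fin_span (fun u : W => gen_wt h u) &
      forall h, exists n0 : nat, forall n : nat, (n0 <= n)%N ->
        forall u : W, gen_wt (h - n%:R) u -> u = 0].

Definition semisimple_op (R : realType) (M : lmodType R[i]) (f : M -> M) :
    Prop :=
  forall w, sum_of (fun u => exists c : R[i], f u = c *: u) w.

(* objects of O_1^fin *)
Definition in_Ofin (R : realType) (V : V1gl11 R) (W : vmod V) : Prop :=
  [/\ finite_length W, grading_restricted W,
      semisimple_op (curw W glN 0) & semisimple_op (curw W glE 0)].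

(* parity-p morphisms: f(v_n w) = (-1)^(p |v|) v_n f(w) *)
Record hom (R : realType) (V : V1gl11 R) (p : bool) (W1 W2 : vmod V) := Hom {
  hfun :> {linear W1 -> W2};
  hom_par : forall w, hfun (par W1 w) = (-1) ^+ p *: par W2 (hfun w);
  hom_Y : forall v n w, hfun (Yw W1 v n w) = Yw W2 (parX p v) n (hfun w) }.

Definition surj (A B : Type) (f : A -> B) : Prop := forall y, exists x, f x = y.

Program Definition hid (R : realType) (V : V1gl11 R) (W : vmod V) :
  hom false W W := @Hom R V false W W idfun _ _.
Next Obligation. by move=> *; rewrite scale1r. Qed.
Next Obligation. by []. Qed.

Program Definition hcomp (R : realType) (V : V1gl11 R) (W1 W2 W3 : vmod V)
    (g : hom false W2 W3) (f : hom false W1 W2) : hom false W1 W3 :=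
  @Hom R V false W1 W3 (g \o f) _ _.
Next Obligation.
by move=> *; rewrite /= !hom_par !scale1r !hom_par !scale1r.
Qed.
Next Obligation. by move=> *; rewrite /= !hom_Y. Qed.

(* objects of Ind(O_1^fin): unions of submodules in O_1^fin *)
Definition in_Ind (R : realType) (V : V1gl11 R) (W : vmod V) : Prop :=
  forall w : W, exists (M : vmod V) (f : hom false M W),
    [/\ in_Ofin M, injective f & exists x, f x = w].

Lemma Ofin_Ind (R : realType) (V : V1gl11 R) (W : vmod V) :
  in_Ofin W -> in_Ind W.
Proof. by move=> hW w; exists W, (hid W); split=> //; exists w. Qed.

Record ofin (R : realType) (V : V1gl11 R) := OFin {
  ofin_mod :> vmod V; ofinP : in_Ofin ofin_mod }.

Record indO (R : realType) (V : V1gl11 R) := IndO {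
  indO_mod :> vmod V; indOP : in_Ind indO_mod }.

Coercion ofin_ind (R : realType) (V : V1gl11 R) (W : ofin V) : indO V :=
  IndO (Ofin_Ind (ofinP W)).

(* \hat V_(n,e) *)
Definition is_Vhat (R : realType) (V : V1gl11 R) (n e : R[i]) (M : vmod V) :
    Prop :=
  exists (U : glmod R) (v : U) (j : {linear U -> M}),
    is_Verma n e v /\ is_induced (curw M) j.

(* \hat A_(n,l) *)
Definition is_Ahat (R : realType) (V : V1gl11 R) (n : R[i]) (l : int)
    (S : vmod V) : Prop :=
  if l == 0 then
    exists (U : glmod R) (u : U) (j : {linear U -> S}),
      is_A n u /\ is_induced (curw S) j
  else irreducible S /\
    exists (M : vmod V) (f : hom false M S), is_Vhat n l%:~R M /\ surj f.

(* An even operator of type (W3; W1 W2):                                      *)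
(* I w1 h k w2 is the coefficient of x^(-h-1) (log x)^k in I(w1,x)w2.         *)
Record intw (R : realType) (V : V1gl11 R) (W1 W2 W3 : vmod V) := Intw {
  icoef :> W1 -> R[i] -> nat -> {linear W2 -> W3};
  i_linear : forall h k w2, linear (fun w1 => icoef w1 h k w2);
  i_par : forall w1 h k w2,
    par W3 (icoef w1 h k w2) = icoef (par W1 w1) h k (par W2 w2);
  i_trunc : forall w1 w2 h, exists m0 : nat, forall m k : nat,
    (m0 <= m)%N -> icoef w1 (h + m%:R) k w2 = 0;
  i_log : forall w1 w2 h, exists k0 : nat, forall k,
    (k0 <= k)%N -> icoef w1 h k w2 = 0;
  i_borcherds : forall p q (v : V) (w1 : W1) (w2 : W2) (m n : int) h k,
    homog p v -> homog q w1 ->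
    \sum_(j \in [set: nat])
       gbin m%:~R j *: icoef (Yw W1 v (n + j%:Z) w1) (h + m%:~R - j%:R) k w2 =
    \sum_(j \in [set: nat]) ((-1) ^+ j * gbin n%:~R j) *:
       (Yw W3 v (m + n - j%:Z) (icoef w1 (h + j%:R) k w2)
        - ((-1) ^+ (p && q) * (-1) ^ n) *:
            icoef w1 (h + n%:~R - j%:R) k (Yw W2 v (m + j%:Z) w2));
  i_derivative : forall w1 h k w2,
    icoef (Lop W1 (-1) w1) h k w2 =
    - h *: icoef w1 (h - 1) k w2 + k.+1%:R *: icoef w1 (h - 1) k.+1 w2 }.

(* f (I(w1,x)w2) = \sum_n (y_n w1 w2) x^(-n-1) *)
Definition realizes (R : realType) (V : V1gl11 R) (W1 W2 W3 X : vmod V)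
    (I : intw W1 W2 W3) (f : W3 -> X) (y : W1 -> int -> W2 -> X) : Prop :=
  (forall w1 (n : int) w2, f (I w1 n%:~R 0%N w2) = y w1 n w2) /\
  (forall w1 h k w2, (k != 0%N) \/ (forall n : int, h <> n%:~R) ->
     f (I w1 h k w2) = 0).

Definition graded_dual (R : realType) (V : V1gl11 R) (W : vmod V)
    (f : {scalar W}) : Prop :=
  exists s : seq R[i], forall h (w : W), gen_wt h w -> h \notin s -> f w = 0.

(* x^(-h-1) (log x)^k at log x = z *)
Definition xlog (R : realType) (z h : R[i]) (k : nat) : R[i] :=
  cexp (z * (- h - 1)) * z ^+ k.

(* < f, I(w1,e^z)w2 > *)
Definition ieval (R : realType) (V : V1gl11 R) (W1 W2 W3 : vmod V)
    (I : intw W1 W2 W3) (z : R[i]) (f : W3 -> R[i]) (w1 : W1) (w2 : W2) :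
    R[i] :=
  \sum_(hk \in [set: R[i] * nat]) xlog z hk.1 hk.2 * f (I w1 hk.1 hk.2 w2).

(* < f, I1(w1,r1) I2(w2,r2)w3 > = x.  For w2, w3 of generalized weights, the  *)
(* terms of fixed h form the projection of I2(w2,r2)w3 to one weight space,   *)
(* so that this is the sum over the intermediate weights.                     *)
Definition product_is (R : realType) (V : V1gl11 R) (W1 W2 W3 M W : vmod V)
    (I1 : intw W1 M W) (I2 : intw W2 W3 M) (r1 r2 : R) (f : W -> R[i])
    (w1 : W1) (w2 : W2) (w3 : W3) (x : R[i]) : Prop :=
  abs_sum (fun h => \sum_(k \in [set: nat])
    xlog (ln r2)%:C h k * ieval I1 (ln r1)%:C f w1 (I2 w2 h k w3)) x.

(* < f, I1(I2(w1,r0)w2,r2)w3 > = x *)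
Definition iterate_is (R : realType) (V : V1gl11 R) (W1 W2 W3 M W : vmod V)
    (I1 : intw M W3 W) (I2 : intw W1 W2 M) (r0 r2 : R) (f : W -> R[i])
    (w1 : W1) (w2 : W2) (w3 : W3) (x : R[i]) : Prop :=
  abs_sum (fun h => \sum_(k \in [set: nat])
    xlog (ln r0)%:C h k * ieval I1 (ln r2)%:C f (I2 w1 h k w2) w3) x.

(* coefficient of x^(-h-1) (log x)^k in e^(x L_(-1)) I(w1,e^(i pi)x)w2 *)
Definition skew (R : realType) (V : V1gl11 R) (W1 W2 W3 : vmod V)
    (I : intw W1 W2 W3) (w1 : W1) (h : R[i]) (k : nat) (w2 : W2) : W3 :=
  \sum_(j \in [set: nat]) j`!%:R^-1 *: iter j (Lop W3 (-1))
    (\sum_(l \in [set: nat])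
       ('C(l, k)%:R * ipi R ^+ (l - k) * cexp (ipi R * (- (h + j%:R) - 1)))
         *: I w1 (h + j%:R) l w2).

(* The tensor product of two objects carries the universal even intertwining  *)
(* operator tenI.  The associativity isomorphisms go from W1 (W2 W3) to       *)
(* (W1 W2) W3 and are fixed by their values at real r1 > r2 > r1 - r2 > 0.    *)
Record hlz (R : realType) (V : V1gl11 R) := Hlz {
  one_fin : in_Ofin (adjoint V);
  unitO : indO V := OFin one_fin;
  ten : indO V -> indO V -> indO V;
  tenI : forall W1 W2 : indO V, intw W1 W2 (ten W1 W2);
  ten_univ : forall (W1 W2 X : indO V) (I : intw W1 W2 X),
    exists f : hom false (ten W1 W2) X,
      (forall w1 h k w2, f (tenI W1 W2 w1 h k w2) = I w1 h k w2) /\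
      (forall f' : hom false (ten W1 W2) X,
         (forall w1 h k w2, f' (tenI W1 W2 w1 h k w2) = I w1 h k w2) ->
         f' =1 f);
  ten_fin : forall W1 W2 : indO V, in_Ofin W1 -> in_Ofin W2 ->
    in_Ofin (ten W1 W2);
  tmap : forall (p q : bool) (W1 X1 W2 X2 : indO V),
    hom p W1 X1 -> hom q W2 X2 -> hom (p (+) q) (ten W1 W2) (ten X1 X2);
  tmapE : forall p q (W1 X1 W2 X2 : indO V) (f : hom p W1 X1)
      (g : hom q W2 X2) w1 h k w2,
    tmap f g (tenI W1 W2 w1 h k w2) = tenI X1 X2 (f (parX q w1)) h k (g w2);
  lunit : forall W : indO V, hom false (ten unitO W) W;
  lunit_bij : forall W, bijective (lunit W);
  lunitE : forall W : indO V, realizes (tenI unitO W) (lunit W) (Yw W);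
  assoc : forall W1 W2 W3 : indO V,
    hom false (ten W1 (ten W2 W3)) (ten (ten W1 W2) W3);
  assoc_bij : forall W1 W2 W3, bijective (assoc W1 W2 W3);
  assocE : forall (W1 W2 W3 : indO V) (r1 r2 : R) w1 w2 w3
      (f : {scalar ten (ten W1 W2) W3}),
    graded_dual f -> r2 < r1 -> r1 - r2 < r2 -> 0 < r1 - r2 ->
    exists x,
      product_is (tenI W1 (ten W2 W3)) (tenI W2 W3) r1 r2
        (f \o assoc W1 W2 W3) w1 w2 w3 x /\
      iterate_is (tenI (ten W1 W2) W3) (tenI W1 W2) (r1 - r2) r2 f w1 w2 w3 x;
  braid : forall W1 W2 : indO V, hom false (ten W1 W2) (ten W2 W1);
  braid_bij : forall W1 W2, bijective (braid W1 W2);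
  braidE : forall (W1 W2 : indO V) p q w1 w2 h k,
    homog p w1 -> homog q w2 ->
    braid W1 W2 (tenI W1 W2 w1 h k w2) =
    (-1) ^+ (p && q) *: skew (tenI W2 W1) w2 h k w1;
  assoc_nat : forall p q r (W1 X1 W2 X2 W3 X3 : indO V) (f : hom p W1 X1)
      (g : hom q W2 X2) (l : hom r W3 X3) t,
    assoc X1 X2 X3 (tmap f (tmap g l) t) = tmap (tmap f g) l (assoc W1 W2 W3 t);
  braid_nat : forall p q (W1 X1 W2 X2 : indO V) (f : hom p W1 X1)
      (g : hom q W2 X2) t,
    braid X1 X2 (tmap f g t) = (-1) ^+ (p && q) *: tmap g f (braid W1 W2 t);
  triangle : forall (W1 W2 : indO V) t,
    tmap (hcomp (lunit W1) (braid W1 unitO)) (hid W2) (assoc W1 unitO W2 t) =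
    tmap (hid W1) (lunit W2) t;
  pentagon : forall (W1 W2 W3 W4 : indO V) t,
    assoc (ten W1 W2) W3 W4 (assoc W1 W2 (ten W3 W4) t) =
    tmap (assoc W1 W2 W3) (hid W4)
      (assoc W1 (ten W2 W3) W4 (tmap (hid W1) (assoc W2 W3 W4) t));
  hexagon : forall (W1 W2 W3 : indO V) t,
    assoc W3 W1 W2 (braid (ten W1 W2) W3 (assoc W1 W2 W3 t)) =
    tmap (braid W1 W3) (hid W2)
      (assoc W1 W3 W2 (tmap (hid W1) (braid W2 W3) t));
  (* the second hexagon, composed with associativity isomorphisms *)
  hexagon' : forall (W1 W2 W3 : indO V) t s,
    assoc W2 W1 W3 s = tmap (braid W1 W2) (hid W3) (assoc W1 W2 W3 t) ->
    assoc W2 W3 W1 (tmap (hid W2) (braid W1 W3) s) =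
    braid W1 (ten W2 W3) t }.

(* C^(2|1) has basis e_0, e_1 (even), e_2 (odd) *)
Definition par3 (i : 'I_3) : bool := i == 2%N :> nat.

Definition strace (R : realType) (x : 'M[R[i]]_3) : R[i] :=
  \sum_i (-1) ^+ par3 i * x i i.

Definition mx_homog (R : realType) (p : bool) (x : 'M[R[i]]_3) : Prop :=
  forall i j, x i j != 0 -> par3 i (+) par3 j = p.

(* The simple affine vertex operator superalgebra of                          *)
(* sl(2|1) = {x | strace x = 0}, with form strace (x y), at level 1; J x is   *)
(* x_(-1) 1.  That the J x are primary of weight 1 determines the conformal   *)
(* vector.                                                                    *)
Definition is_V1sl21 (R : realType) (S : superspace R) (A : vosa_on S) : Prop :=
  exists J : {linear 'M[R[i]]_3 -> S},
    [/\ forall p x, mx_homog p x -> strace x = 0 -> homog p (J x),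
        forall p q x y, mx_homog p x -> mx_homog q y ->
          strace x = 0 -> strace y = 0 ->
          [/\ Y A (J x) 0 (J y) = J (x *m y - (-1) ^+ (p && q) *: (y *m x)),
              Y A (J x) 1 (J y) = strace (x *m y) *: vac A &
              forall n, 2 <= n -> Y A (J x) n (J y) = 0],
        forall x, strace x = 0 ->
          Y A (omega A) 1 (J x) = J x /\ Y A (omega A) 2 (J x) = 0,
        forall D : S -> Prop, D (vac A) ->
          (forall c u w, D u -> D w -> D (c *: u + w)) ->
          (forall x n u, strace x = 0 -> D u -> D (Y A (J x) n u)) ->
          forall u, D u &
        vac A != 0 /\
        forall D : S -> Prop, D 0 ->
          (forall c u w, D u -> D w -> D (c *: u + w)) ->
          (forall u, D u -> D (par S u)) ->
          (forall a n u, D u -> D (Y A a n u) /\ D (Y A u n a)) ->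
          (forall u, D u -> u = 0) \/ (forall u, D u)].

Definition eps (R : realType) (m : int) : R[i] :=
  if 0 < m then 2%:R^-1 else if m == 0 then 0 else - 2%:R^-1.

(* V_1(sl(2|1)) as an object of Ind(O_1^fin), the vertex algebra inclusion    *)
(* extU of V_1(gl(1|1)), its decomposition, and the corresponding algebra     *)
(* (extA, extmu, extU) in Ind(O_1^fin)                                        *)
Record extension (R : realType) (V : V1gl11 R) (T : hlz V) := Extension {
  extA : indO V;
  extV : vosa_on extA;
  ext_sl21 : is_V1sl21 extV;
  extU : hom false (unitO T) extA;
  extU_vac : extU (vac (Vv V)) = vac extV;
  extU_omega : extU (omega (Vv V)) = omega extV;
  extU_Y : forall v n a, Y extV (extU v) n a = Yw extA v n a;
  ext_decomp : exists (S : int -> vmod V) (i : forall m, hom false (S m) extA),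
    [/\ forall m, is_Ahat (eps R m) m (S m),
        forall a, exists (s : seq int) (u : forall m, S m),
          a = \sum_(m <- s) i m (u m) &
        forall (s : seq int) (u : forall m, S m), uniq s ->
          \sum_(m <- s) i m (u m) = 0 -> forall m, m \in s -> u m = 0];
  extmu : hom false (ten T extA extA) extA;
  extmuE : realizes (tenI T extA extA) extmu (Y extV) }.

Record actobj (R : realType) (V : V1gl11 R) (T : hlz V) (A : extension T) :=
  Actobj {
    rX :> indO V;
    rmu : hom false (ten T (extA A) rX) rX }.

Definition is_Rep (R : realType) (V : V1gl11 R) (T : hlz V) (A : extension T)
    (X : actobj A) : Prop :=
  (forall t, rmu X (tmap T (hid (extA A)) (rmu X) t) =
     rmu X (tmap T (extmu A) (hid X) (assoc T (extA A) (extA A) X t))) /\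
  (forall t, rmu X (tmap T (extU A) (hid X) t) = lunit T X t).

Definition is_local (R : realType) (V : V1gl11 R) (T : hlz V) (A : extension T)
    (X : actobj A) : Prop :=
  forall t, rmu X (braid T X (extA A) (braid T (extA A) X t)) = rmu X t.

Definition is_Rep0 (R : realType) (V : V1gl11 R) (T : hlz V) (A : extension T)
    (X : actobj A) : Prop := is_Rep X /\ is_local X.

Definition Rep_hom (R : realType) (V : V1gl11 R) (T : hlz V) (A : extension T)
    (X X' : actobj A) (f : {linear X -> X'}) : Prop :=
  exists (p : bool) (g : hom p X X'), f =1 g /\
    forall t, g (rmu X t) = rmu X' (tmap T (hid (extA A)) g t).

Definition induction (R : realType) (V : V1gl11 R) (T : hlz V) (A : extension T)
    (W : ofin V) : actobj A :=
  @Actobj R V T A (ten T (extA A) W)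
    (hcomp (tmap T (extmu A) (hid (ofin_ind W)))
       (assoc T (extA A) (extA A) W)).

(* Objects are the X with cobj X; morphisms are parity-homogeneous.           *)
Record supercat (R : realType) := Supercat {
  cOb :> Type;
  cobj : cOb -> Prop;
  cund : cOb -> superspace R;
  cmor : forall X X' : cOb, {linear cund X -> cund X'} -> Prop }.

Definition Ofin_cat (R : realType) (V : V1gl11 R) : supercat R :=
  @Supercat R (ofin V) (fun=> True) (fun W => W : superspace R)
    (fun W W' f => exists (p : bool) (g : hom p W W'), f =1 g).

Definition Rep0_cat (R : realType) (V : V1gl11 R) (T : hlz V)
    (A : extension T) : supercat R :=
  @Supercat R (actobj A) (@is_Rep0 R V T A) (fun X => X : superspace R)
    (@Rep_hom R V T A).

Definition isomorphic (R : realType) (K : supercat R) (X X' : K) : Prop :=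
  exists (f : {linear cund X -> cund X'}) (g : {linear cund X' -> cund X}),
    [/\ cmor f, cmor g, cancel f g & cancel g f].

Definition simple_obj (R : realType) (K : supercat R) (X : K) : Prop :=
  [/\ cobj X, exists x : cund X, x != 0 &
      forall (X' : K) (f : {linear cund X' -> cund X}),
        cobj X' -> cmor f -> injective f -> (forall x, f x = 0) \/ surj f].

Definition projective (R : realType) (K : supercat R) (P : K) : Prop :=
  cobj P /\
  forall (X X' : K) (g : {linear cund X -> cund X'})
         (f : {linear cund P -> cund X'}),
    cobj X -> cobj X' -> cmor g -> surj g -> cmor f ->
    exists f' : {linear cund P -> cund X}, cmor f' /\ forall x, f x = g (f' x).

Definition projective_cover (R : realType) (K : supercat R) (P S : K) : Prop :=
  [/\ projective P, cobj S &
      exists pi : {linear cund P -> cund S},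
        [/\ cmor pi, surj pi &
            forall (Q : K) (q : {linear cund Q -> cund S}),
              projective Q -> cmor q -> surj q ->
              exists q' : {linear cund Q -> cund P},
                [/\ cmor q', surj q' & forall x, q x = pi (q' x)]]].

Definition is_int (R : realType) (x : R[i]) : Prop := exists k : int, x = k%:~R.

Definition is_half_int (R : realType) (x : R[i]) : Prop :=
  exists k : int, x = 2%:R^-1 + k%:~R.

Definition local_simple (R : realType) (V : V1gl11 R) (S : vmod V) : Prop :=
  (exists (n : R[i]) (l : int), is_Ahat n l S /\
     ((is_half_int n /\ l != 0) \/ (is_int n /\ l = 0))) \/
  (exists n e : R[i], [/\ is_Vhat n e S, ~ is_int e & is_half_int (n + e)]).

(* Main.v *)
(* Put h = N + E.  For u of degree m in A satisfying the relations of a lattice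
   vector e^(m alpha), an intertwining operator applied to u and to a vector w
   of h_0-charge c killed by all h_r, r > 0, is determined through L_(-1) by its
   leading coefficient, with exponent m c.  Hence all questions about A reduce
   to leading coefficients.  Paired with functionals killing every h_(-r) A,
   products and iterates are binomial series, which gives the associativity of
   the multiplication of A; and the double braiding with A is trivial exactly
   when h_0 has integral eigenvalues, which is locality of F(W).
   By Kelly's argument F(W) is a module, and W is the part of F(W) where E_0 acts
   as on W.  Since vac lies in A_(-m) A_m, every nonzero submodule of F(S) meets
   S, so F(S) is simple; a simple local X contains a simple S, and F(S) -> X is an
   isomorphism.  Irreducible modules with integral h_0 are identified by their
   singular vectors, after a twist by Li's Delta operator if E_0 = l <> 0.
   By a length argument P_S -> S is essential, so E_0 is scalar and h_0 integral on
   P_S, and F(P_S) inherits projectivity and the covering property by adjunction. *)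

(* The vector h = N + E has norm 2, and h_0 and E_0 are integral on A; since each degree of A is
   irreducible over V, a single lattice vector in it controls the whole degree, and no basis of A is
   ever described. Three obstacles shape the rest. Induced modules are known through their universal
   property only, so that they are nonzero needs an argument: the summands of A are quotients of
   nonzero induced modules at all nonzero integral eigenvalues of E_0, and matrix coefficients
   polynomial in this eigenvalue carry the conclusion to every other one. The associativity
   isomorphism is given by values of matrix coefficients at real points, so that associativity of
   the action is a comparison of numbers; functionals killing every h_(-r) A leave one coefficient
   to compare, at one point. Projectivity is a property within O_1^fin, while modules over A live in
   the ind-completion, so lifting problems are first cut down to submodules of finite length. *)
From HB Require Import structures.
From mathcomp Require Import all_boot all_order all_algebra.
From mathcomp Require Import boolp classical_sets functions fsbigop reals.
From mathcomp Require Import topology normedtype summability sequences.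
From mathcomp Require Import exp trigo.
From mathcomp Require Import complex.
From mathcomp Require Import finmap zify ring.
Require Import Defs.

Set Implicit Arguments.
Unset Strict Implicit.
Unset Printing Implicit Defensive.

Import Order.TTheory GRing.Theory Num.Theory numFieldNormedType.Exports.
Local Open Scope ring_scope.
Local Open Scope complex_scope.

(** * Linear combinations, binomials, Borcherds identities *)

(* Reflexive normalisation of linear combinations: an identity between two
   combinations of the same vectors is reduced to one scalar identity for each
   vector. *)
Section Lincomb.
Variables (K : pzRingType) (M : lmodType K).

Inductive lexp := LVar of nat | LZero | LAdd of lexp & lexp | LOpp of lexp
  | LScale of K & lexp.

Fixpoint leval (env : seq M) (e : lexp) : M :=
  match e with
  | LVar i => nth 0 env i
  | LZero => 0
  | LAdd a b => leval env a + leval env b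
  | LOpp a => - leval env a
  | LScale c a => c *: leval env a
  end.

Fixpoint lcoef (e : lexp) (i : nat) : K :=
  match e with
  | LVar j => if Nat.eqb i j then 1 else 0
  | LZero => 0
  | LAdd a b => lcoef a i + lcoef b i
  | LOpp a => - lcoef a i
  | LScale c a => c * lcoef a i
  end.

Lemma leval_coef env e :
  leval env e = \sum_(i < size env) lcoef e i *: nth 0 env i.
Proof.
elim: e => [j||a Ha b Hb|a Ha|c a Ha] /=.
- have [jn|nj] := ltnP j (size env).
    rewrite (bigD1 (Ordinal jn)) //= big1 ?addr0.
      by rewrite PeanoNat.Nat.eqb_refl scale1r.
    move=> i /eqP ij; case E: (Nat.eqb i j); last by rewrite scale0r.
    by case: ij; apply: val_inj; apply/PeanoNat.Nat.eqb_eq.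
  rewrite nth_default // big1 // => i _.
  case E: (Nat.eqb i j); last by rewrite scale0r.
  move/PeanoNat.Nat.eqb_eq: E => E; move: (ltn_ord i); rewrite E ltnNge nj //.
- by rewrite big1 // => i _; rewrite scale0r.
- by rewrite Ha Hb -big_split /=; apply: eq_bigr => i _; rewrite scalerDl.
- by rewrite Ha -sumrN; apply: eq_bigr => i _; rewrite scaleNr.
- by rewrite Ha scaler_sumr; apply: eq_bigr => i _; rewrite scalerA.
Qed.

Fixpoint all_upto (P : nat -> Prop) (n : nat) : Prop :=
  match n with 0 => True | n'.+1 => P n' /\ all_upto P n' end.

Lemma lincomb_eq env e1 e2 :
  all_upto (fun i => lcoef e1 i = lcoef e2 i) (size env) ->
  leval env e1 = leval env e2.
Proof.
move=> h; rewrite !leval_coef; apply: eq_bigr => i _; congr (_ *: _).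
move: (size env) h i; elim=> [|n IH] /=; first by move=> _ [].
move=> [h1 h2] i.
have [E|ni] := eqVneq (i : nat) n; first by rewrite E.
have iln : (i < n)%N by rewrite ltn_neqAle ni -ltnS ltn_ord.
exact: (IH h2 (Ordinal iln)).
Qed.

End Lincomb.

Ltac lc_findc env x :=
  lazymatch env with
  | cons ?y ?r =>
    match goal with
    | _ => let _ := match goal with _ => constr_eq x y end in constr:(Some 0%N)
    | _ => lazymatch lc_findc r x with Some ?n => constr:(Some (S n)) | None => constr:(@None nat) end
    end
  | _ => constr:(@None nat)
  end.

Ltac lc_findu env x :=
  lazymatch env with
  | cons ?y ?r =>
    match goal with
    | _ => let _ := match goal with _ => unify x y end in constr:(Some 0%N)
    | _ => lazymatch lc_findu r x with Some ?n => constr:(Some (S n)) | None => constr:(@None nat) end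
    end
  | _ => constr:(@None nat)
  end.

(** The whole list is searched syntactically before any unification is tried: unification also
    recognises convertible forms of an atom, but is costlier. *)
Ltac lc_find env x :=
  lazymatch lc_findc env x with
  | Some ?n => constr:(Some n)
  | None => lc_findu env x
  end.

Ltac lc_snoc env x :=
  lazymatch env with
  | cons ?y ?r => let r' := lc_snoc r x in constr:(cons y r')
  | @nil ?T => constr:(cons x (@nil T))
  end.

Ltac lc_atoms env t :=
  lazymatch t with
  | @Algebra.add _ ?a ?b => let e := lc_atoms env a in lc_atoms e b
  | @Algebra.opp _ ?a => lc_atoms env a
  | @GRing.scale _ _ _ ?a => lc_atoms env a
  | @Algebra.zero _ => env
  | _ => lazymatch lc_find env t with
         | Some _ => env
         | None => lc_snoc env t end
  end.

Ltac lc_reify K env t :=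
  lazymatch t with
  | @Algebra.add _ ?a ?b =>
    let x := lc_reify K env a in let y := lc_reify K env b in constr:(@LAdd K x y)
  | @Algebra.opp _ ?a => let x := lc_reify K env a in constr:(@LOpp K x)
  | @GRing.scale _ _ ?c ?a => let x := lc_reify K env a in constr:(@LScale K c x)
  | @Algebra.zero _ => constr:(@LZero K)
  | _ => lazymatch lc_find env t with Some ?n => constr:(@LVar K n) end
  end.

Ltac lincomb_raw K :=
  lazymatch goal with
  | |- @eq ?T ?a ?b =>
    let env := lc_atoms (@nil T) a in
    let env := lc_atoms env b in
    let e1 := lc_reify K env a in
    let e2 := lc_reify K env b in
    refine (@lincomb_eq K _ env e1 e2 _);
    cbn [all_upto size lcoef Nat.eqb]; repeat split
  end.

(** Scalar goals that [ring] does not close, typically those with inverses, are left for a following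
    [field]. *)
Ltac lincomb :=
  lazymatch goal with
  | R : realType |- _ =>
    lincomb_raw (complex_complex__canonical__GRing_PzRing (reals_Real__to__GRing_Field R));
    try ring
  end.

Section Sums.
Variable R : realType.
Local Notation K := R[i].

Lemma fsum_nat (M : nmodType) (F : nat -> M) n :
  (forall j, (n <= j)%N -> F j = 0) ->
  \sum_(j \in [set: nat]) F j = \sum_(j < n) F j.
Proof.
move=> F0; rewrite (@fsbigE _ _ _ _ _ (iota 0 n)) ?iota_uniq //.
  rewrite -[RHS](big_mkord xpredT F) /index_iota subn0.
  by apply: eq_bigl => j; rewrite in_setT.
by move=> j _; rewrite mem_iota add0n /= -leqNgt => /F0.
Qed.

Lemma sum_trunc (M : nmodType) (F : nat -> M) n m :
  (n <= m)%N -> (forall j, (n <= j)%N -> F j = 0) ->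
  \sum_(j < m) F j = \sum_(j < n) F j.
Proof.
move=> nm F0; rewrite -!fsum_nat // => j mj; apply: F0.
exact: leq_trans mj.
Qed.

Lemma fsum_single (I : choiceType) (M : nmodType) (F : I -> M) i0 :
  (forall i, i != i0 -> F i = 0) -> \sum_(i \in [set: I]) F i = F i0.
Proof.
move=> F0; rewrite (@fsbigE _ _ _ _ _ [:: i0]) //.
  by rewrite big_mkcond big_seq1 in_setT.
by move=> i _; rewrite inE => /F0.
Qed.

Lemma fsum_zero (I : choiceType) (M : nmodType) (F : I -> M) :
  (forall i, F i = 0) -> \sum_(i \in [set: I]) F i = 0.
Proof. by move=> F0; apply: fsbig1 => i _; apply: F0. Qed.

Lemma gbin0 (x : K) : gbin x 0 = 1.
Proof. by rewrite /gbin big_ord0 fact0 divr1. Qed.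

Lemma gbin_0S j : gbin (0 : K) j.+1 = 0.
Proof. by rewrite /gbin big_ord_recl subrr !mul0r. Qed.

Lemma gbinz0 j : gbin (0%:~R : K) j = (j == 0%N)%:R.
Proof. by case: j => [|j]; rewrite ?gbin0 ?gbin_0S. Qed.

Lemma fact_unit j : (j`!%:R : K) != 0.
Proof. by rewrite pnatr_eq0 -lt0n fact_gt0. Qed.

Lemma gbinS (x : K) j : j.+1%:R * gbin x j.+1 = (x - j%:R) * gbin x j.
Proof.
rewrite /gbin big_ord_recr /= factS natrM invfM.
have h1 : (j.+1%:R : K) != 0 by rewrite pnatr_eq0.
have hj : 1 + (j%:R : K) != 0 by rewrite -natr1 addrC in h1.
by field; rewrite fact_unit hj.
Qed.

Lemma gbin1 (x : K) : gbin x 1 = x.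
Proof. by have := gbinS x 0; rewrite gbin0 mulr1 mul1r subr0. Qed.

Lemma gbinSE (x : K) j : gbin x j.+1 = (x - j%:R) * gbin x j / j.+1%:R.
Proof. by rewrite -gbinS mulrC mulrA mulVf ?mul1r ?pnatr_eq0. Qed.

Lemma gbinN1 j : gbin ((-1)%:~R : K) j = (-1) ^+ j.
Proof.
elim: j => [|j IH]; first by rewrite gbin0.
rewrite gbinSE IH exprS -mulrA [_ ^+ _ / _]mulrC mulrA; congr (_ * _).
rewrite rmorphN rmorph1 -opprD -natr1 addrC mulNr mulfV //.
by rewrite natr1 pnatr_eq0.
Qed.

Lemma gbin_pascal (x : K) j : gbin (x + 1) j.+1 = gbin x j.+1 + gbin x j.
Proof.
elim: j => [|j IH]; first by rewrite !gbin1 gbin0.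
have h1 : (j.+2%:R : K) != 0 by rewrite pnatr_eq0.
apply: (mulfI h1); rewrite mulrDr !gbinS IH.
have := gbinS x j => h2.
transitivity ((x - j.+1%:R) * gbin x j.+1 + (x - j%:R) * gbin x j + gbin x j.+1).
  rewrite -!natr1; ring.
rewrite -h2 -!natr1; ring.
Qed.

Lemma gbin_pascalz (x : int) j :
  gbin ((x + 1)%:~R : K) j.+1 = gbin x%:~R j.+1 + gbin x%:~R j.
Proof. by rewrite rmorphD /= gbin_pascal. Qed.

Lemma gbin_natE (m j : nat) : gbin (m%:Z%:~R : K) j = 'C(m, j)%:R.
Proof.
elim: m j => [|m IH] [|j]; rewrite ?gbin0 ?bin0 //; first by rewrite gbinz0 bin0n.
by rewrite -addn1 PoszD rmorphD /= gbin_pascal !IH addn1 binS natrD.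
Qed.

(** As functions of x both sides obey Pascal's rule and agree at x = 0. The rule can be run in both
    directions on the integers; downwards it takes a second induction, on t. *)
Lemma gbin_vandermonde (x y : int) t :
  \sum_(j < t.+1) gbin (x%:~R : K) j * gbin (y%:~R : K) (t - j) =
  gbin ((x + y)%:~R : K) t.
Proof.
set S := fun (x : int) t => \sum_(j < t.+1) gbin (x%:~R : K) j * gbin (y%:~R : K) (t - j).
have S0 z : S z 0%N = 1 by rewrite /S big_ord_recl big_ord0 !gbin0 mulr1 addr0.
have SS z s : S (z + 1) s.+1 = S z s.+1 + S z s.
  rewrite /S big_ord_recl [X in X + _ = _]/= gbin0.
  rewrite [in RHS]big_ord_recl gbin0 -addrA; congr (_ + _).
  rewrite -big_split /=; apply: eq_bigr => j _.
  by rewrite /bump /= !add1n subSS rmorphD /= gbin_pascal mulrDl.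
suff H : forall t, S x t = gbin ((x + y)%:~R : K) t by exact: H.
elim/int_ind: x => [s|n IH s|n IH s].
- rewrite add0r /S big_ord_recl gbin0 mul1r subn0 big1 ?addr0 // => j _.
  by rewrite gbinz0 /bump mul0r.
- case: s => [|s]; first by rewrite S0 gbin0.
  have -> : n.+1%:Z = n%:Z + 1 by lia.
  by rewrite SS !IH addrAC gbin_pascalz.
- have e : - (n.+1)%:Z + 1 = - n%:Z by lia.
  have e2 : - n%:Z + y = (- (n.+1)%:Z + y) + 1 by lia.
  elim: s => [|s IHs]; first by rewrite S0 gbin0.
  have := SS (- (n.+1)%:Z) s; rewrite e IH e2 gbin_pascalz IHs.
  by move/addIr.
Qed.

End Sums.

Section Super.
Variable R : realType.
Local Notation K := R[i].

Lemma two_neq0 : (2%:R : K) != 0. Proof. by rewrite pnatr_eq0. Qed.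

Lemma lfZ (M N : lmodType K) (f : {linear M -> N}) c x : f (c *: x) = c *: f x.
Proof. exact: linearZ. Qed.
Lemma lfD (M N : lmodType K) (f : {linear M -> N}) x y : f (x + y) = f x + f y.
Proof. exact: linearD. Qed.
Lemma lfB (M N : lmodType K) (f : {linear M -> N}) x y : f (x - y) = f x - f y.
Proof. exact: linearB. Qed.
Lemma lf0 (M N : lmodType K) (f : {linear M -> N}) : f 0 = 0.
Proof. exact: linear0. Qed.
Lemma lfN (M N : lmodType K) (f : {linear M -> N}) x : f (- x) = - f x.
Proof. exact: linearN. Qed.

Lemma half2 (M : lmodType K) (x : M) : 2%:R^-1 *: (x + x) = x.
Proof.
have -> : x + x = (2%:R : K) *: x by rewrite scaler_nat mulr2n.
by rewrite scalerA mulVf ?scale1r ?two_neq0.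
Qed.

Definition hpart (S : superspace R) (p : bool) (v : S) : S :=
  2%:R^-1 *: (v + (-1) ^+ p *: par S v).

Lemma parKE (S : superspace R) (v : S) : par S (par S v) = v.
Proof. exact: (parK (s := S)). Qed.

Lemma hpart_homog (S : superspace R) p (v : S) : homog p (hpart p v).
Proof.
rewrite /homog /hpart lfZ lfD lfZ parKE.
rewrite scalerA mulrC -scalerA; congr (_ *: _).
by rewrite scalerDr scalerA -expr2 sqrr_sign scale1r addrC.
Qed.

Lemma hpartE (S : superspace R) (v : S) : v = hpart false v + hpart true v.
Proof.
rewrite /hpart expr0 expr1 scale1r scaleN1r -scalerDr addrACA subrr addr0.
by rewrite half2.
Qed.

Lemma homogD (S : superspace R) p (u v : S) :
  homog p u -> homog p v -> homog p (u + v).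
Proof. by rewrite /homog lfD => -> ->; rewrite scalerDr. Qed.

Lemma parXE (S : superspace R) p q (v : S) :
  homog q v -> parX p v = (-1) ^+ (p && q) *: v.
Proof. by case: p => //= _; rewrite expr0 scale1r. Qed.

Lemma parX_linear (S : superspace R) p : linear (@parX R S p).
Proof. by case: p => c u v //=; rewrite linearP. Qed.

Lemma parXK (S : superspace R) p (v : S) : parX p (parX p v) = v.
Proof. by case: p => //=; rewrite parKE. Qed.

End Super.

Section Borch.
Variables (R : realType) (V : V1gl11 R).
Local Notation K := R[i].

(* A common interface to module vertex operators, to the operators of a VOSA
   extension, and to the coefficients of an intertwining operator at exponents
   in a fixed coset of the integers and at a fixed power of log x. *)
Record gborch (V0 W1 W2 W3 : superspace R) (Y1 : V0 -> int -> {linear W1 -> W1})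
    (Y2 : V0 -> int -> {linear W2 -> W2}) (Y3 : V0 -> int -> {linear W3 -> W3})
    (J : W1 -> int -> W2 -> W3) : Prop := Borch {
  bo_lin1 : forall k w2, linear (fun w1 => J w1 k w2);
  bo_lin2 : forall w1 k, linear (J w1 k);
  bo_par : forall w1 k w2, par W3 (J w1 k w2) = J (par W1 w1) k (par W2 w2);
  bo_trunc : forall w1 w2, exists k0 : int, forall k, k0 <= k -> J w1 k w2 = 0;
  bo_bor : forall p q (v : V0) (w1 : W1) (w2 : W2) (m n k : int),
    homog p v -> homog q w1 ->
    \sum_(j \in [set: nat])
       gbin m%:~R j *: J (Y1 v (n + j%:Z) w1) (m + k - j%:Z) w2 =
    \sum_(j \in [set: nat]) ((-1) ^+ j * gbin n%:~R j) *:
       (Y3 v (m + n - j%:Z) (J w1 (k + j%:Z) w2)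
        - ((-1) ^+ (p && q) * (-1) ^ n) *:
            J w1 (n + k - j%:Z) (Y2 v (m + j%:Z) w2));
  bo_t1 : forall v w, exists n0 : int, forall n, n0 <= n -> Y1 v n w = 0;
  bo_t2 : forall v w, exists n0 : int, forall n, n0 <= n -> Y2 v n w = 0;
  bo_l1 : forall n w, linear (fun v => Y1 v n w);
  bo_l2 : forall n w, linear (fun v => Y2 v n w) }.

Definition borch (W1 W2 W3 : vmod V) (J : W1 -> int -> W2 -> W3) :=
  gborch (Yw W1) (Yw W2) (Yw W3) J.

Lemma Yw0 (W : vmod V) n w : Yw W 0 n w = 0.
Proof. by have := Yw_linear (v0:=W) n w (-1) 0 0; rewrite scaler0 addr0 scaleN1r addNr. Qed.

Lemma YwD (W : vmod V) u v n w : Yw W (u + v) n w = Yw W u n w + Yw W v n w.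
Proof. by have := Yw_linear (v0:=W) n w 1 u v; rewrite !scale1r. Qed.

Lemma YwZ (W : vmod V) c v n w : Yw W (c *: v) n w = c *: Yw W v n w.
Proof. by have := Yw_linear (v0:=W) n w c v 0; rewrite !addr0 Yw0 addr0. Qed.

Lemma YwB (W : vmod V) u v n w : Yw W (u - v) n w = Yw W u n w - Yw W v n w.
Proof. by rewrite YwD -scaleN1r YwZ scaleN1r. Qed.

Lemma borch_Yw (W : vmod V) : @borch (adjoint V) W W (@Yw R V W).
Proof.
split; [exact: Yw_linear| | | | |exact: Yw_trunc|exact: Yw_trunc|exact: Yw_linear|exact: Yw_linear].
- by move=> w k c u v; rewrite linearP.
- exact: Yw_par.
- exact: Yw_trunc.
- exact: Yw_borcherds.
Qed.

Lemma borch_intw (W1 W2 W3 : vmod V) (I : intw W1 W2 W3) h kap :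
  @borch W1 W2 W3 (fun w1 k => I w1 (h + k%:~R) kap).
Proof.
split; last 4 first.
- exact: Yw_trunc.
- exact: Yw_trunc.
- exact: Yw_linear.
- exact: Yw_linear.
- by move=> k w2 c u v; rewrite i_linear.
- by move=> w1 k c u v; rewrite linearP.
- by move=> w1 k w2; rewrite i_par.
- move=> w1 w2; have [m0 hm] := i_trunc I w1 w2 h.
  by exists m0%:Z => -[k|k] // hk; apply: hm; lia.
- move=> p q v w1 w2 m n k hp hq.
  have := i_borcherds I w2 m n (h + k%:~R) kap hp hq.
  move=> e; have e1 : forall j : nat, h + k%:~R + m%:~R - j%:R = h + (m + k - j%:Z)%:~R :> K.
    by move=> j; rewrite rmorphB rmorphD /= -!addrA; congr (_ + _); rewrite addrA [k%:~R + _]addrC addrA.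
  have e2 : forall j : nat, h + k%:~R + j%:R = h + (k + j%:Z)%:~R :> K.
    by move=> j; rewrite rmorphD /= addrA.
  have e3 : forall j : nat, h + k%:~R + n%:~R - j%:R = h + (n + k - j%:Z)%:~R :> K.
    by move=> j; rewrite rmorphB rmorphD /= -!addrA; congr (_ + _); rewrite addrA [k%:~R + _]addrC addrA.
  under eq_fsbigr do rewrite -e1.
  rewrite e; apply: eq_fsbigr => j _.
  by rewrite e2 e3.
Qed.

Lemma addz0 (x : int) : x + Posz 0 = x. Proof. exact: addr0. Qed.
Lemma subz0 (x : int) : x - Posz 0 = x. Proof. exact: subr0. Qed.

Section Consequences.
Variables (V0 W1 W2 W3 : superspace R) (Y1 : V0 -> int -> {linear W1 -> W1}).
Variables (Y2 : V0 -> int -> {linear W2 -> W2}) (Y3 : V0 -> int -> {linear W3 -> W3}).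
Variable J : W1 -> int -> W2 -> W3.
Hypothesis bJ : gborch Y1 Y2 Y3 J.

Lemma bo0l k w2 : J 0 k w2 = 0.
Proof. by have := bo_lin1 bJ k w2 (-1) 0 0; rewrite scaler0 addr0 scaleN1r addNr. Qed.

Lemma boDl u v k w2 : J (u + v) k w2 = J u k w2 + J v k w2.
Proof. by have := bo_lin1 bJ k w2 1 u v; rewrite !scale1r. Qed.

Lemma boZl c u k w2 : J (c *: u) k w2 = c *: J u k w2.
Proof. by have := bo_lin1 bJ k w2 c u 0; rewrite bo0l !addr0. Qed.

Lemma bo0r w1 k : J w1 k 0 = 0.
Proof. by have := bo_lin2 bJ w1 k (-1) 0 0; rewrite scaler0 addr0 scaleN1r addNr. Qed.

Lemma boDr w1 k u v : J w1 k (u + v) = J w1 k u + J w1 k v.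
Proof. by have := bo_lin2 bJ w1 k 1 u v; rewrite !scale1r. Qed.

Lemma boZr w1 k c u : J w1 k (c *: u) = c *: J w1 k u.
Proof. by have := bo_lin2 bJ w1 k c u 0; rewrite bo0r !addr0. Qed.

(** The sign of the Borcherds identity is absorbed into [parX p w1], which is linear in [w1], so the
    identities for the two homogeneous parts of [w1] add up. *)
Lemma bo_fin p (v : V0) w1 w2 (m n k : int) (N : nat) : homog p v ->
  (forall j : nat, (N <= j)%N -> Y1 v (n + j%:Z) w1 = 0) ->
  (forall j : nat, (N <= j)%N -> J w1 (k + j%:Z) w2 = 0) ->
  (forall j : nat, (N <= j)%N -> Y2 v (m + j%:Z) w2 = 0) ->
  \sum_(j < N) gbin m%:~R j *: J (Y1 v (n + j%:Z) w1) (m + k - j%:Z) w2 =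
  \sum_(j < N) ((-1) ^+ j * gbin n%:~R j) *:
     (Y3 v (m + n - j%:Z) (J w1 (k + j%:Z) w2)
      - (-1) ^ n *: J (parX p w1) (n + k - j%:Z) (Y2 v (m + j%:Z) w2)).
Proof.
move=> hp N1 N2 N3.
have key q w : homog q w -> (exists c, w = 2%:R^-1 *: (w1 + c *: par W1 w1)) ->
   exists M, (N <= M)%N /\ forall M', (M <= M')%N ->
  \sum_(j < M') gbin m%:~R j *: J (Y1 v (n + j%:Z) w) (m + k - j%:Z) w2 =
  \sum_(j < M') ((-1) ^+ j * gbin n%:~R j) *:
     (Y3 v (m + n - j%:Z) (J w (k + j%:Z) w2)
      - (-1) ^ n *: J (parX p w) (n + k - j%:Z) (Y2 v (m + j%:Z) w2)).
  move=> hq _.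
  have [a ha] := bo_trunc bJ w w2.
  have [b hb] := bo_t1 bJ v w.
  pose M := (N + `|a - k| + `|b - n|)%N.
  exists M; split; first by rewrite /M; lia.
  move=> M' MM'.
  have := bo_bor bJ w2 m n k hp hq.
  rewrite (fsum_nat (n:=M')); last first.
    by move=> j hj; rewrite hb ?bo0l ?scaler0 //; move: MM'; rewrite /M; lia.
  rewrite (fsum_nat (n:=M')); last first.
    move=> j hj; rewrite ha ?linear0; last by move: MM'; rewrite /M; lia.
    by rewrite N3 ?bo0r ?scaler0 ?subr0 ?scaler0 //; move: MM'; rewrite /M; lia.
  move=> ->; apply: eq_bigr => j _.
  by rewrite (parXE p hq) boZl scalerA [_ ^ n * _]mulrC.
(* The truncation orders of the two parts of [w1] may exceed [N], so both identities are taken at a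
   common larger bound, to which the sums for [w1] are extended. *)
have [M0 [NM0 h0]] := key false (hpart false w1) (hpart_homog _ _) (ex_intro _ _ erefl).
have [M1 [NM1 h1]] := key true (hpart true w1) (hpart_homog _ _) (ex_intro _ _ erefl).
have := h0 (M0 + M1)%N (leq_addr _ _); have := h1 (M0 + M1)%N (leq_addl _ _).
move=> e1 e0.
rewrite -(@sum_trunc _ (fun j => gbin m%:~R j *: J (Y1 v (n + j%:Z) w1) (m + k - j%:Z) w2) N (M0 + M1)%N); last first.
- by move=> j Nj; rewrite N1 ?(bo0l) ?scaler0.
- lia.
rewrite -(@sum_trunc _ (fun j => ((-1) ^+ j * gbin n%:~R j) *:
     (Y3 v (m + n - j%:Z) (J w1 (k + j%:Z) w2)
      - (-1) ^ n *: J (parX p w1) (n + k - j%:Z) (Y2 v (m + j%:Z) w2))) N (M0 + M1)%N); last first.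
- by move=> j Nj; rewrite N2 ?N3 // bo0r linear0 scaler0 subr0 scaler0.
- lia.
rewrite [in LHS](hpartE w1) [in RHS](hpartE w1).
under eq_bigr do rewrite linearD boDl scalerDr.
rewrite big_split /= e0 e1 -big_split /=; apply: eq_bigr => j _.
rewrite -scalerDr; congr (_ *: _).
have -> : parX p (hpart false w1 + hpart true w1) = parX p (hpart false w1) + parX p (hpart true w1).
  by have := parX_linear p 1 (hpart false w1) (hpart true w1); rewrite !scale1r.
by rewrite !boDl linearD scalerDr opprD addrACA.
Qed.

(** The commutator formula, which is the Borcherds identity for n = 0. *)
Lemma bo_comm p (v : V0) w1 w2 (m k : int) (N : nat) : homog p v ->
  (forall j : nat, (N <= j)%N -> Y1 v j%:Z w1 = 0) ->
  Y3 v m (J w1 k w2) = J (parX p w1) k (Y2 v m w2) +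
  \sum_(j < N) gbin m%:~R j *: J (Y1 v j%:Z w1) (m + k - j%:Z) w2.
Proof.
move=> hp N1.
have [a ha] := bo_trunc bJ w1 w2.
have [b hb] := bo_t2 bJ v w2.
pose M := (N + `|a - k| + `|b - m|).+1%N.
have := @bo_fin p v w1 w2 m 0 k M hp.
rewrite -(@sum_trunc _ (fun j => gbin m%:~R j *: J (Y1 v j%:Z w1) (m + k - j%:Z) w2) N M); last first.
- by move=> j Nj; rewrite N1 ?bo0l ?scaler0.
- by rewrite /M; lia.
move=> e; rewrite (eq_bigr (fun j : 'I_M => gbin m%:~R j *: J (Y1 v (0 + j%:Z) w1) (m + k - j%:Z) w2)); last first.
  by move=> j _; rewrite add0r.
rewrite e.
- rewrite /M big_ord_recl expr0 gbin0 mulr1 scale1r big1 => [|j _]; last first.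
    by rewrite gbinz0 mulr0 scale0r.
  by rewrite /= ?subz0 ?addz0 ?addr0 ?add0r expr0z scale1r addrC subrK.
- by move=> j hj; rewrite add0r N1 //; move: hj; rewrite /M; lia.
- by move=> j hj; apply: ha; move: hj; rewrite /M; lia.
- by move=> j hj; apply: hb; move: hj; rewrite /M; lia.
Qed.

(** The iterate formula, which is the Borcherds identity for m = 0. *)
Lemma bo_iter p (v : V0) w1 w2 (n k : int) (N : nat) : homog p v ->
  (forall j : nat, (N <= j)%N -> J w1 (k + j%:Z) w2 = 0) ->
  (forall j : nat, (N <= j)%N -> Y2 v j%:Z w2 = 0) ->
  J (Y1 v n w1) k w2 =
  \sum_(j < N) ((-1) ^+ j * gbin n%:~R j) *:
     (Y3 v (n - j%:Z) (J w1 (k + j%:Z) w2)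
      - (-1) ^ n *: J (parX p w1) (n + k - j%:Z) (Y2 v j%:Z w2)).
Proof.
move=> hp N2 N3.
have [a ha] := bo_t1 bJ v w1.
pose M := (N + `|a - n|).+1%N.
rewrite -(@sum_trunc _ (fun j => ((-1) ^+ j * gbin n%:~R j) *:
     (Y3 v (n - j%:Z) (J w1 (k + j%:Z) w2)
      - (-1) ^ n *: J (parX p w1) (n + k - j%:Z) (Y2 v j%:Z w2))) N M); last first.
- by move=> j Nj; rewrite N2 ?N3 // bo0r linear0 scaler0 subr0 scaler0.
- by rewrite /M; lia.
have := @bo_fin p v w1 w2 0 n k M hp.
rewrite {1}/M big_ord_recl gbin0 scale1r big1 ?addr0 => [|j _]; last first.
  by rewrite gbinz0 scale0r.
rewrite add0r => ->.
- by apply: eq_bigr => j _; rewrite !add0r.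
- by move=> j hj; apply: ha; move: hj; rewrite /M; lia.
- by move=> j hj; apply: N2; move: hj; rewrite /M; lia.
- by move=> j hj; rewrite add0r; apply: N3; move: hj; rewrite /M; lia.
Qed.

End Consequences.

End Borch.

(** * Subspaces, currents and Virasoro modes *)

Section Subspaces.
Variable R : realType.
Local Notation K := R[i].

Record lsub (M : lmodType K) := Lsub {
  lsubP :> M -> Prop;
  lsub0 : lsubP 0;
  lsubL : forall c u w, lsubP u -> lsubP w -> lsubP (c *: u + w) }.

Section LsubTheory.
Variables (M : lmodType K) (D : lsub M).

Lemma lsubD u w : D u -> D w -> D (u + w).
Proof. by move=> hu hw; have := lsubL 1 hu hw; rewrite scale1r. Qed.

Lemma lsubZ c u : D u -> D (c *: u).
Proof. by move=> hu; have := lsubL c hu (lsub0 D); rewrite addr0. Qed.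

Lemma lsubN u : D u -> D (- u).
Proof. by move=> hu; rewrite -scaleN1r; apply: lsubZ. Qed.

Lemma lsubB u w : D u -> D w -> D (u - w).
Proof. by move=> hu hw; apply: lsubD => //; apply: lsubN. Qed.

Lemma lsub_sum (I : Type) (s : seq I) (P : pred I) (F : I -> M) :
  (forall i, P i -> D (F i)) -> D (\sum_(i <- s | P i) F i).
Proof. by move=> h; elim/big_ind: _ => //; [exact: lsub0|exact: lsubD]. Qed.

Lemma lsub_sum_seq (I : eqType) (s : seq I) (F : I -> M) :
  (forall i, i \in s -> D (F i)) -> D (\sum_(i <- s) F i).
Proof.
move=> h; rewrite big_seq_cond; apply: lsub_sum => i; rewrite andbT; exact: h.
Qed.

Definition lpred : {pred M} := fun x => `[< D x >].

Lemma lpred_closed : submod_closed lpred.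
Proof.
split; first by rewrite unfold_in; apply/asboolP; apply: lsub0.
move=> c u w; rewrite !unfold_in => /asboolP hu /asboolP hw.
by apply/asboolP; apply: lsubL.
Qed.

HB.instance Definition _ := GRing.isSubmodClosed.Build K M lpred lpred_closed.

Record lsub_type := LsubType { lval : M; lvalP : lval \in lpred }.

HB.instance Definition _ := [isSub of lsub_type for lval].
HB.instance Definition _ := [Choice of lsub_type by <:].
HB.instance Definition _ := [SubChoice_isSubLmodule of lsub_type by <:].

Lemma lvalD (x : lsub_type) : D (lval x).
Proof. by case: x => x /= /asboolP. Qed.

Definition lsubI (x : M) (h : D x) : lsub_type := LsubType (introT (asboolP _) h : x \in lpred).

Lemma lval_inj : injective lval. Proof. exact: val_inj. Qed.

Lemma lval_lin : linear lval.
Proof. by move=> c u w; exact: (@linearP _ _ _ _ (val : {linear lsub_type -> M})). Qed.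

End LsubTheory.

(** The linearity proof is an argument of the alias, so that the linear structure is inferred from
    the term alone. *)
Definition lin_of (M N : lmodType K) (f : M -> N) (h : linear f) := f.
HB.instance Definition _ (M N : lmodType K) (f : M -> N) (h : linear f) :=
  GRing.isLinear.Build K M N *:%R (lin_of h) h.

Definition mklin (M N : lmodType K) (f : M -> N) (h : linear f) :
  {linear M -> N} := lin_of h.

Lemma lsub_map_linear (M N : lmodType K) (D : lsub M) (E : lsub N)
    (f : {linear M -> N}) (h : forall x, D x -> E (f x)) :
  linear (fun x : lsub_type D => lsubI (h _ (lvalD x))).
Proof.
move=> c u w; apply: lval_inj; rewrite [RHS]lval_lin.
by transitivity (f (lval (c *: u + w))); rewrite // lval_lin linearP.
Qed.

Definition lsub_map (M N : lmodType K) (D : lsub M) (E : lsub N)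
    (f : {linear M -> N}) (h : forall x, D x -> E (f x)) :
  {linear lsub_type D -> lsub_type E} := mklin (lsub_map_linear h).

Definition lincl (M : lmodType K) (D : lsub M) : {linear lsub_type D -> M} :=
  mklin (@lval_lin M D).

Section SubSuper.
Variables (S : superspace R) (D : lsub S) (hp : forall u, D u -> D (par S u)).

Lemma sub_par_inv : involutive (lsub_map hp).
Proof. by move=> x; apply: lval_inj; rewrite /= parKE. Qed.

Definition sub_super : superspace R := Superspace sub_par_inv.

Definition sincl : {linear sub_super -> S} := lincl D.
Lemma sincl_inj : injective sincl. Proof. exact: lval_inj. Qed.
Lemma sincl_in x : D (sincl x). Proof. exact: lvalD. Qed.
Lemma sincl_par x : sincl (par sub_super x) = par S (sincl x). Proof. by []. Qed.

Definition sub_end (f : {linear S -> S}) (hf : forall x, D x -> D (f x)) :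
  {linear sub_super -> sub_super} := lsub_map hf.
Lemma sub_endE (f : {linear S -> S}) (hf : forall x, D x -> D (f x)) x :
  sincl (sub_end hf x) = f (sincl x).
Proof. by []. Qed.

Lemma sub_lift_lin (N : lmodType K) (f : {linear N -> S}) (hf : forall x, D (f x)) :
  linear (fun x : N => lsubI (hf x) : sub_super).
Proof. by move=> c u w; apply: lval_inj; rewrite [RHS]lval_lin /= linearP. Qed.
Definition sub_lift (N : lmodType K) (f : {linear N -> S}) (hf : forall x, D (f x)) :
  {linear N -> sub_super} := mklin (sub_lift_lin hf).
Lemma sub_liftE (N : lmodType K) (f : {linear N -> S}) (hf : forall x, D (f x)) x :
  sincl (sub_lift hf x) = f x.
Proof. by []. Qed.
Lemma sub_elim x : D x -> exists y : sub_super, sincl y = x.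
Proof. by move=> h; exists (lsubI h). Qed.

Lemma sub_level1 (act : gl11 -> int -> {linear S -> S})
  (ha : forall a r u, D u -> D (act a r u)) :
  level1 act -> level1 (fun a r => sub_end (ha a r)).
Proof.
move=> [l1 l2]; split=> [a r w|a b r s w]; apply: sincl_inj.
  by rewrite lfZ sub_endE [LHS]sincl_par sub_endE l1.
by rewrite lfB lfD !(lfZ sincl) !sub_endE l2.
Qed.
End SubSuper.

Section ProdSuper.
Variables (S T : superspace R).
Lemma prod_par_linear : linear (fun x : S * T => (par S x.1, par T x.2)).
Proof. by move=> c u w; rewrite /= !linearP. Qed.
Lemma prod_par_inv : involutive (mklin prod_par_linear).
Proof. by case=> a b; apply: (f_equal2 pair); exact: parKE. Qed.
Definition prod_super : superspace R := Superspace prod_par_inv.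
End ProdSuper.

End Subspaces.

Section Induced.
Variable R : realType.
Local Notation K := R[i].

(** The universal property, applied to [j] corestricted to [D], gives a map from [M] to [D];
    followed by the inclusion it agrees with the identity on the image of [j], hence everywhere by
    uniqueness. *)
Lemma induced_gen (U : glmod R) (M : superspace R)
    (act : gl11 -> int -> {linear M -> M}) (j : {linear U -> M}) (D : lsub M) :
  is_induced act j -> (forall u, D u -> D (par M u)) ->
  (forall a r u, D u -> D (act a r u)) -> (forall u, D (j u)) -> forall w, D w.
Proof.
move=> [lev [t1 t2 t3] univ] hp ha hj.
pose M' := sub_super hp.
have lev' := sub_level1 hp ha lev.
pose f : {linear U -> M'} := sub_lift hp hj.
have tf : top_map (fun a r => sub_end hp (ha a r)) f.
  split=> [u|a u|a r u r0]; apply: sincl_inj.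
  - by rewrite sincl_par !sub_liftE t1.
  - by rewrite sub_endE !sub_liftE t2.
  - by rewrite sub_endE !sub_liftE t3 // lf0.
have [F [[F1 F2] F3 _]] := univ _ _ lev' f tf.
have [F0 [_ _ uni]] := univ _ _ lev j (And3 t1 t2 t3).
move=> w; have -> : w = sincl hp (F w); last exact: sincl_in.
have e1 : (sincl hp \o F : {linear M -> M}) =1 F0.
  apply: uni => [|u]; last by rewrite /= F3 sub_liftE.
  split=> [x|a r x]; rewrite [LHS]/= [in RHS]/=.
    by rewrite -sincl_par F1.
  by rewrite F2 sub_endE.
have e2 : (idfun : {linear M -> M}) =1 F0 by apply: uni.
by rewrite -[LHS]/((idfun : {linear M -> M}) w) e2 -e1.
Qed.

End Induced.

Section Currents.
Variables (R : realType) (V : V1gl11 R).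
Local Notation K := R[i].
Local Notation VV := (Vv V).

Lemma level1_V : level1 (fun a r => Y VV (cur V a) r).
Proof. by have [U [u [j [_ [h _ _] _]]]] := V_induced V. Qed.

Lemma cur_par a : par V (cur V a) = (-1) ^+ glpar a *: cur V a.
Proof.
rewrite -[in LHS](Y_creation VV (cur V a)) (proj1 level1_V).
by have := vac_even VV; rewrite /homog expr0 scale1r => ->; rewrite Y_creation.
Qed.

Lemma cur_homog a : homog (glpar a) (cur V a).
Proof. exact: cur_par. Qed.

(** With [cur V b] written as b_(-1) vac this is an affine commutation relation, because a_n kills
    vac for n >= 0. *)
Lemma cur_cur a b (n : int) : 0 <= n ->
  Y VV (cur V a) n (cur V b) =
  (if n == 0 then (glbr R a b).1 *: cur V (glbr R a b).2 else 0) +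
  (if n == 1 then glform R a b else 0) *: vac VV.
Proof.
move=> n0; rewrite -[in LHS](Y_creation VV (cur V b)).
have := (proj2 level1_V) a b n (-1) (vac VV) => /=.
rewrite (Y_creation0 VV (cur V a) n0) lf0 scaler0 subr0 => ->.
rewrite subr_eq0; congr (_ + _).
  case: eqP => [->|/eqP n1]; first by rewrite add0r Y_creation.
  by rewrite Y_creation0 ?scaler0 //; lia.
by case: eqP => [->|//]; rewrite mul1r.
Qed.

(** In the commutator formula only j = 0 and j = 1 contribute; they give the bracket and the central
    term. *)
Lemma curw_level1 (W : vmod V) : level1 (curw W).
Proof.
split=> [a r w|a b r s w].
  by rewrite /curw Yw_par cur_par YwZ.
have e := @bo_comm _ _ _ _ _ _ _ _ _ (borch_Yw W) (glpar a) (cur V a) (cur V b) w r s 2 (cur_homog a).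
rewrite /curw e; last first.
  move=> j hj; rewrite /= cur_cur //.
  by case: j hj => [|[|j]] // _; rewrite scale0r addr0.
rewrite (parXE _ (cur_homog b)) (boZl (borch_Yw W)) addrAC subrr add0r.
rewrite !big_ord_recl big_ord0 /= !cur_cur //= gbin0 scale1r scale0r addr0 add0r addr0.
rewrite /bump /= gbin1 addr0 !YwZ Yw_vac scalerA; congr (_ + _).
have -> : (r + s - 1 == -1) = (r + s == 0) by lia.
by case: ifP => _; rewrite ?scale0r ?scaler0.
Qed.

End Currents.

Section Generation.
Variables (R : realType) (V : V1gl11 R).
Local Notation K := R[i].
Local Notation VV := (Vv V).

Lemma V_gen (D : lsub V) : (forall u, D u -> D (par V u)) ->
  (forall a r u, D u -> D (Y VV (cur V a) r u)) -> D (vac VV) -> forall w, D w.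
Proof.
move=> hp ha hv; have [U [u [j [[_ _ sp _ _] ind ju]]]] := V_induced V.
apply: (induced_gen ind hp ha) => x.
by have [c ->] := sp x; rewrite lfZ ju; apply: lsubZ.
Qed.

Definition stable (W : vmod V) (D : W -> Prop) :=
  (forall u, D u -> D (par W u)) /\ (forall a r u, D u -> D (curw W a r u)).

Lemma hpart_in (S : superspace R) (D : lsub S) (hp : forall u, D u -> D (par S u)) p v :
  D v -> D (hpart p v).
Proof. by move=> h; apply: lsubZ; apply: lsubD => //; apply: lsubZ; apply: hp. Qed.

Lemma parX_in (S : superspace R) (D : S -> Prop) (hp : forall u, D u -> D (par S u)) p v :
  D v -> D (parX p v).
Proof. by case: p => //=; apply: hp. Qed.

(* V is generated by the currents, so stability under their modes suffices. *)
Lemma stable_submod (W : vmod V) (D : lsub W) : stable D -> submod D.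
Proof.
move=> [hp hc]; split=> //; [exact: lsub0|exact: lsubL|].
pose P v := forall n u, D u -> D (Yw W v n u).
have P0 : P 0 by move=> n u _; rewrite Yw0; apply: lsub0.
have PL c u w : P u -> P w -> P (c *: u + w).
  by move=> hu hw n x hx; rewrite YwD YwZ; apply: lsubL; [apply: hu|apply: hw].
move=> v; apply: (@V_gen (Lsub P0 PL)) => /=.
- by move=> u hu n x hx; rewrite -[x]parKE -Yw_par; apply/hp/hu/hp.
- move=> a r u hu n x hx.
  have [k hk] := Yw_trunc u x; have [l hl] := Yw_trunc (cur V a) x.
  rewrite (@bo_iter _ _ _ _ _ _ _ _ _ (borch_Yw W) _ _ u x r n (`|k - n| + `|l|)%N (cur_homog V a)).
  + apply: lsub_sum => j _; apply: lsubZ; apply: lsubB; first by apply: hc; apply: hu.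
    apply: lsubZ; case: (glpar a) => /=; last by apply: hu; apply: hc.
    by rewrite -[Yw W (cur V a) _ x]parKE -Yw_par; apply/hp/hu/hp/hc.
  + by move=> j hj; apply: hk; lia.
  + by move=> j hj; apply: hl; lia.
- by move=> n u hu; rewrite Yw_vac; case: ifP => // _; apply: lsub0.
Qed.

Lemma quad_iter (W : vmod V) a b k w N :
  (forall j : nat, (N <= j)%N -> curw W b (k + j%:Z) w = 0) ->
  (forall j : nat, (N <= j)%N -> curw W a j%:Z w = 0) ->
  Yw W (Y VV (cur V a) (-1) (cur V b)) k w =
  \sum_(j < N) (curw W a (-1 - j%:Z) (curw W b (k + j%:Z) w) +
    (-1) ^+ (glpar a && glpar b) *: curw W b (k - 1 - j%:Z) (curw W a j%:Z w)).
Proof.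
move=> h1 h2.
rewrite (@bo_iter _ _ _ _ _ _ _ _ _ (borch_Yw W) _ _ (cur V b) w (-1) k N (cur_homog V a)) //.
apply: eq_bigr => j _; rewrite gbinN1 -exprMn mulrNN mulr1 expr1n scale1r.
rewrite (parXE _ (cur_homog V b)) YwZ scalerA exprN1 invrN1 mulN1r scaleNr opprK.
by rewrite [-1 + k]addrC.
Qed.

Lemma om_mode (W : vmod V) k w :
  Yw W (omega VV) k w =
  2%:R^-1 *: (Yw W (Y VV (cur V glN) (-1) (cur V glE)) k w
     + Yw W (Y VV (cur V glE) (-1) (cur V glN)) k w
     - Yw W (Y VV (cur V psip) (-1) (cur V psim)) k w
     + Yw W (Y VV (cur V psim) (-1) (cur V psip)) k w)
  + 2%:R^-1 *: Yw W (Y VV (cur V glE) (-1) (cur V glE)) k w.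
Proof. by rewrite V_omega YwD !YwZ YwD YwB YwD. Qed.

Lemma quad1 a b c :
  Y VV (Y VV (cur V a) (-1) (cur V b)) 1 (cur V c) =
  glform R b c *: cur V a +
  (-1) ^+ (glpar a && glpar b) *:
     ((glbr R a c).1 *: ((glbr R b (glbr R a c).2).1 *: cur V (glbr R b (glbr R a c).2).2)
      + glform R a c *: cur V b).
Proof.
have := @quad_iter (adjoint V) a b 1 (cur V c) 2 => /= ->.
- rewrite !big_ord_recl big_ord0 /= /curw /= /bump /= addr0.
  rewrite !cur_cur //= ?(scale0r, addr0, add0r, lf0, scaler0).
  have -> : (1 - 1 : int) = 0 by [].
  rewrite (lfZ (Y VV (cur V a) (-1))) (Y_creation VV (cur V a)).
  rewrite (lfZ (Y VV (cur V b) 0)) (lfZ (Y VV (cur V b) _)).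
  have -> : - Posz (1 + 0) = -1 by [].
  rewrite (Y_creation VV (cur V b)).
  rewrite cur_cur //= scale0r addr0.
  lincomb.
- by move=> j hj; rewrite /curw /= cur_cur //; case: j hj => [|[|]] //= j _; rewrite scale0r addr0.
- by move=> j hj; rewrite /curw /= cur_cur //; case: j hj => [|[|]] //= j _; rewrite scale0r addr0.
Qed.

(** For a = N the double brackets of the odd terms of [omega] contribute - E, which the summand
    E_(-1) E / 2 of [omega] cancels. *)
Lemma L0_cur a : Y VV (omega VV) 1 (cur V a) = cur V a.
Proof.
rewrite -[LHS]/(Yw (adjoint V) (omega VV) 1 (cur V a)) om_mode /= !quad1.
by case: a; cbn [glpar andb glform glbr fst snd]; rewrite !(expr0, expr1); lincomb; field.
Qed.

Lemma om0_cre v : Y VV (omega VV) 0 v = Y VV v (-2) (vac VV).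
Proof.
have := Y_translation VV v (-1) (vac VV).
by rewrite Y_creation rmorphN1 opprK scale1r.
Qed.

Lemma gbinN2 j : (-1) ^+ j * gbin ((-2)%:~R : K) j = j.+1%:R.
Proof.
elim: j => [|j IH]; first by rewrite gbin0 mul1r.
apply: (mulfI (_ : (j.+1%:R : K) != 0)); first by rewrite pnatr_eq0.
rewrite mulrCA gbinS exprS.
transitivity ((2%:R + j%:R) * ((-1) ^+ j * gbin ((-2)%:~R : K) j)).
  by rewrite [(-2)%:~R](rmorphN _ (2%:Z)) /= ; ring.
rewrite IH -!natr1; ring.
Qed.

Lemma Yw_vacE (W : vmod V) n w :
  Yw W (vac VV) n w = if n == -1 then w else 0.
Proof. exact: Yw_vac. Qed.

(** Since L_(-1) v = v_(-2) vac, the iterate formula applies with vac in second place. A single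
    index survives: in the first summand if n < 0, in the second if n > 0, and none if n = 0. *)
Lemma Yw_translation (W : vmod V) v n w :
  Yw W (Y VV (omega VV) 0 v) n w = - n%:~R *: Yw W v (n - 1) w.
Proof.
rewrite om0_cre.
have key p u : homog p u ->
    Yw W (Y VV u (-2) (vac VV)) n w = - n%:~R *: Yw W u (n - 1) w.
  move=> hu; have [l hl] := Yw_trunc u w.
  rewrite (@bo_iter _ _ _ _ _ _ _ _ _ (borch_Yw W) _ _ (vac VV) w (-2) n (`|n| + `|l|).+1 hu); last 2 first.
  - by move=> j hj; rewrite Yw_vacE; case: eqP => //; lia.
  - by move=> j hj; apply: hl; lia.
  have vp : parX p (vac VV) = vac VV.
    by rewrite (parXE _ (vac_even VV)) andbF expr0 scale1r.
  under eq_bigr do rewrite gbinN2 vp.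
  have [n0|n0] := eqVneq n 0.
    rewrite [X in - X%:~R]n0 big1 ?scaler0 ?oppr0 ?scale0r // => j _.
    by rewrite !Yw_vacE !ifF ?(lf0, scaler0, oppr0, addr0) //; apply/eqP; lia.
  have ltN : (`|n|.-1 < (`|n| + `|l|).+1)%N by lia.
  rewrite (bigD1 (Ordinal ltN)) //= big1 ?addr0; last first.
    move=> j /eqP jn; have {}jn : (j : nat) <> `|n|.-1 by move=> e; apply: jn; apply: val_inj.
    by rewrite !Yw_vacE !ifF ?(lf0, scaler0, oppr0, addr0) //; apply/eqP; lia.
  rewrite !Yw_vacE; have [np|nn] : (0 < n) \/ (n < 0) by lia.
    rewrite ifF; last by apply/eqP; lia.
    rewrite ifT; last by apply/eqP; lia.
    have sq : (-1 : K) ^ (-2) = 1.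
      by rewrite -[(-1) ^ (-2)]/(((-1) ^+ 2)^-1) sqrrN expr1n invr1.
    rewrite lf0 sub0r sq scale1r.
    have -> : `|n|.-1%:Z = n - 1 by lia.
    rewrite scalerN -scaleNr; congr (- _ *: _).
    by rewrite -[ `|n|.-1.+1%:R]/((`|n|.-1.+1)%:Z%:~R) ; congr (_%:~R); lia.
  rewrite ifT; last by apply/eqP; lia.
  rewrite ifF; last by apply/eqP; lia.
  rewrite scaler0 subr0; have -> : -2 - `|n|.-1%:Z = n - 1 by lia.
  congr (_ *: _).
  by rewrite -[ `|n|.-1.+1%:R]/((`|n|.-1.+1)%:Z%:~R) -rmorphN; congr (_%:~R); lia.
rewrite [in LHS](hpartE v) [in RHS](hpartE v).
have Yl (x y : V) : Y VV (x + y) (-2) (vac VV) = Y VV x (-2) (vac VV) + Y VV y (-2) (vac VV).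
  exact: (YwD (W := adjoint V)).
by rewrite Yl !YwD !(key _ _ (hpart_homog _ _)) scalerDr.
Qed.

Lemma om_homog : homog false (omega VV). Proof. exact: omega_even. Qed.

Lemma L0_comm (W : vmod V) v r w :
  Lop W 0 (Yw W v r w) = Yw W v r (Lop W 0 w) - (1 + r)%:~R *: Yw W v r w
    + Yw W (Y VV (omega VV) 1 v) r w.
Proof.
have [l hl] := Y_trunc VV (omega VV) v.
rewrite /Lop (@bo_comm _ _ _ _ _ _ _ _ _ (borch_Yw W) _ _ v w (0 + 1) r (`|l|.+2)%N om_homog) /=.

  rewrite 2!big_ord_recl big1 /=; last first.
    by move=> j _; rewrite /bump /= !add1n -[(0 + 1)]/(1%:Z) gbin_natE bin_small ?scale0r.
  rewrite /bump /= gbin0 add0r gbin1 addr0 Yw_translation addn0.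
  have -> : 1 + r - 1 = r by lia.
  have -> : Yw W (Y VV (omega VV) (Posz 1) v) r w = Yw W (Y VV (omega VV) 1 v) r w by [].

  lincomb.
move=> j hj; apply: hl; lia.
Qed.

Lemma L0_curw (W : vmod V) a r w :
  Lop W 0 (curw W a r w) = curw W a r (Lop W 0 w) - r%:~R *: curw W a r w.
Proof.
by rewrite /curw L0_comm L0_cur rmorphD /=; lincomb.
Qed.

Lemma Lm1_sing (W : vmod V) w :
  (forall a (r : int), 0 < r -> curw W a r w = 0) ->
  Lop W (-1) w = curw W glN (-1) (curw W glE 0 w) + curw W glE (-1) (curw W glN 0 w)
   - curw W psip (-1) (curw W psim 0 w) + curw W psim (-1) (curw W psip 0 w)
   + curw W glE (-1) (curw W glE 0 w).
Proof.
move=> h.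
have q a b : Yw W (Y VV (cur V a) (-1) (cur V b)) 0 w =
   curw W a (-1) (curw W b 0 w) + (-1) ^+ (glpar a && glpar b) *: curw W b (-1) (curw W a 0 w).
  rewrite (@quad_iter W a b 0 w 1) => [|j hj|j hj]; last 2 first.
  - by apply: h; lia.
  - by apply: h; lia.
  by rewrite big_ord_recl big_ord0 /= addr0.
by rewrite /Lop om_mode !q; cbn [glpar andb]; rewrite !(expr0, expr1); lincomb; field.
Qed.

End Generation.

(** * Generalized eigenspaces and submodules *)

Lemma sum_of_map (R : realType) (M N : lmodType R[i]) (f : {linear M -> N}) (P : M -> Prop) (Q : N -> Prop) v :
  (forall u, P u -> Q (f u)) -> sum_of P v -> sum_of Q (f v).
Proof.
move=> PQ [s [hs ->]]; exists (map f s); rewrite linear_sum big_map; split=> //.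
by move=> u /mapP[w /hs hw ->]; apply: PQ.
Qed.

Lemma sum_of_impl (R : realType) (M : lmodType R[i]) (P Q : M -> Prop) v :
  (forall u, P u -> Q u) -> sum_of P v -> sum_of Q v.
Proof. by move=> PQ [s [hs ->]]; exists s; split=> // u /hs /PQ. Qed.

Lemma sum_of0 (R : realType) (M : lmodType R[i]) (P : M -> Prop) : sum_of P 0.
Proof. by exists [::]; rewrite big_nil. Qed.

Lemma sum_of1 (R : realType) (M : lmodType R[i]) (P : M -> Prop) u : P u -> sum_of P u.
Proof. by move=> h; exists [:: u]; rewrite big_seq1; split=> // w; rewrite inE => /eqP ->. Qed.

Lemma sum_ofD (R : realType) (M : lmodType R[i]) (P : M -> Prop) u v :
  sum_of P u -> sum_of P v -> sum_of P (u + v).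
Proof.
move=> [s [hs ->]] [t [ht ->]]; exists (s ++ t); rewrite big_cat; split=> // w.
by rewrite mem_cat => /orP[/hs|/ht].
Qed.

Lemma sum_ofZ (R : realType) (M : lmodType R[i]) (P : M -> Prop) c u :
  (forall c w, P w -> P (c *: w)) -> sum_of P u -> sum_of P (c *: u).
Proof.
move=> h [s [hs ->]]; exists (map (fun w => c *: w) s); rewrite scaler_sumr big_map.
by split=> // w /mapP[x /hs hx ->]; apply: h.
Qed.

Lemma sum_of_lsub (R : realType) (M : lmodType R[i]) (P : M -> Prop) (D : lsub M) u :
  (forall w, P w -> D w) -> sum_of P u -> D u.
Proof. by move=> h [s [hs ->]]; apply: lsub_sum_seq => i /hs /h. Qed.

Definition sum_sub (R : realType) (M : lmodType R[i]) (P : M -> Prop)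
  (h : forall c w, P w -> P (c *: w)) : lsub M :=
  @Lsub R M (sum_of P) (sum_of0 P)
    (fun c u w hu hw => sum_ofD (sum_ofZ c h hu) hw).

Section LinAlg.
Variable R : realType.
Local Notation K := R[i].

(** Injectivity makes the supports of the two families equal, whether finite or not. *)
Lemma lin_fsum_inj (M N : lmodType K) (f : {linear M -> N}) (T : choiceType)
    (F : T -> M) :
  injective f -> f (\sum_(j \in [set: T]) F j) = \sum_(j \in [set: T]) f (F j).
Proof.
move=> finj; rewrite linear_sum.
suff -> : finite_support 0 [set: T]%classic (fun i => f (F i)) =
          finite_support 0 [set: T]%classic F by [].
rewrite /finite_support !unlock; congr (finmap.enum_fset (cardinality.fset_set (_ `&` _)%classic)).
apply/funext => i; apply/propext; split => /= h e; apply: h.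
  by rewrite e lf0.
by apply: finj; rewrite e lf0.
Qed.

Definition genE (M : lmodType K) (T : {linear M -> M}) (c : K) (u : M) : Prop :=
  exists k, iter k (fun u => T u - c *: u) u = 0.

Section PolyAct.
Variables (M : lmodType K) (T : {linear M -> M}).

Definition pact (p : {poly K}) (u : M) : M := \sum_(i < size p) p`_i *: iter i T u.

Lemma pactE (p : {poly K}) u n : (size p <= n)%N -> pact p u = \sum_(i < n) p`_i *: iter i T u.
Proof.
move=> h; rewrite /pact (@sum_trunc _ (fun i => p`_i *: iter i T u) (size p) n) //.
by move=> j hj; rewrite nth_default // scale0r.
Qed.

Lemma pactD (p q : {poly K}) u : pact (p + q) u = pact p u + pact q u.
Proof.
set n := maxn (size p) (size q).
rewrite (@pactE _ u n); last by rewrite (leq_trans (size_polyD _ _)).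
rewrite (@pactE p u n) ?leq_maxl // (@pactE q u n) ?leq_maxr // -big_split /=.
by apply: eq_bigr => i _; rewrite coefD scalerDl.
Qed.

Lemma pactC c u : pact c%:P u = c *: u.
Proof.
rewrite (@pactE _ u 1) ?big_ord_recl ?big_ord0 ?addr0 /= ?coefC //.
by rewrite size_polyC; case: eqP.
Qed.

Lemma pact_lin (p : {poly K}) : linear (pact p).
Proof.
move=> c u w; rewrite /pact scaler_sumr -big_split /=; apply: eq_bigr => i _.
have -> : iter i T (c *: u + w) = c *: iter i T u + iter i T w.
  by elim: (nat_of_ord i) => //= m ->; rewrite linearP.
by rewrite scalerDr !scalerA mulrC.
Qed.

Lemma pactMX (p : {poly K}) u : pact (p * 'X) u = T (pact p u).
Proof.
rewrite (@pactE _ u (size p).+1); last by rewrite (leq_trans (size_polyMleq _ _)) // size_polyX addn2.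
rewrite big_ord_recl coefMX eqxx scale0r add0r /pact linear_sum; apply: eq_bigr => i _.
by rewrite coefMX /= linearZ.
Qed.

Lemma pact0 u : pact 0 u = 0.
Proof. by rewrite /pact size_poly0 big_ord0. Qed.

Lemma pactM (p q : {poly K}) u : pact (p * q) u = pact p (pact q u).
Proof.
elim/poly_ind: p => [|p c IH]; first by rewrite mul0r !pact0.
rewrite mulrDl !pactD !pactC -mulrA [_ * q]mulrC mulrA pactMX IH pactMX; congr (_ + _).
rewrite mulrC -pactC.
elim/poly_ind: q {IH} => [|q d IH]; first by rewrite mul0r !pact0 pactC scaler0.
rewrite mulrDl !pactD -mulrA [_ * c%:P]mulrC mulrA !pactMX IH pactC.
by rewrite -polyCM !pactC linearZ scalerDr scalerA mulrC.
Qed.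

Lemma pact_XsubC c k u : pact (('X - c%:P) ^+ k) u = iter k (fun u => T u - c *: u) u.
Proof.
elim: k => [|k IH] /=; first by rewrite expr0 pactC scale1r.
rewrite exprS pactM IH pactD -polyCN pactC scaleNr; congr (_ - _).
by rewrite -['X]mul1r pactMX pactC scale1r.
Qed.

Lemma pact_in (D : lsub M) (hT : forall u, D u -> D (T u)) p u : D u -> D (pact p u).
Proof.
move=> hu; apply: lsub_sum => i _; apply: lsubZ.
by elim: (nat_of_ord i) => //= m; apply: hT.
Qed.

Definition othE c (y : M) := sum_of (fun u => exists c', c' != c /\ genE T c' u) y.

Lemma genE0 c : genE T c 0.
Proof. by exists 0%N. Qed.

Lemma genEL c a u w : genE T c u -> genE T c w -> genE T c (a *: u + w).
Proof.
move=> [k hk] [l hl]; exists (k + l)%N.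
rewrite -pact_XsubC pact_lin {1}addnC !exprD !pactM !pact_XsubC hk hl.
have i0 m : iter m (fun u => T u - c *: u) 0 = 0.
  by elim: m => //= m ->; rewrite lf0 scaler0 subr0.
by rewrite !i0 scaler0 addr0.
Qed.

Definition eigE c (u : M) := T u = c *: u.

Lemma eigE_gen c u : eigE c u -> genE T c u.
Proof. by move=> h; exists 1%N; rewrite /= h subrr. Qed.

Lemma eigEL c a u w : eigE c u -> eigE c w -> eigE c (a *: u + w).
Proof. by rewrite /eigE linearP => -> ->; rewrite scalerDr !scalerA mulrC. Qed.

Section Split.
Variable G : K -> M -> Prop.
Hypotheses (G0 : forall c, G c 0)
  (GL : forall c a u w, G c u -> G c w -> G c (a *: u + w)).

(** The family [G] of subspaces is arbitrary so as to serve eigenspaces and generalized eigenspaces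
    alike; the bound on the size of t carries the induction in [sum_of_in]. *)
Lemma split_seq c (s : seq M) : (forall u, u \in s -> exists c, G c u) ->
  exists x t, [/\ \sum_(u <- s) u = x + \sum_(u <- t) u, G c x,
    forall u, u \in t -> exists c', c' != c /\ G c' u & (size t <= size s)%N].
Proof.
elim: s => [|u s IH] hs; first by exists 0, [::]; rewrite big_nil addr0.
have [|x [t [e gx ht st]]] := IH; first by move=> w hw; apply: hs; rewrite inE hw orbT.
have [|c' hc'] := hs u; first by rewrite inE eqxx.
rewrite big_cons e; have [ec|nc] := eqVneq c' c.
  exists (u + x), t; rewrite addrA; split=> //; last exact: leqW.
  by rewrite -[u]scale1r; apply: GL => //; rewrite -ec.
exists x, (u :: t); rewrite big_cons; split=> //; first by rewrite addrCA.
move=> w; rewrite inE => /orP[/eqP ->|/ht //].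
by exists c'.
Qed.

End Split.

Lemma genE_split c v : sum_of (fun u => exists c, genE T c u) v ->
  exists x y, [/\ v = x + y, genE T c x & othE c y].
Proof.
move=> [s [hs ->]].
have [x [t [e gx ht _]]] := split_seq genE0 genEL c hs.
by exists x, (\sum_(u <- t) u); split=> //; exists t.
Qed.

(* Bezout: a polynomial in T projects a sum onto its generalized eigencomponent. *)
Lemma genE_comp (D : lsub M) (hT : forall u, D u -> D (T u)) c x y :
  genE T c x -> othE c y -> D (x + y) -> D x.
Proof.
move=> [k hk] [s [hs ->]] hD.
have [q [hq1 hq2]] : exists q : {poly K}, coprimep (('X - c%:P) ^+ k) q /\
    pact q (\sum_(u <- s) u) = 0.
  elim: s hs {hD} => [|u s IH] hs.
    exists 1; split; first exact: coprimep1.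
    by rewrite big_nil (_ : 1 = 1%:P) // pactC scaler0.
  have [|q [h1 h2]] := IH; first by move=> w hw; apply: hs; rewrite inE hw orbT.
  have [|c' [nc [l hl]]] := hs u; first by rewrite inE eqxx.
  exists (('X - c'%:P) ^+ l * q); split.
    rewrite coprimepMr h1 andbT; apply: coprimep_expl; apply: coprimep_expr.
    by rewrite coprimep_XsubC root_XsubC.
  rewrite big_cons.
  have := pact_lin (('X - c'%:P) ^+ l * q) 1 u (\sum_(u <- s) u); rewrite !scale1r => ->.
  have p0 p : pact p 0 = 0 by have := pact_lin p (-1) 0 0; rewrite scaler0 addr0 scaleN1r addNr.
  by rewrite {1}mulrC !pactM h2 pact_XsubC hl !p0 addr0.
have /Bezout_eq1_coprimepP [[a b] /= ab] := hq1.
have p0 p : pact p 0 = 0 by have := pact_lin p (-1) 0 0; rewrite scaler0 addr0 scaleN1r addNr.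
have e : pact (b * q) (x + \sum_(u <- s) u) = x.
  have := pact_lin (b * q) 1 x (\sum_(u <- s) u); rewrite !scale1r => ->.
  rewrite [pact (b * q) (\sum_(u <- s) u)]pactM hq2 p0 addr0.
  have ex : pact (a * ('X - c%:P) ^+ k + b * q) x = x.
    by rewrite ab (_ : 1 = 1%:P) // pactC scale1r.
  by rewrite -[RHS]ex pactD [pact (a * _) x]pactM pact_XsubC hk p0 add0r.
by rewrite -e; apply: pact_in.
Qed.

(** The summands of one eigenvalue are collected into a single vector, which [genE_comp] puts into
    [D]; what remains is a shorter sum that still lies in [D]. *)
Lemma sum_of_in (D : lsub M) (hT : forall u, D u -> D (T u)) (G : K -> M -> Prop) v :
  (forall c, G c 0) -> (forall c a u w, G c u -> G c w -> G c (a *: u + w)) ->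
  (forall c u, G c u -> genE T c u) ->
  sum_of (fun u => exists c, G c u) v -> D v ->
  sum_of (fun u => D u /\ exists c, G c u) v.
Proof.
move=> G0 GL Gg [s [hs ->]] {v}; have [n] := ubnP (size s).
elim: n s hs => // n IH [|u s] hs sn hD; first by exists [::]; rewrite !big_nil.
have [|c hc] := hs u; first by rewrite inE eqxx.
have [|x [t [e gx ht st]]] := split_seq G0 GL c (s := s).
  by move=> w hw; apply: hs; rewrite inE hw orbT.
have gux : G c (u + x) by rewrite -[u]scale1r; apply: GL.
have hoth : othE c (\sum_(u <- t) u).
  by exists t; split=> // w /ht [c' [nc gc]]; exists c'; split=> //; apply: Gg.
move: hD; rewrite big_cons e addrA => hD.
have Dux : D (u + x) by apply: (genE_comp hT (Gg _ _ gux) hoth).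
have Dt : D (\sum_(u <- t) u) by have := lsubB hD Dux; rewrite [X in D (X - _)]addrC addrK.
apply: sum_ofD; first by apply: sum_of1; split=> //; exists c.
apply: IH => //; first by move=> w /ht [c' [_ h]]; exists c'.
by apply: leq_ltn_trans st _; rewrite -ltnS.
Qed.

End PolyAct.

(** Independence of generalized eigenspaces is [genE_comp] for the zero subspace. *)
Lemma genE_othE0 (M : lmodType K) (T : {linear M -> M}) c x y :
  genE T c x -> othE T c y -> x + y = 0 -> x = 0.
Proof.
move=> hx hy e.
pose D := @Lsub R M (fun x => x = 0) erefl
  (fun c u w hu hw => etrans (congr2 (fun a b => c *: a + b) hu hw)
     (etrans (congr1 (fun z => z + 0) (scaler0 M c)) (addr0 0))).
by apply: (@genE_comp M T D _ c x y) => // u /= ->; rewrite lf0.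
Qed.

End LinAlg.

Section FinSpan.
Variable R : realType.
Local Notation K := R[i].
Variable M : lmodType K.

Definition inspan (s : seq M) (v : M) :=
  exists c : nat -> K, v = \sum_(i < size s) c i *: s`_i.

Lemma inspan_cons x s v : inspan (x :: s) v <-> exists a y, inspan s y /\ v = a *: x + y.
Proof.
split=> [[c ->]|[a [y [[c ->] ->]]]].
  rewrite big_ord_recl /=; exists (c 0%N), (\sum_(i < size s) c i.+1 *: s`_i); split=> //.
  by exists (fun i => c i.+1).
exists (fun i => if i is j.+1 then c j else a).
by rewrite /= big_ord_recl.
Qed.

Lemma inspan0 s : inspan s 0.
Proof. by exists (fun=> 0); rewrite big1 // => i _; rewrite scale0r. Qed.

Lemma inspanL s c u w : inspan s u -> inspan s w -> inspan s (c *: u + w).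
Proof.
move=> [a ->] [b ->]; exists (fun i => c * a i + b i).
rewrite scaler_sumr -big_split /=; apply: eq_bigr => i _.
by rewrite scalerDl scalerA.
Qed.

Lemma inspan_catD s t u w : inspan s u -> inspan t w -> inspan (s ++ t) (u + w).
Proof.
elim: s u => [|x s IH] u /=.
  by move=> [c ->] hw; rewrite big_ord0 add0r.
move=> /inspan_cons[a [y [hy ->]]] hw; apply/inspan_cons.
by exists a, (y + w); rewrite addrA; split=> //; apply: IH.
Qed.

(** Gaussian elimination: a vector of [P] with nonzero coefficient at [x], if there is one, reduces
    every other vector of [P] to one spanned by the rest of the list. *)
Lemma inspan_subspace s (P : M -> Prop) :
  P 0 -> (forall c u w, P u -> P w -> P (c *: u + w)) ->
  (forall v, P v -> inspan s v) ->
  exists t, (forall u, u \in t -> P u) /\ forall v, P v -> inspan t v.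
Proof.
elim: s P => [|x s IH] P P0 PL hP; first by exists [::].
have [] := IH (fun v => P v /\ inspan s v).
- by split=> //; apply: inspan0.
- by move=> c u w [a b] [d e]; split; [apply: PL|apply: inspanL].
- by move=> v [].
move=> t [t1 t2].
have [[p [a [y [hp hy e a0]]]]|no] := pselect (exists p a y, [/\ P p, inspan s y, p = a *: x + y & a != 0]); last first.
  exists t; split=> [u /t1[]//|v hv]; apply: t2; split=> //.
  have /inspan_cons[a [y [hy e]]] := hP _ hv.
  have [a0|a0] := eqVneq a 0; first by rewrite e a0 scale0r add0r.
  by case: no; exists v, a, y.
exists (p :: t); split=> [u|v hv].
  by rewrite inE => /orP[/eqP ->//|/t1[]].
have /inspan_cons[b [z [hz ev]]] := hP _ hv.
apply/inspan_cons; exists (b / a), (v - (b / a) *: p); split; last by rewrite addrC subrK.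
apply: t2; split.
  by have := PL (- (b / a)) p v hp hv; rewrite scaleNr addrC.
have -> : v - (b / a) *: p = - (b / a) *: y + z by rewrite ev e; lincomb; field.
exact: inspanL.
Qed.

End FinSpan.

Lemma inspan_map (R : realType) (M N : lmodType R[i]) (f : {linear M -> N}) s v :
  inspan s v -> inspan (map f s) (f v).
Proof.
elim: s v => [|x s IH] v; first by move=> [c ->]; rewrite big_ord0 lf0; apply: inspan0.
move=> /inspan_cons[a [y [hy ->]]]; rewrite /= lfD lfZ; apply/inspan_cons.
by exists a, (f y); split=> //; apply: IH.
Qed.

Section SubModules.
Variables (R : realType) (V : V1gl11 R).
Local Notation K := R[i].

Definition lsubV (W : vmod V) (D : W -> Prop) (h : submod D) : lsub W :=
  match h with And4 h0 hL _ _ => @Lsub R W D h0 hL end.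

Lemma lsubVE (W : vmod V) (D : W -> Prop) (h : submod D) x : lsubV h x = D x.
Proof. by case: h. Qed.

Section SubV.
Variables (W : vmod V) (D : W -> Prop) (h : submod D).
Let DD := lsubV h.
Lemma subV_par u : DD u -> DD (par W u).
Proof. by rewrite !lsubVE; case: h => _ _ hp _; apply: hp. Qed.
Lemma subV_Y v n u : DD u -> DD (Yw W v n u).
Proof. by rewrite !lsubVE; case: h => _ _ _ hY; apply: hY. Qed.

Let S := sub_super subV_par.
Let ic : {linear S -> W} := sincl subV_par.
Let Ys v n : {linear S -> S} := sub_end subV_par (subV_Y v n).

Lemma subV_linear n w : linear (fun v => Ys v n w).
Proof.
move=> c u v; apply: (@sincl_inj _ _ _ subV_par).
by rewrite lfD lfZ !sub_endE YwD YwZ.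
Qed.
Lemma subV_Ypar v n w : par S (Ys v n w) = Ys (par V v) n (par S w).
Proof. by apply: (@sincl_inj _ _ _ subV_par); exact: Yw_par. Qed.
Lemma subV_trunc v w : exists n0 : int, forall n, n0 <= n -> Ys v n w = 0.
Proof.
have [n0 hn] := Yw_trunc v (ic w); exists n0 => n hn0.
by apply: (@sincl_inj _ _ _ subV_par); rewrite lf0 sub_endE hn.
Qed.
Lemma subV_vac n w : Ys (vac (Vv V)) n w = if n == -1 then w else 0.
Proof.
apply: (@sincl_inj _ _ _ subV_par); rewrite sub_endE Yw_vac.
by case: ifP => // _; rewrite lf0.
Qed.
Lemma subV_borcherds p q (a b : V) (w : S) (m n k : int) :
  homog p a -> homog q b ->
    \sum_(j \in [set: nat])
       gbin m%:~R j *: Ys (Y (Vv V) a (n + j%:Z) b) (m + k - j%:Z) w =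
    \sum_(j \in [set: nat]) ((-1) ^+ j * gbin n%:~R j) *:
       (Ys a (m + n - j%:Z) (Ys b (k + j%:Z) w)
        - ((-1) ^+ (p && q) * (-1) ^ n) *:
            Ys b (n + k - j%:Z) (Ys a (m + j%:Z) w)).
Proof.
move=> ha hb; have inj := @sincl_inj _ _ _ subV_par.
apply: (inj); rewrite !(lin_fsum_inj _ inj).
apply: etrans (etrans (Yw_borcherds (sincl subV_par w) m n k ha hb) _).
  by apply: eq_fsbigr => j _; rewrite lfZ.
by apply: eq_fsbigr => j _; rewrite [in RHS](lfZ ic) (lfB ic) (lfZ ic).
Qed.

Definition subV : vmod V :=
  @Vmod R V S Ys subV_linear subV_Ypar subV_trunc subV_vac subV_borcherds.

Definition subi : {linear subV -> W} := ic.
Lemma subi_par w : subi (par subV w) = (-1) ^+ false *: par W (subi w).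
Proof. by rewrite expr0 scale1r. Qed.
Lemma subi_Y v n w : subi (Yw subV v n w) = Yw W (parX false v) n (subi w).
Proof. by []. Qed.
Definition subh : hom false subV W := Hom subi_par subi_Y.

Lemma subh_inj : injective subh. Proof. exact: sincl_inj. Qed.
Lemma subh_in x : D (subh x). Proof. by have := sincl_in (x : S); rewrite lsubVE. Qed.
Lemma subh_elim x : D x -> exists y, subh y = x.
Proof. by rewrite -(lsubVE h) => /(sub_elim subV_par). Qed.

Section Lift.
Variables (p : bool) (X : vmod V) (f : hom p X W) (hf : forall x, D (f x)).
Let hf' x : DD (f x). Proof. by rewrite lsubVE. Qed.
Definition sublift_fun : {linear X -> subV} := sub_lift subV_par hf'.
Lemma sublift_par w : sublift_fun (par X w) = (-1) ^+ p *: par subV (sublift_fun w).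
Proof.
by apply: subh_inj; rewrite lfZ [LHS](hom_par f) [in RHS](hom_par subh) expr0 scale1r.
Qed.
Lemma sublift_Y v n w : sublift_fun (Yw X v n w) = Yw subV (parX p v) n (sublift_fun w).
Proof. by apply: subh_inj; rewrite [LHS](hom_Y f). Qed.
Definition sublift : hom p X subV := Hom sublift_par sublift_Y.
Lemma subliftE x : subh (sublift x) = f x. Proof. by []. Qed.
End Lift.
End SubV.

Program Definition hcompp p q (W1 W2 W3 : vmod V) (g : hom p W2 W3) (f : hom q W1 W2) :
  hom (p (+) q) W1 W3 := @Hom R V (p (+) q) W1 W3 (g \o f) _ _.
Next Obligation.
by move=> p q W1 W2 W3 g f w; rewrite /= !hom_par lfZ hom_par scalerA signr_addb mulrC.
Qed.
Next Obligation.
move=> p q W1 W2 W3 g f v n w; rewrite /= !hom_Y; congr (Yw _ _ _ _).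
by case: p g => g; case: q f => f //=; rewrite parKE.
Qed.

Lemma hom_Ye (W1 W2 : vmod V) (f : hom false W1 W2) v n w : f (Yw W1 v n w) = Yw W2 v n (f w).
Proof. by rewrite hom_Y. Qed.
Lemma hom_pare (W1 W2 : vmod V) (f : hom false W1 W2) w : f (par W1 w) = par W2 (f w).
Proof. by rewrite hom_par scale1r. Qed.

Lemma hom_L p (W1 W2 : vmod V) (f : hom p W1 W2) n w : f (Lop W1 n w) = Lop W2 n (f w).
Proof. by rewrite /Lop hom_Y (parXE _ (om_homog V)) andbF expr0 scale1r. Qed.

Lemma hom_cur p (W1 W2 : vmod V) (f : hom p W1 W2) a r w :
  f (curw W1 a r w) = (-1) ^+ (p && glpar a) *: curw W2 a r (f w).
Proof. by rewrite /curw hom_Y (parXE _ (cur_homog V a)) YwZ. Qed.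

Lemma hom_curN p (W1 W2 : vmod V) (f : hom p W1 W2) r w :
  f (curw W1 glN r w) = curw W2 glN r (f w).
Proof. by rewrite hom_cur andbF expr0 scale1r. Qed.
Lemma hom_curE p (W1 W2 : vmod V) (f : hom p W1 W2) r w :
  f (curw W1 glE r w) = curw W2 glE r (f w).
Proof. by rewrite hom_cur andbF expr0 scale1r. Qed.

Lemma sgnZ_in (W : lmodType K) (D : lsub W) p u : D ((-1) ^+ p *: u) -> D u.
Proof.
move=> h; have := lsubZ ((-1) ^+ p) h.
by rewrite scalerA -expr2 sqrr_sign scale1r.
Qed.

Lemma hom_Yx p (W1 W2 : vmod V) (f : hom p W1 W2) v n w :
  Yw W2 v n (f w) = f (Yw W1 (parX p v) n w).
Proof. by rewrite hom_Y parXK. Qed.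

Lemma hom_parx p (W1 W2 : vmod V) (f : hom p W1 W2) w :
  par W2 (f w) = f ((-1) ^+ p *: par W1 w).
Proof. by rewrite lfZ hom_par scalerA -expr2 sqrr_sign scale1r. Qed.

Lemma im_submod p (W1 W2 : vmod V) (f : hom p W1 W2) (D : W1 -> Prop) :
  submod D -> submod (fun y => exists x, D x /\ f x = y).
Proof.
move=> [h0 hL hp hY]; have DZ c x : D x -> D (c *: x).
  by move=> hx; have := hL c x 0 hx h0; rewrite addr0.
split.
- by exists 0; rewrite lf0.
- move=> c _ _ [x [hx <-]] [y [hy <-]]; exists (c *: x + y); rewrite linearP.
  by split=> //; apply: hL.
- move=> _ [x [hx <-]]; rewrite hom_parx; eexists; split; last by [].
  by apply: DZ; apply: hp.
- by move=> v n _ [x [hx <-]]; rewrite hom_Yx; eexists; split; last by []; apply: hY.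
Qed.

Lemma pre_submod p (W1 W2 : vmod V) (f : hom p W1 W2) (D : W2 -> Prop) :
  submod D -> submod (fun x => D (f x)).
Proof.
move=> [h0 hL hp hY]; split.
- by rewrite lf0.
- by move=> c x y hx hy; rewrite linearP; apply: hL.
- move=> x hx; rewrite hom_par; have := hL ((-1) ^+ p) _ 0 (hp _ hx) h0.
  by rewrite addr0.
- by move=> v n x hx; rewrite hom_Y; apply: hY.
Qed.

Lemma submodT (W : vmod V) : submod (fun _ : W => True).
Proof. by split. Qed.
Lemma submod0 (W : vmod V) : submod (fun x : W => x = 0).
Proof. by split=> // [c u w -> ->|u ->|v n u ->]; rewrite ?lf0 ?scaler0 ?addr0. Qed.
Lemma submodI (W : vmod V) (D E : W -> Prop) : submod D -> submod E ->
  submod (fun x => D x /\ E x).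
Proof.
move=> [a b c d] [a' b' c' d']; split=> //.
- by move=> t u w [] ? ? [] ? ?; split; [apply: b|apply: b'].
- by move=> u [] ? ?; split; [apply: c|apply: c'].
- by move=> v n u [] ? ?; split; [apply: d|apply: d'].
Qed.
Lemma submodD (W : vmod V) (D E : W -> Prop) : submod D -> submod E ->
  submod (fun x => exists y z, [/\ D y, E z & x = y + z]).
Proof.
move=> [a b c d] [a' b' c' d']; split.
- by exists 0, 0; rewrite addr0.
- move=> t _ _ [y [z [hy hz ->]]] [y' [z' [hy' hz' ->]]].
  exists (t *: y + y'), (t *: z + z'); split; [exact: b|exact: b'|lincomb].
- move=> _ [y [z [hy hz ->]]]; exists (par W y), (par W z); rewrite lfD; split=> //.
    exact: c.
  exact: c'.
- move=> v n _ [y [z [hy hz ->]]]; exists (Yw W v n y), (Yw W v n z); rewrite lfD.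
  by split=> //; [apply: d|apply: d'].
Qed.

Lemma gen_wt_hom p (W1 W2 : vmod V) (f : hom p W1 W2) h w : gen_wt h w -> gen_wt h (f w).
Proof.
move=> [k hk]; exists k; rewrite -[RHS](lf0 f) -hk.
by elim: k {hk} => //= k ->; rewrite (lfB f) hom_L (lfZ f).
Qed.

Lemma gen_wt_inj p (W1 W2 : vmod V) (f : hom p W1 W2) h w : injective f ->
  gen_wt h (f w) -> gen_wt h w.
Proof.
move=> inj [k hk]; exists k; apply: inj; rewrite lf0 -hk.
by elim: k {hk} => //= k <-; rewrite (lfB f) hom_L (lfZ f).
Qed.

End SubModules.

(** * Finite-length submodules *)

Section Ofin.
Variables (R : realType) (V : V1gl11 R).
Local Notation K := R[i].

Definition simple_step (W : vmod V) (D E : W -> Prop) :=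
  forall F : W -> Prop, submod F -> (forall w, D w -> F w) ->
   (forall w, F w -> E w) -> (forall w, F w -> D w) \/ (forall w, E w -> F w).

(** The chain consists of submodules of [W] and only has to end above [D], so that the same chain
    serves every smaller submodule. *)
Definition FL (W : vmod V) (D : W -> Prop) :=
  exists (n : nat) (U : nat -> W -> Prop),
    [/\ forall i, submod (U i), forall w, U 0%N w -> w = 0, forall w, D w -> U n w,
        forall i w, U i w -> U i.+1 w & forall i, simple_step (U i) (U i.+1)].

(* D is (the image of) an object of O_1^fin inside W *)
Record OfinD (W : vmod V) (D : W -> Prop) : Prop := MkOfinD {
  od_sub : submod D;
  od_fl : FL D;
  od_wt : forall w, D w -> sum_of (fun u => exists h, gen_wt h u) w;
  od_fs : forall h, fin_span (fun u : W => D u /\ gen_wt h u);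
  od_bd : forall h, exists n0 : nat, forall n : nat, (n0 <= n)%N ->
        forall u : W, D u -> gen_wt (h - n%:R) u -> u = 0;
  od_N : forall w, D w -> sum_of (fun u => exists c : K, curw W glN 0 u = c *: u) w;
  od_E : forall w, D w -> sum_of (fun u => exists c : K, curw W glE 0 u = c *: u) w }.

Lemma othE_map (M N : lmodType K) (T : {linear M -> M}) (T' : {linear N -> N})
  (f : {linear M -> N}) c y :
  (forall u, f (T u) = T' (f u)) -> othE T c y -> othE T' c (f y).
Proof.
move=> h; apply: sum_of_map => u [c' [nc [k hk]]]; exists c'; split=> //; exists k.
rewrite -[RHS](lf0 f) -hk.
by elim: k {hk} => //= k ->; rewrite (lfB f) h (lfZ f).
Qed.

Lemma othEZ (M : lmodType K) (T : {linear M -> M}) c a y : othE T c y -> othE T c (a *: y).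
Proof.
apply: sum_ofZ => b w [c' [nc hw]]; exists c'; split=> //.
by have := genEL b hw (genE0 T c'); rewrite addr0.
Qed.

Lemma genE_map (M N : lmodType K) (T : {linear M -> M}) (T' : {linear N -> N})
  (f : {linear M -> N}) c y :
  (forall u, f (T u) = T' (f u)) -> genE T c y -> genE T' c (f y).
Proof.
move=> h [k hk]; exists k; rewrite -[RHS](lf0 f) -hk.
by elim: k {hk} => //= k ->; rewrite (lfB f) h (lfZ f).
Qed.

(** The component of weight h of v already has image f v, since the other components map to other
    weights. Weight spaces of an image are thus images of weight spaces. *)
Lemma gen_of_im p (M X : vmod V) (f : hom p M X) h v :
  sum_of (fun u => exists h, gen_wt h u) v -> gen_wt h (f v) ->
  exists x, gen_wt h x /\ f x = f v.
Proof.
move=> sv gv; have [x [y [e gx oy]]] := genE_split h sv.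
exists x; split=> //; apply/eqP; rewrite eq_sym -subr_eq0; apply/eqP.
apply: (@genE_othE0 R X (Lop X 0) h _ (- f y)).
- rewrite -scaleN1r addrC; apply: genEL => //; exact: gen_wt_hom.
- rewrite -scaleN1r; apply: othEZ; apply: (othE_map (f := f)) oy => u; exact: hom_L.
- by rewrite e lfD; lincomb.
Qed.

Lemma simple_step_im p (M X : vmod V) (f : hom p M X) (D E : M -> Prop) :
  submod D -> submod E -> (forall w, D w -> E w) -> simple_step D E ->
  simple_step (fun y => exists x, D x /\ f x = y) (fun y => exists x, E x /\ f x = y).
Proof.
move=> sD sE DE h F sF DF FE.
have sP := submodI (pre_submod f sF) sE.
have [|||h1] := h _ sP.
- by move=> w hw; split; [apply: DF; exists w|apply: DE].
- by move=> w [].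
- move=> h1; left=> y hy; have [x [hx e]] := FE _ hy; exists x; split=> //.
  by apply: h1; rewrite e.
- by right=> y [x [/h1[h2 _] <-]].
Qed.

Lemma OfinD_im p (M X : vmod V) (f : hom p M X) : in_Ofin M ->
  OfinD (fun y : X => exists x : M, f x = y).
Proof.
move=> [[n [U [U1 U2 U3 U4 U5]]] [g1 g2 g3] hN hE].
have sub : submod (fun y : X => exists x : M, f x = y).
  have := im_submod f (submodT M); congr submod; apply/funext => y; apply/propext.
  by split=> [[x [_ h]]|[x h]]; exists x.
split=> //.
- exists n, (fun i y => exists x, U i x /\ f x = y); split.
  + by move=> i; apply: im_submod.
  + by move=> w [x [/U2 -> <-]]; rewrite lf0.
  + by move=> w [x <-]; exists x.
  + by move=> i w [x [/U4 h <-]]; exists x.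
  + by move=> i; apply: simple_step_im => //; first exact: U4; exact: U5.
- by move=> _ [x <-]; apply: (sum_of_map (f := f)) (g1 x) => u [h hu]; exists h; apply: gen_wt_hom.
- move=> h; have [s hs] := g2 h; exists (map f s) => _ [[x <-] gx].
  have [y [gy e]] := gen_of_im (g1 x) gx.
  by rewrite -e; apply: inspan_map; apply: hs.
- move=> h; have [n0 hn] := g3 h; exists n0 => m hm _ [x <-] gx.
  have [y [gy <-]] := gen_of_im (g1 x) gx.
  by rewrite (hn m hm y gy) lf0.
- move=> _ [x <-]; apply: (sum_of_map (f := f)) (hN x) => u [c hc]; exists c.
  by rewrite -(hom_curN f) hc lfZ.
- move=> _ [x <-]; apply: (sum_of_map (f := f)) (hE x) => u [c hc]; exists c.
  by rewrite -(hom_curE f) hc lfZ.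
Qed.

Lemma OfinD_le (X : vmod V) (D E : X -> Prop) : OfinD D -> submod E ->
  (forall w, E w -> D w) -> OfinD E.
Proof.
move=> [d1 [n [U [U1 U2 U3 U4 U5]]] d3 d4 d5 d6 d7] sE ED; split=> //.
- by exists n, U; split=> // w /ED /U3.
- by move=> w /ED /d3.
- by move=> h; have [s hs] := d4 h; exists s => v [/ED a b]; apply: hs.
- by move=> h; have [m hm] := d5 h; exists m => k mk u /ED a b; apply: hm b.
- by move=> w /ED /d6.
- by move=> w /ED /d7.
Qed.

Lemma OfinD_add (X : vmod V) (D E : X -> Prop) : OfinD D -> OfinD E ->
  OfinD (fun x => exists y z, [/\ D y, E z & x = y + z]).
Proof.
move=> [d1 [n [U [U1 U2 U3 U4 U5]]] d3 d4 d5 d6 d7] [e1 [m [P [P1 P2 P3 P4 P5]]] e3 e4 e5 e6 e7].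
(* The summands of a vector of weight h are replaced by their components of weight h, which stay in
   [D] and [E]; the finiteness conditions on the sum then follow from those on [D] and [E]. *)
have comp h w y z : D y -> E z -> w = y + z -> gen_wt h w ->
    exists y' z', [/\ D y', E z', gen_wt h y', gen_wt h z' & w = y' + z'].
  move=> Dy Ez ew gw.
  have [y1 [y2 [ey gy oy]]] := genE_split h (d3 _ Dy).
  have [z1 [z2 [ez gz oz]]] := genE_split h (e3 _ Ez).
  have LT (F : X -> Prop) (sF : submod F) u : lsubV sF u -> lsubV sF (Lop X 0 u).
    by rewrite !lsubVE; case: sF => _ _ _; apply.
  exists y1, z1; split=> //.
  - have := @genE_comp R X (Lop X 0) (lsubV d1) (LT _ d1) h y1 y2 gy oy.
    by rewrite !lsubVE -ey; apply.
  - have := @genE_comp R X (Lop X 0) (lsubV e1) (LT _ e1) h z1 z2 gz oz.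
    by rewrite !lsubVE -ez; apply.
  apply/eqP; rewrite -subr_eq0; apply/eqP.
  apply: (@genE_othE0 R X (Lop X 0) h _ (- (y2 + z2))).
  - rewrite -scaleN1r addrC; apply: genEL => //.
    by rewrite -[y1]scale1r; apply: genEL.
  - by rewrite -scaleN1r; apply: othEZ; apply: sum_ofD.
  - by rewrite ew ey ez; lincomb.
split.
- exact: submodD.
- exists (n + m)%N, (fun i => if (i <= n)%N then U i else
     fun x => exists y z, [/\ U n y, P (i - n)%N z & x = y + z]); split.
  + by move=> i; case: ifP => _ //; apply: submodD.
  + by move=> w; rewrite leq0n => /U2.
  + move=> w [y [z [/U3 hy /P3 hz ->]]]; case: ifP => h.
      have m0 : m = 0%N by lia.
      by move: hz; rewrite m0 addn0 => /P2 ->; rewrite addr0.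
    by exists y, z; rewrite addKn.
  + move=> i w; case: ifP => h1; case: ifP => h2; try lia.
    * exact: U4.
    * have -> : i = n by lia.
      have [p0 _ _ _] := P1 (n.+1 - n)%N.
      by move=> hw; exists w, 0; rewrite addr0.
    * by move=> [y [z [hy hz ->]]]; exists y, z; split=> //; rewrite subSn ?P4 //; [apply: P4|lia].
  + have step i : simple_step (fun x => exists y z, [/\ U n y, P i z & x = y + z])
          (fun x => exists y z, [/\ U n y, P i.+1 z & x = y + z]).
      move=> F sF h1 h2; have [f0 fL _ _] := sF.
      have Un y : U n y -> F y.
        move=> hy; apply: h1; exists y, 0; rewrite addr0; split=> //.
        by have [] := P1 i.
      have [|||h3] := P5 i _ (submodI sF (P1 i.+1)).
      * move=> w hw; split; last exact: P4.
        by apply: h1; exists 0, w; rewrite add0r; split=> //; have [] := U1 n.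
      * by move=> w [].
      * move=> h3; left=> w hw; have [y [z [hy hz e]]] := h2 _ hw.
        exists y, z; split=> //; apply: h3; split=> //.
        have := fL (-1) _ _ (Un _ hy) hw; rewrite e.
        by have -> : -1 *: y + (y + z) = z by lincomb.
      * right=> w [y [z [hy /h3[hz _] ->]]].
        by have := fL 1 _ _ (Un _ hy) hz; rewrite scale1r.
    move=> i; case: ifP => h1; case: ifP => h2; try lia.
    * exact: U5.
    * have -> : i = n by lia.
      have := step 0%N; rewrite subSnn; congr simple_step; apply/funext => x; apply/propext.
      split=> [[y [z [hy /P2 -> ->]]]|hx]; first by rewrite addr0.
      by exists x, 0; rewrite addr0; split=> //; have [] := P1 0%N.
    * by rewrite subSn; [apply: step|lia].
- by move=> w [y [z [/d3 hy /e3 hz ->]]]; apply: sum_ofD.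
- move=> h; have [s hs] := d4 h; have [t ht] := e4 h; exists (s ++ t).
  move=> w [[y [z [hy hz e]]] gw]; have [y' [z' [a b c d ->]]] := comp _ _ _ _ hy hz e gw.
  by apply: inspan_catD; [apply: hs|apply: ht].
- move=> h; have [a ha] := d5 h; have [b hb] := e5 h; exists (a + b)%N => k hk.
  move=> w [y [z [hy hz e]]] gw; have [y' [z' [A B C D' ->]]] := comp _ _ _ _ hy hz e gw.
  have -> : y' = 0 by apply: (ha k) => //; lia.
  by rewrite add0r; apply: (hb k) => //; lia.
- by move=> w [y [z [/d6 hy /e6 hz ->]]]; apply: sum_ofD.
- by move=> w [y [z [/d7 hy /e7 hz ->]]]; apply: sum_ofD.
Qed.

Lemma sum_of_sub (W : vmod V) (D : W -> Prop) (h : submod D) (P : W -> Prop) (x : subV h) :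
  sum_of (fun u => D u /\ P u) (subh h x) -> sum_of (fun y : subV h => P (subh h y)) x.
Proof.
move=> [s [hs e]].
suff [t [ht et]] : exists t : seq (subV h), (forall y, y \in t -> P (subh h y)) /\
    \sum_(u <- s) u = subh h (\sum_(u <- t) u).
  by exists t; split=> //; apply: subh_inj; rewrite e.
elim: s hs {e} => [|u s IH] hs; first by exists [::]; rewrite !big_nil lf0.
have [|t [ht e]] := IH; first by move=> w hw; apply: hs; rewrite inE hw orbT.
have [|Du Pu] := hs u; first by rewrite inE eqxx.
have [y ey] := subh_elim h Du.
exists (y :: t); rewrite !big_cons lfD ey e; split=> // w.
by rewrite inE => /orP[/eqP ->|/ht //]; rewrite ey.
Qed.

Lemma OfinD_fin (W : vmod V) (D : W -> Prop) (h : OfinD D) : in_Ofin (subV (od_sub h)).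
Proof.
have [d1 [n [U [U1 U2 U3 U4 U5]]] d3 d4 d5 d6 d7] := h; set sD := od_sub h.
have inv (T : {linear W -> W}) v m : (forall u, T u = Yw W v m u) ->
    forall u, lsubV sD u -> lsubV sD (T u).
  by move=> e u; rewrite !lsubVE e; case: (sD) => _ _ _; apply.
split.
- exists n, (fun i x => U i (subh sD x)); split.
  + by move=> i; apply: pre_submod.
  + by move=> w /U2 e; apply: (@subh_inj _ _ _ _ sD); rewrite e lf0.
  + by move=> w; apply: U3; apply: subh_in.
  + by move=> i w /U4.
  + move=> i E sE h1 h2; have [e0 eL _ _] := sE.
    have sF := submodD (U1 i) (im_submod (subh sD) sE).
    have [|||h3] := U5 i _ sF.
    * by move=> w hw; exists w, 0; rewrite addr0; split=> //; exists 0; rewrite lf0.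
    * move=> _ [y [_ [hy [x [/h2 hx <-]] ->]]].
      by have [_ uL _ _] := U1 i.+1; have := uL 1 _ _ (U4 _ _ hy) hx; rewrite scale1r.
    * move=> h3; left=> x hx; apply: h3; exists 0, (subh sD x); rewrite add0r.
      by split=> //; [have [] := U1 i|exists x].
    * right=> x /h3 [y [_ [hy [z [hz <-]] e]]].
      have : E (x - z) by apply: h1; rewrite lfB e addrK.
      by move=> ex; have := eL 1 _ _ ex hz; rewrite scale1r subrK.
- split.
  + move=> x; have := d3 _ (subh_in x) => hs.
    have := @sum_of_in R W (Lop W 0) (lsubV sD) (inv _ _ _ (fun u => erefl)) (fun c u => gen_wt c u)
      _ (@genE0 R W (Lop W 0)) (@genEL R W (Lop W 0)) (fun _ _ h => h) hs.
    rewrite lsubVE => /(_ (subh_in x)) hs'.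
    have {}hs' : sum_of (fun u => D u /\ exists c, gen_wt c u) (subh sD x).
      by apply: sum_of_impl hs' => u; rewrite lsubVE.
    by apply: sum_of_impl (sum_of_sub hs') => y [c hc]; exists c; apply: gen_wt_inj hc; apply: subh_inj.
  + move=> hh; have [s hs] := d4 hh.
    have [||t [t1 t2]] := inspan_subspace _ _ hs.
    * by split; [have [] := d1|exists 0%N].
    * move=> c u w [a b] [a' b']; split; first by have [_ H _ _] := d1; apply: H.
      exact: genEL.
    have [t' et] : exists t', map (subh sD) t' = t.
      elim: (t) t1 => [|u r IH] hr; first by exists [::].
      have [|t' e] := IH; first by move=> w hw; apply: hr; rewrite inE hw orbT.
      have [|Du _] := hr u; first by rewrite inE eqxx.
      by have [y ey] := subh_elim sD Du; exists (y :: t'); rewrite /= ey e.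
    exists t' => x gx; have [|c hc] := t2 (subh sD x).
      by split; [apply: subh_in|apply: gen_wt_hom].
    exists c; apply: (@subh_inj _ _ _ _ sD); rewrite hc -et size_map linear_sum.
    by apply: eq_bigr => i _; rewrite (lfZ (subh sD)) (nth_map 0).
  + move=> hh; have [m hm] := d5 hh; exists m => k mk u gu.
    apply: (@subh_inj _ _ _ _ sD); rewrite lf0; apply: (hm k mk); first exact: subh_in.
    exact: gen_wt_hom.
- move=> x; have := d6 _ (subh_in x) => hs.
  have := @sum_of_in R W (curw W glN 0) (lsubV sD) (inv _ _ _ (fun u => erefl)) (eigE (curw W glN 0))
      _ _ (@eigEL R W _) (@eigE_gen R W _) hs.
  rewrite lsubVE => H; have {}H := H (fun c => etrans (lf0 _) (esym (scaler0 _ c))) (subh_in x).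
  have {}H : sum_of (fun u => D u /\ exists c : K, curw W glN 0 u = c *: u) (subh sD x).
    by apply: sum_of_impl H => u; rewrite lsubVE.
  apply: sum_of_impl (sum_of_sub H) => y [c hc]; exists c; apply: (@subh_inj _ _ _ _ sD).
  by rewrite hom_curN hc lfZ.
- move=> x; have := d7 _ (subh_in x) => hs.
  have := @sum_of_in R W (curw W glE 0) (lsubV sD) (inv _ _ _ (fun u => erefl)) (eigE (curw W glE 0))
      _ _ (@eigEL R W _) (@eigE_gen R W _) hs.
  rewrite lsubVE => H; have {}H := H (fun c => etrans (lf0 _) (esym (scaler0 _ c))) (subh_in x).
  have {}H : sum_of (fun u => D u /\ exists c : K, curw W glE 0 u = c *: u) (subh sD x).
    by apply: sum_of_impl H => u; rewrite lsubVE.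
  apply: sum_of_impl (sum_of_sub H) => y [c hc]; exists c; apply: (@subh_inj _ _ _ _ sD).
  by rewrite hom_curE hc lfZ.
Qed.

(** Allows arguing with submodules of [W] instead of modules embedded in it. *)
Lemma in_IndP (W : vmod V) : in_Ind W <-> forall w, exists D : W -> Prop, OfinD D /\ D w.
Proof.
split=> h w.
  have [M [f [fM inj [x hx]]]] := h w.
  by exists (fun y => exists x, f x = y); split; [apply: OfinD_im|exists x].
have [D [hD Dw]] := h w.
exists (subV (od_sub hD)), (subh (od_sub hD)); split; [exact: OfinD_fin|exact: subh_inj|].
exact: subh_elim.
Qed.

Lemma OfinD_sub (W : vmod V) (D E : W -> Prop) (sE : submod E) : OfinD D ->
  (forall w, D w -> E w) -> OfinD (fun x : subV sE => D (subh sE x)).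
Proof.
move=> hD DE; have fD := OfinD_fin hD; set sD := od_sub hD in fD.
have hf x : E (subh sD x) by apply: DE; apply: subh_in.
have := OfinD_im (sublift sE hf) fD; congr OfinD; apply/funext => x; apply/propext.
split=> [[y <-]|/(subh_elim sD)[y hy]]; first by rewrite subliftE; apply: subh_in.
by exists y; apply: (@subh_inj _ _ _ _ sE); rewrite subliftE.
Qed.

Lemma Ind_sub (W : vmod V) (E : W -> Prop) (sE : submod E) : in_Ind W -> in_Ind (subV sE).
Proof.
move=> /in_IndP h; apply/in_IndP => x.
have [D [hD Dx]] := h (subh sE x).
have hDE := OfinD_le hD (submodI (od_sub hD) sE) (fun w => @proj1 _ _).
exists (fun x => D (subh sE x) /\ E (subh sE x)); split.
  by apply: (OfinD_sub sE hDE) => w [].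
by split=> //; apply: subh_in.
Qed.

End Ofin.

(** * Intertwining operators *)

Section Intw.
Variables (R : realType) (V : V1gl11 R).
Local Notation K := R[i].

Lemma lin_fsum (M N : lmodType K) (f : {linear M -> N}) (F : nat -> M) n :
  (forall j, (n <= j)%N -> F j = 0) ->
  f (\sum_(j \in [set: nat]) F j) = \sum_(j \in [set: nat]) f (F j).
Proof.
move=> F0; rewrite !(fsum_nat (n := n)) ?linear_sum // => j hj.
by rewrite F0 ?lf0.
Qed.

Lemma intw0l (W1 W2 W3 : vmod V) (I : intw W1 W2 W3) h k w2 : I 0 h k w2 = 0.
Proof. by have := i_linear I h k w2 (-1) 0 0; rewrite scaler0 addr0 scaleN1r addNr. Qed.
Lemma intwDl (W1 W2 W3 : vmod V) (I : intw W1 W2 W3) u v h k w2 :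
  I (u + v) h k w2 = I u h k w2 + I v h k w2.
Proof. by have := i_linear I h k w2 1 u v; rewrite !scale1r. Qed.
Lemma intwZl (W1 W2 W3 : vmod V) (I : intw W1 W2 W3) c u h k w2 :
  I (c *: u) h k w2 = c *: I u h k w2.
Proof. by have := i_linear I h k w2 c u 0; rewrite intw0l !addr0. Qed.

Lemma i_borch_fin (W1 W2 W3 : vmod V) (I : intw W1 W2 W3) (v : V) (w1 : W1) (w2 : W2)
    (m n : int) h k : exists N : nat, forall j : nat, (N <= j)%N ->
  [/\ I (Yw W1 v (n + j%:Z) w1) (h + m%:~R - j%:R) k w2 = 0,
      I w1 (h + j%:R) k w2 = 0 & Yw W2 v (m + j%:Z) w2 = 0].
Proof.
have [a ha] := Yw_trunc v w1; have [b hb] := i_trunc I w1 w2 h.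
have [c hc] := Yw_trunc v w2.
exists (`|a - n| + b + `|c - m|)%N => j hj; split.
- by rewrite ha ?intw0l //; lia.
- by apply: hb; lia.
- by apply: hc; lia.
Qed.

Section Comp.
Variables (W1 W2 W3 X : vmod V) (I : intw W1 W2 W3) (f : hom false W3 X).
Definition icomp_coef w1 h k : {linear W2 -> X} := f \o I w1 h k.

Definition icomp : intw W1 W2 X.
Proof.
refine (@Intw R V W1 W2 X icomp_coef _ _ _ _ _ _).
- by move=> h k w2 c u v; rewrite /= i_linear linearP.
- by move=> w1 h k w2; rewrite /= -(hom_pare f) i_par.
- move=> w1 w2 h; have [m0 hm] := i_trunc I w1 w2 h; exists m0 => m k hk.
  by rewrite /= hm ?lf0.
- move=> w1 w2 h; have [m0 hm] := i_log I w1 w2 h; exists m0 => k hk.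
  by rewrite /= hm ?lf0.
- move=> p q v w1 w2 m n h k hp hq; rewrite /=.
  have [N hN] := i_borch_fin I v w1 w2 m n h k.
  have := congr1 f (i_borcherds I w2 m n h k hp hq).
  rewrite (@lin_fsum _ _ f _ N); last by move=> j /hN [-> _ _]; rewrite scaler0.
  rewrite (@lin_fsum _ _ f _ N); last by move=> j /hN [_ -> ->]; rewrite !(lf0, scaler0, subr0).
  move=> e; apply: etrans (etrans e _); apply: eq_fsbigr => j _; rewrite (lfZ f) //.
  by rewrite (lfB f) (lfZ f) hom_Ye.
- by move=> w1 h k w2; rewrite /= i_derivative (lfD f) !(lfZ f).
Defined.

Lemma icompE w1 h k w2 : icomp w1 h k w2 = f (I w1 h k w2). Proof. by []. Qed.
End Comp.

Section Sub.
Variables (W1 W2 W3 : vmod V) (I : intw W1 W2 W3) (E : W3 -> Prop) (sE : submod E).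
Hypothesis hI : forall w1 h k w2, E (I w1 h k w2).
Let hI' w1 h k w2 : lsubV sE (I w1 h k w2).
Proof. by rewrite lsubVE. Qed.

Definition isub_coef w1 h k : {linear W2 -> subV sE} := sub_lift (@subV_par R V W3 E sE) (hI' w1 h k).
Let sc := subh sE.
Let scI w1 h k w2 : sc (isub_coef w1 h k w2) = I w1 h k w2. Proof. by []. Qed.
Let scinj : injective sc. Proof. exact: subh_inj. Qed.

Definition isub : intw W1 W2 (subV sE).
Proof.
refine (@Intw R V W1 W2 (subV sE) isub_coef _ _ _ _ _ _).
- by move=> h k w2 c u v; apply: scinj; rewrite (lfD sc) (lfZ sc) !scI i_linear.
- by move=> w1 h k w2; apply: scinj; rewrite (hom_pare sc) !scI i_par.
- move=> w1 w2 h; have [m0 hm] := i_trunc I w1 w2 h; exists m0 => m k hk.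
  by apply: scinj; rewrite scI hm ?lf0.
- move=> w1 w2 h; have [m0 hm] := i_log I w1 w2 h; exists m0 => k hk.
  by apply: scinj; rewrite scI hm ?lf0.
- move=> p q v w1 w2 m n h k hp hq; apply: (scinj); rewrite !(lin_fsum_inj _ scinj).
  apply: etrans (etrans (i_borcherds I w2 m n h k hp hq) _).
    by apply: eq_fsbigr => j _; rewrite (lfZ sc) scI.
  by apply: eq_fsbigr => j _; rewrite [in RHS](lfZ sc) (lfB sc) (lfZ sc) hom_Ye !scI.
- by move=> w1 h k w2; apply: scinj; rewrite (lfD sc) !(lfZ sc) !scI i_derivative.
Defined.

End Sub.

Lemma bo_span (W1 W2 W3 : vmod V) (J : W1 -> int -> W2 -> W3) (bJ : borch J)
    (D : lsub W3) v m k w1 w2 :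
  (forall a l b, D (J a l b)) -> D (Yw W3 v m (J w1 k w2)).
Proof.
move=> hD.
have key p (u : V) : homog p u -> D (Yw W3 u m (J w1 k w2)).
  move=> hu; have [l hl] := Yw_trunc u w1.
  rewrite (bo_comm bJ w2 m k (N := `|l|) hu); last by move=> j hj; apply: hl; lia.
  by apply: lsubD => //; apply: lsub_sum => j _; apply: lsubZ.
by rewrite (hpartE v) YwD; apply: lsubD; apply: key; apply: hpart_homog.
Qed.

Variable T : hlz V.

(** By the commutator formula the span [Q] of the coefficients is a submodule. The operator [tenI]
    corestricted to [Q] yields a map from the tensor product to [Q], and by uniqueness this map
    followed by the inclusion is the identity. *)
Lemma ten_span (W1 W2 : indO V) (D : lsub (ten T W1 W2)) :
  (forall w1 h k w2, D (tenI T W1 W2 w1 h k w2)) -> forall t, D t.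
Proof.
move=> hD.
pose P (t : ten T W1 W2) := exists w1 h k w2, t = tenI T W1 W2 w1 h k w2.
have PZ c w : P w -> P (c *: w).
  by move=> [w1 [h [k [w2 ->]]]]; exists (c *: w1), h, k, w2; rewrite intwZl.
pose Q := sum_sub PZ.
have QI w1 h k w2 : Q (tenI T W1 W2 w1 h k w2) by apply: sum_of1; exists w1, h, k, w2.
have sQ : submod Q.
  split; [exact: lsub0|exact: lsubL| |].
    move=> u [s [hs ->]]; rewrite linear_sum; apply: lsub_sum_seq => t /hs [w1 [h [k [w2 ->]]]].
    by rewrite i_par.
  move=> v n u [s [hs ->]]; rewrite linear_sum; apply: lsub_sum_seq => t /hs [w1 [h [k [w2 ->]]]].
  have := bo_span (borch_intw (tenI T W1 W2) h k) (D := Q) v n 0 w1 w2.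
  by rewrite addr0; apply => a l b.
pose QO := IndO (@Ind_sub _ _ _ _ sQ (@indOP R V (ten T W1 W2))).
have [f [hf _]] := ten_univ T (isub sQ QI : intw W1 W2 QO).
have [g [_ hg]] := ten_univ T (tenI T W1 W2).
have e1 := hg (hcomp (subh sQ) f); have e2 := hg (hid (ten T W1 W2)) => t.
have -> : t = subh sQ (f t).
  have E1 : hcomp (subh sQ) f =1 g by apply: e1 => w1 h k w2; rewrite /= hf.
  have E2 : hid (ten T W1 W2) =1 g by apply: e2.
  by rewrite -[RHS]/(hcomp (subh sQ) f t) E1 -E2.
apply: (sum_of_lsub (P := P)); last exact: (subh_in (h := sQ)).
by move=> w [w1 [h [k [w2 ->]]]].
Qed.

Lemma eq_lsub_proof (M N : lmodType K) (f g : {linear M -> N}) :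
  forall c u w, f u = g u -> f w = g w -> f (c *: u + w) = g (c *: u + w).
Proof. by move=> c u w hu hw; rewrite !linearP hu hw. Qed.
Definition eq_lsub (M N : lmodType K) (f g : {linear M -> N}) : lsub M :=
  @Lsub R M (fun x => f x = g x) (etrans (lf0 f) (esym (lf0 g))) (eq_lsub_proof (f:=f) (g:=g)).

Lemma ten_eq (W1 W2 : indO V) (N : lmodType K) (f g : {linear ten T W1 W2 -> N}) :
  (forall w1 h k w2, f (tenI T W1 W2 w1 h k w2) = g (tenI T W1 W2 w1 h k w2)) -> f =1 g.
Proof. by move=> h; apply: (ten_span (D := eq_lsub f g)). Qed.

Lemma sub_linmap_proof (M N : lmodType K) (f : {linear M -> N}) (D : lsub N) :
  forall c u w, D (f u) -> D (f w) -> D (f (c *: u + w)).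
Proof. by move=> c u w hu hw; rewrite linearP; apply: lsubL. Qed.
Lemma sub_linmap_proof0 (M N : lmodType K) (f : {linear M -> N}) (D : lsub N) : D (f 0).
Proof. by rewrite lf0; apply: lsub0. Qed.
Definition pre_lsub (M N : lmodType K) (f : {linear M -> N}) (D : lsub N) : lsub M :=
  @Lsub R M (fun x => D (f x)) (sub_linmap_proof0 f D) (sub_linmap_proof (f:=f) (D:=D)).

End Intw.

(** * Heisenberg modes of N + E *)

Section MoreSub.
Variables (R : realType).
Local Notation K := R[i].

Definition lsub_and (M : lmodType K) (D E : lsub M) : lsub M :=
  @Lsub R M (fun x => D x /\ E x) (conj (lsub0 D) (lsub0 E))
    (fun c u w hu hw => conj (lsubL c (proj1 hu) (proj1 hw)) (lsubL c (proj2 hu) (proj2 hw))).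

Definition eig_lsub (M : lmodType K) (f : {linear M -> M}) c : lsub M :=
  @Lsub R M (fun x => f x = c *: x) (etrans (lf0 _) (esym (scaler0 _ c)))
    (fun a u w hu hw => @eigEL R M f c a u w hu hw).

End MoreSub.

Section Weyl.
Variables (R : realType).
Local Notation K := R[i].
Variables (M : lmodType K) (a b : {linear M -> M}) (kap : K).
Hypothesis (kap0 : kap != 0) (hab : forall x, a (b x) = b (a x) + kap *: x).

Lemma iterS_lin (f : {linear M -> M}) j c x y :
  iter j f (c *: x + y) = c *: iter j f x + iter j f y.
Proof. by elim: j => //= j ->; rewrite linearP. Qed.

Lemma iter0_lin (f : {linear M -> M}) j : iter j f 0 = 0.
Proof. by elim: j => //= j ->; rewrite lf0. Qed.

Lemma weyl_aiter j x : a (iter j.+1 b x) = iter j.+1 b (a x) + (j.+1%:R * kap) *: iter j b x.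
Proof.
elim: j => [|j IH]; first by rewrite /= hab mul1r.
rewrite iterS hab IH lfD lfZ -!iterS -[j.+2%:R]natr1; lincomb.
Qed.

Lemma weyl_itera j x : iter j.+1 a (b x) = b (iter j.+1 a x) + (j.+1%:R * kap) *: iter j a x.
Proof.
elim: j => [|j IH]; first by rewrite /= hab mul1r.
rewrite iterS IH lfD lfZ hab -!iterS -[j.+2%:R]natr1; lincomb.
Qed.

(** Coefficients of the normally ordered exponential of - b a / kap, the extremal projector of the
    Heisenberg pair (a, b). *)
Definition wcoef j : K := (-1) ^+ j / (j`!%:R * kap ^+ j).
Lemma wcoefS j : wcoef j.+1 * (j.+1%:R * kap) = - wcoef j.
Proof.
rewrite /wcoef factS natrM exprS exprS.
field; rewrite kap0 expf_neq0 // fact_unit /=.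
by rewrite addrC natr1 pnatr_eq0.
Qed.

(* Projection onto ker a, where a is locally nilpotent. *)
Definition wproj J y := \sum_(j < J) wcoef j *: iter j b (iter j a y).

Lemma wproj_ker J y : iter J a y = 0 -> a (wproj J y) = 0.
Proof.
(* The sum telescopes, leaving its last term, which contains a^J y. *)
move=> hJ; suff -> : a (wproj J y) = if J is J'.+1 then wcoef J' *: iter J' b (iter J'.+1 a y) else 0.
  by case: J hJ => // J ->; rewrite iter0_lin scaler0.
case: J {hJ} => [|J]; first by rewrite /wproj big_ord0 lf0.
elim: J => [|J IH]; first by rewrite /wproj big_ord_recl big_ord0 addr0 /= lfZ.
rewrite /wproj big_ord_recr /= -[\sum_(i < J.+1) _]/(wproj J.+1 y) lfD IH lfZ weyl_aiter.
rewrite scalerDr scalerA wcoefS -!iterS; lincomb.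
Qed.

(** The projector kills the image of b by the same telescoping: what is left contains a^J z. *)
Lemma wproj_b J z : iter J a z = 0 -> wproj J.+1 (b z) = 0.
Proof.
move=> hJ; suff -> : wproj J.+1 (b z) = wcoef J *: iter J.+1 b (iter J a z).
  by rewrite hJ iter0_lin scaler0.
elim: J {hJ} => [|J IH]; first by rewrite /wproj big_ord_recl big_ord0 addr0.
rewrite /wproj big_ord_recr /= -[\sum_(i < J.+1) _]/(wproj J.+1 (b z)) IH.
rewrite -[a (iter J a (b z))]/(iter J.+1 a (b z)) weyl_itera.
have -> : b (iter J b (b (iter J.+1 a z) + (J.+1%:R * kap) *: iter J a z)) =
   b (iter J b (b (iter J.+1 a z))) + (J.+1%:R * kap) *: iter J.+1 b (iter J a z).
  rewrite addrC iterS_lin lfD lfZ -iterS; lincomb.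
rewrite -[iter J b (b _)]iterSr scalerDr scalerA wcoefS; lincomb.
Qed.

Lemma wproj_id J y : a y = 0 -> wproj J.+1 y = y.
Proof.
move=> h; rewrite /wproj big_ord_recl big1 ?addr0 => [|j _]; last first.
  by rewrite [iter (lift _ _) a _](iterSr j a) h !iter0_lin scaler0.
by rewrite /= /wcoef expr0 fact0 expr0 mulr1 divr1 scale1r.
Qed.

Lemma wproj_split J y :
  wproj J.+1 y = y + b (\sum_(j < J) wcoef j.+1 *: iter j b (iter j.+1 a y)).
Proof.
rewrite /wproj big_ord_recl /= /wcoef expr0 fact0 expr0 mulr1 divr1 scale1r; congr (_ + _).
by rewrite linear_sum; apply: eq_bigr => j _; rewrite lfZ.
Qed.

Lemma wproj_lin J : linear (wproj J).
Proof.
move=> c x y; rewrite /wproj scaler_sumr -big_split /=; apply: eq_bigr => j _.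
rewrite !iterS_lin; lincomb.
Qed.

Lemma wproj_comm J (f : {linear M -> M}) y :
  (forall x, f (a x) = a (f x)) -> (forall x, f (b x) = b (f x)) ->
  f (wproj J y) = wproj J (f y).
Proof.
move=> ha hb; rewrite linear_sum; apply: eq_bigr => j _; rewrite lfZ; congr (_ *: _).
have e k x : f (iter k b x) = iter k b (f x) by elim: k => //= k <-.
rewrite e; congr iter.
by elim: (nat_of_ord j) => //= k <-.
Qed.

Lemma wproj_in J (D : lsub M) y : (forall x, D x -> D (a x)) -> (forall x, D x -> D (b x)) ->
  D y -> D (wproj J y).
Proof.
move=> ha hb hy; apply: lsub_sum => j _; apply: lsubZ.
have e k x : D x -> D (iter k b x) by move=> hx; elim: k => //= k; apply: hb.
apply: e; by elim: (nat_of_ord j) => //= k; apply: ha.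
Qed.

End Weyl.

Section Heis.
Variables (R : realType) (V : V1gl11 R).
Local Notation K := R[i].

Definition hv : V := cur V glN + cur V glE.
Definition hb (W : vmod V) (r : int) : {linear W -> W} := Yw W hv r.

Lemma hbE (W : vmod V) r w : hb W r w = curw W glN r w + curw W glE r w.
Proof. by rewrite /hb YwD. Qed.

Lemma hv_homog : homog false hv.
Proof. by apply: homogD; apply: (cur_homog V _). Qed.

(** The constant 2 is the norm of N + E; it comes from the two mixed pairings of N and E. *)
Lemma hb_comm (W : vmod V) (r s : int) w :
  hb W r (hb W s w) = hb W s (hb W r w) + (if r + s == 0 then 2%:R * r%:~R else 0) *: w.
Proof.
have l2 := proj2 (curw_level1 W).
have e1 := l2 glN glN r s w; have e2 := l2 glN glE r s w.
have e3 := l2 glE glN r s w; have e4 := l2 glE glE r s w.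
cbn [glpar andb glform glbr fst snd] in e1, e2, e3, e4.
rewrite !hbE !lfD.
move/eqP: e1; move/eqP: e2; move/eqP: e3; move/eqP: e4.
rewrite !expr0 !scale1r !scale0r !add0r !subr_eq => /eqP -> /eqP -> /eqP -> /eqP ->.
by case: ifP => _; lincomb.
Qed.

Lemma L0_hb (W : vmod V) r w : Lop W 0 (hb W r w) = hb W r (Lop W 0 w) - r%:~R *: hb W r w.
Proof. by rewrite !hbE lfD !L0_curw; lincomb. Qed.

Lemma hb_par (W : vmod V) r w : par W (hb W r w) = hb W r (par W w).
Proof.
by rewrite !hbE lfD !(proj1 (curw_level1 W)) /= expr0 !scale1r.
Qed.

Lemma hom_hb p (W1 W2 : vmod V) (f : hom p W1 W2) r w : f (hb W1 r w) = hb W2 r (f w).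
Proof. by rewrite !hbE lfD hom_curN hom_curE. Qed.

Lemma submod_hb (W : vmod V) (D : W -> Prop) r w : submod D -> D w -> D (hb W r w).
Proof. by case=> _ _ _; apply. Qed.

Lemma bo_hb (W1 W2 W3 : vmod V) (J : W1 -> int -> W2 -> W3) (bJ : borch J) u al r k w :
  (forall j : int, 0 < j -> hb W1 j u = 0) -> hb W1 0 u = al *: u ->
  hb W3 r (J u k w) = J u k (hb W2 r w) + al *: J u (r + k) w.
Proof.
move=> h1 h0; rewrite /hb (bo_comm bJ w r k (N := 1) hv_homog); last first.
  by move=> j hj; apply: h1; lia.
by rewrite big_ord_recl big_ord0 addr0 gbin0 scale1r [Yw W1 hv _ u]h0 (boZl bJ) subz0.
Qed.

Definition vac_h (W : vmod V) (w : W) := forall r : int, 0 < r -> hb W r w = 0.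

Lemma gen_wt_hb (W : vmod V) r h w : gen_wt h w -> gen_wt (h - r%:~R) (hb W r w).
Proof.
move=> [k hk]; exists k; rewrite -[RHS](lf0 (hb W r)) -hk.
elim: k {hk} => //= k ->; rewrite (lfB (hb W r)) L0_hb (lfZ (hb W r)); lincomb.
Qed.

Definition gwt (W : vmod V) (h : K) : lsub W :=
  @Lsub R W (fun w => gen_wt h w) (genE0 (Lop W 0) h)
    (fun c u w hu hw => genEL (T := Lop W 0) c hu hw).

Lemma hb_pos_ker (X : vmod V) (D : X -> Prop) (hD : OfinD D) h (x : X) (s : nat) :
  (0 < s)%N -> D x -> gen_wt h x -> exists J, iter J (hb X s%:Z) x = 0.
Proof.
move=> s0 Dx gx; have [n0 hn] := od_bd hD h; exists n0.
have st j : D (iter j (hb X s%:Z) x) /\ gen_wt (h - (j * s)%:R) (iter j (hb X s%:Z) x).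
  elim: j => [|j [IH1 IH2]]; first by rewrite mul0n subr0.
  split; first by apply: submod_hb => //; apply: od_sub hD.
  have := gen_wt_hb s%:Z IH2; rewrite -addrA -opprD -natrD mulSn addnC.
  by [].
have [a b] := st n0; apply: hn a b; by rewrite leq_pmulr.
Qed.

(** The outer induction is on a bound for the steps by which the weight can drop, the inner one on s
    such that h_r y = 0 for all r > s. The projector of the modes h_(s+1), h_(-s-1) makes y vanish
    under h_(s+1) as well, and changes it by h_(-s-1) of a vector of smaller weight. *)
Lemma heis_gen (X : vmod V) (D : X -> Prop) (hD : OfinD D) (G : lsub X) c :
  (forall (r : nat) x, (0 < r)%N -> G x -> G (hb X (- r%:Z) x)) ->
  (forall x, D x -> vac_h x -> hb X 0 x = c *: x -> G x) ->
  forall h x, D x -> gen_wt h x -> hb X 0 x = c *: x -> G x.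
Proof.
move=> Gc Gv h x Dx gx hx.
have [n0 hn] := od_bd hD h.
have {hn} : forall k : nat, (n0 <= k)%N -> forall u, D u -> gen_wt (h - k%:R) u -> u = 0 by [].
elim/ltn_ind: n0 h x Dx gx hx => n IH h x Dx gx hx hn.
have [n00|npos] := posnP n.
  by rewrite (hn 0%N _ x) ?n00 ?subr0 //; apply: lsub0.
have sD := od_sub hD.
have [R0 hR] : exists R0 : nat, forall r : nat, (R0 <= r)%N -> hb X r%:Z x = 0.
  have [l hl] := Yw_trunc hv x; exists `|l|%N => r hr; apply: hl; lia.
have Q (s : nat) : forall y, D y -> gen_wt h y -> hb X 0 y = c *: y ->
    (forall r : nat, (s < r)%N -> hb X r%:Z y = 0) -> G y.
  elim: s => [|s IHs] y Dy gy ey hy.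
    by apply: Gv => // -[r|r] // r0; apply: hy; lia.
  have [J0 hJ0] := hb_pos_ker hD (ltn0Sn s) Dy gy.
  have [J hJ] : exists J, iter J.+1 (hb X s.+1%:Z) y = 0.
    by exists J0; rewrite iterS hJ0 lf0.
  have kap0 : (2%:R * s.+1%:R : K) != 0 by rewrite mulf_neq0 ?pnatr_eq0.
  have hab z : hb X s.+1%:Z (hb X (- s.+1%:Z) z) = hb X (- s.+1%:Z) (hb X s.+1%:Z z) + (2%:R * s.+1%:R) *: z.
    by rewrite hb_comm subrr eqxx.
  set pi := wproj (hb X s.+1%:Z) (hb X (- s.+1%:Z)) (2%:R * s.+1%:R) J.+1 y.
  have cm (q r : int) : q + r != 0 -> forall z, hb X q (hb X r z) = hb X r (hb X q z).
    by move=> /negbTE e z; rewrite hb_comm e scale0r addr0.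
  pose D' := lsub_and (lsubV sD) (eig_lsub (hb X 0) c).
  have D'P z : D' z <-> D z /\ hb X 0 z = c *: z by rewrite /= lsubVE.
  have D'h (q : int) z : q != 0 -> D' z -> D' (hb X q z).
    rewrite !D'P => q0 [hz1 hz2]; split; first exact: submod_hb.
    by rewrite cm ?add0r // hz2 lfZ.
  have y' : D' y by apply/D'P.
  have itb j (z : X) q : gen_wt q z -> gen_wt (q + (j * s.+1)%:R) (iter j (hb X (- s.+1%:Z)) z).
    move=> hz; elim: j => [|j IHj]; first by rewrite mul0n addr0.
    have := gen_wt_hb (- s.+1%:Z) IHj.
    by rewrite rmorphN opprK -addrA -natrD mulSn addnC.
  have ita j : gen_wt (h - (j * s.+1)%:R) (iter j (hb X s.+1%:Z) y).
    elim: j => [|j IHj]; first by rewrite mul0n subr0.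
    have := gen_wt_hb s.+1%:Z IHj.
    by rewrite -addrA -opprD -natrD mulSn addnC.
  have gpi : gwt X h pi.
    apply: lsub_sum => j _; apply: lsubZ => /=.
    by have := itb j _ _ (ita j); rewrite subrK.
  have /D'P [pi1 pi2] : D' pi by apply: wproj_in => // z; apply: D'h.
  have Gpi : G pi.
    apply: IHs => // r; rewrite leq_eqVlt => /orP[/eqP <-|hr].
      by apply: wproj_ker.
    rewrite /pi wproj_comm; first last.
    - by move=> z; apply: cm; lia.
    - by move=> z; apply: cm; lia.
    rewrite hy // /wproj big1 // => j _.
    by rewrite !iter0_lin scaler0.
  have := wproj_split (hb X s.+1%:Z) (hb X (- s.+1%:Z)) (2%:R * s.+1%:R) J y.
  rewrite -/pi => /eqP; rewrite -subr_eq => /eqP <-.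
  apply: lsubB => //; apply: Gc => //; apply: lsub_sum => j _; apply: lsubZ.
  have iD k z (q : int) : q != 0 -> D' z -> D' (iter k (hb X q) z).
    by move=> q0 hz; elim: k => //= k; apply: D'h.
  have /D'P [w1 w2] := iD j _ (- s.+1%:Z) isT (iD j.+1 _ s.+1%:Z isT y').
  apply: (IH n.-1 _ (h - s.+1%:R) _ w1) => //; first by rewrite prednK.
    have := itb j _ _ (ita j.+1); rewrite mulSn natrD.
    by congr gen_wt; rewrite opprD addrA subrK.
  move=> k hk u Du gu; apply: (hn (s.+1 + k)%N) => //; first by lia.
  by rewrite natrD opprD addrA.
by apply: (Q R0) => // r hr; apply: hR; apply: ltnW.
Qed.

Definition intg (X : vmod V) := forall x : X,
  sum_of (fun u => exists k : int, hb X 0 u = k%:~R *: u) x.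

Lemma intg_eig (X : vmod V) c (u : X) : intg X -> u != 0 -> hb X 0 u = c *: u ->
  exists k : int, c = k%:~R.
Proof.
move=> iX u0 hu; case: (pselect (exists k : int, c = k%:~R)) => // nc; case/eqP: u0.
apply: (@genE_othE0 R X (hb X 0) c u (- u)).
- exact: eigE_gen.
- rewrite -scaleN1r; apply: othEZ; apply: sum_of_impl (iX u) => w [k hk].
  exists k%:~R; split; last exact: eigE_gen.
  by apply/eqP => e; apply: nc; exists k.
- by rewrite subrr.
Qed.

(** Splitting x into weight vectors and these into eigenvectors of h_0, whose charges are integral,
    reduces to [heis_gen]. *)
Lemma heis_all (X : vmod V) (G : lsub X) : in_Ind X -> intg X ->
  (forall (r : nat) x, (0 < r)%N -> G x -> G (hb X (- r%:Z) x)) ->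
  (forall x (k : int), vac_h x -> hb X 0 x = k%:~R *: x -> G x) -> forall x, G x.
Proof.
move=> /in_IndP iX gX Gc Gv x; have [D [hD Dx]] := iX x.
have key h (y : X) : D y -> gen_wt h y -> G y.
  move=> Dy gy; pose D' := lsub_and (lsubV (od_sub hD)) (gwt X h).
  have D'P z : D' z <-> D z /\ gen_wt h z by rewrite /= lsubVE.
  have st u : D' u -> D' (hb X 0 u).
    rewrite !D'P => -[a b]; split; first by apply: submod_hb => //; apply: od_sub hD.
    by have := gen_wt_hb 0 b; rewrite subr0.
  have := @sum_of_in R X (hb X 0) D' st (eigE (hb X 0)) y _ (@eigEL R X _) (@eigE_gen R X _).
  case.
  - by move=> c; rewrite /eigE lf0 scaler0.
  - by apply: sum_of_impl (gX y) => u [k hk]; exists k%:~R.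
  - by apply/D'P.
  move=> s [hs ->]; apply: lsub_sum_seq => u /hs [/D'P [Du gu] [c hc]].
  have [->|u0] := eqVneq u 0; first exact: lsub0.
  have [k ck] := intg_eig gX u0 hc.
  apply: (heis_gen hD (G := G) Gc _ Du gu hc) => z Dz vz ez.
  by apply: (Gv z k) => //; rewrite ez ck.
have := @sum_of_in R X (Lop X 0) (lsubV (od_sub hD)) _ (fun c u => gen_wt c u)
      x (@genE0 R X (Lop X 0)) (@genEL R X (Lop X 0)) (fun _ _ h => h) (od_wt hD Dx).
case.
- by move=> u; rewrite !lsubVE; case: (od_sub hD) => _ _ _; apply.
- by rewrite lsubVE.
move=> s [hs ->]; apply: lsub_sum_seq => u /hs []; rewrite lsubVE => Du [h gu].
exact: key gu.
Qed.

End Heis.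

(** * Lattice vectors *)

Section GProp.
Variables (R : realType) (V0 W1 W2 W3 : superspace R) (Y1 : V0 -> int -> {linear W1 -> W1}).
Variables (Y2 : V0 -> int -> {linear W2 -> W2}) (Y3 : V0 -> int -> {linear W3 -> W3}).
Local Notation K := R[i].
Variables (J : W1 -> int -> W2 -> W3) (bJ : gborch Y1 Y2 Y3 J).
Variable D : lsub W3.
Hypothesis DY : forall v n u, D u -> D (Y3 v n u).

(* For m large the terms with v_(m+j) acting on w2 vanish in the Borcherds
   identity, and one concludes by downward induction on n. *)
Lemma gprop_left v w1 w2 : (forall k, D (J w1 k w2)) ->
  forall n k, D (J (Y1 v n w1) k w2).
Proof.
move=> h.
have key p (u : V0) : homog p u -> forall n k, D (J (Y1 u n w1) k w2).
  move=> hu n; have [a ha] := bo_t1 bJ u w1; have [b hb] := bo_t2 bJ u w2.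
  have [N] := ubnP `|a - n|; elim: N n => // N IH n hN k.
  have [an|na] := leP a n; first by rewrite ha // (bo0l bJ); apply: lsub0.
  have [c hc] := bo_trunc bJ w1 w2.
  have e := @bo_fin _ _ _ _ _ _ _ _ _ bJ p u w1 w2 `|b|%N%:Z n (k - `|b|%N%:Z)
    (`|(a - n)%R| + `|(c - (k - `|b|%N%:Z))%R|).+1%N hu.
  have [S1 [S2 [D1 D2 E]]] : exists S1 S2, [/\ D S1, D S2 & J (Y1 u n w1) k w2 + S1 = S2].
    eexists; eexists; split; last first.
    - move: e; rewrite big_ord_recl gbin0 scale1r addz0 subz0 [ `|b|%N%:Z + _]addrC subrK; apply=> j hj.
      + by apply: ha; lia.
      + by apply: hc; lia.
      + by apply: hb; lia.
    - apply: lsub_sum => j _; apply: lsubZ; apply: lsubB; first exact: DY.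
      rewrite hb ?(bo0r bJ) ?scaler0; [exact: lsub0|lia].
    - apply: lsub_sum => j _; apply: lsubZ.
      have [an'|na'] := leP a (n + (lift ord0 j)%:Z).
        by rewrite ha // (bo0l bJ); apply: lsub0.
      by apply: IH; move: na'; rewrite /= /bump; lia.
  have -> : J (Y1 u n w1) k w2 = S2 - S1 by rewrite -E addrK.
  exact: lsubB.
move=> n k; rewrite (hpartE v) (lfD (mklin (bo_l1 bJ n w1)) _ _ : Y1 _ n w1 = _) (boDl bJ).
by apply: lsubD; apply: key; apply: hpart_homog.
Qed.

(** The commutator formula trades v_n on [w2] for v_n on the outside and modes of v on [w1]. Hence
    the condition is imposed on a stable set [P] of vectors [w1] rather than on one of them. *)
Lemma gprop_right (P : W1 -> Prop) : (forall u, P u -> P (par W1 u)) ->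
  (forall v n u, P u -> P (Y1 v n u)) -> forall w2,
  (forall w1, P w1 -> forall k, D (J w1 k w2)) ->
  forall v n w1, P w1 -> forall k, D (J w1 k (Y2 v n w2)).
Proof.
move=> pp pY w2 h v n w1 Pw k.
have key p (u : V0) : homog p u -> D (J w1 k (Y2 u n w2)).
  move=> hu; have [a ha] := bo_t1 bJ u (parX p w1).
  have := @bo_comm _ _ _ _ _ _ _ _ _ bJ p u (parX p w1) w2 n k `|a| hu.
  rewrite parXK => e.
  have Pw' : P (parX p w1) by case: (p) => //=; apply: pp.
  have -> : J w1 k (Y2 u n w2) = Y3 u n (J (parX p w1) k w2) -
      \sum_(j < `|a|) gbin n%:~R j *: J (Y1 u j%:Z (parX p w1)) (n + k - j%:Z) w2.
    by rewrite e ?addrK // => j hj; apply: ha; lia.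
  apply: lsubB; first by apply: DY; apply: h.
  by apply: lsub_sum => j _; apply: lsubZ; apply: h => //; apply: pY.
rewrite (hpartE v) (lfD (mklin (bo_l2 bJ n w2)) _ _ : Y2 _ n w2 = _) (boDr bJ).
by apply: lsubD; apply: key; apply: hpart_homog.
Qed.

End GProp.

Section Propagate.
Variables (R : realType) (V : V1gl11 R).
Variables (W1 W2 W3 : vmod V) (J : W1 -> int -> W2 -> W3) (bJ : borch J).
Variable D : lsub W3.
Hypothesis sD : submod D.
Let DY v n u : D u -> D (Yw W3 v n u). Proof. by case: sD => _ _ _; apply. Qed.
Let Dp u : D u -> D (par W3 u). Proof. by case: sD => _ _ h _; apply: h. Qed.

Definition gen_by (W : vmod V) (u w : W) := forall E : W -> Prop, submod E -> E u -> E w.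

(** The reduction to generators: [gprop_left] extends from [u] to the module it generates, then
    [gprop_right] does the same for [w]. *)
Lemma propagate p u w : homog p u -> (forall k, D (J u k w)) ->
  forall a b, gen_by u a -> gen_by w b -> forall k, D (J a k b).
Proof.
move=> hu h.
have hp' k : D (J u k (par W2 w)).
  have := Dp (h k); rewrite (bo_par bJ) hu (boZl bJ); exact: sgnZ_in.
(* Parity acts on both arguments at once, so stability of [P] under parity requires [par W2 w] next
   to [w]. *)
pose P a := (forall k, D (J a k w)) /\ (forall k, D (J a k (par W2 w))).
have sP : submod P.
  split.
  - by split=> k; rewrite (bo0l bJ); apply: lsub0.
  - by move=> c x y [x1 x2] [y1 y2]; split=> k; rewrite (boDl bJ) (boZl bJ); apply: lsubL.
  - move=> x [x1 x2]; split=> k; last by rewrite -(bo_par bJ); apply: Dp.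
    by rewrite -[w]parKE -(bo_par bJ); apply: Dp.
  - by move=> v n x [x1 x2]; split=> k; apply: (gprop_left bJ DY).
pose Q b := forall a, P a -> forall k, D (J a k b).
have sQ : submod Q.
  have pP a : P a -> P (par W1 a) by case: sP => _ _ + _; apply.
  split.
  - by move=> a _ k; rewrite (bo0r bJ); apply: lsub0.
  - by move=> c x y hx hy a Pa k; rewrite (boDr bJ) (boZr bJ); apply: lsubL; [apply: hx|apply: hy].
  - by move=> x hx a Pa k; rewrite -[a]parKE -(bo_par bJ); apply: Dp; apply: hx; apply: pP.
  - by move=> v n x hx a Pa k; apply: (gprop_right bJ DY (P := P)) => //; by case: sP.
move=> a b ga gb k.
have Pa : P a by apply: ga.
have Qb : Q b by apply: gb => // a' [].
exact: Qb.
Qed.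

End Propagate.

Section Lattice.
Variables (R : realType) (V : V1gl11 R).
Local Notation K := R[i].

(* The relations satisfied by a lattice-type vector e^(m alpha), where h = N + E
   is the element alpha. *)
Record lat (W : vmod V) (m : K) (u : W) : Prop := Lat {
  lat_vac : vac_h u;
  lat_h : hb W 0 u = (2%:R * m) *: u;
  lat_L : Lop W (-1) u = m *: hb W (-1) u }.

Section Fix.
Variables (W1 W2 W3 : vmod V) (I : intw W1 W2 W3).
Variables (m c : K) (u : W1) (w : W2).
Hypotheses (lu : lat m u) (vw : vac_h w) (cw : hb W2 0 w = c *: w).

Lemma intw_hb r h k x : hb W3 r (I u h k x) = I u h k (hb W2 r x) + (2%:R * m) *: I u (h + r%:~R) k x.
Proof.
have := bo_hb (borch_intw I h k) r 0 x (lat_vac lu) (lat_h lu).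
by rewrite !addr0.
Qed.

(** A differential equation in x: the derivative property is combined with L_(-1) u = m h_(-1) u.
    The iterate formula for h_(-1) u has creation modes on the left and, as [w] is a vacuum vector,
    only the charge c on the right. *)
Lemma lat_rec h k (N : nat) : (forall j : nat, (N <= j)%N -> I u (h + 1 + j%:R) k w = 0) ->
  (- h - 1 - m * c) *: I u h k w + k.+1%:R *: I u h k.+1 w =
  m *: \sum_(j < N) hb W3 (-1 - j%:Z) (I u (h + 1 + j%:R) k w).
Proof.
move=> hN; have := i_derivative I u (h + 1) k w.
rewrite (lat_L lu) intwZl addrK.
have -> : I (hb W1 (-1) u) (h + 1) k w =
    \sum_(j < N) hb W3 (-1 - j%:Z) (I u (h + 1 + j%:R) k w) + c *: I u h k w.
  have := bo_iter (borch_intw I (h + 1) k) (w1 := u) (w2 := w) (-1) (k := 0) (N := N.+1) (hv_homog V).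
  rewrite addr0 => ->.
  - rewrite -[in RHS](@sum_trunc _ (fun j => hb W3 (-1 - j%:Z) (I u (h + 1 + j%:R) k w)) N N.+1) //; last first.
      by move=> j /hN ->; rewrite lf0.
    rewrite big_ord_recl [in RHS]big_ord_recl /=.
    rewrite gbin0 mulr1 expr0 scale1r [Yw W2 _ _ w]cw.
    rewrite (eq_bigr (fun j : 'I_N => hb W3 (-1 - (bump 0 j)%:Z) (I u (h + 1 + (bump 0 j)%:R) k w))); last first.
      move=> j _; rewrite gbinN1 -exprMn mulrNN mulr1 expr1n scale1r.
      rewrite [Yw W2 _ _ w](vw _) // (lf0 (I u _ k)) scaler0 subr0.
      by rewrite add0r -pmulrn.
    have -> : (-1 + 0 - 0%N%:Z) = -1 :> int by [].
    have -> : (0 + 0%N%:Z)%:~R = 0 :> K by [].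
    rewrite exprN1 invrN1 scaleN1r opprK (lfZ (I u _ k)).
    have -> : h + 1 + (-1)%:~R = h by rewrite rmorphN1 addrK.
    by rewrite addrAC.
  - by move=> j hj; rewrite add0r hN //; lia.
  - by move=> j hj; apply: vw; lia.
rewrite scalerDr => e.
have -> : (- h - 1 - m * c) *: I u h k w = (- (h + 1)) *: I u h k w - m *: (c *: I u h k w) by lincomb.
rewrite addrAC -e; lincomb.
Qed.

(** The power x^(-h-1) is then x^(m c + j), as for a vertex operator of lattice type. *)
Definition lat_exp h := exists j : nat, h = - 1 - m * c - j%:R.

(** Downward induction on h from the truncation bound. The right side of [lat_rec] vanishes by
    induction, which leaves a I_k + (k+1) I_(k+1) = 0 with a = - h - 1 - m c. If a is nonzero,
    descending in k from the bound on logarithms kills everything; if a = 0, the relation itself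
    kills all k > 0. *)
Lemma lat_zero h k : k <> 0%N \/ ~ lat_exp h -> I u h k w = 0.
Proof.
have [m0 hm0] := i_trunc I u w h.
suff H : forall d i, (m0 - i <= d)%N -> forall k, k <> 0%N \/ ~ lat_exp (h + i%:R) ->
    I u (h + i%:R) k w = 0.
  by have := H m0 0%N _ k; rewrite addr0; apply; rewrite subn0.
elim=> [|d IH] i hi {}k hk; first by apply: hm0; rewrite -subn_eq0 -leqn0.
have {IH}IH i' k' : (i < i')%N -> k' <> 0%N \/ ~ lat_exp (h + i'%:R) -> I u (h + i'%:R) k' w = 0.
  move=> ii' hk'; apply: IH => //.
  by move: hi ii'; lia.
have shift j : h + i%:R + 1 + j%:R = h + (i + j.+1)%:R by rewrite natrD -natr1; ring.
have hN j : (m0 <= j)%N -> forall k, I u (h + i%:R + 1 + j%:R) k w = 0.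
  by move=> hj k'; rewrite shift; apply: hm0; lia.
set a := - (h + i%:R) - 1 - m * c.
have rec k' : (k' <> 0%N \/ forall j : nat, ~ lat_exp (h + (i + j.+1)%:R)) ->
    a *: I u (h + i%:R) k' w + k'.+1%:R *: I u (h + i%:R) k'.+1 w = 0.
  move=> hk'; rewrite (lat_rec (N := m0)) => [|j /hN //].
  rewrite big1 ?scaler0 // => j _; rewrite shift IH ?lf0 //; first by lia.
  by case: hk' => h'; [left|right; apply: h'].
have [k0 hk0] := i_log I u w (h + i%:R).
have down (l : nat) : a != 0 -> (forall k', (l <= k')%N -> a *: I u (h + i%:R) k' w + k'.+1%:R *: I u (h + i%:R) k'.+1 w = 0) ->
    forall k', (l <= k')%N -> I u (h + i%:R) k' w = 0.
  move=> a0 hr k' lk'; have [n] := ubnP (k0 - k')%N; elim: n k' lk' => // n IHn k' lk' hn.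
  have [k0k|kk0] := leqP k0 k'; first exact: hk0.
  have := hr k' lk'; rewrite (IHn k'.+1); [|lia|lia].
  by rewrite scaler0 addr0 => /eqP; rewrite scaler_eq0 (negbTE a0) => /eqP.
have nform : a != 0 -> ~ lat_exp (h + i%:R) -> forall j : nat, ~ lat_exp (h + (i + j.+1)%:R).
  move=> _ nf j [j' e]; apply: nf; exists (j' + j.+1)%N.
  have -> : h + i%:R = h + (i + j.+1)%:R - j.+1%:R by rewrite natrD; ring.
  by rewrite e natrD; ring.
have [a0|a0] := eqVneq a 0.
  have fi : lat_exp (h + i%:R).
    by exists 0%N; move/eqP: a0; rewrite /a subr0 -opprD -opprD oppr_eq0 => /eqP e; rewrite -[LHS]addr0 -[X in _ + X]oppr0 -e; ring.
  case: hk => // k0'; case: k k0' => // k _.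
  have nf j : ~ lat_exp (h + (i + j.+1)%:R).
    move=> [j' e]; have : (j' + j.+1)%:R = 0 :> K.
      rewrite natrD; have -> : j'%:R = - 1 - m * c - (h + (i + j.+1)%:R) by rewrite e; ring.
      have := a0; rewrite /a natrD => e'; rewrite -[RHS]e'; ring.
    by move/eqP; rewrite pnatr_eq0 addnS.
  have := rec k (or_intror nf); rewrite a0 scale0r add0r => /eqP.
  by rewrite scaler_eq0 pnatr_eq0 /= => /eqP.
case: hk => [k0'|nf].
  apply: (down 1%N a0); last by case: (k) k0' => // n _.
  by move=> k' hk'; apply: rec; left; lia.
apply: (down 0%N a0) => // k' _; apply: rec; right; exact: nform.
Qed.

Definition Ic (j : nat) := I u (- 1 - m * c - j%:R) 0 w.

Lemma Ic_rec j : j.+1%:R *: Ic j.+1 = m *: \sum_(i < j.+1) hb W3 (-1 - i%:Z) (Ic (j - i)).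
Proof.
have := @lat_rec (- 1 - m * c - j.+1%:R) 0 j.+1.
rewrite (@lat_zero _ 1%N); last by left.
rewrite scaler0 addr0 => e.
have -> : j.+1%:R *: Ic j.+1 = (- (-1 - m * c - j.+1%:R) - 1 - m * c) *: Ic j.+1.
  by congr (_ *: _); ring.
rewrite e => [|i hi].
  congr (_ *: _); apply: eq_bigr => i _; congr (hb _ _ (I _ _ _ _)).
  have hij : (i <= j)%N by rewrite -ltnS.
  by rewrite natrB // -natr1; ring.
apply: lat_zero; right=> -[j' e'].
have : (j' + (i - j))%:R = 0 - 0 :> K.
  rewrite natrD natrB; last by lia.
  have -> : j'%:R = - 1 - m * c - (-1 - m * c - j.+1%:R + 1 + i%:R) by rewrite e'; ring.
  by rewrite -natr1; ring.
by move/eqP; rewrite subrr pnatr_eq0; lia.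
Qed.

Lemma Ic_vac : vac_h (Ic 0).
Proof.
move=> r r0; rewrite /Ic intw_hb vw // (_ : I u _ _ 0 = 0) ?lf0 // add0r.
rewrite (@lat_zero _ 0%N) ?scaler0 //; right => -[j e].
case: r r0 e => // -[//|r] _; rewrite -pmulrn => e.
have : (r.+1 + j)%:R = 0 :> K.
  rewrite natrD; have -> : j%:R = - 1 - m * c - (-1 - m * c + 0 + r.+1%:R) by rewrite e; ring.
  ring.
by move/eqP; rewrite pnatr_eq0.
Qed.

Lemma Ic_h : hb W3 0 (Ic 0) = (c + 2%:R * m) *: Ic 0.
Proof. by rewrite /Ic intw_hb cw addr0 lfZ; lincomb. Qed.

Lemma Ic_in (D : lsub W3) : submod D -> D (Ic 0) -> forall h k, D (I u h k w).
Proof.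
move=> sD D0 h k.
have [[k0 [j hj]]|nf] := pselect (k = 0%N /\ lat_exp h); last first.
  rewrite lat_zero; first exact: lsub0.
  by case: (eqVneq k 0%N) => [k0|/eqP]; [right => f; apply: nf|left].
rewrite k0 hj -/(Ic j) {hj}; elim/ltn_ind: j => -[//|j] IH.
have := Ic_rec j => e.
have -> : Ic j.+1 = j.+1%:R^-1 *: (m *: \sum_(i < j.+1) hb W3 (-1 - i%:Z) (Ic (j - i))).
  by rewrite -e scalerA mulVf ?scale1r ?pnatr_eq0.
apply: lsubZ; apply: lsubZ; apply: lsub_sum => i _; apply: submod_hb => //.
by apply: IH; lia.
Qed.

(** The product of e^(m alpha) and e^(m' alpha) is again of lattice type; the charge of e^(m' alpha)
    is 2 m' because alpha has norm 2. The operator L_(-1) maps the leading coefficient to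
    combinations of [Ic 1] and of coefficients of h_(-1) w, and [Ic_rec] expresses [Ic 1] by
    h_(-1). *)
Lemma Ic_lat m' : c = 2%:R * m' -> Lop W2 (-1) w = m' *: hb W2 (-1) w ->
  lat (m + m') (Ic 0).
Proof.
move=> cm' Lw; split; first exact: Ic_vac.
  by rewrite Ic_h cm'; congr (_ *: _); ring.
have LI : Lop W3 (-1) (Ic 0) = I (Lop W1 (-1) u) (- 1 - m * c - 0) 0 w
    + I u (- 1 - m * c - 0) 0 (Lop W2 (-1) w).
  have [l hl] := Yw_trunc (omega (Vv V)) u.
  have := bo_comm (borch_intw I (- 1 - m * c - 0) 0) (w1 := u) w (-1 + 1) 0 (N := `|l|.+1) (om_homog V).
  rewrite addr0 => ->; last by move=> j hj; apply: hl; lia.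
  rewrite big_ord_recl big1 ?addr0 => [|j _]; last first.
    by rewrite addNr gbinz0 scale0r.
  by rewrite gbin0 scale1r addrC.
have e1 : I u (- 1 - m * c - 0 - 1) 0 w = Ic 1 by congr (I _ _ _ _); ring.
have r1 : Ic 1 = m *: hb W3 (-1) (Ic 0).
  by have := Ic_rec 0; rewrite scale1r big_ord_recl big_ord0 addr0 subnn subz0.
rewrite LI i_derivative (@lat_zero _ 1%N); last by left.
rewrite scaler0 addr0 e1 Lw.
have := intw_hb (-1) (- 1 - m * c - 0) 0 w.
rewrite rmorphN1 e1 (lfZ (I u _ 0%N)) -/(Ic 0) => e2.
have -> : I u (-1 - m * c - 0) 0 (hb W2 (-1) w) = hb W3 (-1) (Ic 0) - (2%:R * m) *: Ic 1.
  by rewrite e2; lincomb.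
rewrite r1 cm'; lincomb.
Qed.

End Fix.
End Lattice.

(** * Singular vectors of induced modules *)

Section Peel.
Variable R : realType.
Local Notation K := R[i].
Variables (U : glmod R) (M : superspace R) (act : gl11 -> int -> {linear M -> M}).
Variable (j : {linear U -> M}).
Hypotheses (lev : level1 act) (top : top_map act j).

Lemma act_comm a b r s w :
  act a r (act b s w) = (-1) ^+ (glpar a && glpar b) *: act b s (act a r w) +
     (glbr R a b).1 *: act (glbr R a b).2 (r + s) w
     + (if r + s == 0 then r%:~R * glform R a b else 0) *: w.
Proof. by rewrite -addrA -(proj2 lev) addrC subrK. Qed.

Lemma top0 a u : act a 0 (j u) = j (gact U a u).
Proof. by case: top => _ -> _. Qed.
Lemma topp a (r : int) u : 0 < r -> act a r (j u) = 0.
Proof. by case: top => _ _ h; apply: h. Qed.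

(* Words in the creation operators selected by C. *)
Inductive cl (C : gl11 -> nat -> Prop) : M -> Prop :=
| cl_top u : cl C (j u)
| cl_act a s x : C a s -> (0 < s)%N -> cl C x -> cl C (act a (- s%:Z) x)
| cl_lin c x y : cl C x -> cl C y -> cl C (c *: x + y).

Lemma cl0 C : cl C 0.
Proof. by have := cl_top C 0; rewrite lf0. Qed.

Definition cls C : lsub M := @Lsub R M (cl C) (cl0 C) (@cl_lin C).

Lemma cl_mono (C C' : gl11 -> nat -> Prop) x :
  (forall a s, C a s -> C' a s) -> cl C x -> cl C' x.
Proof.
move=> h; elim=> [u|a s y /h hC s0 _ IH|c y z _ IH1 _ IH2]; first exact: cl_top.
  exact: cl_act.
exact: cl_lin.
Qed.

Lemma cl_ind' C (D : lsub M) : (forall u, D (j u)) ->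
  (forall a s x, C a s -> (0 < s)%N -> cl C x -> D x -> D (act a (- s%:Z) x)) ->
  forall x, cl C x -> D x.
Proof.
move=> h1 h2 x; elim=> [//|a s y hC s0 cy IH|c y z _ IH1 _ IH2]; first exact: h2.
exact: lsubL.
Qed.

Lemma ker_lsub_proof (f : {linear M -> M}) c u w : f u = 0 -> f w = 0 -> f (c *: u + w) = 0.
Proof. by move=> hu hw; rewrite linearP hu hw scaler0 addr0. Qed.
Definition ker_lsub (f : {linear M -> M}) : lsub M :=
  @Lsub R M (fun x => f x = 0) (lf0 f) (ker_lsub_proof (f:=f)).

Section Step.
Variables (C : gl11 -> nat -> Prop) (c : gl11) (s : nat).
Hypothesis s0 : (0 < s)%N.
Definition addC a t := C a t \/ (a = c /\ t = s).
(* commutators of the new creation operator with the old ones are old *)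
Hypothesis closed : forall b t, C b t -> (0 < t)%N -> (glbr R b c).1 = 0 \/ C (glbr R b c).2 (t + s)%N.
Let cc : {linear M -> M} := act c (- s%:Z).

(** One step of PBW ordering: an old operator moves inward past the new one at the cost of a
    commutator, which is zero or again an old operator by [closed]. *)
Lemma step_span x : cl addC x ->
  sum_of (fun z => exists i y, cl C y /\ z = iter i cc y) x.
Proof.
have PZ a w : (exists i y, cl C y /\ w = iter i cc y) -> (exists i y, cl C y /\ a *: w = iter i cc y).
  move=> [i [y [hy ->]]]; exists i, (a *: y); split; first by apply: (lsubZ (D := cls C)).
  by elim: i => //= i <-; rewrite lfZ.
pose P := sum_sub PZ.
have Pc z : P z -> P (cc z).
  apply: (sum_of_map (f := cc)) => w [i [y [hy ->]]]; exists i.+1, y; by [].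
apply: (@cl_ind' addC P) => [u|a t y hC t0 cy Py].
  by apply: sum_of1; exists 0%N, (j u); split=> //; apply: cl_top.
case: hC => [hC|[-> ->]]; last exact: Pc.
suff H : forall i z, cl C z -> forall b q, C b q -> (0 < q)%N -> P (act b (- q%:Z) (iter i cc z)).
  apply: (sum_of_lsub (P := fun z => exists i y, cl C y /\ z = iter i cc y) (D := pre_lsub (act a (- t%:Z)) P)) Py.
  by move=> w [i [z [hz ->]]]; apply: H.
elim=> [|i IH] z hz b q hb q0.
  by apply: sum_of1; exists 0%N, (act b (- q%:Z) z); split=> //; apply: cl_act.
rewrite iterS {1}/cc act_comm; apply: lsubD; first apply: lsubD.
- by apply: lsubZ; apply: Pc; apply: IH.
- have [->|hC'] := closed hb q0; first by rewrite scale0r; apply: lsub0.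
  apply: lsubZ; rewrite -opprD -PoszD; apply: IH => //; lia.
- rewrite ifF; last by apply/eqP; lia.
  by rewrite scale0r; apply: lsub0.
Qed.

Variables (a : {linear M -> M}) (kap : K).
Hypotheses (kap0 : kap != 0) (akill : forall y, cl C y -> a y = 0).

Lemma sum_iter x : sum_of (fun z => exists i y, cl C y /\ z = iter i cc y) x ->
  exists n (y : nat -> M), (forall i, cl C (y i)) /\ x = \sum_(i < n) iter i cc (y i).
Proof.
move=> [q [hq ->]] {x}; elim: q hq => [|z q IH] hq.
  by exists 0%N, (fun=> 0); rewrite big_nil big_ord0; split=> // i; apply: cl0.
have [|n [y [hy e]]] := IH; first by move=> w hw; apply: hq; rewrite inE hw orbT.
have [|i [x [hx ez]]] := hq z; first by rewrite inE eqxx.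
have ext m : (n <= m)%N -> \sum_(l < m) iter l cc (if (l < n)%N then y l else 0) = \sum_(l < n) iter l cc (y l).
  move=> nm; rewrite (@sum_trunc _ (fun l => iter l cc (if (l < n)%N then y l else 0)) n m) //.
    by apply: eq_bigr => l _; rewrite ltn_ord.
  by move=> l nl; rewrite ltnNge nl /= iter0_lin.
exists (n + i.+1)%N, (fun l => (if (l < n)%N then y l else 0) + (if l == i then x else 0)).
split=> [l|].
  by apply: (lsubD (D := cls C)); case: ifP => _ //; apply: cl0.
rewrite big_cons e addrC.
transitivity (\sum_(l < n + i.+1) (iter l cc (if (l < n)%N then y l else 0) + iter l cc (if l == i :> nat then x else 0))).
  rewrite big_split /= ext ?leq_addr //; congr (_ + _).
  have iN : (i < n + i.+1)%N by lia.
  rewrite (bigD1 (Ordinal iN)) //= eqxx -ez big1 ?addr0 // => l /eqP li.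
  rewrite ifF ?iter0_lin //; apply/eqP => e'; apply: li; exact: val_inj.
by apply: eq_bigr => l _; have := iterS_lin cc l 1 (if (l < n)%N then y l else 0) (if l == i :> nat then x else 0); rewrite !scale1r.
Qed.

(** The operator [a] acts on polynomials in [cc] as kap times the derivative, so its (n+1)-st power
    isolates the coefficient of cc^(n+1); for a vector killed by [a] the coefficients of positive
    degree vanish one after the other. *)
Lemma step_boson : (forall z, a (cc z) = cc (a z) + kap *: z) ->
  forall x, cl addC x -> a x = 0 -> cl C x.
Proof.
move=> hab x /step_span /sum_iter [n [y [hy ->]]] {x}.
elim: n => [|n IH]; first by rewrite big_ord0 => _; apply: cl0.
move=> h.
have ki i l : iter i a (iter l cc (y l)) = if (i <= l)%N then ((l ^_ i)%:R * kap ^+ i) *: iter (l - i) cc (y l) else 0.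
  elim: i => [|i IHi]; first by rewrite ffactn0 expr0 mulr1 scale1r subn0.
  rewrite iterS IHi; case: ifP => il; last by rewrite lf0 ifF //; lia.
  rewrite lfZ; have [li|li] := ltnP i l; last first.
    have -> : (l - i = 0)%N by lia.
    by rewrite /= akill ?scaler0 // ifF //; lia.
  have -> : (l - i = (l - i.+1).+1)%N by lia.
  rewrite (weyl_aiter hab) akill // iter0_lin add0r scalerA; congr (_ *: _).
  rewrite ffactnSr natrM exprS (_ : (l - i = (l - i.+1).+1)%N); last by lia.
  ring.
case: n IH h => [|n] IH h; first by rewrite big_ord_recl big_ord0 addr0 /=; apply: hy.
have it_sum m : iter n.+1 a (\sum_(l < m) iter l cc (y l)) = \sum_(l < m) iter n.+1 a (iter l cc (y l)).
  elim: m => [|m IHm]; first by rewrite !big_ord0 iter0_lin.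
  by rewrite !big_ord_recr -IHm; have := iterS_lin a n.+1 1 (\sum_(l < m) iter l cc (y l)) (iter m cc (y m)); rewrite !scale1r.
have yn0 : y n.+1 = 0.
  have : iter n.+1 a (\sum_(l < n.+2) iter l cc (y l)) = 0 by rewrite iterSr h iter0_lin.
  rewrite it_sum big_ord_recr big1 ?add0r /=; last first.
    by move=> l _; rewrite -/(iter n.+1 _ _) ki ifF //; have := ltn_ord l; lia.
  rewrite -/(iter n.+1 _ _) -[cc (iter n cc _)]/(iter n.+1 cc _) ki leqnn subnn add0r => /eqP.
  rewrite scaler_eq0 mulf_eq0 expf_eq0 (negbTE kap0) andbF orbF pnatr_eq0.
  by rewrite ffactnn (negbTE (lt0n_neq0 (fact_gt0 _))) => /eqP.
move: h; rewrite big_ord_recr /= yn0 iter0_lin lf0 addr0; exact: IH.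
Qed.

(** As cc^2 = 0, the vector is y_0 + cc y_1, and [a] maps it to kap y_1. *)
Lemma step_fermion : (forall z, cc (cc z) = 0) -> (forall z, a (cc z) = - cc (a z) + kap *: z) ->
  forall x, cl addC x -> a x = 0 -> cl C x.
Proof.
move=> cc0 hab x /step_span /sum_iter [n [y [hy ->]]] {x}.
have e2 i z : iter i.+2 cc z = 0 by elim: i => [|i IH]; rewrite iterS ?cc0 ?IH ?lf0 //=.
case: n => [|[|n]].
- by rewrite big_ord0 => _; apply: cl0.
- by rewrite big_ord_recl big_ord0 addr0 => _; apply: hy.
rewrite 2!big_ord_recl big1 ?addr0; last by move=> i _; exact: e2.
rewrite /=.
rewrite lfD akill // hab akill // lf0 oppr0 !add0r => /eqP; rewrite scaler_eq0 (negbTE kap0) => /eqP ->.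
by rewrite lf0 addr0; apply: hy.
Qed.

End Step.

(** A vector involves finitely many creation operators, so one stage of an increasing family
    contains them all. *)
Lemma cl_union (C : nat -> gl11 -> nat -> Prop) x :
  (forall n m a s, (n <= m)%N -> C n a s -> C m a s) ->
  cl (fun a s => exists n, C n a s) x -> exists n, cl (C n) x.
Proof.
move=> mono; elim=> [u|a s y [n hn] s0 _ [m hm]|c y z _ [n hn] _ [m hm]].
- by exists 0%N; apply: cl_top.
- exists (n + m)%N; apply: cl_act => //; first by apply: mono hn; apply: leq_addr.
  by apply: cl_mono hm => b t; apply: mono; apply: leq_addl.
- exists (n + m)%N; apply: cl_lin.
    by apply: cl_mono hn => b t; apply: mono; apply: leq_addr.
  by apply: cl_mono hm => b t; apply: mono; apply: leq_addl.
Qed.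

Variable e : K.
Hypotheses (hE : forall u, gact U glE u = e *: u)
  (eint : forall s : int, s != 0 -> e + s%:~R != 0).

Definition CA (_ : gl11) (_ : nat) := True.

Lemma cl_par x : cl CA x -> cl CA (par M x).
Proof.
apply: (@cl_ind' CA (pre_lsub (par M) (cls CA))) => [u|a s y _ s0 cy IH] /=.
  by case: top => -> _ _; apply: cl_top.
rewrite (proj1 lev); apply: (lsubZ (D := cls CA)); exact: cl_act.
Qed.

(** Filtration by depth. Here it plays the role of L_0, since [M] is only a module over the affine
    algebra. *)
Inductive cd : nat -> M -> Prop :=
| cd_top d u : cd d (j u)
| cd_act d a s x : (0 < s)%N -> cd d x -> cd (d + s)%N (act a (- s%:Z) x)
| cd_lin d c x y : cd d x -> cd d y -> cd d (c *: x + y).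

Lemma cd0 d : cd d 0.
Proof. by have := cd_top d 0; rewrite lf0. Qed.
Definition cds d : lsub M := @Lsub R M (cd d) (cd0 d) (@cd_lin d).

Lemma cd_mono d d' x : (d <= d')%N -> cd d x -> cd d' x.
Proof.
move=> dd h; elim: h d' dd => [q u|q a s y s0 _ IH|q c y z _ IH1 _ IH2] d' dd.
- exact: cd_top.
- have -> : d' = ((d' - s) + s)%N by lia.
  by apply: cd_act => //; apply: IH; lia.
- by apply: cd_lin; [apply: IH1|apply: IH2].
Qed.

Lemma cd_cl d x : cd d x -> cl CA x.
Proof.
elim=> [q u|q a s y s0 _ IH|q c y z _ IH1 _ IH2]; [exact: cl_top|exact: cl_act|exact: cl_lin].
Qed.

Lemma cl_cd x : cl CA x -> exists d, cd d x.
Proof.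
elim=> [u|a s y _ s0 _ [d IH]|c y z _ [d IH1] _ [d' IH2]].
- by exists 0%N; apply: cd_top.
- by exists (d + s)%N; apply: cd_act.
- exists (d + d')%N; apply: cd_lin; [apply: cd_mono IH1|apply: cd_mono IH2]; lia.
Qed.

Lemma cd_lower d x : cd d x -> forall a (r : nat),
  if (r <= d)%N then cd (d - r) (act a r%:Z x) else act a r%:Z x = 0.
Proof.
elim=> {d x} [d u|d b s x s0 cx IH|d c x y _ IH1 _ IH2] a r.
- case: r => [|r]; first by rewrite leq0n subn0 top0; apply: cd_top.
  by rewrite topp //; case: ifP => _ //; apply: cd0.
- have t1 : if (r <= d + s)%N then cd (d + s - r) (act b (- s%:Z) (act a r%:Z x)) else act b (- s%:Z) (act a r%:Z x) = 0.
    have := IH a r; case: ifP => h1 h; case: ifP => h2; try lia.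
    + by rewrite (_ : (d + s - r = d - r + s)%N); [apply: cd_act|lia].
    + by rewrite h lf0; apply: cd0.
    + by rewrite h lf0.
  have t2 : forall b', if (r <= d + s)%N then cd (d + s - r) (act b' (r%:Z - s%:Z) x) else act b' (r%:Z - s%:Z) x = 0.
    move=> b'; have [rs|sr] := leqP s r.
      have -> : r%:Z - s%:Z = (r - s)%N%:Z by lia.
      have := IH b' (r - s)%N; case: ifP => h1; case: ifP => h2 //; try lia.
      by have -> : (d - (r - s) = d + s - r)%N by lia.
    have -> : r%:Z - s%:Z = - (s - r)%N%:Z by lia.
    rewrite ifT; last by lia.
    by rewrite (_ : (d + s - r = d + (s - r))%N); [apply: cd_act => //; lia|lia].
  have t3 (k : K) : if (r <= d + s)%N then cd (d + s - r) ((if r%:Z - s%:Z == 0 then k else 0) *: x) else (if r%:Z - s%:Z == 0 then k else 0) *: x = 0.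
    case: eqP => h; last by case: ifP => _; rewrite scale0r //; apply: cd0.
    rewrite ifT; last by lia.
    have -> : (d + s - r = d)%N by lia.
    by apply: (lsubZ (D := cds d)).
  rewrite act_comm; move: t1 t2 t3; case: ifP => _ t1 t2 t3.
    apply: (lsubD (D := cds _)) (t3 _); apply: (lsubD (D := cds _)); apply: (lsubZ (D := cds _)) => //; exact: t2.
  by rewrite t1 t2 t3 !scaler0 !addr0.
- have := IH1 a r; have := IH2 a r; case: ifP => _ h1 h2; rewrite linearP; first exact: cd_lin.
  by rewrite h1 h2 scaler0 addr0.
Qed.

Lemma cl_stable x a (r : int) : cl CA x -> cl CA (act a r x).
Proof.
case: r => r; last by rewrite NegzE => h; apply: cl_act.
move=> /cl_cd [d /cd_lower h]; have := h a r; case: ifP => _; first exact: cd_cl.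
by move=> ->; apply: cl0.
Qed.

Hypothesis gen : forall D : lsub M, (forall u, D u -> D (par M u)) ->
  (forall a r u, D u -> D (act a r u)) -> (forall u, D (j u)) -> forall w, D w.

Lemma cl_all x : cl CA x.
Proof.
apply: (gen (D := cls CA)) => [u|a r u|u]; [exact: cl_par|exact: cl_stable|exact: cl_top].
Qed.

Lemma act_E r b s w : b <> glN -> act glE r (act b s w) = act b s (act glE r w).
Proof.
move=> bN; rewrite act_comm; case: b bN => //= _; rewrite expr0 scale1r scale0r addr0 !mulr0 if_same scale0r addr0 //.
Qed.

Lemma E0_act x : act glE 0 x = e *: x.
Proof.
apply: (@cl_ind' CA (eig_lsub (act glE 0) e) _ _ x (cl_all x)) => [u|a s y _ s0 _] /=.
  by rewrite top0 hE lfZ.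
move=> IH; rewrite act_comm IH add0r ifF; last by apply/eqP; lia.
by case: a => /=; rewrite expr0 !scale0r scale1r !addr0 lfZ.
Qed.

Lemma Epos_kill (r : nat) x : (0 < r)%N -> cl (fun a _ => a <> glN) x -> act glE r%:Z x = 0.
Proof.
move=> r0; apply: (@cl_ind' _ (ker_lsub (act glE r%:Z))) => [u|a s y aN s0 _ IH] /=.
  by rewrite topp.
by rewrite act_E // IH lf0.
Qed.

Definition sing (x : M) := forall a (r : int), 0 < r -> act a r x = 0.

(** The creation operators still allowed at the stages of the peeling, with n the highest remaining
    mode of the kind being removed; [Cp'] is the stage at which only one of the two fermions of mode
    n + 1 is gone. *)
Definition CN n a s := a <> glN \/ (a = glN /\ (s <= n)%N).
Definition Cp n a (s : nat) := a = glE \/ ((a = psip \/ a = psim) /\ (s <= n)%N).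
Definition Cp' n := addC (Cp n) psip n.+1.
Definition CE n (a : gl11) (s : nat) := a = glE /\ (s <= n)%N.

Lemma Cp'_N n a s : Cp' n a s -> a <> glN.
Proof. by move=> [[->|[[->|->] _]]|[-> _]]. Qed.

Lemma ferm_sq a s z : glpar a -> act a (- s%:Z) (act a (- s%:Z) z) = 0.
Proof.
move=> ha; have := act_comm a a (- s%:Z) (- s%:Z) z.
rewrite ha expr1 scaleN1r.
have -> : (glbr R a a).1 = 0 by case: a ha.
have -> : glform R a a = 0 by case: a ha.
rewrite mulr0 if_same !scale0r !addr0 => h.
have : (2%:R : K) *: act a (- s%:Z) (act a (- s%:Z) z) = 0.
  by rewrite scaler_nat mulr2n {1}h addNr.
by move/eqP; rewrite scaler_eq0 (negbTE (two_neq0 R)) => /eqP.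
Qed.

Lemma kap_nat n : (n.+1%:R : K) != 0. Proof. by rewrite pnatr_eq0. Qed.

(** Creation operators are removed in the order N, fermions, E, from the highest mode downwards,
    each by its dual: N_(-s) by E_s, the fermions by each other, E_(-s) by N_s. The anticommutators
    of the fermions are the scalars e + s and e - s, nonzero by [eint]. *)
Lemma peel_sing x : sing x -> exists u, x = j u.
Proof.
move=> sx.
have x1 : cl (fun a _ => a <> glN) x.
  have [n hn] : exists n, cl (CN n) x.
    apply: cl_union; first by move=> n m a s nm [h|[-> h]]; [left|right; split=> //; lia].
    apply: cl_mono (cl_all x) => a s _; exists s.
    by case: a; [right|left|left|left].
  elim: n hn => [|n IH] hn.
    have : cl (fun a s => CN 0 a s /\ (0 < s)%N) x.
      elim: hn => [u|a s y hC s0 _ IHy|c y z _ IH1 _ IH2]; [exact: cl_top|exact: cl_act|exact: cl_lin].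
    by apply: cl_mono => a s [[//|[_ h]] s0]; lia.
  apply: IH; apply: (@step_boson (CN n) glN n.+1 _ _ (act glE n.+1%:Z) n.+1%:R) => //.
  - by case=> t; [left|left|right; left|right; left].
  - exact: kap_nat.
  - move=> y; apply: (@cl_ind' _ (ker_lsub (act glE n.+1%:Z))) => [u|a s z hC s0 _ IHz] /=.
      by rewrite topp.
    case: hC => [aN|[-> sn]]; first by rewrite act_E // IHz lf0.
    rewrite act_comm IHz lf0 scaler0 add0r scale0r add0r ifF ?scale0r //; apply/eqP; lia.
  - by move=> z; rewrite act_comm /= expr0 scale1r scale0r addr0 subrr eqxx mulr1.
  - by apply: cl_mono hn => a s [h|[-> h]]; [left; left|case: (ltngtP s n.+1) => hs; [left; right|lia|right]].
  - exact: sx.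
have x2 : cl (fun a _ => a = glE) x.
  have [n hn] : exists n, cl (Cp n) x.
    apply: cl_union; first by move=> n m a s nm [h|[a' h]]; [left|right; split=> //; lia].
    apply: cl_mono x1 => a s aN; exists s.
    by case: a aN => //; [left|right; split=> //; left|right; split=> //; right].
  elim: n hn => [|n IH] hn.
    have : cl (fun a s => Cp 0 a s /\ (0 < s)%N) x.
      elim: hn => [u|a s y hC s0 _ IHy|c y z _ IH1 _ IH2]; [exact: cl_top|exact: cl_act|exact: cl_lin].
    by apply: cl_mono => a s [[//|[_ h]] s0]; lia.
  have kill1 y : cl (Cp' n) y -> act psip n.+1%:Z y = 0.
    apply: (@cl_ind' _ (ker_lsub (act psip n.+1%:Z))) => [u|a s z hC s0 cz IHz] /=.
      by rewrite topp.
    rewrite act_comm IHz lf0 scaler0 add0r.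
    case: hC => [[->|[[->|->] sn]]|[-> ->]] /=; rewrite ?mulr0 ?if_same ?scale0r ?addr0 //.
    have -> : n.+1%:Z + - s%:Z = (n.+1 - s)%N%:Z by lia.
    rewrite Epos_kill ?scaler0 ?add0r; first by rewrite ifF ?scale0r //; apply/eqP; lia.
      by lia.
    by apply: cl_mono cz => b t; apply: Cp'_N.
  have kill2 y : cl (Cp n) y -> act psim n.+1%:Z y = 0.
    apply: (@cl_ind' _ (ker_lsub (act psim n.+1%:Z))) => [u|a s z hC s0 cz IHz] /=.
      by rewrite topp.
    rewrite act_comm IHz lf0 scaler0 add0r.
    case: hC => [->|[[->|->] sn]] /=; rewrite ?mulr0 ?if_same ?scale0r ?addr0 //.
    have -> : n.+1%:Z + - s%:Z = (n.+1 - s)%N%:Z by lia.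
    rewrite Epos_kill ?scaler0 ?add0r; first by rewrite ifF ?scale0r //; apply/eqP; lia.
      by lia.
    by apply: cl_mono cz => b t hb; apply: (@Cp'_N n b t); left.
  apply: IH.
  apply: (@step_fermion (Cp n) psip n.+1 _ _ (act psim n.+1%:Z) (e + (- n.+1%:Z)%:~R)) => //.
  - by move=> b t [->|[[->|->] h]] _; [left|left|right; left].
  - by apply: eint.
  - by move=> z; apply: ferm_sq.
  - move=> z; rewrite act_comm /= expr1 scaleN1r scale1r subrr eqxx E0_act rmorphN /= mulrN1; lincomb.
  - apply: (@step_fermion (Cp' n) psim n.+1 _ _ (act psip n.+1%:Z) (e + n.+1%:Z%:~R)) => //.
    + by move=> b t [[->|[[->|->] h]]|[-> _]] _; [left|right; left; left|left|right; left; left].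
    + by apply: eint.
    + by move=> z; apply: ferm_sq.
    + move=> z; rewrite act_comm /= expr1 scaleN1r scale1r subrr eqxx E0_act mulr1; lincomb.
    + apply: cl_mono hn => a s [->|[[->|->] h]].
      * by left; left; left.
      * by left; case: (ltngtP s n.+1) => hs; [left; right; split=> //; left|lia|right].
      * by case: (ltngtP s n.+1) => hs; [left; left; right; split=> //; right|lia|right].
    + exact: sx.
  - exact: sx.
have [n hn] : exists n, cl (CE n) x.
  apply: cl_union; first by move=> n m a s nm [-> h]; split=> //; lia.
  by apply: cl_mono x2 => a s ->; exists s.
elim: n hn => [|n IH] hn.
  have : cl (fun a s => CE 0 a s /\ (0 < s)%N) x.
    elim: hn => [u|a s y hC s0 _ IHy|c y z _ IH1 _ IH2]; [exact: cl_top|exact: cl_act|exact: cl_lin].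
  elim=> [u|a s y [[_ h] s0]|c y z _ [u ->] _ [v ->]]; first by exists u.
    by lia.
  by exists (c *: u + v); rewrite linearP.
apply: IH; apply: (@step_boson (CE n) glE n.+1 _ _ (act glN n.+1%:Z) n.+1%:R) => //.
- by move=> b t [-> _] _; left.
- exact: kap_nat.
- move=> y; apply: (@cl_ind' _ (ker_lsub (act glN n.+1%:Z))) => [u|a s z [-> sn] s0 _ IHz] /=.
    by rewrite topp.
  rewrite act_comm IHz lf0 scaler0 add0r scale0r add0r ifF ?scale0r //; apply/eqP; lia.
- by move=> z; rewrite act_comm /= expr0 scale1r scale0r addr0 subrr eqxx mulr1.
- by apply: cl_mono hn => a s [-> h]; case: (ltngtP s n.+1) => hs; [left|lia|right].
- exact: sx.
Qed.

(** An annihilation operator that does not kill x lowers its depth and stays in [D], so the descent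
    ends at a singular vector, which [peel_sing] puts into the image of [j]. *)
Lemma peel_main (D : lsub M) : (forall a r u, D u -> D (act a r u)) ->
  (exists x, D x /\ x != 0) -> exists u, D (j u) /\ j u != 0.
Proof.
move=> Dc [x [Dx x0]]; have [d hd] := cl_cd (cl_all x).
elim/ltn_ind: d x Dx x0 hd => d IH x Dx x0 hd.
have [sx|] := pselect (sing x).
  by have [u eu] := peel_sing sx; exists u; rewrite -eu.
move=> /existsNP [a /existsNP [r /not_implyP [r0 ar]]].
case: r r0 ar => // r r0 ar.
have := cd_lower hd a r; case: ifP => rd h; last by case: ar.
apply: (IH (d - r)%N _ (act a r%:Z x)) => //; [lia|exact: Dc|exact/eqP].
Qed.

End Peel.

(** * Irreducible induced modules *)

Section Induced.
Variable R : realType.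
Local Notation K := R[i].

Definition Hgen (U : glmod R) (M : superspace R) (act : gl11 -> int -> {linear M -> M})
    (j : {linear U -> M}) :=
  forall D : lsub M, (forall u, D u -> D (par M u)) ->
    (forall a r u, D u -> D (act a r u)) -> (forall u, D (j u)) -> forall w, D w.

Lemma range_lsub_proof (M N : lmodType K) (f : {linear M -> N}) (D : lsub M) c u w :
  (exists y, D y /\ f y = u) -> (exists y, D y /\ f y = w) -> exists y, D y /\ f y = c *: u + w.
Proof.
by move=> [y [hy <-]] [z [hz <-]]; exists (c *: y + z); rewrite linearP; split=> //; apply: lsubL.
Qed.
Definition im_lsub (M N : lmodType K) (f : {linear M -> N}) (D : lsub M) : lsub N :=
  @Lsub R N (fun x => exists y, D y /\ f y = x) (ex_intro _ 0 (conj (lsub0 D) (lf0 f)))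
    (range_lsub_proof (f:=f) (D:=D)).

Section Graph.
Variables (U : glmod R) (M : superspace R) (act : gl11 -> int -> {linear M -> M}).
Variable (j : {linear U -> M}).
Hypotheses (lev : level1 act) (top : top_map act j).
Variable e : K.
Hypotheses (hE : forall u, gact U glE u = e *: u)
  (eint : forall s : int, s != 0 -> e + s%:~R != 0).
Hypotheses (gen : Hgen act j) (jinj : injective j).
Variables (M' : superspace R) (act' : gl11 -> int -> {linear M' -> M'}).
Variable (f : {linear U -> M'}).
Hypotheses (lev' : level1 act') (top' : top_map act' f).

Let P := prod_super M M'.
Lemma pact_linear a r : linear (fun x : P => (act a r x.1, act' a r x.2) : P).
Proof. by move=> c u w; rewrite /= !linearP. Qed.
Let pa a r : {linear P -> P} := mklin (pact_linear a r).
Lemma pj_linear : linear (fun u : U => (j u, f u) : P).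
Proof. by move=> c u w; rewrite /= !linearP. Qed.
Let pj : {linear U -> P} := mklin pj_linear.

Let paE a r x : pa a r x = (act a r x.1, act' a r x.2). Proof. by []. Qed.
Let pjE u : pj u = (j u, f u). Proof. by []. Qed.
Let ppE (x : P) : par P x = (par M x.1, par M' x.2). Proof. by []. Qed.

Lemma pair_eq2 (x y : P) : x.1 = y.1 -> x.2 = y.2 -> x = y.
Proof. by case: x y => [a b] [c d] /= -> ->. Qed.

Lemma plev : level1 pa.
Proof.
split=> [a r w|a b r s w]; apply: pair_eq2; rewrite /=.
- exact: (proj1 lev).
- exact: (proj1 lev').
- exact: (proj2 lev).
- exact: (proj2 lev').
Qed.

(** The submodule generated by the graph of [f] over [U]; it will be the graph of the extension of
    [f] to [M]. *)
Definition inG (x : P) := forall D : lsub P, (forall u, D u -> D (par P u)) ->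
    (forall a r u, D u -> D (pa a r u)) -> (forall u, D (pj u)) -> D x.
Lemma inG0 : inG 0. Proof. by move=> D _ _ _; apply: lsub0. Qed.
Lemma inGL c u w : inG u -> inG w -> inG (c *: u + w).
Proof. by move=> hu hw D a b d; apply: lsubL; [apply: hu|apply: hw]. Qed.
Let G : lsub P := Lsub inG0 inGL.
Lemma Gpar u : G u -> G (par P u).
Proof. by move=> h D a b d; apply: (a); apply: h. Qed.
Lemma Gact a r u : G u -> G (pa a r u).
Proof. by move=> h D x b d; apply: (b); apply: h. Qed.
Lemma Gj u : G (pj u). Proof. by move=> D x b d. Qed.

Let S := sub_super Gpar.
Let si : {linear S -> P} := sincl Gpar.
Let sa a r : {linear S -> S} := sub_end Gpar (@Gact a r).
Let sj : {linear U -> S} := sub_lift Gpar Gj.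

Lemma stop_ : top_map sa sj.
Proof.
split=> [u|a u|a r u r0]; apply: (@sincl_inj _ _ _ Gpar).
- rewrite sincl_par !sub_liftE ppE !pjE /=.
  by case: top => -> _ _; case: top' => -> _ _.
- rewrite sub_endE !sub_liftE paE !pjE /=.
  by case: top => _ -> _; case: top' => _ -> _.
- rewrite sub_endE !sub_liftE paE lf0 !pjE /=.
  by case: top => _ _ -> //; case: top' => _ _ -> //.
Qed.

Lemma slev : level1 sa. Proof. exact: sub_level1 plev. Qed.

Lemma sgen : Hgen sa sj.
Proof.
move=> D Dp Da Dj w.
have : im_lsub si D (si w).
  have := @sincl_in _ _ _ Gpar w; apply.
  - by move=> _ [y [hy <-]]; exists (par S y); split; [apply: Dp|].
  - by move=> a r _ [y [hy <-]]; exists (sa a r y); split; [apply: Da|].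
  - by move=> u; exists (sj u).
by move=> [y [hy /(@sincl_inj _ _ _ Gpar) <-]].
Qed.

(** The vertical vectors (0, y) of the graph form a subspace stable under the modes. Were it
    nonzero, [peel_main] would find in it a nonzero vector (j u, f u); but j u = 0 forces u = 0. *)
Lemma graph_fun x y : G (x, y) -> x = 0 -> y = 0.
Proof.
move=> Gxy x0; apply/eqP; rewrite -[_ == _]negbK; apply/negP => y0.
have kl c (u w : S) : (si u).1 = 0 -> (si w).1 = 0 -> (si (c *: u + w)).1 = 0.
  by move=> hu hw; rewrite linearP /= hu hw scaler0 addr0.
pose D : lsub S := @Lsub R S (fun z => (si z).1 = 0) (congr1 (fun z => z.1) (lf0 si)) kl.
have Da a r u : D u -> D (sa a r u).
  by move=> h; change (act a r (si u).1 = 0); rewrite (h : (si u).1 = 0) lf0.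
have [z hz] := sub_elim Gpar Gxy.
have [|u [Du nz]] := peel_main slev stop_ hE eint sgen Da.
  exists z; split; first by rewrite /D /= -/si hz.
  apply/eqP => z0; move/eqP: y0; apply.
  by have := congr1 (fun q => (si q).2) z0; rewrite hz lf0.
move/eqP: nz; apply.
have : j u = j 0 by rewrite lf0; exact: Du.
by move=> /jinj ->; rewrite lf0.
Qed.

Lemma graph_ex x : exists y, G (x, y).
Proof.
have ex0 : exists y, G (0, y) by exists 0; apply: (lsub0 G).
have exL c u w : (exists y, G (u, y)) -> (exists y, G (w, y)) -> exists y, G (c *: u + w, y).
  move=> [y hy] [z hz]; exists (c *: y + z).
  exact: (@lsubL _ _ G c _ _ hy hz).
pose D : lsub M := @Lsub R M (fun x => exists y, G (x, y)) ex0 exL.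
apply: (gen (D := D)) => [u [y hy]|a r u [y hy]|u].
- by exists (par M' y); apply: (Gpar hy).
- by exists (act' a r y); apply: (Gact a r hy).
- by exists (f u); apply: Gj.
Qed.

Definition gfun x := xget 0 [set y | G (x, y)]%classic.
Lemma gfunP x : G (x, gfun x).
Proof. by have [y hy] := graph_ex x; apply: (@xgetPex _ 0 [set y | G (x, y)]%classic); exists y. Qed.
Lemma gfun_uniq x y : G (x, y) -> y = gfun x.
Proof.
move=> hy; apply/eqP; rewrite -subr_eq0; apply/eqP; apply: (@graph_fun (x - x)); last exact: subrr.
exact: (lsubB hy (gfunP x)).
Qed.
Lemma gfun_lin : linear gfun.
Proof. by move=> c u w; apply/esym/gfun_uniq; apply: (@lsubL _ _ G c _ _ (gfunP u) (gfunP w)). Qed.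

Lemma graph_main : exists F : {linear M -> M'},
        [/\ affine_map act act' F, forall u, F (j u) = f u &
            forall F' : {linear M -> M'}, affine_map act act' F' ->
              (forall u, F' (j u) = f u) -> F' =1 F].
Proof.
exists (mklin gfun_lin); split.
- split=> [w|a r w]; [exact: (gfun_uniq (Gpar (gfunP w)))|exact: (esym (gfun_uniq (Gact a r (gfunP w))))].
- by move=> u; apply/esym/gfun_uniq; apply: Gj.
move=> F' [h1 h2] h3 x; apply: gfun_uniq.
have l0 : G (0, F' 0) by rewrite lf0; apply: (lsub0 G).
have lL c u w : G (u, F' u) -> G (w, F' w) -> G (c *: u + w, F' (c *: u + w)).
  by move=> hu hw; rewrite linearP; apply: (@lsubL _ _ G c _ _ hu hw).
pose D : lsub M := @Lsub R M (fun x => G (x, F' x)) l0 lL.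
apply: (gen (D := D)) => [u hu|a r u hu|u] /=.
- by rewrite -h1; apply: (Gpar hu).
- by rewrite h2; apply: (Gact a r hu).
- by rewrite h3; apply: Gj.
Qed.

End Graph.

(** A criterion for being induced: generation by an injective top, for an eigenvalue of E_0 at which
    the fermionic anticommutators do not vanish. *)
Lemma induced_of (U : glmod R) (M : superspace R) (act : gl11 -> int -> {linear M -> M})
  (j : {linear U -> M}) (e : K) : level1 act -> top_map act j ->
  (forall u, gact U glE u = e *: u) -> (forall s : int, s != 0 -> e + s%:~R != 0) ->
  Hgen act j -> injective j -> is_induced act j.
Proof.
move=> lev top hE eint gen jinj; split=> // M' act' lev' f top'.
exact: (graph_main lev top hE eint gen jinj lev' top').
Qed.

Variable V : V1gl11 R.

Lemma submod_lsub_act (W : vmod V) (D : W -> Prop) (h : submod D) a r u :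
  lsubV h u -> lsubV h (curw W a r u).
Proof. by rewrite !lsubVE; case: h => _ _ _; apply. Qed.

Lemma irred_of (W : vmod V) (U : glmod R) (j : {linear U -> W}) (e : K) :
  top_map (curw W) j ->
  (forall u, gact U glE u = e *: u) -> (forall s : int, s != 0 -> e + s%:~R != 0) ->
  Hgen (curw W) j -> (exists w : W, w != 0) ->
  (forall D : lsub W, (forall a r u, D u -> D (curw W a r u)) -> forall u, D (j u) -> j u != 0 ->
     forall u', D (j u')) ->
  irreducible W.
Proof.
move=> top hE eint gen Wn0 topirr; split=> //.
move=> D sD; have [[x [Dx x0]]|no] := pselect (exists x, D x /\ x != 0); last first.
  left=> w Dw; apply/eqP; rewrite -[_ == _]negbK; apply/negP => w0; apply: no.
  by exists w.
right.
have [|u [Du nu]] := peel_main (curw_level1 W) top hE eint gen (submod_lsub_act (h := sD)).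
  by exists x; rewrite lsubVE.
move=> w; rewrite -(lsubVE sD); apply: (gen (lsubV sD)).
- by move=> v; rewrite !lsubVE; case: (sD) => _ _ + _; apply.
- exact: submod_lsub_act.
- by move=> u'; apply: (topirr _ (submod_lsub_act (h := sD)) _ Du nu).
Qed.

Lemma induced_Hgen (U : glmod R) (M : superspace R) (act : gl11 -> int -> {linear M -> M})
  (j : {linear U -> M}) : is_induced act j -> Hgen act j.
Proof. by move=> h D a b c; apply: (induced_gen h). Qed.

Lemma Verma_E n e (U : glmod R) (v : U) : is_Verma n e v -> forall u, gact U glE u = e *: u.
Proof.
move=> [_ _ hE _ hb] u; have [c [-> _]] := hb u.
have h : gact U glE (gact U psim v) = e *: gact U psim v.
  have := gact_br glE psim v; rewrite /= expr0 scale1r scale0r => /eqP; rewrite subr_eq0 => /eqP ->.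
  by rewrite hE lfZ.
by rewrite (lfD (gact U glE)) !(lfZ (gact U glE)) hE h; lincomb.
Qed.

Lemma Verma_pm n e (U : glmod R) (v : U) : is_Verma n e v -> gact U psip (gact U psim v) = e *: v.
Proof.
move=> [_ _ hE hp _]; have := gact_br psip psim v.
by rewrite /= hp lf0 scaler0 subr0 scale1r hE.
Qed.

Lemma Vhat_irr n e (W : vmod V) : (exists w : W, w != 0) -> is_Vhat n e W -> ~ is_int e ->
  irreducible W.
Proof.
move=> Wn0 [U [v [j [hv ind]]]] ne; have [lev top _] := ind.
have eint (s : int) : s != 0 -> e + s%:~R != 0.
  move=> _; apply/eqP => h; apply: ne; exists (- s).
  by rewrite rmorphN; apply/eqP; rewrite -addr_eq0 h.
have e0 : e != 0 by apply/eqP => h; apply: ne; exists 0; rewrite h.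
have [_ top0 _] := top.
apply: (irred_of top (Verma_E hv) eint (induced_Hgen ind) Wn0).
move=> D Da u Du nu u'; have [_ _ _ hp hb] := hv.
have [c [hu _]] := hb u.
have Dv : D (j v).
  have [c2|c2] := eqVneq c.2 0.
    have c1 : c.1 != 0.
      by apply: contraNneq nu => c1; rewrite hu c1 c2 !scale0r addr0 lf0.
    have -> : j v = c.1^-1 *: j u.
      by rewrite hu c2 scale0r addr0 lfZ scalerA mulVf // scale1r.
    exact: lsubZ.
  have -> : j v = (c.2 * e)^-1 *: curw W psip 0 (j u).
    rewrite -top0 hu (lfD (gact U psip)) !(lfZ (gact U psip)) hp (Verma_pm hv) scaler0 add0r.
    by rewrite !(lfZ j) !scalerA mulVf ?scale1r // mulf_neq0.
  exact: lsubZ (Da _ _ _ Du).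
have [d [-> _]] := hb u'; rewrite lfD !lfZ; apply: lsubD; apply: lsubZ => //.
by rewrite top0; apply: Da.
Qed.

Lemma Ahat0_irr n (W : vmod V) (U : glmod R) (u : U) (j : {linear U -> W}) :
  (exists w : W, w != 0) -> is_A n u -> is_induced (curw W) j -> irreducible W.
Proof.
move=> Wn0 [_ [p _ hU] _ [hE _ _]] ind; have [lev top _] := ind.
have hE' w : gact U glE w = 0 *: w.
  by have [c ->] := hU w; rewrite (lfZ (gact U glE)) hE !scale0r scaler0.
have eint (s : int) : s != 0 -> (0 : K) + s%:~R != 0.
  by move=> s0; rewrite add0r intr_eq0.
apply: (irred_of top hE' eint (induced_Hgen ind) Wn0).
move=> D Da w Dw nw w'; have [c hw] := hU w; have [d ->] := hU w'.
have c0 : c != 0 by apply: contraNneq nw => c0; rewrite hw c0 scale0r lf0.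
have -> : j (d *: u) = (d / c) *: j w.
  by rewrite hw !(lfZ j) scalerA divfK.
exact: lsubZ.
Qed.

Definition nsc (k : K) (a : gl11) (r : int) : K :=
  match a with glN => if r == 0 then k else 0 | _ => 0 end.
Lemma nsh_lin (M : superspace R) (act : gl11 -> int -> {linear M -> M}) k a r :
  linear (fun x : M => act a r x + nsc k a r *: x).
Proof. by move=> c u w; rewrite linearP; lincomb. Qed.
Definition nsh (M : superspace R) (act : gl11 -> int -> {linear M -> M}) k a r :
  {linear M -> M} := mklin (nsh_lin act k a r).

(** A shift of N_0 by a scalar preserves the relations because no bracket has an N-component. *)
Lemma nsh_level1 (M : superspace R) (act : gl11 -> int -> {linear M -> M}) k :
  level1 act -> level1 (nsh act k).
Proof.
move=> [lp lb]; split=> [a r w|a b r s w].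
  change (par M (act a r w + nsc k a r *: w) =
    (-1) ^+ glpar a *: (act a r (par M w) + nsc k a r *: par M w)).
  by rewrite lfD lfZ lp; case: a => /=; lincomb.
have E a' r' x : nsh act k a' r' x = act a' r' x + nsc k a' r' *: x by [].
have h : nsc k (glbr R a b).2 (r + s) = 0 by case: a; case: b.
rewrite (E _ _ w) (E _ _ w) (E _ _ w) h scale0r addr0 -lb !E.
rewrite (lfD (act a r)) (lfD (act b s)) (lfZ (act a r)) (lfZ (act b s)).
by case: a {h}; case: b => /=; lincomb.
Qed.

Lemma pish_proof p (S : superspace R) :
  involutive (mklin (fun c u w => linearP ((-1) ^+ p \*: par S : {linear S -> S}) c u w)).
Proof.
move=> x; change ((-1) ^+ p *: par S ((-1) ^+ p *: par S x) = x).
by rewrite lfZ parKE scalerA -expr2 sqrr_sign scale1r.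
Qed.
(** The top vector of an induced module may have either parity while [top_map] and [affine_map] are
    even; a global sign on [par] reconciles the two. *)
Definition pish p S : superspace R := Superspace (@pish_proof p S).
Lemma pish_par p (S : superspace R) (x : S) : par (pish p S) x = (-1) ^+ p *: par S x.
Proof. by []. Qed.
Lemma pish_level1 p (S : superspace R) (act : gl11 -> int -> {linear S -> S}) :
  level1 act -> level1 (act : gl11 -> int -> {linear pish p S -> pish p S}).
Proof.
move=> [lp lb]; split=> // a r w.
by rewrite !pish_par lp (lfZ (act a r)) !scalerA mulrC.
Qed.

(* The induced module receives the shift of V along N_0 -> N_0 + n. *)
Lemma Ahat0_neq0 n (W : vmod V) (U : glmod R) (u : U) (j : {linear U -> W}) :
  vac (Vv V) != 0 -> is_A n u -> is_induced (curw W) j -> exists w : W, w != 0.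
Proof.
move=> vn0 hA [_ _ ind]; have [un0 [p hpu hU] hN [hE hp hm]] := hA.
have cP w : exists c, w = c *: u by apply: hU.
pose c w := xget 0 [set c | w = c *: u]%classic.
have cE w : w = c w *: u.
  have [d hd] := cP w; apply: (@xgetPex _ 0 [set c | w = c *: u]%classic); by exists d.
have cU d w : w = d *: u -> c w = d.
  move=> h; apply/eqP; rewrite -subr_eq0; apply/eqP.
  have : (c w - d) *: u = 0 by rewrite scalerBl -cE -h subrr.
  by move/eqP; rewrite scaler_eq0 (negPf un0) orbF => /eqP.
have cl : linear (fun w => c w *: vac (Vv V)).
  move=> a x y; rewrite scalerA -scalerDl; congr (_ *: _); apply: cU.
  by rewrite scalerDl -scalerA -!cE.
pose f := mklin cl.
have fE w : f w = c w *: vac (Vv V) by [].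
pose M' := pish p V.
pose act' : gl11 -> int -> {linear M' -> M'} := nsh (fun a r => Y (Vv V) (cur V a) r) n.
have lev' : level1 act' by apply/pish_level1/nsh_level1/level1_V.
have a0 a r : 0 <= r -> act' a r (vac (Vv V)) = nsc n a r *: vac (Vv V).
  move=> r0; change (Y (Vv V) (cur V a) r (vac (Vv V)) + nsc n a r *: vac (Vv V) = nsc n a r *: vac (Vv V)).
  by rewrite Y_creation0 // add0r.
have topf : top_map (M := M') act' f.
  split=> [w|a w|a r w r0].
  - rewrite pish_par !fE lfZ (vac_even (Vv V)) expr0 scale1r scalerA mulrC -scalerA.
    rewrite scalerA; congr (_ *: _); apply/esym/cU.
    by rewrite {1}(cE w) lfZ hpu scalerA mulrC.
  - rewrite !fE lfZ a0 // scalerA; congr (_ *: _); apply: cU.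
    rewrite {1}(cE w) (lfZ (gact U a)).
    by case: a; rewrite /= ?hN ?hE ?hp ?hm ?mulr0 ?scaler0 ?scale0r // scalerA.
  - rewrite fE lfZ a0 ?ltW // /nsc; case: a; rewrite ?scale0r ?scaler0 //.
    by rewrite gt_eqF // scale0r scaler0.
have [F [_ hF _]] := ind _ _ lev' f topf.
exists (j u); apply: contraNneq vn0 => ju0.
by rewrite -[vac _]scale1r -(cU 1 u) ?scale1r // -fE -hF ju0 lf0.
Qed.

End Induced.

(** * Interpolation in the eigenvalue of E_0 *)

Section Interp.
Variables (R : realType) (V : V1gl11 R).
Local Notation K := R[i].

Lemma L0_sing (W : vmod V) w :
  (forall a (r : int), 0 < r -> curw W a r w = 0) ->
  Lop W 0 w = 2%:R^-1 *: (curw W glN 0 (curw W glE 0 w) + curw W glE 0 (curw W glN 0 w)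
   - curw W psip 0 (curw W psim 0 w) + curw W psim 0 (curw W psip 0 w)
   + curw W glE 0 (curw W glE 0 w)).
Proof.
move=> h.
have q a b : Yw W (Y (Vv V) (cur V a) (-1) (cur V b)) 1 w =
   (-1) ^+ (glpar a && glpar b) *: curw W b 0 (curw W a 0 w).
  rewrite (@quad_iter _ _ W a b 1 w 1) => [|j hj|j hj]; last 2 first.
  - by apply: h; lia.
  - by apply: h; lia.
  by rewrite big_ord_recl big_ord0 /= addr0 addz0 h // lf0 add0r.
rewrite /Lop om_mode !q; cbn [glpar andb]; rewrite !(expr0, expr1).
by lincomb.
Qed.

Lemma cur_comm0 (W : vmod V) a b w :
  curw W a 0 (curw W b 0 w) = (-1) ^+ (glpar a && glpar b) *: curw W b 0 (curw W a 0 w)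
   + (glbr R a b).1 *: curw W (glbr R a b).2 0 w.
Proof.
have [_ lb] := curw_level1 W; have := lb a b 0 0 w.
rewrite addr0 eqxx mul0r scale0r addr0 => <-; lincomb.
Qed.

Variables (M : nat -> vmod V) (U : nat -> glmod R) (v : forall m, U m).
Variables (j : forall m, {linear U m -> M m}) (n0 : K).
Hypotheses (hv : forall m, is_Verma n0 m.+1%:R (v m)) (ind : forall m, is_induced (curw (M m)) (@j m)).
Hypothesis (Mn0 : forall m, exists w : M m, w != 0).

Let x0 m : M m := j m (v m).
Let y0 m : M m := curw (M m) psim 0 (x0 m).
Let em m : K := m.+1%:R.
Let top m := let: And3 _ t _ := ind m in t.

Lemma tE m u : j m (gact (U m) u (v m)) = curw (M m) u 0 (x0 m).
Proof. by have [_ t _] := top m; rewrite t. Qed.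

Lemma tN0 m : curw (M m) glN 0 (x0 m) = (n0 + 2%:R^-1) *: x0 m.
Proof. by rewrite -tE; have [_ -> _ _ _] := hv m; rewrite lfZ. Qed.
Lemma tE0 m : curw (M m) glE 0 (x0 m) = em m *: x0 m.
Proof. by rewrite -tE; have [_ _ -> _ _] := hv m; rewrite lfZ. Qed.
Lemma tp0 m : curw (M m) psip 0 (x0 m) = 0.
Proof. by rewrite -tE; have [_ _ _ -> _] := hv m; rewrite lf0. Qed.
Lemma tpos m a (r : int) : 0 < r -> curw (M m) a r (x0 m) = 0.
Proof. by have [_ _ t] := top m; apply: t. Qed.
Lemma ty0 m : y0 m = j m (gact (U m) psim (v m)).
Proof. by rewrite tE. Qed.
Lemma ypos m a (r : int) : 0 < r -> curw (M m) a r (y0 m) = 0.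
Proof. by rewrite ty0; have [_ _ t] := top m; apply: t. Qed.
Lemma yN0 m : curw (M m) glN 0 (y0 m) = (n0 - 2%:R^-1) *: y0 m.
Proof. by rewrite /y0 cur_comm0 /= tN0 (lfZ (curw _ _ _)); lincomb; field. Qed.
Lemma yE0 m : curw (M m) glE 0 (y0 m) = em m *: y0 m.
Proof. by rewrite /y0 cur_comm0 /= tE0 (lfZ (curw _ _ _)); lincomb. Qed.
Lemma yp0 m : curw (M m) psip 0 (y0 m) = em m *: x0 m.
Proof. by rewrite /y0 cur_comm0 /= tp0 (lf0 (curw _ _ _)) tE0; lincomb. Qed.
Lemma ym0 m : curw (M m) psim 0 (y0 m) = 0.
Proof.
have := cur_comm0 psim psim (x0 m); rewrite /= -/(y0 m) scale0r addr0 expr1 scaleN1r => /eqP.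
by rewrite -addr_eq0 -mulr2n -scaler_nat scaler_eq0 (negPf (two_neq0 R)) => /eqP.
Qed.

Lemma em0 m : em m != 0. Proof. by rewrite pnatr_eq0. Qed.

Lemma x0n0 m : x0 m != 0.
Proof.
apply/eqP => h; have [w /eqP] := Mn0 m; apply.
have D0 : lsub0 (ker_lsub (idfun : {linear M m -> M m})) = lsub0 (ker_lsub idfun) by [].
apply: (induced_Hgen (ind m) (D := ker_lsub (idfun : {linear M m -> M m}))) => /=.
- by move=> u ->; rewrite lf0.
- by move=> a r u ->; rewrite lf0.
move=> u; have [_ _ _ _ hb] := hv m; have [c [-> _]] := hb u.
by rewrite lfD !lfZ -ty0 /y0 -/(x0 m) h (lf0 (curw _ _ _)) !scaler0 addr0.
Qed.

Definition Mp m : lsub (M m) :=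
  sum_sub (P := fun x => exists a (s : nat) y, (0 < s)%N /\ x = curw (M m) a (- s%:Z) y)
   (fun c w => fun '(ex_intro a (ex_intro s (ex_intro y (conj h1 h2)))) =>
     ex_intro _ a (ex_intro _ s (ex_intro _ (c *: y) (conj h1 (etrans (congr1 _ h2) (esym (lfZ _ c y))))))).

Definition topw m : K := 2%:R^-1 * ((n0 + 2%:R^-1) * em m + em m * (n0 - 2%:R^-1) + em m * em m).

Lemma x0L m : Lop (M m) 0 (x0 m) = topw m *: x0 m.
Proof.
rewrite L0_sing; last exact: tpos.
rewrite tp0 tE0 tN0 (lfZ (curw _ glN _)) !(lfZ (curw _ glE _)) -/(y0 m) yp0 tE0 tN0 (lf0 (curw _ _ _)) /topw.
by lincomb; field.
Qed.
Lemma y0L m : Lop (M m) 0 (y0 m) = topw m *: y0 m.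
Proof. by rewrite /y0 L0_curw x0L (lfZ (curw _ _ _)); lincomb. Qed.

Lemma Mwt m (x : M m) : sum_of (fun u => exists d : nat, Lop (M m) 0 u = (topw m + d%:R) *: u) x.
Proof.
have hc c (w : M m) : (exists d : nat, Lop (M m) 0 w = (topw m + d%:R) *: w) ->
    exists d : nat, Lop (M m) 0 (c *: w) = (topw m + d%:R) *: (c *: w).
  by move=> [d hd]; exists d; rewrite lfZ hd; lincomb.
have := cl_all (curw_level1 (M m)) (top m) (induced_Hgen (ind m)) x.
apply: (cl_ind' (D := sum_sub hc)) => [u|a s y _ s0 _ hy].
  have [_ _ _ _ hb] := hv m; have [c [-> _]] := hb u.
  rewrite lfD !lfZ -ty0; apply: lsubD; apply: lsubZ; apply: sum_of1; exists 0%N.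
    by rewrite addr0 x0L.
  by rewrite addr0 y0L.
apply: (sum_of_map (P := fun u => exists d : nat, Lop (M m) 0 u = (topw m + d%:R) *: u)) hy.
move=> u [d hd]; exists (d + s)%N; rewrite L0_curw hd (lfZ (curw _ _ _)).
rewrite natrD rmorphN; lincomb.
Qed.

Lemma Mp_oth m (x : M m) : Mp m x -> othE (Lop (M m) 0) (topw m) x.
Proof.
have hP c (w : M m) : (exists c', c' != topw m /\ genE (Lop (M m) 0) c' w) ->
    exists c', c' != topw m /\ genE (Lop (M m) 0) c' (c *: w).
  move=> [c' [h1 h2]]; exists c'; split=> //.
  by have := genEL c h2 (genE0 _ c'); rewrite addr0.
apply: (sum_of_lsub (D := sum_sub hP)) => _ [a [s [y [s0 ->]]]].
apply: sum_of_map (Mwt y) => u [d hd]; exists (topw m + (d + s)%:R); split.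
  by rewrite -subr_eq0 addrC addKr pnatr_eq0; lia.
apply: eigE_gen; rewrite /eigE L0_curw hd (lfZ (curw _ _ _)) natrD rmorphN; lincomb.
Qed.

(** Images of creation operators have L_0-weights strictly above the top, and a relation between
    [x0] and [y0] themselves is excluded by psi^+_0 y0 = e x0 with e = m + 1. *)
Lemma top_indep m p q : Mp m (p *: x0 m + q *: y0 m) -> p = 0 /\ q = 0.
Proof.
move=> h; have e0 : p *: x0 m + q *: y0 m = 0.
  apply: (@genE_othE0 _ _ (Lop (M m) 0) (topw m) _ (- (p *: x0 m + q *: y0 m))).
  - by apply: eigE_gen; rewrite /eigE lfD !lfZ x0L y0L; lincomb.
  - by apply: Mp_oth; apply: lsubN.
  by rewrite subrr.
have q0 : q = 0.
  have : curw (M m) psip 0 (p *: x0 m + q *: y0 m) = 0 by rewrite e0 lf0.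
  rewrite lfD !lfZ tp0 yp0 scaler0 add0r => /eqP.
  by rewrite !scaler_eq0 (negPf (em0 m)) (negPf (x0n0 m)) !orbF => /eqP.
split=> //; move/eqP: e0; rewrite q0 scale0r addr0 scaler_eq0 (negPf (x0n0 m)) orbF.
by move/eqP.
Qed.
Definition fam := forall m, M m.
Implicit Types x y z : fam.
(** Families produced by the same words for all m at once, with coefficients polynomial in the
    eigenvalue m + 1 of E_0. *)
Inductive nw : fam -> Prop :=
| nw_top (p q : {poly K}) x : (forall m, x m = p.[em m] *: x0 m + q.[em m] *: y0 m) -> nw x
| nw_act a (s : nat) x y : (0 < s)%N -> nw x -> (forall m, y m = curw (M m) a (- s%:Z) (x m)) -> nw y
| nw_lin c x y z : nw x -> nw y -> (forall m, z m = c *: x m + y m) -> nw z.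

Lemma nw0 : nw (fun m => 0).
Proof. by apply: (@nw_top 0 0) => m; rewrite !horner0 !scale0r addr0. Qed.

Lemma nwL c x y : nw x -> nw y -> nw (fun m => c *: x m + y m).
Proof. by move=> hx hy; apply: (nw_lin hx hy). Qed.

Lemma nwZ c x : nw x -> nw (fun m => c *: x m).
Proof. by move=> hx; apply: (@nw_lin c _ _ _ hx nw0) => m; rewrite addr0. Qed.

Lemma act_cm m (x : M m) a b (r s : int) :
  curw (M m) a r (curw (M m) b s x) = (-1) ^+ (glpar a && glpar b) *: curw (M m) b s (curw (M m) a r x) +
     ((glbr R a b).1 *: curw (M m) (glbr R a b).2 (r + s) x
     + (if r + s == 0 then r%:~R * glform R a b else 0) *: x).
Proof. by rewrite (act_comm (curw_level1 (M m))) addrA. Qed.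

Lemma nwA x : nw x -> forall a (r : int), nw (fun m => curw (M m) a r (x m)).
Proof.
elim=> {x} [p q x hx a r|b s x y s0 hx IH hy a r|c x y z hx IHx hy IHy hz a r].
- have [r0|r0|->] := ltgtP r 0.
  + have -> : r = - `|r|%N%:Z by lia.
    by apply: (nw_act (s := `|r|%N) _ (nw_top hx) (fun m => erefl)); lia.
  + apply: (@nw_top 0 0) => m; rewrite hx lfD !lfZ tpos // ypos //.
    by rewrite !horner0 !scale0r !scaler0.
  case: a.
  + apply: (@nw_top ((n0 + 2%:R^-1) *: p) ((n0 - 2%:R^-1) *: q)) => m.
    by rewrite hx lfD !lfZ tN0 yN0 !hornerZ; lincomb.
  + apply: (@nw_top (p * 'X) (q * 'X)) => m.
    by rewrite hx lfD !lfZ tE0 yE0 !hornerM !hornerX; lincomb.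
  + apply: (@nw_top (q * 'X) 0) => m.
    by rewrite hx lfD !lfZ tp0 yp0 !hornerM !hornerX horner0; lincomb.
  + apply: (@nw_top 0 p) => m.
    by rewrite hx lfD !lfZ -/(y0 m) ym0 horner0; lincomb.
- apply: (nw_lin (c := (-1) ^+ (glpar a && glpar b))
    (nw_act (a := b) s0 (IH a r) (fun m => erefl))
    (nwL (glbr R a b).1 (IH (glbr R a b).2 (r - s%:Z))
      (nwZ (if r - s%:Z == 0 then r%:~R * glform R a b else 0) hx))) => m.
  by rewrite hy act_cm.
- apply: (nw_lin (c := c) (IHx a r) (IHy a r)) => m.
  by rewrite hz linearP.
Qed.

(** Modulo images of creation operators, p is the coefficient of the family along the top vector. *)
Definition rel x (p : {poly K}) :=
  exists q : {poly K}, forall m, Mp m (x m - (p.[em m] *: x0 m + q.[em m] *: y0 m)).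

Lemma relL c x y p q : rel x p -> rel y q -> rel (fun m => c *: x m + y m) (c *: p + q).
Proof.
move=> [p' hp] [q' hq]; exists (c *: p' + q') => m.
have := lsubL c (hp m) (hq m); rewrite !hornerD !hornerZ.
by congr (Mp m _); lincomb.
Qed.

Lemma rel_ex x : nw x -> exists p, rel x p.
Proof.
elim=> {x} [p q x hx|b s x y s0 hx IH hy|c x y z hx [p hp] hy [q hq] hz].
- by exists p, q => m; rewrite hx subrr; apply: lsub0.
- exists 0, 0 => m; rewrite !horner0 !scale0r addr0 subr0 hy.
  by apply: sum_of1; exists b, s, (x m).
- exists (c *: p + q); have [q' hq'] := relL c hp hq; exists q' => m.
  by rewrite hz; apply: hq'.
Qed.

Lemma poly_nat0 (p : {poly K}) : (forall m, p.[em m] = 0) -> p = 0.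
Proof.
move=> h; apply/eqP; apply: contraT => pn0.
have := max_poly_roots (rs := [seq em m | m <- iota 0 (size p)]) pn0.
rewrite size_map size_iota ltnn; apply.
  by apply/allP => _ /mapP [m _ ->]; apply/rootP.
rewrite map_inj_uniq ?iota_uniq // => a b /eqP.
by rewrite eqr_nat => /eqP [].
Qed.

Lemma rel_uniq x p q : rel x p -> rel x q -> p = q.
Proof.
move=> [p' hp] [q' hq]; apply/eqP; rewrite -subr_eq0; apply/eqP/poly_nat0 => m.
apply: (proj1 (@top_indep m _ (p'.[em m] - q'.[em m]) _)).
have := lsubB (hq m) (hp m); rewrite hornerD hornerN.
by congr (Mp m _); lincomb.
Qed.

Variable e : K.
(** The coefficient along the top vector, continued from the eigenvalues 1, 2, ... to the given [e];
    by [rel_uniq] the polynomial is unique. *)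
Definition lam x : K := (xget 0 [set p | rel x p]%classic).[e].
Lemma lamE x p : rel x p -> lam x = p.[e].
Proof.
move=> h; rewrite /lam; congr (_.[e]).
have hx : rel x (xget 0 [set p | rel x p]%classic).
  by apply: (@xgetPex _ 0 [set p | rel x p]%classic); exists p.
exact: rel_uniq hx h.
Qed.
Lemma lamL c x y : nw x -> nw y -> lam (fun m => c *: x m + y m) = c * lam x + lam y.
Proof.
move=> /rel_ex [p hp] /rel_ex [q hq].
by rewrite (lamE hp) (lamE hq) (lamE (relL c hp hq)) hornerD hornerZ.
Qed.
Lemma lam_ext x y : (forall m, x m = y m) -> nw x -> lam x = lam y.
Proof.
move=> h /rel_ex [p hp]; rewrite (lamE hp); apply/esym/lamE.
by have [q hq] := hp; exists q => m; rewrite -h.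
Qed.
Lemma lamZ c x : nw x -> lam (fun m => c *: x m) = c * lam x.
Proof.
move=> /rel_ex [p hp']; have [q hp] := hp'; rewrite (lamE hp') -hornerZ; apply: lamE.
exists (c *: q) => m; have := lsubZ c (hp m); rewrite !hornerZ.
by congr (Mp m _); lincomb.
Qed.
Lemma lam_E x : nw x -> lam (fun m => em m *: x m) = e * lam x.
Proof.
move=> /rel_ex [p hp']; rewrite (lamE hp'); have [q hp] := hp'.
rewrite (lamE (p := 'X * p)) ?hornerM ?hornerX //; exists ('X * q) => m.
have := lsubZ (em m) (hp m); rewrite !hornerM !hornerX.
by congr (Mp m _); lincomb.
Qed.
Lemma lam_x0 : lam x0 = 1.
Proof.
rewrite (lamE (p := 1)) ?hornerC //; exists 0 => m.
by rewrite hornerC horner0 scale1r scale0r addr0 subrr; apply: lsub0.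
Qed.
Definition aact a (r : int) x : fam := fun m => curw (M m) a r (x m).
Definition run (w : seq (gl11 * int)) x := foldr (fun ar y => aact ar.1 ar.2 y) x w.
Lemma run_nw w x : nw x -> nw (run w x).
Proof. by move=> hx; elim: w => //= ar w IH; apply: nwA. Qed.
Lemma run_lin w c x y m : run w (fun m => c *: x m + y m) m = c *: run w x m + run w y m.
Proof. by elim: w m => //= ar w IH m; rewrite /aact IH linearP. Qed.
Lemma run_E w x m : run w (fun m => em m *: x m) m = em m *: run w x m.
Proof. by elim: w m => //= ar w IH m; rewrite /aact IH lfZ. Qed.

(* Matrix coefficients: Phi x w is the component of w x along the top vector,
   a polynomial in the eigenvalue of E_0, evaluated at e.  *)
Definition WF : lmodType K := (seq (gl11 * int) -> K^o).
Definition Phi x : WF := fun w => lam (run w x).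
Lemma famext x y : (forall m, x m = y m) -> x = y.
Proof. exact: functional_extensionality_dep. Qed.
Lemma Phi_lin c x y : nw x -> nw y -> Phi (fun m => c *: x m + y m) = c *: Phi x + Phi y.
Proof.
move=> hx hy; apply/funext => w.
transitivity (c * lam (run w x) + lam (run w y)) => //.
rewrite -lamL; [|exact: run_nw|exact: run_nw]; apply/esym/lam_ext; last by apply: nwL; apply: run_nw.
by move=> m; rewrite run_lin.
Qed.
Lemma Phi_E x : nw x -> Phi (fun m => em m *: x m) = e *: Phi x.
Proof.
move=> hx; apply/funext => w; transitivity (e * lam (run w x)) => //.
rewrite -lam_E; last exact: run_nw.
by congr (lam _); apply/famext => m; rewrite run_E.
Qed.

Definition wpar (w : seq (gl11 * int)) := foldr (fun ar b => glpar ar.1 (+) b) false w.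
Lemma wsgn_lin : linear (fun F : WF => (fun w => (-1) ^+ wpar w * F w) : WF).
Proof. by move=> c F G; apply/funext => w; rewrite /= mulrDr mulrCA. Qed.
Lemma wsgn_inv : involutive (mklin wsgn_lin).
Proof.
move=> F; apply/funext => w; change ((-1) ^+ wpar w * ((-1) ^+ wpar w * F w) = F w).
by rewrite mulrA -expr2 sqrr_sign mul1r.
Qed.
Definition WS : superspace R := Superspace wsgn_inv.
Lemma WS_par (F : WS) w : par WS F w = (-1) ^+ wpar w * F w. Proof. by []. Qed.
Lemma ract_lin a (r : int) : linear (fun F : WF => (fun w => F (rcons w (a, r))) : WF).
Proof. by []. Qed.
(** The last letter of a word acts first in [run], so acting on x before evaluating a word appends a
    letter at its end. *)
Definition ract a r : {linear WS -> WS} := mklin (ract_lin a r).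
Lemma ractE a r x : ract a r (Phi x) = Phi (aact a r x).
Proof.
apply/funext => w; change (lam (run (rcons w (a, r)) x) = lam (run w (aact a r x))).
by rewrite /run -cats1 foldr_cat.
Qed.

(** The affine relations are established on the functions that come from families, to which the
    space is therefore restricted. *)
Definition inD (F : WS) := exists x, nw x /\ F = Phi x.
Lemma inD0 : inD 0.
Proof.
exists (fun m => 0); split; first exact: nw0.
have := Phi_lin (-1) nw0 nw0; rewrite scaleN1r addNr => <-.
by congr (Phi _); apply/famext => m; rewrite scaler0 addr0.
Qed.
Lemma inDL c F G : inD F -> inD G -> inD (c *: F + G).
Proof.
move=> [x [hx ->]] [y [hy ->]]; exists (fun m => c *: x m + y m); split; first exact: nwL.
by rewrite Phi_lin.
Qed.
Let D : lsub WS := Lsub inD0 inDL.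
Lemma D_act a r F : D F -> D (ract a r F).
Proof. by move=> [x [hx ->]]; exists (aact a r x); rewrite ractE; split=> //; apply: nwA. Qed.

Lemma vpar m : exists p : bool, par (M m) (x0 m) = (-1) ^+ p *: x0 m.
Proof.
have [[p hp] _ _ _ _] := hv m; exists p; have [t _ _] := top m.
by rewrite t hp lfZ.
Qed.
Definition pm m := xget false [set p : bool | par (M m) (x0 m) = (-1) ^+ p *: x0 m]%classic.
Lemma pmE m : par (M m) (x0 m) = (-1) ^+ pm m *: x0 m.
Proof.
have [p hp] := vpar m.
by apply: (@xgetPex _ false [set p : bool | par (M m) (x0 m) = (-1) ^+ p *: x0 m]%classic); exists p.
Qed.
(** The top vectors of the [M m] may have different parities; the sign makes all of them even, so
    that parity acts on families. *)
Definition fpar x : fam := fun m => (-1) ^+ pm m *: par (M m) (x m).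
Lemma fpar_act a r x m : fpar (aact a r x) m = (-1) ^+ glpar a *: aact a r (fpar x) m.
Proof.
rewrite /fpar /aact (proj1 (curw_level1 (M m))) (lfZ (curw _ _ _)) !scalerA mulrC //.
Qed.
Lemma fpar_x0 m : fpar x0 m = x0 m.
Proof. by rewrite /fpar pmE scalerA -expr2 sqrr_sign scale1r. Qed.
Lemma fpar_y0 m : fpar y0 m = - y0 m.
Proof. by rewrite (fpar_act psim 0 x0) /aact fpar_x0 scaleN1r. Qed.
Lemma fpar_comb m p q :
  (-1) ^+ pm m *: par (M m) (p *: x0 m + q *: y0 m) = p *: x0 m + (- q) *: y0 m.
Proof.
have hy : par (M m) (y0 m) = - (-1) ^+ pm m *: y0 m.
  have E : (-1) ^+ pm m *: par (M m) (y0 m) = - y0 m := fpar_y0 m.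
  have := congr1 (fun w : M m => (-1) ^+ pm m *: w) E.
  by rewrite /= scalerA -expr2 sqrr_sign scale1r scalerN scaleNr.
by rewrite lfD !lfZ pmE hy; case: (pm m); rewrite /= ?expr0 ?expr1; lincomb.
Qed.
Lemma fpar_nw x : nw x -> nw (fpar x).
Proof.
elim=> {x} [p q x hx|b s x y s0 hx IH hy|c x y z hx hp hy hq hz].
- by apply: (@nw_top p (- q)) => m; rewrite {1}/fpar hx hornerN; apply: fpar_comb.
- apply: (@nw_lin ((-1) ^+ glpar b) _ _ _ (nw_act (a := b) s0 IH (fun m => erefl)) nw0) => m.
  rewrite addr0; have <- : aact b (- s%:Z) x = y by apply/famext => k; rewrite hy.
  exact: fpar_act.
- by apply: (nw_lin (c := c) hp hq) => m; rewrite /fpar hz (lfD (par (M m))) (lfZ (par (M m))) scalerDr !scalerA [_ * c]mulrC.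
Qed.
Lemma Mp_par m (x : M m) : Mp m x -> Mp m (par (M m) x).
Proof.
apply: sum_of_map => _ [a [s [y [s0 ->]]]]; exists a, s, ((-1) ^+ glpar a *: par (M m) y); split=> //.
by rewrite (lfZ (curw _ _ _)) (proj1 (curw_level1 (M m))).
Qed.
Lemma lam_fpar x : nw x -> lam (fpar x) = lam x.
Proof.
move=> /rel_ex [p hp']; rewrite (lamE hp'); apply: lamE; have [q hp] := hp'; exists (- q) => m.
have := lsubZ ((-1) ^+ pm m) (Mp_par (hp m)); congr (Mp m _).
by rewrite hornerN -fpar_comb lfB scalerBr.
Qed.
Lemma run_fpar w x m : run w (fpar x) m = (-1) ^+ wpar w *: fpar (run w x) m.
Proof.
elim: w m => /= [|ar w IH] m; first by rewrite scale1r.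
rewrite {1}/aact IH (fpar_act ar.1 ar.2) (lfZ (curw _ _ _)) /aact scalerA signr_addb mulrC.
by rewrite mulrC -mulrA [_ * (-1) ^+ glpar _]mulrC mulrA -expr2 sqrr_sign mul1r.
Qed.
Lemma Phi_par x : nw x -> par WS (Phi x) = Phi (fpar x).
Proof.
move=> hx; apply/funext => w; rewrite WS_par /Phi -(lam_fpar (run_nw w hx)).
rewrite -lamZ; last by apply/fpar_nw/run_nw.
by congr (lam _); apply/famext => m; rewrite run_fpar.
Qed.
Lemma D_par F : D F -> D (par WS F).
Proof. by move=> [x [hx ->]]; exists (fpar x); rewrite Phi_par //; split=> //; apply: fpar_nw. Qed.

Definition Fs : superspace R := sub_super D_par.
Definition fa a r : {linear Fs -> Fs} := sub_end D_par (@D_act a r).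
Let fsi : {linear Fs -> WS} := sincl D_par.
Lemma fsi_inj : injective fsi. Proof. exact: sincl_inj. Qed.
Lemma fsi_in w : D (fsi w). Proof. exact: sincl_in. Qed.
Lemma fsi_par w : fsi (par Fs w) = par WS (fsi w). Proof. exact: sincl_par. Qed.
Lemma fsi_act a r w : fsi (fa a r w) = ract a r (fsi w). Proof. exact: sub_endE. Qed.
Lemma Phi_Z c x : nw x -> Phi (fun m => c *: x m) = c *: Phi x.
Proof.
move=> hx; have := Phi_lin c hx nw0; have [x0' [_ h0]] := inD0.
have <- : 0 = Phi (fun m => 0).
  have := Phi_lin (-1) nw0 nw0; rewrite scaleN1r addNr => <-.
  by congr (Phi _); apply/famext => m; rewrite scaler0 addr0.
rewrite addr0 => <-; congr (Phi _); apply/famext => m; rewrite addr0 //.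
Qed.
Lemma fa_level1 : level1 fa.
Proof.
split=> [a r w|a b r s w]; apply: fsi_inj; have [x [hx hw]] := fsi_in w.
- rewrite (lfZ fsi) fsi_par !fsi_act fsi_par hw Phi_par // !ractE Phi_par; last exact: nwA.
  rewrite -Phi_Z; last by apply: nwA; apply: fpar_nw.
  by congr (Phi _); apply/famext => m; rewrite fpar_act.
- rewrite (lfB fsi) (lfD fsi) !(lfZ fsi) !fsi_act hw !ractE.
  have na := nwA hx; have nab := nwA (na b s) a r; have nba := nwA (na a r) b s.
  apply/eqP; rewrite subr_eq addrC; apply/eqP.
  rewrite -(Phi_Z _ hx) -Phi_lin; [|exact: na|exact: nwZ].
  rewrite -Phi_lin; [|exact: nba|by apply: nwL; [apply: na|apply: nwZ]].
  by congr (Phi _); apply/famext => m; rewrite /aact act_cm.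
Qed.

Lemma nw_x0 : nw x0.
Proof. by apply: (@nw_top 1 0) => m; rewrite hornerC horner0; lincomb. Qed.
Lemma nw_y0 : nw y0.
Proof. exact: (nwA nw_x0 psim 0). Qed.
Lemma Phi_x0 : Phi x0 != 0.
Proof.
apply/eqP => h; have : Phi x0 [::] = 0 by rewrite h.
rewrite /Phi /= lam_x0 => /eqP; apply/negP; exact: oner_neq0.
Qed.
Lemma Phi_0 : Phi (fun m => 0) = 0.
Proof. by rewrite -[RHS](scale0r (Phi x0)) -Phi_Z; [congr (Phi _); apply/famext => m; rewrite scale0r|exact: nw_x0]. Qed.

(** Evaluated at [e], the matrix coefficients form a level 1 module with a nonzero top vector on
    which E_0 = e. After a shift of N_0 and of parity, [W] maps to it by the universal property, and
    its top vector has nonzero image. *)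
Lemma interp (n : K) (W : vmod V) : is_Vhat n e W -> exists w : W, w != 0.
Proof.
move=> [Ue [u [je [hu [_ _ ie]]]]]; have [[p hp] uN uE up ub] := hu.
have [X hX] : exists X, fsi X = Phi x0.
  by have := @sub_elim _ _ _ D_par (Phi x0); apply; exists x0; split=> //; exact: nw_x0.
pose Y := fa psim 0 X.
have hY : fsi Y = Phi y0 by rewrite fsi_act hX ractE.
have XN : fa glN 0 X = (n0 + 2%:R^-1) *: X.
  apply: fsi_inj; rewrite (lfZ fsi) fsi_act hX ractE -Phi_Z; last exact: nw_x0.
  by congr (Phi _); apply/famext => m; rewrite /aact tN0.
have XE : fa glE 0 X = e *: X.
  apply: fsi_inj; rewrite (lfZ fsi) fsi_act hX ractE -Phi_E; last exact: nw_x0.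
  by congr (Phi _); apply/famext => m; rewrite /aact tE0.
have Xp : fa psip 0 X = 0.
  apply: fsi_inj; rewrite (lf0 fsi) fsi_act hX ractE -Phi_0.
  by congr (Phi _); apply/famext => m; rewrite /aact tp0.
have YN : fa glN 0 Y = (n0 - 2%:R^-1) *: Y.
  apply: fsi_inj; rewrite (lfZ fsi) fsi_act hY ractE -Phi_Z; last exact: nw_y0.
  by congr (Phi _); apply/famext => m; rewrite /aact yN0.
have YE : fa glE 0 Y = e *: Y.
  apply: fsi_inj; rewrite (lfZ fsi) fsi_act hY ractE -Phi_E; last exact: nw_y0.
  by congr (Phi _); apply/famext => m; rewrite /aact yE0.
have Yp : fa psip 0 Y = e *: X.
  apply: fsi_inj; rewrite (lfZ fsi) fsi_act hY hX ractE -Phi_E; last exact: nw_x0.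
  by congr (Phi _); apply/famext => m; rewrite /aact yp0.
have Ym : fa psim 0 Y = 0.
  apply: fsi_inj; rewrite (lf0 fsi) fsi_act hY ractE -Phi_0.
  by congr (Phi _); apply/famext => m; rewrite /aact ym0.
have XY0 a (r : int) : 0 < r -> fa a r X = 0 /\ fa a r Y = 0.
  move=> r0; split; apply: fsi_inj; rewrite (lf0 fsi) fsi_act ?hX ?hY ractE -Phi_0;
    by congr (Phi _); apply/famext => m; rewrite /aact ?tpos ?ypos.
have Xpar : par Fs X = X.
  apply: fsi_inj; rewrite fsi_par hX Phi_par; last exact: nw_x0.
  by congr (Phi _); apply/famext => m; rewrite fpar_x0.
have Ypar : par Fs Y = - Y.
  by rewrite /Y (proj1 fa_level1) Xpar /= expr1 scaleN1r.
pose um := gact Ue psim u.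
pose c w := xget 0 [set c : K * K | w = c.1 *: u + c.2 *: um]%classic.
have cE w : w = (c w).1 *: u + (c w).2 *: um.
  have [d [hd _]] := ub w.
  by apply: (@xgetPex _ 0 [set c : K * K | w = c.1 *: u + c.2 *: um]%classic); exists d.
have cU a b : c (a *: u + b *: um) = (a, b).
  have [d [hd ud]] := ub (a *: u + b *: um).
  by rewrite -(ud _ (cE _)); apply: ud.
have fl : linear (fun w => (c w).1 *: X + (c w).2 *: Y).
  move=> a x y; have h : a *: x + y = (a * (c x).1 + (c y).1) *: u + (a * (c x).2 + (c y).2) *: um.
    by rewrite {1}(cE x) {1}(cE y); lincomb.
  by rewrite h cU /=; lincomb.
pose M' := pish p Fs.
pose act' : gl11 -> int -> {linear M' -> M'} := nsh fa (n - n0).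
pose f : {linear Ue -> M'} := mklin fl.
have fE a b : f (a *: u + b *: um) = a *: X + b *: Y.
  by change ((c (a *: u + b *: um)).1 *: X + (c (a *: u + b *: um)).2 *: Y = a *: X + b *: Y); rewrite cU.
have lev' : level1 act' by apply/pish_level1/nsh_level1/fa_level1.
have aE a r (x : Fs) : act' a r x = fa a r x + nsc (n - n0) a r *: x by [].
have umpar : par Ue um = - (-1) ^+ p *: um.
  by rewrite /um gact_par hp (lfZ (gact _ _)); lincomb.
have umE := Verma_E hu um.
have ump : gact Ue psip um = e *: u := Verma_pm hu.
have umN : gact Ue glN um = (n - 2%:R^-1) *: um.
  have := gact_br glN psim u; rewrite /= uN (lfZ (gact _ psim)) -/um => /eqP.
  by rewrite subr_eq => /eqP ->; lincomb; field.
have umm : gact Ue psim um = 0.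
  have := gact_br psim psim u; rewrite /= -/um expr1 scale0r => /eqP.
  by rewrite scaleN1r opprK -mulr2n -scaler_nat scaler_eq0 (negPf (two_neq0 R)) => /eqP.
have topf : top_map act' f.
  split=> [w|a w|a r w r0]; rewrite (cE w); set c1 := (c w).1; set c2 := (c w).2.
  - rewrite (lfD (par Ue)) !(lfZ (par Ue)) hp umpar !scalerA !fE pish_par.
    rewrite (lfD (par Fs)) !(lfZ (par Fs)) Xpar Ypar; lincomb.
  - rewrite (lfD (gact Ue a)) !(lfZ (gact Ue a)) fE aE (lfD (fa a 0)) !(lfZ (fa a 0)).
    case: a; rewrite /= ?uN ?umN ?uE ?umE ?up ?ump ?umm ?XN ?XE ?Xp ?YN ?YE ?Yp ?Ym.
    + by rewrite !scalerA fE; lincomb; field.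
    + by rewrite !scalerA fE; lincomb.
    + by rewrite scaler0 add0r scalerA -[_ *: u]addr0 -(scale0r um) fE; lincomb.
    + by rewrite scaler0 addr0 -/um -[_ *: um]add0r -(scale0r u) fE -/Y; lincomb.
  - have [h1 h2] := XY0 a r r0.
    rewrite fE aE (lfD (fa a r)) !(lfZ (fa a r)) h1 h2 /nsc.
    by case: a {h1 h2}; rewrite ?gt_eqF //; lincomb.
have [F [_ hF _]] := ie _ _ lev' f topf.
exists (je u); apply/eqP => h; move/eqP: Phi_x0; apply.
have := hF u; rewrite h lf0 -[u]scale1r -[1 *: u]addr0 -(scale0r um) fE => /esym h1.
have : fsi (1 *: X + 0 *: Y) = fsi 0 by rewrite h1.
by rewrite scale0r addr0 scale1r hX lf0.
Qed.
End Interp.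

(** * The twist by Li's Delta operator *)

Section Shift.
Variable R : realType.
Local Notation K := R[i].
Variable M : lmodType K.

(** The sums on Delta run up to one common bound [B], so that they can be exchanged; extending terms
    by zero to negative indices then allows shifts without changing the range. *)
Lemma shift_sum (f : int -> M) (t B : nat) : (forall j : int, j < 0 -> f j = 0) ->
  (forall j : nat, (B <= j + t)%N -> f j%:Z = 0) ->
  \sum_(P < B) f (P%:Z - t%:Z) = \sum_(P < B) f P%:Z.
Proof.
move=> f0 fB; have [tB|Bt] := leqP B t.
  rewrite !big1 // => i _; first by apply: fB; lia.
  by apply: f0; have := ltn_ord i; lia.
rewrite (sum_trunc (F := fun P => f P%:Z) (n := (B - t)%N)); [|lia|by move=> j hj; apply: fB; lia].
rewrite -(big_mkord xpredT (fun P => f (P%:Z - t%:Z))) (big_cat_nat _ (n := t)) //=; last by lia.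
rewrite big_nat_cond big1 ?add0r; last by move=> i /andP [/andP [_ it] _]; apply: f0; lia.
rewrite -{1}[t]add0n big_addn big_mkord; apply: eq_bigr => i _; congr f; lia.
Qed.

Lemma tri_sum (c d : nat -> K) (g : nat -> M) (B : nat) : (forall j, (B <= j)%N -> g j = 0) ->
  \sum_(j < B) \sum_(s < B) (c j * d s) *: g (j + s)%N =
  \sum_(t < B) (\sum_(j < t.+1) c j * d (t - j)%N) *: g t.
Proof.
move=> g0.
pose F (u : nat) (s : int) := match s with
  | Posz s' => (c u * d s') *: g (u + s')%N | _ => 0 end.
transitivity (\sum_(u < B) \sum_(s < B) F u (s%:Z - u%:Z)).
  apply: eq_bigr => u _; rewrite (shift_sum (f := F u)) //.
  - by case.
  - by move=> j hj; rewrite /F g0 ?scaler0 // addnC.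
rewrite exchange_big; apply: eq_bigr => t _ /=; rewrite scaler_suml.
rewrite (sum_trunc (F := fun u : nat => F u (t%:Z - u%:Z)) (n := t.+1)) //; last first.
  by move=> u hu; rewrite /F; have -> : t%:Z - u%:Z = Negz (u - t).-1 by lia.
apply: eq_bigr => u _; rewrite subzn /F; last by have := ltn_ord u; lia.
by rewrite subnKC //; have := ltn_ord u; lia.
Qed.

Lemma vsum (x y : int) (g : nat -> M) (B : nat) : (forall j, (B <= j)%N -> g j = 0) ->
  \sum_(j < B) \sum_(s < B) (gbin (x%:~R : K) j * gbin y%:~R s) *: g (j + s)%N =
  \sum_(t < B) gbin ((x + y)%:~R : K) t *: g t.
Proof.
move=> g0; rewrite (tri_sum (gbin (x%:~R : K)) (gbin (y%:~R : K)) g0).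
by apply: eq_bigr => t _; rewrite gbin_vandermonde.
Qed.
End Shift.

Section Delta.
Variables (R : realType) (V : V1gl11 R) (kk : R[i]).
Local Notation K := R[i].
Local Notation VV := (Vv V).
Local Notation Ee r := (Y VV (cur V glE) r).

Lemma V_E0 v : Ee 0 v = 0.
Proof.
have z0 : Ee 0 (0 : V) = 0 by rewrite lf0.
have zL c (u w : V) : Ee 0 u = 0 -> Ee 0 w = 0 -> Ee 0 (c *: u + w) = 0.
  by move=> hu hw; rewrite linearP hu hw scaler0 addr0.
apply: (V_gen (D := @Lsub R V (fun v => Ee 0 v = 0) z0 zL)) => /=.
- move=> u hu; have := proj1 (level1_V V) glE 0 u; rewrite hu lf0 /= expr0 scale1r => <- //.
- move=> a r u hu; have := proj2 (level1_V V) glE a 0 r u.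
  rewrite /= hu lf0 scaler0 subr0 => ->; case: a; rewrite /= ?scale0r ?add0r ?mul0r ?if_same ?scale0r //.
- exact: Y_creation0.
Qed.

(** The coefficient of z^(-i) in Delta(z) = exp(kk sum_(r > 0) (-1)^(r+1) E_r z^(-r) / r), by the
    recursion that results from differentiating the exponential. The argument f is fuel; the factor
    z^(kk E_0) is absent as E_0 = 0 on V. *)
Fixpoint Dfu (f i : nat) (v : V) : V :=
  if f is f'.+1 then
    if i is i'.+1 then (kk / i%:R) *: \sum_(r < i) (-1) ^+ r *: Ee r.+1%:Z (Dfu f' (i' - r) v) else v
  else 0.
Lemma Dfu_st f f' i v : (i < f)%N -> (i < f')%N -> Dfu f i v = Dfu f' i v.
Proof.
elim: f f' i => // f IH [|f'] [|i] //= hf hf'; congr (_ *: _); apply: eq_bigr => r _.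
by rewrite (IH f') //; lia.
Qed.
Lemma DfuS i v : Dfu i.+2 i.+1 v =
  (kk / i.+1%:R) *: \sum_(r < i.+1) (-1) ^+ r *: Ee r.+1%:Z (Dfu (i - r).+1 (i - r) v).
Proof.
rewrite [LHS]/=; congr (_ *: _); apply: eq_bigr => r _.
by rewrite -/(Dfu i.+1 (i - r) v) (Dfu_st (f' := (i - r).+1)) //; have := ltn_ord r; lia.
Qed.
Lemma DN_lin i : linear (Dfu i.+1 i).
Proof.
elim/ltn_ind: i => [[|i]] IH c u w //.
rewrite !DfuS (scalerA c) (mulrC c) -(scalerA _ c) -scalerDr; congr (_ *: _).
rewrite scaler_sumr -big_split; apply: eq_bigr => r _.
have -> := IH (i - r)%N (leq_subr r i) c u w.
rewrite (lfD (Y VV _ _)) (lfZ (Y VV _ _)); by rewrite /= scalerDr !scalerA mulrC.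
Qed.
Definition DN i : {linear V -> V} := mklin (DN_lin i).
Arguments DN : simpl never.
Lemma DN0 v : DN 0 v = v. Proof. by []. Qed.
Lemma DNS i v : DN i.+1 v = (kk / i.+1%:R) *: \sum_(r < i.+1) (-1) ^+ r *: Ee r.+1%:Z (DN (i - r) v).
Proof. exact: DfuS. Qed.
Lemma DN_par i v : par V (DN i v) = DN i (par V v).
Proof.
elim/ltn_ind: i => [[|i]] IH; first by rewrite !DN0.
rewrite !DNS (lfZ (par V)) linear_sum; congr (_ *: _); apply: eq_bigr => r _.
rewrite (lfZ (par V)) (proj1 (level1_V V)) expr0 scale1r IH //; lia.
Qed.
Lemma DN_hom p i v : homog p v -> homog p (DN i v).
Proof. by rewrite /homog DN_par => ->; rewrite (lfZ (DN i)). Qed.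
Lemma DN_L0 i (n : int) v : Y VV (omega VV) 1 v = n%:~R *: v ->
  Y VV (omega VV) 1 (DN i v) = (n - i%:Z)%:~R *: DN i v.
Proof.
move=> hv; elim/ltn_ind: i => [[|i]] IH; first by rewrite DN0 subr0.
rewrite DNS (lfZ (Y VV _ _)) linear_sum (scalerA (n - i.+1%:Z)%:~R) (mulrC (n - i.+1%:Z)%:~R) -(scalerA (kk / i.+1%:R)).
congr (_ *: _); rewrite [RHS]scaler_sumr.
apply: eq_bigr => r _; rewrite (lfZ (Y VV _ _)).
have := @L0_curw _ _ (adjoint V) glE r.+1%:Z (DN (i - r) v).
rewrite /Lop /curw /= => ->.
rewrite IH; last by lia.
have -> : i.+1%:Z = (i - r)%N%:Z + r.+1%:Z by have := ltn_ord r; lia.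
rewrite (lfZ (Y VV _ _)); rewrite !rmorphB /= rmorphD /=; lincomb.
Qed.
Lemma DN_bound v : exists B : nat, forall i, (B <= i)%N -> DN i v = 0.
Proof.
have [n0 hn0] := wt_bounded VV.
have [s [hs ->]] := wt_int VV v; elim: s hs => [|u s IH] hs.
  by exists 0%N => i _; rewrite big_nil (lf0 (DN i)).
have [B hB] : exists B : nat, forall i, (B <= i)%N -> DN i (\sum_(u <- s) u) = 0.
  by apply: IH => w ws; apply: hs; rewrite inE ws orbT.
have [n hn] : exists n : int, Y VV (omega VV) 1 u = n%:~R *: u by apply: hs; rewrite inE eqxx.
exists (maxn B (`|n - n0|.+1)%N) => i; rewrite geq_max => /andP [h1 h2].
rewrite big_cons (lfD (DN i)) (hB i h1) addr0.
by apply: (hn0 (n - i%:Z)); [lia|apply: DN_L0].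
Qed.

Definition DZ (i : int) v := if i is Posz n then DN n v else 0.
Lemma DZneg (i : int) v : i < 0 -> DZ i v = 0. Proof. by case: i. Qed.

Lemma DZ_rec (i : int) (B : nat) v : i <= B%:Z ->
  i%:~R *: DZ i v = kk *: \sum_(r < B) (-1) ^+ r *: Ee r.+1%:Z (DZ (i - 1 - r%:Z) v).
Proof.
have z (r : nat) (q : int) : q < 0 -> (-1) ^+ r *: Ee r.+1%:Z (DZ q v) = 0.
  by move=> q0; rewrite DZneg // lf0 scaler0.
case: i => [[|i]|i] iB.
- by rewrite scale0r big1 ?scaler0 // => r _; apply: z; lia.
- rewrite /DZ DNS scalerA mulrC divfK ?pnatr_eq0 //; congr (_ *: _).
  rewrite (sum_trunc (F := fun r : nat => (-1) ^+ r *: Ee r.+1%:Z (DZ (i.+1%:Z - 1 - r%:Z) v)) (n := i.+1)); [|lia|]; last first.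
    by move=> r hr; apply: z; lia.
  apply: eq_bigr => r _; have -> : i.+1%:Z - 1 - r%:Z = (i - r)%N%:Z by have := ltn_ord r; lia.
  by [].
- by rewrite /= scaler0 big1 ?scaler0 // => r _; apply: z; lia.
Qed.

Lemma E_comm (r : nat) x (m : int) y (B : nat) : (r < B)%N ->
  Ee r.+1%:Z (Y VV x m y) = Y VV x m (Ee r.+1%:Z y) +
   \sum_(t < B) gbin (r.+1%:Z%:~R : K) t.+1 *: Y VV (Ee t.+1%:Z x) (m + r%:Z - t%:Z) y.
Proof.
have [n0 hn0] := Y_trunc VV (cur V glE) x; move=> rB.
pose N := maxn `|n0|%N B.
have h (j : nat) : (N.+1 <= j)%N -> Yw (adjoint V) (cur V glE) j%:Z x = 0.
  by move=> hj; apply: hn0; move: hj; rewrite /N; lia.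
have gz t : (B <= t)%N -> gbin (r.+1%:Z%:~R : K) t.+1 *: Y VV (Ee t.+1%:Z x) (m + r%:Z - t%:Z) y = 0.
  by move=> ht; rewrite gbin_natE bin_small ?scale0r //; lia.
rewrite -(sum_trunc (leq_maxr `|n0|%N B) gz) -/N.
have := bo_comm (borch_Yw (adjoint V)) y r.+1%:Z m (cur_homog V glE) h.
move=> E1; refine (etrans E1 _); congr (_ + _); rewrite big_ord_recl.
have z m' : Yw (adjoint V) (Yw (adjoint V) (cur V glE) 0 x) m' y = 0.
  by rewrite (V_E0 x : Yw (adjoint V) (cur V glE) 0 x = 0) Yw0.
rewrite [X in X + _](_ : _ = 0) ?add0r; last exact: (etrans (congr1 _ (z _)) (scaler0 _ _)).
apply: eq_bigr => t _; rewrite lift0; congr (_ *: Yw (adjoint V) _ _ _); lia.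
Qed.
Lemma YvZ c x (m : int) y : Y VV (c *: x) m y = c *: Y VV x m y.
Proof. exact: (@YwZ _ _ (adjoint V)). Qed.
Lemma Yv0 (m : int) y : Y VV 0 m y = 0.
Proof. exact: (@Yw0 _ _ (adjoint V)). Qed.
Lemma Yv_sum (I : Type) (s : seq I) (P : pred I) (F : I -> V) (m : int) y :
  Y VV (\sum_(i <- s | P i) F i) m y = \sum_(i <- s | P i) Y VV (F i) m y.
Proof. exact: (linear_sum (mklin (Y_linear VV m y))). Qed.

Lemma gbin_up (t u : nat) : (-1) ^+ u * gbin ((t + u).+1%:Z%:~R : K) t.+1 = gbin ((- t.+2%:Z)%:~R : K) u.
Proof.
rewrite gbin_natE; elim: u t => [|u IH] t.
  by rewrite addn0 binn gbin0 mulr1.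
have h1 : (u.+1%:R : K) != 0 by rewrite pnatr_eq0.
have := mul_bin_down (t + u.+1).+1 t.+1; rewrite /= addnS => /(congr1 (fun n => n%:R : K)).
rewrite !natrM; have -> : ((t + u).+2 - t.+1)%N = u.+1 by lia.
move=> h2; apply: (mulfI h1); rewrite gbinSE -IH exprS.
rewrite mulrCA -h2 rmorphN /= -!natr1 !natrD; field.
by rewrite natr1.
Qed.

Lemma gbin_shift (P s : nat) : (P + s)%:R * gbin ((- P%:Z)%:~R : K) s = P%:R * gbin ((- P.+1%:Z)%:~R : K) s.
Proof.
elim: s => [|s IH]; first by rewrite addn0 !gbin0.
have h1 : (s.+1%:R : K) != 0 by rewrite pnatr_eq0.
rewrite !gbinSE (_ : _ * (_ * gbin _ s / _) = - ((P + s).+1%:R / s.+1%:R) * ((P + s)%:R * gbin ((- P%:Z)%:~R : K) s)).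
  by rewrite IH !rmorphN /= -!natr1 natrD; field; rewrite natr1.
by rewrite addnS !rmorphN /= -!natr1 natrD; field; rewrite natr1.
Qed.

(* Delta(z) (a_n b), with Delta(z) = sum_i Delta_i z^(-i). *)
Lemma conv1 (t p B : nat) (g : nat -> V) : (forall j, (B <= j + t)%N -> g j = 0) ->
  \sum_(r < B) \sum_(s < B) ((-1) ^+ r * (gbin ((- p%:Z)%:~R : K) s * gbin (r.+1%:Z%:~R : K) t.+1)) *:
     (if (t <= r)%N then g (s + (r - t))%N else 0) =
  \sum_(s < B) ((-1) ^+ t * gbin ((- (p + t).+2%:Z)%:~R : K) s) *: g s.
Proof.
move=> g0.
pose f (u : int) := match u with
  | Posz u' => (-1) ^+ t *: \sum_(s < B) (gbin ((- t.+2%:Z)%:~R : K) u' * gbin ((- p%:Z)%:~R : K) s) *: g (u' + s)%N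
  | _ => 0 end.
transitivity (\sum_(r < B) f (r%:Z - t%:Z)).
  apply: eq_bigr => r _; have [tr|rt] := leqP t r; last first.
    by rewrite big1 => [|s _]; rewrite ?scaler0 //; have -> : r%:Z - t%:Z = Negz (t - r).-1 by lia.
  rewrite subzn // /f scaler_sumr; apply: eq_bigr => s _; rewrite -gbin_up scalerA.
  rewrite subnKC // [(s + _)%N]addnC; congr (_ *: _).
  by rewrite -{1}(subnK tr) exprD; ring.
rewrite (shift_sum (f := f)) //; last 2 first.
- by case.
- move=> j hj; rewrite /f big1 ?scaler0 // => s _; rewrite g0 ?scaler0 //; lia.
rewrite -scaler_sumr (@vsum R V (- t.+2%:Z) (- p%:Z)) ?scaler_sumr; last by move=> j hj; apply: g0; lia.
apply: eq_bigr => s _; rewrite scalerA; congr (_ * gbin _%:~R _ *: _); lia.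
Qed.

(** The conjugation formula Delta(z) Y(a,x) = Y(Delta(z+x) a, x) Delta(z), with (z+x)^(-p) expanded
    in powers of x. The induction on i compares i times both sides through the recursion of [DZ]. *)
Lemma DZ_prod a (n : int) b (i : int) (B : nat) : i < B%:Z ->
  DZ i (Y VV a n b) =
  \sum_(p < B) \sum_(s < B) gbin ((- p%:Z)%:~R : K) s *: Y VV (DN p a) (n + s%:Z) (DZ (i - p%:Z - s%:Z) b).
Proof.
have [k hk] : exists k : nat, i < k%:Z by exists `|i|.+1%N; lia.
elim: k i hk B => [|k IH] i hk B iB.
  rewrite DZneg; last by lia.
  by rewrite big1 // => p _; rewrite big1 // => s _; rewrite (DZneg (i := i - p%:Z - s%:Z)) ?lf0 ?scaler0 //; lia.
have [i0|i0] := ltP i 1.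
  case: B iB => [|B] iB; first by apply: (IH i) => //; lia.
  rewrite big_ord_recl [X in _ + X]big1 ?addr0; last first.
    move=> p _; rewrite big1 // => s _.
    by rewrite (DZneg (i := i - (lift ord0 p)%:Z - s%:Z)) ?lf0 ?scaler0 //= /bump /=; lia.
  rewrite big_ord_recl [X in _ + X]big1 ?addr0; last first.
    by move=> s _; rewrite (DZneg (i := _ - (lift ord0 s)%:Z)) ?lf0 ?scaler0 //= /bump /=; lia.
  rewrite gbin0 scale1r DN0.
  by case: i i0 {iB hk} => [[|i]|i] //= _; rewrite lf0.
have iK : (i%:~R : K) != 0 by rewrite intr_eq0; lia.
apply: (scalerI iK); rewrite (DZ_rec _ (ltW iB)).
have BD (P : nat) : (P < B)%N -> P%:R *: DN P a = kk *: \sum_(r < B) (-1) ^+ r *: Ee r.+1%:Z (DZ (P%:Z - 1 - r%:Z) a).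
  by move=> PB; rewrite -DZ_rec //; lia.
pose G t p s := Y VV (Ee t.+1%:Z (DN p a)) (n + s%:Z) (DZ (i - p%:Z - t.+1%:Z - s%:Z) b).
have G0 t p s : (B <= p + t.+1 + s)%N -> G t p s = 0.
  by move=> h; rewrite /G DZneg ?lf0 //; lia.
transitivity (kk *: \sum_(r < B) \sum_(p < B) \sum_(s < B) ((-1) ^+ r * gbin ((- p%:Z)%:~R : K) s) *:
    Y VV (DN p a) (n + s%:Z) (Ee r.+1%:Z (DZ (i - p%:Z - s%:Z - 1 - r%:Z) b)) +
  kk *: \sum_(t < B) \sum_(p < B) \sum_(s < B) ((-1) ^+ t * gbin ((- (p + t).+2%:Z)%:~R : K) s) *: G t p s).
  rewrite -scalerDr; congr (_ *: _).
  transitivity (\sum_(r < B) \sum_(p < B) \sum_(s < B) ((-1) ^+ r * gbin ((- p%:Z)%:~R : K) s) *: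
    (Y VV (DN p a) (n + s%:Z) (Ee r.+1%:Z (DZ (i - p%:Z - s%:Z - 1 - r%:Z) b)) +
      \sum_(t < B) gbin (r.+1%:Z%:~R : K) t.+1 *: (if (t <= r)%N then G t p (s + (r - t))%N else 0))).
    apply: eq_bigr => r _; rewrite (IH (i - 1 - r%:Z) _ B); [|lia|lia].
    rewrite (linear_sum (Ee r.+1%:Z)) scaler_sumr; apply: eq_bigr => p _.
    rewrite (linear_sum (Ee r.+1%:Z)) scaler_sumr; apply: eq_bigr => s _.
    rewrite (lfZ (Ee r.+1%:Z)) scalerA (E_comm _ _ _ (ltn_ord r)); congr (_ *: (Y _ _ _ _ + _)).
      by congr (Ee _ (DZ _ _)); lia.
    apply: eq_bigr => t _; have [tr|rt] := leqP t r; last by rewrite gbin_natE bin_small ?scale0r //.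
    by congr (_ *: Y _ _ _ (DZ _ _)); lia.
  have -> : \sum_(t < B) \sum_(p < B) \sum_(s < B) ((-1) ^+ t * gbin ((- (p + t).+2%:Z)%:~R : K) s) *: G t p s =
     \sum_(r < B) \sum_(p < B) \sum_(s < B) \sum_(t < B) ((-1) ^+ r * (gbin ((- p%:Z)%:~R : K) s * gbin (r.+1%:Z%:~R : K) t.+1)) *:
       (if (t <= r)%N then G t p (s + (r - t))%N else 0).
    transitivity (\sum_(t < B) \sum_(p < B) \sum_(r < B) \sum_(s < B) ((-1) ^+ r * (gbin ((- p%:Z)%:~R : K) s * gbin (r.+1%:Z%:~R : K) t.+1)) *:
       (if (t <= r)%N then G t p (s + (r - t))%N else 0)).
      apply: eq_bigr => t _; apply: eq_bigr => p _; rewrite conv1 // => j hj; apply: G0; lia.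
    rewrite exchange_big [RHS]exchange_big; apply: eq_bigr => p _ /=.
    rewrite exchange_big; apply: eq_bigr => r _ /=; rewrite exchange_big //.
  rewrite -big_split; apply: eq_bigr => r _; rewrite /= -big_split; apply: eq_bigr => p _.
  rewrite /= -big_split; apply: eq_bigr => s _; rewrite /= scalerDr scaler_sumr; congr (_ + _).
  by apply: eq_bigr => t _; rewrite scalerA -mulrA.
(* The factor i is split as (i - p - s) + (p + s), to match the action of the E_r on b and on a;
   [gbin_shift] turns p + s into p. *)
have -> : i%:~R *: \sum_(p < B) \sum_(s < B) gbin ((- p%:Z)%:~R : K) s *: Y VV (DN p a) (n + s%:Z) (DZ (i - p%:Z - s%:Z) b) =
  \sum_(p < B) \sum_(s < B) gbin ((- p%:Z)%:~R : K) s *: Y VV (DN p a) (n + s%:Z) ((i - p%:Z - s%:Z)%:~R *: DZ (i - p%:Z - s%:Z) b)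
  + \sum_(p < B) \sum_(s < B) gbin ((- p.+1%:Z)%:~R : K) s *: Y VV (p%:R *: DN p a) (n + s%:Z) (DZ (i - p%:Z - s%:Z) b).
  rewrite scaler_sumr -big_split; apply: eq_bigr => p _; rewrite scaler_sumr -big_split; apply: eq_bigr => s _.
  rewrite /= (lfZ (Y VV _ _)) YvZ !scalerA -scalerDl; congr (_ *: _).
  by rewrite [_ * p%:R]mulrC -gbin_shift natrD !rmorphB /=; ring.
congr (_ + _).
  rewrite exchange_big scaler_sumr; apply: eq_bigr => p _ /=.
  rewrite exchange_big scaler_sumr; apply: eq_bigr => s _ /=.
  rewrite (DZ_rec (B := B) b); last lia.
  rewrite (lfZ (Y VV _ _)) (linear_sum (Y VV (DN p a) (n + s%:Z))) !scaler_sumr; apply: eq_bigr => r _.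
  by rewrite (lfZ (Y VV _ _)) !scalerA; congr (_ *: _); ring.
rewrite scaler_sumr; transitivity (\sum_(t < B) \sum_(s < B) \sum_(p < B) kk *:
   (((-1) ^+ t * gbin ((- p.+1%:Z)%:~R : K) s) *:
     Y VV (Ee t.+1%:Z (DZ (p%:Z - t.+1%:Z) a)) (n + s%:Z) (DZ (i - p%:Z - s%:Z) b))).
  apply: eq_bigr => t _; rewrite scaler_sumr exchange_big /= ; rewrite [LHS](eq_bigr _ (fun p _ => erefl _)).
  rewrite exchange_big /=.
  transitivity (\sum_(s < B) \sum_(p < B) kk *: (((-1) ^+ t * gbin ((- (p + t).+2%:Z)%:~R : K) s) *: G t p s)).
    by rewrite -scaler_sumr exchange_big /= scaler_sumr; apply: eq_bigr => s _; rewrite scaler_sumr.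
  apply: eq_bigr => s _.
  pose f (u : int) := match u with
    | Posz p => kk *: (((-1) ^+ t * gbin ((- (p + t).+2%:Z)%:~R : K) s) *: G t p s) | _ => 0 end.
  transitivity (\sum_(p < B) f p%:Z) => //; rewrite -(shift_sum (f := f) (t := t.+1)) //; last 2 first.
  - by case.
  - by move=> j hj; rewrite /f G0 ?scaler0 //; lia.
  apply: eq_bigr => p _; have [tp|pt] := leqP t.+1 p.
    rewrite subzn // /f /G; congr (_ *: ((_ * gbin _%:~R _) *: Y _ _ _ (DZ _ _))); lia.
  by rewrite (DZneg (i := p%:Z - t.+1%:Z)) ?lf0 ?Yv0 ?scaler0; [have -> : p%:Z - t.+1%:Z = Negz (t.+1 - p).-1 by lia|lia].
rewrite exchange_big [LHS](eq_bigr _ (fun s _ => exchange_big _ _ _ _ _ _)) /= exchange_big.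
apply: eq_bigr => p _; apply: eq_bigr => s _ /=.
rewrite BD // YvZ Yv_sum !scaler_sumr; apply: eq_bigr => t _.
rewrite YvZ !scalerA; congr (_ *: Y _ (Ee _ (DZ _ _)) _ _); [ring|lia].
Qed.

Section Twist.
Variable W : vmod V.
(* Li's twist: Y'(v,z) = Y(Delta(z)v,z). *)
Definition Bd v : nat := xget 0%N [set B : nat | forall i, (B <= i)%N -> DN i v = 0]%classic.
Lemma BdP v i : (Bd v <= i)%N -> DN i v = 0.
Proof.
have [B hB] := DN_bound v.
by apply: (@xgetPex _ 0%N [set B : nat | forall i, (B <= i)%N -> DN i v = 0]%classic); exists B.
Qed.
Definition Yt_fun v (n : int) (w : W) : W := \sum_(i < Bd v) Yw W (DN i v) (n - i%:Z) w.
Lemma Yt_E v n w B : (forall i, (B <= i)%N -> DN i v = 0) ->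
  Yt_fun v n w = \sum_(i < B) Yw W (DN i v) (n - i%:Z) w.
Proof.
move=> hB; have z i : DN i v = 0 -> Yw W (DN i v) (n - i%:Z) w = 0 by move=> ->; rewrite Yw0.
rewrite /Yt_fun -(sum_trunc (F := fun i : nat => Yw W (DN i v) (n - i%:Z) w) (leq_maxl (Bd v) B)); last first.
  by move=> i hi; apply/z/BdP.
apply: (sum_trunc (F := fun i : nat => Yw W (DN i v) (n - i%:Z) w) (leq_maxr (Bd v) B)).
by move=> i hi; apply/z/hB.
Qed.
Lemma Yt_lin v n : linear (Yt_fun v n).
Proof.
move=> c u w; rewrite /Yt_fun scaler_sumr -big_split; apply: eq_bigr => i _.
by rewrite linearP.
Qed.
Definition Yt v n : {linear W -> W} := mklin (Yt_lin v n).
Lemma YtE v n w B : (forall i, (B <= i)%N -> DN i v = 0) ->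
  Yt v n w = \sum_(i < B) Yw W (DN i v) (n - i%:Z) w.
Proof. exact: Yt_E. Qed.
Lemma Yt_linear n w : linear (fun v => Yt v n w).
Proof.
move=> c u v; pose B := (Bd u + Bd v)%N.
have hu i : (B <= i)%N -> DN i u = 0 by move=> h; apply: BdP; rewrite /B in h; lia.
have hv i : (B <= i)%N -> DN i v = 0 by move=> h; apply: BdP; rewrite /B in h; lia.
rewrite (YtE n w hu) (YtE n w hv) (@YtE _ n w B); last first.
  by move=> i hi; rewrite linearP hu // hv // scaler0 addr0.
rewrite scaler_sumr -big_split; apply: eq_bigr => i _.
by rewrite linearP YwD YwZ.
Qed.
Lemma Yw_suml (X : vmod V) (I : Type) (s : seq I) (P : pred I) (F : I -> V) (m : int) y :
  Yw X (\sum_(i <- s | P i) F i) m y = \sum_(i <- s | P i) Yw X (F i) m y.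
Proof. exact: (linear_sum (mklin (Yw_linear (v0 := X) m y))). Qed.
Lemma Yt0 n w : Yt 0 n w = 0.
Proof. exact: lf0 (mklin (Yt_linear n w)). Qed.
Lemma Yt_par v n w : par W (Yt v n w) = Yt (par V v) n (par W w).
Proof.
rewrite (@YtE (par V v) n _ (Bd v)); last by move=> i hi; rewrite -DN_par BdP // lf0.
rewrite (YtE n w (@BdP v)) linear_sum; apply: eq_bigr => i _.
by rewrite Yw_par DN_par.
Qed.
Lemma Yt_trunc v w : exists n0 : int, forall n, n0 <= n -> Yt v n w = 0.
Proof.
have [n0 hn0] : exists n0 : int, forall i, (i < Bd v)%N -> forall n, n0 <= n -> Yw W (DN i v) n w = 0.
  elim: (Bd v) => [|B [n0 h]]; first by exists 0.
  have [n1 h1] := Yw_trunc (v0 := W) (DN B v) w.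
  exists (Num.max n0 n1) => i; rewrite ltnS leq_eqVlt => /orP [/eqP ->|iB] n; rewrite ge_max => /andP [h2 h3].
    exact: h1.
  exact: (h i iB n h2).
exists (n0 + (Bd v)%:Z) => n hn; rewrite (YtE n w (@BdP v)) big1 // => i _.
by apply: hn0 => //; have := ltn_ord i; lia.
Qed.
Lemma DN_vac i : DN i.+1 (vac VV) = 0.
Proof.
rewrite DNS big1 ?scaler0 // => r _.
have h : forall m, Ee r.+1%:Z (DN m (vac VV)) = 0.
  elim/ltn_ind => [[|m]] IH; first by rewrite DN0 Y_creation0.
  rewrite DNS (lfZ (Ee _)) linear_sum big1 ?scaler0 // => q _.
  rewrite (lfZ (Ee r.+1%:Z)) (act_E (level1_V V) r.+1%:Z q.+1%:Z) //.
  by rewrite IH ?lf0 ?scaler0 //; lia.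
by rewrite h scaler0.
Qed.
Lemma Yt_vac n w : Yt (vac VV) n w = if n == -1 then w else 0.
Proof.
rewrite (@YtE _ n w 1%N); last by case=> // i _; apply: DN_vac.
by rewrite big_ord_recl big_ord0 DN0 subr0 addr0 Yw_vacE.
Qed.
(** After [DZ_prod], Vandermonde's identity merges the binomials of m and of - p' into those of m -
    p'; what remains is the Borcherds identity in [W] for Delta_p' a and Delta_y b, with m and k
    shifted. *)
Lemma Yt_borcherds p q (a b : V) (w : W) (m n k : int) :
  homog p a -> homog q b ->
    \sum_(j \in [set: nat])
       gbin m%:~R j *: Yt (Y (Vv V) a (n + j%:Z) b) (m + k - j%:Z) w =
    \sum_(j \in [set: nat]) ((-1) ^+ j * gbin n%:~R j) *:
       (Yt a (m + n - j%:Z) (Yt b (k + j%:Z) w)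
        - ((-1) ^+ (p && q) * (-1) ^ n) *:
            Yt b (n + k - j%:Z) (Yt a (m + j%:Z) w)).
Proof.
move=> hp hq; set Ba := (Bd a).+1; set Bb := (Bd b).+1.
have da i : (Ba <= i)%N -> DN i a = 0 by move=> h; apply: BdP; apply: ltnW.
have db i : (Bb <= i)%N -> DN i b = 0 by move=> h; apply: BdP; apply: ltnW.
have [N1 hN1] : exists N : nat, forall x y : nat, (x < Ba)%N -> (y < Bb)%N -> forall j : nat, (N <= j)%N ->
    [/\ Y VV (DN x a) (n + j%:Z) (DN y b) = 0,
        Yw W (DN y b) (k - y%:Z + j%:Z) w = 0 & Yw W (DN x a) (m - x%:Z + j%:Z) w = 0].
  have h1 x y : exists N : nat, forall j : nat, (N <= j)%N ->
    [/\ Y VV (DN x a) (n + j%:Z) (DN y b) = 0,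
        Yw W (DN y b) (k - y%:Z + j%:Z) w = 0 & Yw W (DN x a) (m - x%:Z + j%:Z) w = 0].
    have [n1 hn1] := Y_trunc VV (DN x a) (DN y b).
    have [n2 hn2] := Yw_trunc (v0 := W) (DN y b) w.
    have [n3 hn3] := Yw_trunc (v0 := W) (DN x a) w.
    exists (`|(n1 - n)%R|%N + `|(n2 - k + y%:Z)%R|%N + `|(n3 - m + x%:Z)%R|%N)%N => j hj.
    by split; [apply: hn1|apply: hn2|apply: hn3]; lia.
  have h2 x : exists N : nat, forall y : nat, (y < Bb)%N -> forall j : nat, (N <= j)%N ->
    [/\ Y VV (DN x a) (n + j%:Z) (DN y b) = 0,
        Yw W (DN y b) (k - y%:Z + j%:Z) w = 0 & Yw W (DN x a) (m - x%:Z + j%:Z) w = 0].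
    elim: (Bb) => [|B [N IH]]; first by exists 0%N.
    have [N' h] := h1 x B; exists (maxn N N') => y; rewrite ltnS leq_eqVlt => /orP [/eqP ->|yB] j; rewrite geq_max => /andP [? ?].
      exact: h.
    exact: IH.
  elim: (Ba) => [|B [N IH]]; first by exists 0%N.
  have [N' h] := h2 B; exists (maxn N N') => x y; rewrite ltnS leq_eqVlt => /orP [/eqP ->|xB] yB j; rewrite geq_max => /andP [? ?].
    exact: h.
  exact: IH.
have [n0 hn0] := Y_trunc VV a b.
(* The bound [C] exceeds all truncation orders involved, including that of Delta on each product
   a_(n+j) b. *)
pose C := (Ba + Bb + (N1 + `|n0 - n|))%N.
have NC : (N1 <= C)%N by rewrite /C; lia.
have BC : (Ba + Bb + N1 <= C)%N by rewrite /C; lia.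
have z1 x y (j : nat) : (N1 <= j)%N -> Y VV (DN x a) (n + j%:Z) (DN y b) = 0.
  move=> hj; have [xB|/da ->] := ltnP x Ba; last by rewrite Yv0.
  have [yB|/db ->] := ltnP y Bb; last by rewrite lf0.
  by have [] := hN1 x y xB yB j hj.
have z2 y (j : nat) : (N1 <= j)%N -> Yw W (DN y b) (k - y%:Z + j%:Z) w = 0.
  move=> hj; have [yB|/db ->] := ltnP y Bb; last by rewrite Yw0.
  by have [] := hN1 0%N y erefl yB j hj.
have z3 x (j : nat) : (N1 <= j)%N -> Yw W (DN x a) (m - x%:Z + j%:Z) w = 0.
  move=> hj; have [xB|/da ->] := ltnP x Ba; last by rewrite Yw0.
  by have [] := hN1 x 0%N xB erefl j hj.
have da' i : (C <= i)%N -> DN i a = 0 by move=> h; apply: da; rewrite /C in h; lia.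
have db' i : (C <= i)%N -> DN i b = 0 by move=> h; apply: db; rewrite /C in h; lia.
have zC i j : (C <= i)%N -> DN i (Y VV a (n + j%:Z) b) = 0.
  move=> hi; have := @DZ_prod a (n + j%:Z) b i%:Z i.+1; rewrite /DZ => ->; last by lia.
  rewrite big1 // => p' _; rewrite big1 // => s _.
  have [pB|/da ->] := ltnP p' Ba; last by rewrite Yv0 scaler0.
  have [sN|sN] := leqP N1 (j + s).
    case: (i%:Z - p'%:Z - s%:Z) => [y|y]; last by rewrite lf0 scaler0.
    by rewrite -addrA -PoszD z1 ?scaler0.
  have -> : i%:Z - p'%:Z - s%:Z = (i - p' - s)%N%:Z by rewrite /C in hi; lia.
  rewrite db ?lf0 ?scaler0 //; rewrite /C in hi; lia.
rewrite (@fsum_nat _ _ C); last first.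
  move=> j hj; have -> : Y VV a (n + j%:Z) b = 0 by apply: hn0; rewrite /C in hj; lia.
  by rewrite Yt0 scaler0.
rewrite (@fsum_nat _ _ C); last first.
  move=> j hj; rewrite (YtE _ w db') big1 ?lf0; last first.
    by move=> y _; rewrite -addrAC z2 //; lia.
  rewrite (YtE (m + j%:Z) w da') [X in Yt b _ X]big1 ?lf0 ?scaler0 ?subr0 ?addr0 ?scaler0 //.
  by move=> x _; rewrite addrAC z3 //; lia.
pose g p' y t := Yw W (Y VV (DN p' a) (n + t%:Z) (DN y b)) ((m - p'%:Z) + (k - y%:Z) - t%:Z) w.
have gC p' y t : (C <= t)%N -> g p' y t = 0.
  by move=> h; rewrite /g z1 ?Yw0 //; lia.
transitivity (\sum_(p' < C) \sum_(y < C) \sum_(t < C) gbin ((m - p'%:Z)%:~R : K) t *: g p' y t).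
  transitivity (\sum_(j < C) \sum_(p' < C) \sum_(s < C) \sum_(y < C) (gbin (m%:~R : K) j * gbin ((- p'%:Z)%:~R : K) s) *: g p' y (j + s)%N).
    apply: eq_bigr => j _; rewrite (YtE _ w (fun i => zC i j)) scaler_sumr.
    transitivity (\sum_(i < C) \sum_(p' < C) \sum_(s < C) (gbin (m%:~R : K) j * gbin ((- p'%:Z)%:~R : K) s) *:
        Yw W (Y VV (DN p' a) (n + (j + s)%N%:Z) (DZ (i%:Z - (p' + s)%N%:Z) b)) (m + k - j%:Z - i%:Z) w).
      apply: eq_bigr => i _; have -> : DN i (Y VV a (n + j%:Z) b) = DZ i%:Z (Y VV a (n + j%:Z) b) by [].
      rewrite (DZ_prod _ _ _ (B := C)); last by have := ltn_ord i; lia.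
      rewrite Yw_suml scaler_sumr; apply: eq_bigr => p' _.
      rewrite Yw_suml scaler_sumr; apply: eq_bigr => s _.
      rewrite YwZ scalerA; congr (_ *: Yw W (Y VV _ _ (DZ _ _)) _ _); lia.
    rewrite exchange_big; apply: eq_bigr => p' _; rewrite exchange_big; apply: eq_bigr => s _ /=.
    pose f (u : int) := (gbin (m%:~R : K) j * gbin ((- p'%:Z)%:~R : K) s) *:
      match u with Posz y => g p' y (j + s)%N | _ => 0 end.
    rewrite -[RHS](shift_sum (f := f) (t := (p' + s)%N)); last 2 first.
    - by case=> // ? _; rewrite /f scaler0.
    - move=> y hy; rewrite /f /g; have [pB|/da ->] := ltnP p' Ba; last by rewrite Yv0 Yw0 scaler0.
      have [yB|/db ->] := ltnP y Bb; last by rewrite lf0 Yw0 scaler0.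
      have h : (N1 <= s)%N.
        by move: hy pB yB BC; clear; lia.
      by rewrite z1 ?Yw0 ?scaler0 // (leq_trans h) // leq_addl.
    apply: eq_bigr => i _; rewrite /f; congr (_ *: _).
    have [h|h] := leqP (p' + s) i; last first.
      have -> : i%:Z - (p' + s)%N%:Z = Negz (p' + s - i).-1 by lia.
      by rewrite lf0 Yw0.
    by rewrite subzn // /g /DZ; congr (Yw W _ _ w); lia.
  rewrite exchange_big; apply: eq_bigr => p' _ /=.
  rewrite [LHS](eq_bigr _ (fun j _ => exchange_big _ _ _ _ _ _)) /= exchange_big; apply: eq_bigr => y _ /=.
  by rewrite (@vsum R W m (- p'%:Z)) // => t ht; apply: gC.
transitivity (\sum_(p' < C) \sum_(y < C) \sum_(t < C) ((-1) ^+ t * gbin (n%:~R : K) t) *: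
     (Yw W (DN p' a) (m - p'%:Z + n - t%:Z) (Yw W (DN y b) (k - y%:Z + t%:Z) w)
      - (-1) ^ n *: Yw W (parX p (DN y b)) (n + (k - y%:Z) - t%:Z) (Yw W (DN p' a) (m - p'%:Z + t%:Z) w))).
  apply: eq_bigr => p' _; apply: eq_bigr => y _.
  apply: (bo_fin (borch_Yw W) (DN_hom p' hp)) => j hj.
  - by apply: z1; lia.
  - by apply: z2; lia.
  - by apply: z3; lia.
rewrite [LHS](eq_bigr _ (fun p' _ => exchange_big _ _ _ _ _ _)) /= exchange_big.
apply: eq_bigr => t _ /=; rewrite (eq_bigr _ (fun p' _ => esym (scaler_sumr _ _ _ _))) -scaler_sumr.
congr (_ *: _).
rewrite (eq_bigr _ (fun p' _ => sumrB _ _ _ _)) sumrB; congr (_ - _).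
  rewrite (YtE _ _ da'); apply: eq_bigr => p' _; rewrite (YtE _ _ db') linear_sum.
  by apply: eq_bigr => y _; congr (Yw W _ _ (Yw W _ _ _)); lia.
rewrite (YtE _ _ db') scaler_sumr exchange_big; apply: eq_bigr => y _ /=.
rewrite (YtE _ _ da') linear_sum scaler_sumr; apply: eq_bigr => p' _.
rewrite (parXE p (DN_hom y hq)) YwZ scalerA mulrC; congr (_ *: Yw W _ _ (Yw W _ _ _)); lia.
Qed.
Definition twist : vmod V := @Vmod R V W Yt Yt_linear Yt_par Yt_trunc Yt_vac Yt_borcherds.
(** On a current, Delta(z) a = a + kk (E, a) z^(-1) vac, so the twist changes nothing but N_0. *)
Lemma twist_cur a r w : curw twist a r w = nsh (curw W) kk a r w.
Proof.
have d1 : DN 1 (cur V a) = (kk * glform R glE a) *: vac VV.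
  rewrite DNS big_ord_recl big_ord0 addr0 expr0 scale1r DN0 cur_cur //=.
  by rewrite add0r divr1 scalerA.
have d2 i : DN i.+2 (cur V a) = 0.
  elim/ltn_ind: i => i IH; rewrite DNS big1 ?scaler0 // => q _.
  case Hq : (i.+1 - q)%N => [|[|j]].
  - have -> : nat_of_ord q = i.+1 by have := ltn_ord q; lia.
    by rewrite DN0 cur_cur //= scale0r addr0 scaler0.
  - by rewrite d1 (lfZ (Ee _)) Y_creation0 // !scaler0.
  - by rewrite IH ?lf0 ?scaler0 //; lia.
have h (i : nat) : (2 <= i)%N -> DN i (cur V a) = 0 by case: i => [|[|i]].
change (Yt (cur V a) r w = Yw W (cur V a) r w + nsc kk a r *: w).
rewrite (YtE r w h) !big_ord_recl big_ord0 addr0 subr0 DN0 d1; congr (_ + _).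
rewrite YwZ Yw_vacE /nsc lift0 -(subr_eq0 _ (-1)) opprK subrK.
by case: a {d1 d2 h}; rewrite /= ?mulr1 ?mulr0 ?scale0r //; case: ifP => _; rewrite ?scaler0 ?scale0r.
Qed.
End Twist.
End Delta.

(** * Irreducible modules *)

Section Classify.
Variables (R : realType) (V : V1gl11 R).
Local Notation K := R[i].
Local Notation VV := (Vv V).

Section AffineHom.
Variables (W1 W2 : vmod V) (F : {linear W1 -> W2}).
Hypothesis hF : affine_map (curw W1) (curw W2) F.

Lemma affine_Y v n w : F (Yw W1 v n w) = Yw W2 v n (F w).
Proof.
have [Fp Fc] := hF.
have z0 : forall n w, F (Yw W1 0 n w) = Yw W2 0 n (F w) by move=> ? ?; rewrite !Yw0 lf0.
have zL c (u v' : V) : (forall n w, F (Yw W1 u n w) = Yw W2 u n (F w)) ->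
   (forall n w, F (Yw W1 v' n w) = Yw W2 v' n (F w)) ->
   forall n w, F (Yw W1 (c *: u + v') n w) = Yw W2 (c *: u + v') n (F w).
  by move=> hu hv n' w'; rewrite !YwD !YwZ linearP hu hv.
pose D := @Lsub R V (fun v => forall n w, F (Yw W1 v n w) = Yw W2 v n (F w)) z0 zL.
have Dp u : D u -> D (par V u).
  have e (W : vmod V) n' (w' : W) : Yw W (par V u) n' w' = par W (Yw W u n' (par W w')).
    by rewrite Yw_par parKE.
  by move=> hu n' w'; rewrite !e -Fp hu Fp.
move: n w; apply: (V_gen (D := D)) => // [a r u hu n w|n w]; last first.
  by rewrite !Yw_vacE; case: ifP => // _; rewrite lf0.
have [n1 h1] := Yw_trunc (v0 := W1) u w; have [n2 h2] := Yw_trunc (v0 := W1) (cur V a) w.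
pose N := (`|(n1 - n)%R|%N + `|n2|%N)%N.
have c1 j : (N <= j)%N -> Yw W1 u (n + j%:Z) w = 0 by move=> hj; apply: h1; rewrite /N in hj; lia.
have c2 j : (N <= j)%N -> Yw W1 (cur V a) j%:Z w = 0 by move=> hj; apply: h2; rewrite /N in hj; lia.
have E1 := bo_iter (borch_Yw W1) r (cur_homog V a) c1 c2.
have c1' j : (N <= j)%N -> Yw W2 u (n + j%:Z) (F w) = 0 by move=> hj; rewrite -hu c1 // lf0.
have c2' j : (N <= j)%N -> Yw W2 (cur V a) j%:Z (F w) = 0.
  by move=> hj; rewrite -[LHS](Fc a j%:Z w) /curw c2 // lf0.
have E2 := bo_iter (borch_Yw W2) r (cur_homog V a) c1' c2'.
refine (etrans (congr1 F E1) (etrans _ (esym E2))).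
rewrite linear_sum; apply: eq_bigr => j _.
rewrite (lfZ F) (lfB F) (lfZ F); congr (_ *: (_ - _ *: _)).
  by rewrite -hu -[RHS]Fc.
have hp : D (parX (glpar a) u) by apply: parX_in hu.
by rewrite hp -[Yw W2 _ j%:Z (F w)]Fc.
Qed.
Lemma affine_hom : exists f : hom false W1 W2, f =1 F.
Proof.
have [Fp _] := hF.
have h1 w : F (par W1 w) = (-1) ^+ false *: par W2 (F w) by rewrite expr0 scale1r Fp.
by exists (Hom h1 affine_Y).
Qed.
End AffineHom.

Lemma Verma_lin n e (U : glmod R) (u : U) (N : lmodType K) (x y : N) : is_Verma n e u ->
  exists f : {linear U -> N}, forall a b, f (a *: u + b *: gact U psim u) = a *: x + b *: y.
Proof.
move=> [_ _ _ _ ub]; pose um := gact U psim u.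
pose c w := xget 0 [set c : K * K | w = c.1 *: u + c.2 *: um]%classic.
have cE w : w = (c w).1 *: u + (c w).2 *: um.
  have [d [hd _]] := ub w.
  by apply: (@xgetPex _ 0 [set c : K * K | w = c.1 *: u + c.2 *: um]%classic); exists d.
have cU a b : c (a *: u + b *: um) = (a, b).
  have [d [hd ud]] := ub (a *: u + b *: um).
  by rewrite -(ud _ (cE _)); apply: ud.
have fl : linear (fun w => (c w).1 *: x + (c w).2 *: y).
  move=> a w z; have h : a *: w + z = (a * (c w).1 + (c z).1) *: u + (a * (c w).2 + (c z).2) *: um.
    by rewrite {1}(cE w) {1}(cE z); lincomb.
  by rewrite h cU /=; lincomb.
exists (mklin fl) => a b.
by change ((c (a *: u + b *: um)).1 *: x + (c (a *: u + b *: um)).2 *: y = a *: x + b *: y); rewrite cU.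
Qed.

Lemma Verma_acts n e (U : glmod R) (u : U) (um := gact U psim u) : is_Verma n e u ->
  [/\ gact U glN um = (n - 2%:R^-1) *: um, gact U glE um = e *: um,
      gact U psip um = e *: u & gact U psim um = 0].
Proof.
move=> hu; have [_ uN uE up _] := hu; split.
- have := gact_br glN psim u; rewrite /= uN (lfZ (gact _ psim)) -/um => /eqP.
  by rewrite subr_eq => /eqP ->; lincomb; field.
- exact: (Verma_E hu).
- exact: (Verma_pm hu).
have := gact_br psim psim u; rewrite /= -/um expr1 scale0r => /eqP.
by rewrite scaleN1r opprK -mulr2n -scaler_nat scaler_eq0 (negPf (two_neq0 R)) => /eqP.
Qed.

Section GShift.
Variables (U : glmod R) (k : K).
Definition gsc (a : gl11) : K := if a is glN then k else 0.
Lemma gsh_lin a : linear (fun u : U => gact U a u + gsc a *: u).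
Proof. by move=> c u w; rewrite linearP; lincomb. Qed.
Definition gsh a : {linear U -> U} := mklin (gsh_lin a).
Lemma gshE a u : gsh a u = gact U a u + gsc a *: u. Proof. by []. Qed.
Lemma gsh_par a u : par U (gsh a u) = (-1) ^+ glpar a *: gsh a (par U u).
Proof. by rewrite !gshE (lfD (par U)) (lfZ (par U)) gact_par; case: a => /=; lincomb. Qed.
Lemma gsh_br a b u :
    gsh a (gsh b u) - (-1) ^+ (glpar a && glpar b) *: gsh b (gsh a u) =
    (glbr R a b).1 *: gsh (glbr R a b).2 u.
Proof.
have h : gsc (glbr R a b).2 = 0 by case: a; case: b.
rewrite !gshE h scale0r addr0 -gact_br.
rewrite (lfD (gact U a)) (lfD (gact U b)) (lfZ (gact U a)) (lfZ (gact U b)).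
by case: a {h}; case: b => /=; lincomb.
Qed.
Definition gshift : glmod R := Glmod gsh_par gsh_br.
Lemma gshift_Verma n e (u : U) : is_Verma n e u -> @is_Verma R (n + k) e gshift u.
Proof.
move=> [hp hN hE hps hb].
have e1 a : gact gshift a u = gact U a u + gsc a *: u by [].
split=> //; rewrite ?e1 /gsc ?scale0r ?addr0 //.
by rewrite hN; lincomb.
Qed.
Lemma gshift_top (M : superspace R) (act : gl11 -> int -> {linear M -> M}) (j : {linear U -> M}) :
  top_map act j -> @top_map R gshift M (nsh act k) j.
Proof.
move=> [h1 h2 h3]; split=> // [a u|a r u r0].
  change (j (gact U a u + gsc a *: u) = act a 0 (j u) + nsc k a 0 *: j u).
  by rewrite lfD lfZ h2; case: a.
change (act a r (j u) + nsc k a r *: j u = 0); rewrite h3 // add0r.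
by case: a; rewrite /= ?gt_eqF // scale0r.
Qed.
Lemma ungshift_top (M : superspace R) (act : gl11 -> int -> {linear M -> M}) (j : {linear U -> M}) :
  @top_map R gshift M act j -> @top_map R U M (nsh act (- k)) j.
Proof.
move=> [h1 h2 h3]; split=> // [a u|a r u r0].
  change (j (gact U a u) = act a 0 (j u) + nsc (- k) a 0 *: j u).
  rewrite -h2; change (j (gact U a u) = j (gact U a u + gsc a *: u) + nsc (- k) a 0 *: j u).
  by rewrite lfD lfZ; case: a => /=; lincomb.
change (act a r (j u) + nsc (- k) a r *: j u = 0); rewrite h3 // add0r.
by case: a; rewrite /= ?gt_eqF // scale0r.
Qed.
End GShift.

(** Shifting N_0 gives a module over the affine algebra only; the Delta twist is what makes it a
    V-module. One induced module at e thus gives those with all other n. *)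
Lemma twist_Vhat n e k (M : vmod V) : is_Vhat n e M -> is_Vhat (n + k) e (twist k M).
Proof.
move=> [U [v [j [hv [lev top ind]]]]]; exists (gshift U k), v, j; split; first exact: gshift_Verma.
have tc a r w : curw (twist k M) a r w = curw M a r w + nsc k a r *: w by rewrite twist_cur.
split; first exact: curw_level1.
  have [h1 h2 h3] := gshift_top k top; split.
  - exact: h1.
  - by move=> a u; rewrite h2; apply/esym/twist_cur.
  - by move=> a r u r0; rewrite twist_cur; apply: h3.
move=> M' act' lev' f topf.
have [F [[F1 F2] F3 F4]] := ind M' (nsh act' (- k)) (nsh_level1 (- k) lev') f (ungshift_top topf).
have nk a r : nsc (- k) a r = - nsc k a r by case: a; rewrite /nsc ?oppr0 //; case: ifP => _; rewrite ?oppr0.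
exists F; split=> //; first split=> // [a r w].
  rewrite tc lfD lfZ F2; change (act' a r (F w) + nsc (- k) a r *: F w + nsc k a r *: F w = act' a r (F w)).
  by rewrite nk scaleNr addrNK.
move=> F' [G1 G2] G3; apply: F4 => //; split=> // a r w.
have := G2 a r w; rewrite tc lfD lfZ => h.
change (F' (curw M a r w) = act' a r (F' w) + nsc (- k) a r *: F' w).
by rewrite nk scaleNr -h addrK.
Qed.

Lemma gen_wt_cur (W : vmod V) a r h w : gen_wt h w -> gen_wt (h - r%:~R) (curw W a r w).
Proof.
move=> [k hk]; exists k; rewrite -[RHS](lf0 (curw W a r)) -hk.
elim: k {hk} => //= k ->; rewrite (lfB (curw W a r)) L0_curw (lfZ (curw W a r)); lincomb.
Qed.

Definition singv (W : vmod V) (x : W) := forall a (r : int), 0 < r -> curw W a r x = 0.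
Lemma singv_act0 (W : vmod V) b (x : W) : singv x -> singv (curw W b 0 x).
Proof.
move=> h a r r0; rewrite (act_comm (curw_level1 W)) !h ?addr0 // lf0 !scaler0 !add0r.
by rewrite gt_eqF // scale0r.
Qed.
Lemma singvL (W : vmod V) c (x y : W) : singv x -> singv y -> singv (c *: x + y).
Proof. by move=> hx hy a r r0; rewrite linearP hx // hy // scaler0 addr0. Qed.

(* A space of singular vectors stable under the zero modes, as a gl(1|1)-module. *)
Section TopMod.
Variables (W : vmod V) (D : lsub W).
Hypotheses (Dp : forall u, D u -> D (par W u)) (Da : forall a u, D u -> D (curw W a 0 u))
  (Ds : forall u, D u -> singv u).
Let si : {linear sub_super Dp -> W} := sincl Dp.
Let sa a : {linear sub_super Dp -> sub_super Dp} := sub_end Dp (@Da a).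
Lemma top_par a u : par (sub_super Dp) (sa a u) = (-1) ^+ glpar a *: sa a (par (sub_super Dp) u).
Proof.
have e1 x : si (par (sub_super Dp) x) = par W (si x) := @sincl_par R W D Dp x.
have e2 c x : si (sa c x) = curw W c 0 (si x) := @sub_endE R W D Dp _ (@Da c) x.
apply: (@sincl_inj _ _ _ Dp); change (si (par (sub_super Dp) (sa a u)) = si ((-1) ^+ glpar a *: sa a (par (sub_super Dp) u))).
by rewrite e1 (lfZ si) !e2 e1 (proj1 (curw_level1 W)).
Qed.
Lemma top_br a b u : sa a (sa b u) - (-1) ^+ (glpar a && glpar b) *: sa b (sa a u) =
    (glbr R a b).1 *: sa (glbr R a b).2 u.
Proof.
apply: (@sincl_inj _ _ _ Dp); rewrite (lfB (sincl Dp)) !(lfZ (sincl Dp)) !sub_endE.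
by rewrite cur_comm0 addrC addKr.
Qed.
Definition topmod : glmod R := Glmod top_par top_br.
Definition topi : {linear topmod -> W} := si.
Lemma topi_act a u : topi (gact topmod a u) = curw W a 0 (topi u).
Proof. exact: sub_endE. Qed.
Lemma topi_par u : topi (par topmod u) = par W (topi u).
Proof. exact: sincl_par. Qed.
Lemma topi_inj : injective topi. Proof. exact: sincl_inj. Qed.
Lemma topi_in u : D (topi u). Proof. exact: sincl_in. Qed.
Lemma topi_ex x : D x -> exists u, topi u = x. Proof. exact: sub_elim. Qed.
Lemma topi_map : top_map (curw W) topi.
Proof.
split=> [u|a u|a r u r0]; rewrite ?topi_par ?topi_act //.
exact: Ds (topi_in u) a r r0.
Qed.
Lemma topi_gen u : irreducible W -> topi u != 0 -> Hgen (curw W) topi.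
Proof.
move=> [_ irr] u0 E Ep Ea Ej w.
have [h|h] := irr E (stable_submod (conj Ep Ea)); last exact: h.
by move: u0; rewrite (h (topi u)) ?eqxx.
Qed.
End TopMod.

Section Irr.
Variable S : vmod V.
Hypotheses (fS : in_Ofin S) (iS : irreducible S).

(** Schur's lemma: E_0 commutes with all modes, so an eigenspace is a submodule. *)
Lemma E_scalar : exists e : K, forall x : S, curw S glE 0 x = e *: x.
Proof.
have [[w w0] irr] := iS; have [_ _ _ ssE] := fS.
have [s [hs ws]] := ssE w.
have [u [us u0]] : exists u, u \in s /\ u != 0.
  apply/not_existsP => h; move/eqP: w0; apply; rewrite ws big_seq big1 // => u us.
  by apply/eqP; apply: contraT => u0; case: (h u).
have [e he] := hs u us; exists e => x.
have st : stable (eig_lsub (curw S glE 0) e).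
  split=> [y hy|a r y hy].
    have := proj1 (curw_level1 S) glE 0 y; rewrite /= expr0 scale1r => /esym ->.
    by rewrite hy lfZ.
  have [->|aN] := pselect (a = glN).
    have := act_comm (curw_level1 S) glE glN 0 r y; rewrite /= expr0 scale1r scale0r addr0 mul0r if_same scale0r addr0 => ->.
    by rewrite hy (lfZ (curw S glN r)).
  by rewrite /= (act_E (curw_level1 S)) // hy (lfZ (curw S a r)).
have [h|h] := irr _ (stable_submod st); last exact: h.
by move: u0; rewrite (h u he) eqxx.
Qed.

(** Going down from an occurring weight h, the last nonzero weight space h - n consists of singular
    vectors. N_0 is diagonalised there, a homogeneous part is taken, and psi^+_0 is applied if it
    does not vanish already; its square is zero. *)
Lemma hw_vector : exists p (m : K) (x : S),
  [/\ x != 0, homog p x, curw S glN 0 x = m *: x, singv x & curw S psip 0 x = 0].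
Proof.
have [[w w0] irr] := iS; have [_ [gr _ bd] ssN _] := fS.
have nz (P : S -> Prop) y : sum_of P y -> y != 0 -> exists u, P u /\ u != 0.
  move=> [s [hs ys]] y0; apply/not_existsP => h; move/eqP: y0; apply; rewrite ys big_seq big1 // => u us.
  by apply/eqP; apply: contraT => u0; case: (h u); split=> //; apply: hs.
have [u [[h hu] u0]] := nz _ _ (gr w) w0.
have [n0 hn0] := bd h.
pose Q n := `[< exists u : S, u != 0 /\ gen_wt (h - n%:R) u >].
have exQ : exists n, Q n by exists 0%N; apply/asboolP; exists u; rewrite subr0.
have bdQ n : Q n -> (n <= n0)%N.
  move/asboolP => [y [y0 hy]]; rewrite leqNgt; apply/negP => nn; move/eqP: y0; apply.
  by apply: (hn0 n) => //; apply: ltnW.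
have [n /asboolP [x [x0 hx]] mx] := ex_maxnP exQ bdQ.
pose D := gwt S (h - n%:R).
have Ds y : D y -> singv y.
  move=> Dy a r r0; apply/eqP; apply: contraT => y0.
  have : Q (n + `|r|)%N.
    apply/asboolP; exists (curw S a r y); split=> //.
    have -> : h - (n + `|r|)%N%:R = (h - n%:R) - r%:~R.
      by rewrite natrD opprD addrA; congr (_ - _); rewrite -[in RHS](gtz0_abs r0).
    exact: gen_wt_cur.
  by move/mx; lia.
have Da a y : D y -> D (curw S a 0 y).
  by move=> /(gen_wt_cur a 0); rewrite subr0.
have Dp y : D y -> D (par S y).
  apply: (genE_map (f := par S)) => z.
  by rewrite /Lop Yw_par (om_homog V) expr0 scale1r.
have [y [[Dy [m hy]] y0]] : exists y, (D y /\ exists c, curw S glN 0 y = c *: y) /\ y != 0.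
  apply: (nz (fun y => D y /\ exists c, curw S glN 0 y = c *: y) x) => //.
  apply: (@sum_of_in _ S (curw S glN 0) D (fun y => Da glN y) (fun c y => curw S glN 0 y = c *: y)) => //.
  - by move=> c; rewrite lf0 scaler0.
  - by move=> c a v1 v2; apply: (@eigEL R S (curw S glN 0)).
  - by move=> c v1; apply: eigE_gen.
have [p [z [z0 hz zN Dz]]] : exists p z, [/\ z != 0, homog p z, curw S glN 0 z = m *: z & D z].
  have pz p : homog p (hpart p y) /\ (curw S glN 0 (hpart p y) = m *: hpart p y /\ D (hpart p y)).
    split; first exact: hpart_homog.
    split; last by apply: hpart_in.
    have := proj1 (curw_level1 S) glN 0 y; rewrite /= expr0 scale1r hy => h1.
    by rewrite /hpart !(lfZ (curw S glN 0)) lfD (lfZ (curw S glN 0)) -h1 hy (lfZ (par S)); lincomb.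
  have [h0|h0] := eqVneq (hpart false y) 0.
    exists true, (hpart true y); have [h1 [h2 h3]] := pz true; split=> //.
    by apply: contraNneq y0 => h4; rewrite (hpartE y) h0 h4 addr0.
  by exists false, (hpart false y); have [h1 [h2 h3]] := pz false.
have [h0|h0] := eqVneq (curw S psip 0 z) 0.
  by exists p, m, z; split=> //; apply: Ds.
exists (~~ p), (m + 1), (curw S psip 0 z); split=> //.
- rewrite /homog (proj1 (curw_level1 S)) hz (lfZ (curw S psip 0)) scalerA; congr (_ *: _).
  by case: (p); rewrite /= !(expr0, expr1); ring.
- by rewrite cur_comm0 zN (lfZ (curw S psip 0)) /=; lincomb.
- exact: Ds (Da _ _ Dz).
have := cur_comm0 psip psip z; rewrite /= scale0r addr0 expr1 scaleN1r => /eqP.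
by rewrite -addr_eq0 -mulr2n -scaler_nat scaler_eq0 (negPf (two_neq0 R)) => /eqP.
Qed.

End Irr.

Section Flip.
Variables (b : bool) (M : vmod V).
Lemma flip_par v n w : par (pish b M) (Yw M v n w) = Yw M (par V v) n (par (pish b M) w).
Proof. by rewrite !pish_par Yw_par (lfZ (Yw M _ _)). Qed.
Definition flip : vmod V := @Vmod R V (pish b M) (Yw M) (Yw_linear (v0 := M)) flip_par
  (Yw_trunc (v0 := M)) (Yw_vac (v0 := M)) (@Yw_borcherds R V M).
Variable (U : glmod R).
Lemma gflip_par a u : par (pish b U) (gact U a u) = (-1) ^+ glpar a *: gact U a (par (pish b U) u).
Proof. by rewrite !pish_par gact_par (lfZ (gact U a)) !scalerA mulrC. Qed.
Definition gflip : glmod R := @Glmod R (pish b U) (gact U) gflip_par (@gact_br R U).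
End Flip.

Lemma flip_top b (U : glmod R) (M : superspace R) (act : gl11 -> int -> {linear M -> M})
   (j : {linear U -> M}) : top_map act j ->
   @top_map R (gflip b U) (pish b M) (act : gl11 -> int -> {linear pish b M -> pish b M}) j.
Proof. by move=> [h1 h2 h3]; split=> // u; rewrite !pish_par h1 lfZ. Qed.

Lemma flip_top' b (U : glmod R) (M : superspace R) (act : gl11 -> int -> {linear M -> M})
   (j : {linear U -> M}) : @top_map R (gflip b U) M act j ->
   @top_map R U (pish b M) (act : gl11 -> int -> {linear pish b M -> pish b M}) j.
Proof.
move=> [h1 h2 h3]; split=> // u; rewrite pish_par h1.
change ((-1) ^+ b *: j ((-1) ^+ b *: par U u) = j (par U u)).
by rewrite lfZ scalerA -expr2 sqrr_sign scale1r.
Qed.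

Lemma Vhat_parity p n e (M : vmod V) : is_Vhat n e M ->
  exists (M' : vmod V) (U : glmod R) (v : U) (j : {linear U -> M'}),
    [/\ is_Verma n e v, is_induced (curw M') j & homog p v].
Proof.
move=> [U [v [j [hv [lev top ind]]]]]; have [[q hq] vN vE vp vb] := hv.
pose b := p (+) q.
have hp : @homog R (gflip b U) p v.
  rewrite /homog pish_par hq scalerA; congr (_ *: _); rewrite /b.
  by case: (p); case: (q); rewrite /= !(expr0, expr1); ring.
exists (flip b M), (gflip b U), v, j; split=> //; first by split=> //; exists p.
split; first exact: curw_level1.
  exact: (flip_top b top).
move=> M' act' lev' f topf.
have [F [[F1 F2] F3 F4]] := ind _ _ (pish_level1 b lev') f (flip_top' topf).
have sg : ((-1) ^+ b * (-1) ^+ b : K) = 1 by rewrite -expr2 sqrr_sign.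
exists F; split=> //.
  split=> // w; change (par M' (F w) = F ((-1) ^+ b *: par M w)).
  by rewrite lfZ -F1 pish_par scalerA sg scale1r.
move=> F' [G1 G2] G3; apply: F4 => //; split=> // w.
rewrite pish_par G1; change ((-1) ^+ b *: F' ((-1) ^+ b *: par M w) = F' (par M w)).
by rewrite lfZ scalerA sg scale1r.
Qed.

Section Irr2.
Variable S : vmod V.
Hypotheses (fS : in_Ofin S) (iS : irreducible S).

Definition haveVhat := forall l : int, l != 0 -> exists M : vmod V, is_Vhat (eps R l) l%:~R M.

Lemma span2L (x y : S) c u w : (exists a b, u = a *: x + b *: y) ->
  (exists a b, w = a *: x + b *: y) -> exists a b, c *: u + w = a *: x + b *: y.
Proof.
by move=> [a [b ->]] [a' [b' ->]]; exists (c * a + a'), (c * b + b'); lincomb.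
Qed.
Lemma eqP_span0 (x y : S) : 0 = 0 *: x + 0 *: y. Proof. by lincomb. Qed.
Definition span2 (x y : S) : lsub S :=
  @Lsub R S (fun u => exists a b, u = a *: x + b *: y)
   (ex_intro _ 0 (ex_intro _ 0 (eqP_span0 x y))) (@span2L x y).

(** If e = 0, one vector killed by both odd zero modes spans the top. If e is not integral, [x] and
    [y] span a Verma module and [induced_of] applies. If e is a nonzero integer, some e + s vanishes
    and that criterion fails; then [S] is exhibited as a quotient of an induced module. *)
Lemma irr_local : haveVhat -> intg S -> local_simple S.
Proof.
move=> hV iS'; have [e hE] := E_scalar fS iS; have [p [m [x [x0 px xN sx xp]]]] := hw_vector fS iS.
pose y := curw S psim 0 x.
have sy : singv y by apply: singv_act0.
have [k hk] : exists k : int, m + e = k%:~R.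
  by apply: (intg_eig iS' x0); rewrite hbE xN hE scalerDl.
have yN : curw S glN 0 y = (m - 1) *: y.
  by rewrite /y cur_comm0 xN (lfZ (curw S psim 0)) /=; lincomb.
have yp : curw S psip 0 y = e *: x.
  by rewrite /y cur_comm0 xp lf0 scaler0 add0r /= hE scale1r.
have ym : curw S psim 0 y = 0.
  have := cur_comm0 psim psim x; rewrite /= -/y scale0r addr0 expr1 scaleN1r => /eqP.
  by rewrite -addr_eq0 -mulr2n -scaler_nat scaler_eq0 (negPf (two_neq0 R)) => /eqP.
have py : par S y = - (-1) ^+ p *: y.
  by rewrite /y (proj1 (curw_level1 S)) px (lfZ (curw S psim 0)); lincomb.
have ex : e *: x = e *: x by [].
have [e0|e0] := eqVneq e 0.
  (* the singular vector killed by all odd zero modes *)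
  have [q [m' [z [z0 pz zN sz [zp zm]]]]] : exists q m' z,
     [/\ z != 0, homog q z, curw S glN 0 z = m' *: z, singv z & curw S psip 0 z = 0 /\ curw S psim 0 z = 0].
    have [h0|h0] := eqVneq y 0; first by exists p, m, x.
    exists (~~ p), (m - 1), y; split=> //; last by rewrite yp e0 scale0r.
    by rewrite /homog py; case: (p); rewrite /= ?expr0 ?expr1 ?opprK.
  pose D := span2 z 0.
  have Dz : D z by exists 1, 0; lincomb.
  have DE u : D u -> exists c, u = c *: z by move=> [a [b ->]]; exists a; lincomb.
  have Dp u : D u -> D (par S u).
    by move=> /DE [c ->]; rewrite (lfZ (par S)) pz scalerA; apply: lsubZ.
  have Da a u : D u -> D (curw S a 0 u).
    move=> /DE [c ->]; rewrite (lfZ (curw S a 0)); apply: lsubZ.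
    case: a; rewrite ?zN ?zp ?zm ?hE; [exact: lsubZ|exact: lsubZ|exact: lsub0|exact: lsub0].
  have Ds u : D u -> singv u.
    by move=> /DE [c ->] a r r0; rewrite (lfZ (curw S a r)) sz // scaler0.
  pose U := topmod Dp Da; pose j : {linear U -> S} := topi Dp Da.
  have [u hu] : exists u, j u = z := topi_ex Dp Da Dz.
  have jinj : injective j := @topi_inj S D Dp Da.
  have jact a w : j (gact U a w) = curw S a 0 (j w) := topi_act a w.
  have hE0 w : gact U glE w = 0 *: w.
    by apply: jinj; rewrite jact (lfZ j) hE e0.
  have gen : Hgen (curw S) j by apply: (topi_gen (u := u) iS); rewrite -/j hu.
  have hA : is_A m' u.
    split.
    - by apply: contraNneq z0 => u0; rewrite -hu u0 lf0.
    - exists q; first by apply: jinj; rewrite topi_par (lfZ j) hu.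
      move=> w; have [c hc] := DE _ (topi_in w); exists c; apply: jinj.
      by rewrite (lfZ j) hu.
    - by apply: jinj; rewrite jact (lfZ j) hu.
    - by split; apply: jinj; rewrite jact hu (lf0 j) ?zp ?zm // hE e0 scale0r.
  left; exists m', 0; split; last first.
    right; split=> //; have [k' hk'] : exists k : int, m' = k%:~R.
      by apply: (intg_eig iS' z0); rewrite hbE zN hE e0 scale0r addr0.
    by exists k'.
  rewrite /is_Ahat eqxx; exists U, u, j; split=> //.
  apply: (induced_of (e := 0)) => //; [exact: curw_level1|exact: topi_map|].
  by move=> s s0; rewrite add0r intr_eq0.
have indep a b : a *: x + b *: y = 0 -> a = 0 /\ b = 0.
  move=> h; have b0 : b = 0.
    have : curw S psip 0 (a *: x + b *: y) = 0 by rewrite h lf0.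
    rewrite lfD !(lfZ (curw S psip 0)) xp yp scaler0 add0r => /eqP.
    by rewrite !scaler_eq0 (negPf e0) (negPf x0) !orbF => /eqP.
  split=> //; move/eqP: h; rewrite b0 scale0r addr0 scaler_eq0 (negPf x0) orbF.
  by move/eqP.
pose n := m - 2%:R^-1.
have nm : n + 2%:R^-1 = m by rewrite /n; field.
have nint : is_half_int (n + e).
  by exists (k - 1); rewrite rmorphB /= -hk /n; field.
have [[l hl]|ne] := pselect (is_int e); last first.
  right; exists n, e; split=> //.
  pose D := span2 x y.
  have Dx : D x by exists 1, 0; lincomb.
  have Dy : D y by exists 0, 1; lincomb.
  have Dp u : D u -> D (par S u).
    by move=> [a [b ->]]; rewrite lfD !(lfZ (par S)) px py; apply: lsubD; rewrite scalerA; apply: lsubZ.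
  have Da a u : D u -> D (curw S a 0 u).
    move=> [c [d ->]]; rewrite lfD !(lfZ (curw S a 0)); apply: lsubD; apply: lsubZ.
      case: a; rewrite ?xN ?xp ?hE //; [exact: lsubZ|exact: lsubZ|exact: lsub0].
    case: a; rewrite ?yN ?yp ?ym ?hE; [exact: lsubZ|exact: lsubZ|exact: lsubZ|exact: lsub0].
  have Ds u : D u -> singv u.
    by move=> [c [d ->]]; apply: singvL sx _ => a r r0; rewrite (lfZ (curw S a r)) sy // scaler0.
  pose U := topmod Dp Da; pose j : {linear U -> S} := topi Dp Da.
  have [u hu] : exists u, j u = x := topi_ex Dp Da Dx.
  have jinj : injective j := @topi_inj S D Dp Da.
  have jact a w : j (gact U a w) = curw S a 0 (j w) := topi_act a w.
  have hE0 w : gact U glE w = e *: w.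
    by apply: jinj; rewrite jact (lfZ j) hE.
  have gen : Hgen (curw S) j by apply: (topi_gen (u := u) iS); rewrite -/j hu.
  exists U, u, j; split; last first.
    apply: (induced_of (e := e)) => //; [exact: curw_level1|exact: topi_map|].
    move=> s s0; apply/eqP => h; apply: ne; exists (- s).
    by rewrite rmorphN; apply/eqP; rewrite -addr_eq0 h.
  have jm : j (gact U psim u) = y by rewrite jact hu.
  split.
  - by exists p; apply: jinj; rewrite topi_par (lfZ j) hu.
  - by apply: jinj; rewrite jact (lfZ j) hu nm.
  - exact: hE0.
  - by apply: jinj; rewrite jact hu (lf0 j).
  move=> w; have [a [b hab]] := topi_in w; exists (a, b); split=> [|[a' b']] /=.
    by apply: jinj; rewrite (lfD j) !(lfZ j) hu jm.
  move=> hw; have := hab; rewrite -/(j w) hw (lfD j) !(lfZ j) hu jm => h.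
  have [h1 h2] : a' - a = 0 /\ b' - b = 0.
    apply: indep; transitivity ((a' *: x + b' *: y) - (a *: x + b *: y)); first lincomb.
    by rewrite h subrr.
  by congr (_, _); apply/esym/eqP; rewrite -subr_eq0 ?h1 ?h2.
have l0 : l != 0 by apply: contraNneq e0 => l0; rewrite hl l0.
left; exists n, l; split; last first.
  left; split=> //; have [k' hk'] := nint; exists (k' - l).
  by rewrite rmorphB /= -hl addrA -hk'; ring.
rewrite /is_Ahat (negPf l0); split=> //.
(* The induced module known at l has N_0-parameter eps(l); the twist moves it to [n], and a parity
   change lets its top vector map to [x] by an even map. *)
have [M0 hM0] := hV l l0.
have hM := twist_Vhat (n - eps R l) hM0; rewrite addrC subrK in hM.
have [M [U [u [j [hu hind hq]]]]] := Vhat_parity p hM; exists M.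
have hM' : is_Vhat n l%:~R M by exists U, u, j.
have [_ _ ind] := hind.
have [f hf] := Verma_lin x y hu.
have [aN aE ap am] := Verma_acts hu; have [_ uN uE up ub] := hu.
pose um := gact U psim u.
have topf : top_map (curw S) f.
  split=> [w|a w|a r w r0]; have [[c d] [/= -> _]] := ub w.
  - rewrite (lfD (par U)) !(lfZ (par U)) gact_par hq (lfZ (gact U psim)) !scalerA !hf.
    by rewrite (lfD (par S)) !(lfZ (par S)) px py; lincomb.
  - rewrite (lfD (gact U a)) !(lfZ (gact U a)) hf (lfD (curw S a 0)) !(lfZ (curw S a 0)).
    case: a; rewrite ?uN ?aN ?uE ?aE ?up ?ap ?am ?xN ?yN ?xp ?yp ?ym ?hE.
    + by rewrite !scalerA hf nm /n; lincomb; field.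
    + by rewrite !scalerA hf hl; lincomb.
    + by rewrite scaler0 add0r scalerA -[_ *: u]addr0 -(scale0r um) hf hl; lincomb.
    + by rewrite scaler0 addr0 -[_ *: _]add0r -(scale0r u) hf -/y; lincomb.
  - by rewrite hf (lfD (curw S a r)) !(lfZ (curw S a r)) sx // sy //; lincomb.
have [F [aF hF _]] := ind _ _ (curw_level1 S) f topf.
have [g hg] := affine_hom aF; exists g; split=> // z.
have sI := im_submod g (submodT M).
have [h|h] := (proj2 iS) _ sI; last by have [w [_ hw]] := h z; exists w.
move: x0; rewrite (h x) ?eqxx //; exists (j u); split=> //.
by rewrite hg hF -[u]scale1r -[1 *: u]addr0 -(scale0r um) hf; lincomb.
Qed.
End Irr2.

Section Converse.
Variable W : vmod V.
Lemma hb0_cur a r (w : W) : exists k : int, hb W 0 (curw W a r w) = curw W a r (hb W 0 w) + k%:~R *: curw W a r w.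
Proof.
exists (match a with psip => 1 | psim => -1 | _ => 0 end).
rewrite !hbE !(act_comm (curw_level1 W) _ a 0 r w) (lfD (curw W a r)) add0r.
by case: a; rewrite /= ?mulr0 ?mul0r ?if_same; lincomb.
Qed.
Definition iP (u : W) := exists k : int, hb W 0 u = k%:~R *: u.
Lemma iPZ c u : iP u -> iP (c *: u).
Proof. by move=> [k hk]; exists k; rewrite lfZ hk; lincomb. Qed.
Lemma iP_cur a r x : sum_of iP x -> sum_of iP (curw W a r x).
Proof.
apply: sum_of_map => u [k hk]; have [k' hk'] := hb0_cur a r u; exists (k + k').
by rewrite hk' hk (lfZ (curw W a r)) rmorphD /=; lincomb.
Qed.
Lemma iP_par x : sum_of iP x -> sum_of iP (par W x).
Proof. by apply: sum_of_map => u [k hk]; exists k; rewrite -hb_par hk (lfZ (par W)). Qed.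
Lemma intg_gen (U : glmod R) (j : {linear U -> W}) : is_induced (curw W) j ->
  (forall u, sum_of iP (j u)) -> intg W.
Proof.
move=> ind hj x; apply: (induced_Hgen ind (D := sum_sub iPZ)) => //.
- exact: iP_par.
- exact: iP_cur.
Qed.
End Converse.

Lemma Vhat_intg n e (W : vmod V) : is_half_int (n + e) -> is_Vhat n e W -> intg W.
Proof.
move=> [k hk] [U [v [j [hv ind]]]]; apply: (intg_gen ind) => u.
have [_ [_ t0 _] _] := ind; have [aN aE _ _] := Verma_acts hv; have [_ vN vE _ vb] := hv.
have [[c d] [/= -> _]] := vb u; rewrite lfD !lfZ.
have h (w : U) : hb W 0 (j w) = j (gact U glN w + gact U glE w) by rewrite hbE -!t0 lfD.
apply: sum_ofD; apply: sum_of1; apply: iPZ; [exists (k + 1)|exists k]; rewrite h -lfZ; congr (j _).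
  rewrite vN vE -scalerDl rmorphD /=; congr (_ *: _).
  by rewrite addrAC hk; field.
rewrite aN aE -scalerDl; congr (_ *: _).
by rewrite addrAC hk; field.
Qed.

Lemma A_intg n (W : vmod V) (U : glmod R) (u : U) (j : {linear U -> W}) : is_int n ->
  is_A n u -> is_induced (curw W) j -> intg W.
Proof.
move=> [k hk] [_ [p _ hU] hN [hE _ _]] ind; apply: (intg_gen ind) => w.
have [c ->] := hU w; rewrite lfZ; apply: sum_of1; apply: iPZ; exists k.
have [_ [_ t0 _] _] := ind.
by rewrite hbE -!t0 hN hE (lf0 j) addr0 (lfZ j) hk.
Qed.

Definition haveVhat1 := forall l : int, l != 0 -> exists M : vmod V,
  is_Vhat (eps R l) l%:~R M /\ exists w : M, w != 0.

Lemma sig4 (A : Type) (B : A -> Type) (C : forall a, B a -> Type) (D : forall a b, C a b -> Type)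
   (P : forall a b c, D a b c -> Prop) :
  (exists a b c d, P a b c d) -> {a : A & {b : B a & {c : C a b & {d : D a b c | P a b c d}}}}.
Proof.
move=> h; have [a ha] := cid h; have [b hb] := cid ha; have [c hc] := cid hb.
by have [d hd] := cid hc; exists a, b, c, d.
Qed.

(** For l > 0 the parameter eps(l) is constantly 1/2, so the modules of the hypothesis at l = 1, 2,
    ... form a family as required by [interp]. *)
Lemma Vhat_neq0 : haveVhat1 -> forall n e (W : vmod V), is_Vhat n e W -> exists w : W, w != 0.
Proof.
move=> hV n e W hW.
have h (m : nat) : {M : vmod V & {U : glmod R & {v : U & {j : {linear U -> M} |
   [/\ is_Verma 2%:R^-1 m.+1%:R v, is_induced (curw M) j & exists w : M, w != 0]}}}}.
  apply: sig4; have [M [[U [v [j [h1 h2]]]] h3]] := hV m.+1%:Z isT.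
  by exists M, U, v, j.
exact: (@interp _ _ (fun m => projT1 (h m)) (fun m => projT1 (projT2 (h m)))
  (fun m => projT1 (projT2 (projT2 (h m)))) (fun m => proj1_sig (projT2 (projT2 (projT2 (h m))))) 2%:R^-1
  (fun m => let: And3 a _ _ := proj2_sig (projT2 (projT2 (projT2 (h m)))) in a)
  (fun m => let: And3 _ a _ := proj2_sig (projT2 (projT2 (projT2 (h m)))) in a)
  (fun m => let: And3 _ _ a := proj2_sig (projT2 (projT2 (projT2 (h m)))) in a) e n W hW).
Qed.

Lemma local_irr (S : vmod V) : haveVhat1 -> vac VV != 0 -> local_simple S -> irreducible S /\ intg S.
Proof.
move=> hV v0 [[n [l [hA hn]]]|[n [e [hS ne hne]]]]; last first.
  split; last exact: Vhat_intg hS.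
  exact: (Vhat_irr (Vhat_neq0 hV hS) hS ne).
move: hA; rewrite /is_Ahat; have [l0|l0] := eqVneq l 0.
  move=> [U [u [j [hu ind]]]]; split.
    by apply: (Ahat0_irr _ hu ind); apply: (Ahat0_neq0 v0 hu ind).
  case: hn => [[_ /eqP] //|[hn _]]; exact: (A_intg hn hu ind).
move=> [irr [M [f [hM sf]]]]; split=> // x.
have hn' : is_half_int (n + l%:~R).
  by case: hn => [[[k ->] _]|[_ /eqP]]; [exists (k + l); rewrite rmorphD addrA|rewrite (negPf l0)].
have [y <-] := sf x; have := Vhat_intg hn' hM y.
by apply: sum_of_map => u [k hk]; exists k; rewrite -hom_hb hk lfZ.
Qed.
End Classify.

(** * The extension A *)

Section Ext.
Variables (R : realType) (V : V1gl11 R) (T : hlz V) (A : extension T).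
Local Notation K := R[i].
Local Notation VV := (Vv V).
Local Notation AA := (extA A).
Local Notation YA := (Y (extV A)).
Local Notation vacA := (vac (extV A)).
Local Notation iU := (extU A).

Lemma YA_borch : gborch YA YA YA (fun a n b => YA a n b).
Proof.
split; [exact: Y_linear| | | | |exact: Y_trunc|exact: Y_trunc|exact: Y_linear|exact: Y_linear].
- by move=> w k c u v; rewrite linearP.
- exact: Y_par.
- exact: Y_trunc.
- exact: Y_borcherds.
Qed.

Lemma YADl u v n b : YA (u + v) n b = YA u n b + YA v n b.
Proof. exact: (boDl YA_borch). Qed.
Lemma YAZl c v n b : YA (c *: v) n b = c *: YA v n b.
Proof. exact: (boZl YA_borch). Qed.

Lemma JA_borch : @borch R V AA AA AA (fun a n b => YA a n b).
Proof.
have hU p v : homog p v -> homog p (iU v).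
  by rewrite /homog => h; have := hom_pare iU v; rewrite h (lfZ iU) => <-.
split; [exact: Y_linear| | | | |exact: Yw_trunc|exact: Yw_trunc|exact: Yw_linear|exact: Yw_linear].
- by move=> w k c u v; rewrite linearP.
- exact: Y_par.
- exact: Y_trunc.
move=> p q v w1 w2 m n k hp hq.
have := @Y_borcherds _ _ (extV A) p q (iU v) w1 w2 m n k (hU p v hp) hq.
under eq_fsbigr do rewrite extU_Y.
move=> ->; apply: eq_fsbigr => j _.
by rewrite !extU_Y.
Qed.

(** The Borcherds identity on vac with m = -1 and k = 0: on the right only a_n (b_(-1) vac) = a_n b
    survives. *)
Lemma skewA p q (a b : AA) (n : int) : homog p a -> homog q b ->
  exists N, YA a n b = - ((-1) ^+ (p && q) * (-1) ^ n) *: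
    \sum_(j < N) (-1) ^+ j *: YA (YA b (n + j%:Z) a) (-1 - j%:Z) vacA.
Proof.
move=> hp hq; have [n0 hn0] := Y_trunc (extV A) b a.
pose N := `|n0 - n|%N.+1; exists N.
have c1 j : (N <= j)%N -> YA b (n + j%:Z) a = 0 by move=> hj; apply: hn0; rewrite /N in hj; lia.
have c2 j : (N <= j)%N -> YA a (0 + j%:Z) vacA = 0 by move=> _; apply: Y_creation0; lia.
have c3 j : (N <= j)%N -> YA b (-1 + j%:Z) vacA = 0 by rewrite /N => hj; apply: Y_creation0; lia.
have e := bo_fin YA_borch hq c1 c2 c3.
have {e} : \sum_(j < N) (-1) ^+ j *: YA (YA b (n + j%:Z) a) (-1 - j%:Z) vacA = - (-1) ^ n *: YA (parX q a) n b.
  transitivity (\sum_(j < N) gbin ((-1)%:~R : K) j *: YA (YA b (n + j%:Z) a) (-1 + 0 - j%:Z) vacA).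
    by apply: eq_bigr => j _; rewrite gbinN1 addr0.
  rewrite e /N big_ord_recl big1 ?addr0; last first.
    move=> j _; rewrite (Y_creation0 (extV A) a) ?lf0; last by lia.
    rewrite (Y_creation0 (extV A) b) ?(lf0 (YA _ _)) ?scaler0 ?subr0 ?scaler0 //.
  rewrite gbin0 expr0 mulr1 scale1r (Y_creation0 (extV A) a) // (lf0 (YA _ _)) sub0r.
  by rewrite Y_creation scaleNr.
rewrite (parXE q hp) => ->.
rewrite YAZl !scalerA mulrNN.
rewrite -[LHS]scale1r; congr (_ *: _); rewrite [q && p]andbC.
by rewrite -[_ * _ * (-1) ^ n]mulrA -expfzMl mulrNN mulr1 exp1rz mulr1 -expr2 sqrr_sign.
Qed.

(** Skew-symmetry expresses u_n a by the x_(-1-j) vac with x = a_(n+j) u in [D], and these are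
    multiples of iterated L_(-1)-derivatives of x. *)
Lemma ideal_two (D : lsub AA) : (forall a n u, D u -> D (YA a n u)) -> (forall u, D u -> D (par AA u)) ->
  forall u n a, D u -> D (YA u n a).
Proof.
move=> Dl Dp.
have tr x : YA (omega (extV A)) 0 x = YA x (-2) vacA.
  by have := Y_translation (extV A) x (-1) vacA; rewrite Y_creation rmorphN1 opprK scale1r.
have cre j x : D x -> D (YA x (-1 - j%:Z) vacA).
  elim: j x => [|j IH] x Dx; first by rewrite subr0 Y_creation.
  have h0 : (- (-1 - j%:Z)%:~R : K) != 0 by rewrite oppr_eq0 intr_eq0; lia.
  have -> : YA x (-1 - j.+1%:Z) vacA = (- (-1 - j%:Z)%:~R)^-1 *: YA (YA (omega (extV A)) 0 x) (-1 - j%:Z) vacA.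
    rewrite Y_translation scalerA mulVf // scale1r; congr (YA _ _ _); lia.
  by apply: lsubZ; apply: IH; apply: Dl.
have key p q u n a : homog p u -> homog q a -> D u -> D (YA u n a).
  move=> hu ha Du; have [N ->] := skewA n hu ha.
  by apply: lsubZ; apply: lsub_sum => j _; apply: lsubZ; apply: cre; apply: Dl.
move=> u n a Du; have hin p : D (hpart p u) by apply: hpart_in.
rewrite [u in YA u]hpartE [a in YA _ n a]hpartE YADl !(lfD (YA _ n)).
by do !apply: lsubD; apply: key (hin _); apply: hpart_homog.
Qed.

Lemma vacA_neq0 : vacA != 0.
Proof. by have [J [_ _ _ _ []]] := ext_sl21 A. Qed.

Lemma A_simple (D : lsub AA) : (forall a n u, D u -> D (YA a n u)) -> (forall u, D u -> D (par AA u)) ->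
  (exists u, D u /\ u != 0) -> forall u, D u.
Proof.
move=> Dl Dp [u [Du u0]]; have [J [_ _ _ _ [_ h]]] := ext_sl21 A.
have [z|//] := h D (lsub0 D) (fun c x y => @lsubL _ _ D c x y) Dp (fun a n x Dx => conj (Dl a n x Dx) (ideal_two Dl Dp n a Dx)).
by move: u0; rewrite (z u Du) eqxx.
Qed.

Definition annA (x : AA) : lsub AA := @Lsub R AA (fun b => forall k, YA b k x = 0)
  (fun k => lf0 (mklin (Y_linear (extV A) k x)))
  (fun c u w hu hw k => etrans (linearP (mklin (Y_linear (extV A) k x)) c u w)
     (etrans (congr2 (fun a b => c *: a + b) (hu k) (hw k)) (etrans (addr0 _) (scaler0 _ c)))).

(** The vectors all of whose modes kill b form an ideal. If it contains a nonzero a, it is all of A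
    and contains vac, whence b = 0. *)
Lemma no_zero_div q (a b : AA) : homog q b -> a != 0 -> b != 0 -> exists k, YA a k b != 0.
Proof.
move=> hb a0 b0; apply/not_existsP => h.
have al n c u : annA b u -> annA b (YA c n u).
  move=> hu k; apply: (gprop_left YA_borch (D := ker_lsub idfun)) => //= v m w ->.
  by rewrite lf0.
have ap u : annA b u -> annA b (par AA u).
  move=> hu k; have := Y_par (extV A) u k b; rewrite hu lf0 hb (lfZ (YA _ _)) => /esym/eqP.
  by rewrite scaler_eq0 signr_eq0 /= => /eqP.
have : annA b vacA.
  apply: (A_simple (fun c n u => @al n c u) ap); exists a; split=> // k.
  by apply/eqP; apply: contraT => hk; case: (h k).
move/(_ (-1)); rewrite Y_vac eqxx => b00; by move: b0; rewrite b00 eqxx.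
Qed.

Definition Agr (m : int) (a : AA) := curw AA glE 0 a = m%:~R *: a.

Lemma E0_comm_A (a b : AA) n : curw AA glE 0 (YA a n b) = YA (curw AA glE 0 a) n b + YA a n (curw AA glE 0 b).
Proof.
have [n0 hn0] := Yw_trunc (v0 := AA) (cur V glE) a.
rewrite /curw (bo_comm JA_borch b 0 n (cur_homog V glE) (N := `|n0|%N.+1)); last first.
  by move=> j hj; apply: hn0; lia.
rewrite /= big_ord_recl big1 => [|j _]; last by rewrite gbinz0 scale0r.
by rewrite gbin0 scale1r addr0 addrC add0r subr0.
Qed.

Lemma Agr_Y m n a b k : Agr m a -> Agr n b -> Agr (m + n) (YA a k b).
Proof.
rewrite /Agr => ha hb; rewrite E0_comm_A ha hb (lfZ (YA _ _)).
by rewrite YAZl rmorphD scalerDl.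
Qed.

Lemma vacV_neq0 : vac VV != 0.
Proof. by apply: contraNneq vacA_neq0 => h; rewrite -(extU_vac A) h lf0. Qed.

Lemma Ahat_irr n m (W : vmod V) : is_Ahat n m W -> irreducible W.
Proof.
rewrite /is_Ahat; case: eqP => [_ [U [u [j [hu ind]]]]|_ []] //.
by apply: (Ahat0_irr _ hu ind); apply: (Ahat0_neq0 vacV_neq0 hu ind).
Qed.

Lemma Ahat_E n m (W : vmod V) : is_Ahat n m W -> forall w : W, curw W glE 0 w = m%:~R *: w.
Proof.
have gE (W' : vmod V) e (U : glmod R) (j : {linear U -> W'}) : is_induced (curw W') j ->
    (forall u, gact U glE u = e *: u) -> forall w, curw W' glE 0 w = e *: w.
  move=> ind hE w; have [lev top _] := ind.
  by apply: (E0_act lev top hE (induced_Hgen ind)).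
rewrite /is_Ahat; case: eqP => [->|m0].
  move=> [U [u [j [[_ [p _ hU] _ [hE _ _]] ind]]]] w; apply: (gE _ _ _ _ ind) => v.
  by have [c ->] := hU v; rewrite (lfZ (gact U glE)) hE scale0r !scaler0.
move=> [_ [M [f [[U [v [j [hv ind]]]] sf]]]] w; have [x <-] := sf w.
by rewrite -(hom_curE f) (gE _ _ _ _ ind (Verma_E hv)) lfZ.
Qed.

Lemma eps_int (m : int) : m != 0 -> is_half_int (eps R m + m%:~R).
Proof.
move=> m0; rewrite /eps (negPf m0); case: ifP => _; first by exists m.
by exists (m - 1); rewrite rmorphB /=; field.
Qed.

Lemma Ahat_intg m (W : vmod V) : is_Ahat (eps R m) m W -> intg W.
Proof.
rewrite /is_Ahat; have [->|m0] := eqVneq m 0.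
  move=> [U [u [j [hu ind]]]]; apply: (A_intg _ hu ind).
  by exists 0; rewrite /eps ltxx eqxx.
move=> [_ [M [f [hM sf]]]] x; have [y <-] := sf x.
have := Vhat_intg (eps_int m0) hM y.
by apply: sum_of_map => u [k hk]; exists k; rewrite -hom_hb hk lfZ.
Qed.

(** Distinct summands have distinct eigenvalues of E_0, so the degree m part is exactly the summand
    of index m. *)
Lemma Agr_dec m : exists (W : vmod V) (f : hom false W AA),
  [/\ is_Ahat (eps R m) m W, injective f & forall x, Agr m x -> exists y, f y = x].
Proof.
have [S [i [hS dec uni]]] := ext_decomp A; exists (S m), (i m); split=> //.
  move=> x y hxy; apply/eqP; rewrite -subr_eq0; apply/eqP.
  pose u := dfwith (fun k => 0 : S k) (x - y).
  have um : u m = x - y by apply: dfwith_in.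
  by rewrite -um; apply: (uni [:: m]); rewrite ?inE // big_seq1 um lfB hxy subrr.
move=> x hx; have [s [u hs]] := dec x.
have hE k (y : S k) : curw AA glE 0 (i k y) = k%:~R *: i k y.
  by rewrite -(hom_curE (i k)) (Ahat_E (hS k)) lfZ.
pose z := \sum_(k <- s | k == m) i m (u m).
have zE : exists y, i m y = z by exists (\sum_(k <- s | k == m) u m); rewrite linear_sum.
have e : x = z + \sum_(k <- s | k != m) i k (u k).
  by rewrite hs (bigID (pred1 m)) /=; congr (_ + _); apply: eq_bigr => k /eqP ->.
have [y hy] := zE; exists y; rewrite hy.
apply/eqP; rewrite -subr_eq0 -opprB oppr_eq0; apply/eqP.
apply: (@genE_othE0 _ _ (curw AA glE 0) m%:~R _ (- \sum_(k <- s | k != m) i k (u k))).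
- by apply: eigE_gen; rewrite /eigE lfB hx -hy hE scalerBr.
- rewrite -sumrN; elim: (s) => [|k r IH]; first by rewrite big_nil; apply: sum_of0.
  rewrite big_cons; case: ifP => // km; apply: sum_ofD IH; apply: sum_of1.
  exists k%:~R; split; first by rewrite eqr_int km.
  by apply: eigE_gen; rewrite /eigE lfN hE scalerN.
by rewrite e [z + _]addrC addrK subrr.
Qed.

Lemma haveV1 : @haveVhat1 R V.
Proof.
move=> l l0; have [W [f [+ _ _]]] := Agr_dec l; rewrite /is_Ahat (negPf l0).
move=> [[[w w0] _] [M [g [hM sg]]]]; exists M; split=> //.
have [x hx] := sg w; exists x; apply: contraNneq w0 => x0.
by rewrite -hx x0 lf0.
Qed.
Lemma haveV0 : @haveVhat R V.
Proof. by move=> l l0; have [M [h _]] := haveV1 l0; exists M. Qed.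

Lemma A_span (D : lsub AA) : (forall m a, Agr m a -> D a) -> forall a, D a.
Proof.
move=> h a; have [S [i [hS dec _]]] := ext_decomp A; have [s [u ->]] := dec a.
apply: lsub_sum => k _; apply: (h k).
by rewrite /Agr -(hom_curE (i k)) (Ahat_E (hS k)) lfZ.
Qed.

Lemma A_intgr : intg AA.
Proof.
move=> a; have [S [i [hS dec _]]] := ext_decomp A; have [s [u ->]] := dec a.
apply: (lsub_sum (D := sum_sub (@iPZ R V AA))) => k _.
have := Ahat_intg (hS k) (u k).
by apply: sum_of_map => v [l hl]; exists l; rewrite -hom_hb hl lfZ.
Qed.

Lemma irr_gen (W : vmod V) (u : W) : irreducible W -> u != 0 -> forall w, gen_by u w.
Proof.
move=> [_ irr] u0 w E sE Eu; have [h|h] := irr E sE; last exact: h.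
by move: u0; rewrite (h u Eu) eqxx.
Qed.

Lemma Agr_gen m (u a : AA) : Agr m u -> u != 0 -> Agr m a -> gen_by u a.
Proof.
move=> hu u0 ha; have [W [f [hW fi fs]]] := Agr_dec m.
have [x hx] := fs u hu; have [y <-] := fs a ha.
move=> E sE Eu; have := irr_gen (u := x) (Ahat_irr hW) _ y.
move=> h; apply: (h _ (fun x => E (f x))); [|exact: pre_submod|by rewrite hx].
by apply: contraNneq u0 => x0; rewrite -hx x0 lf0.
Qed.

Lemma E0_V v : curw AA glE 0 (iU v) = 0.
Proof. by rewrite -(hom_curE iU) /curw /= V_E0 lf0. Qed.

Lemma A0_U (a : AA) : Agr 0 a -> exists v, iU v = a.
Proof.
move=> ha; have := Agr_gen (u := vacA) _ vacA_neq0 ha.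
have h0 : Agr 0 vacA by rewrite /Agr -(extU_vac A) E0_V scale0r.
move=> /(_ h0) /(_ _ (im_submod iU (submodT _))); rewrite -(extU_vac A) => h.
by have [|v [_ hv]] := h; [exists (vac VV)|exists v].
Qed.

Lemma hpart_Agr m p a : Agr m a -> Agr m (hpart p a).
Proof.
rewrite /Agr => ha; have := proj1 (curw_level1 AA) glE 0 a; rewrite /= expr0 scale1r ha => h1.
by rewrite /hpart !(lfZ (curw AA glE 0)) lfD (lfZ (curw AA glE 0)) -h1 ha (lfZ (par AA)); lincomb.
Qed.
Lemma Agr_par m a : Agr m a -> Agr m (par AA a).
Proof.
rewrite /Agr => ha; have := proj1 (curw_level1 AA) glE 0 a; rewrite /= expr0 scale1r ha => <-.
by rewrite lfZ.
Qed.

(* b_n a, b in A_m, a in A_{-m}, span a nonzero submodule of the simple A_0 *)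
Lemma vac_prod m (D : lsub AA) : (forall b n a, Agr m b -> Agr (- m) a -> D (YA b n a)) ->
  submod D -> D vacA.
Proof.
have nz k : exists (u : AA) p, [/\ Agr k u, u != 0 & homog p u].
  have [W [f [hW fi _]]] := Agr_dec k; have [[w w0] _] := Ahat_irr hW.
  have fw0 : f w != 0 by apply: contraNneq w0 => h; rewrite -(inj_eq fi) h lf0.
  have hf : Agr k (f w) by rewrite /Agr -(hom_curE f) (Ahat_E hW) lfZ.
  have [h0|h0] := eqVneq (hpart false (f w)) 0.
    exists (hpart true (f w)), true; split; [exact: hpart_Agr| |exact: hpart_homog].
    by apply: contraNneq fw0 => h4; rewrite (hpartE (f w)) h0 h4 addr0.
  by exists (hpart false (f w)), false; split; [exact: hpart_Agr| |exact: hpart_homog].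
move=> hD sD; have [b [p [hb b0 _]]] := nz m; have [a [q [ha a0 hq]]] := nz (- m).
have [k hk] := no_zero_div hq b0 a0.
have h0 : Agr 0 (YA b k a) by have := Agr_Y k hb ha; rewrite subrr.
apply: (Agr_gen h0 hk _ sD); last exact: hD.
by rewrite /Agr -(extU_vac A) E0_V scale0r.
Qed.

(** A nonzero space of singular vectors of weight c + 1 would generate [W], whose weights would then
    be c + 1 + d with d >= 0; this leaves no room for v. The vanishing supplies the null vectors
    behind the lattice relations. *)
Lemma sing_zero (W : vmod V) c (v x : W) : irreducible W -> v != 0 -> Lop W 0 v = c *: v ->
  singv x -> Lop W 0 x = (c + 1) *: x -> x = 0.
Proof.
move=> irr v0 hv sx hx; apply/eqP; apply: contraT => x0.
have s0 : singv (0 : W) by move=> a r _; rewrite lf0.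
have l0 : Lop W 0 (0 : W) = (c + 1) *: 0 by rewrite lf0 scaler0.
pose D := @Lsub R W (fun y => singv y /\ Lop W 0 y = (c + 1) *: y) (conj s0 l0)
  (fun a u w hu hw => conj (@singvL R V W a u w (proj1 hu) (proj1 hw))
     (@eigEL R W (Lop W 0) (c + 1) a u w (proj2 hu) (proj2 hw))).
have Dp u : D u -> D (par W u).
  move=> [h1 h2]; split.
    move=> a r r0; have := proj1 (curw_level1 W) a r u; rewrite h1 // lf0 => /esym/eqP.
    by rewrite scaler_eq0 signr_eq0 /= => /eqP.
  have := Yw_par (v0 := W) (omega VV) 1 u; rewrite (om_homog V) expr0 scale1r -/(Lop W 0 _) => <-.
  by rewrite -/(Lop W 0 u) h2 lfZ.
have Da a u : D u -> D (curw W a 0 u).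
  by move=> [h1 h2]; split; [exact: singv_act0|rewrite L0_curw h2 (lfZ (curw W a 0)); lincomb].
have Ds u : D u -> singv u by case.
have [u hu] : exists u, topi Dp Da u = x by apply: topi_ex.
have gen : Hgen (curw W) (topi Dp Da) by apply: (topi_gen (u := u)) => //; rewrite hu.
have hc a (w : W) : (exists d : nat, Lop W 0 w = (c + 1 + d%:R) *: w) ->
    exists d : nat, Lop W 0 (a *: w) = (c + 1 + d%:R) *: (a *: w).
  by move=> [d hd]; exists d; rewrite lfZ hd; lincomb.
have wt : sum_of (fun u => exists d : nat, Lop W 0 u = (c + 1 + d%:R) *: u) v.
  have := cl_all (curw_level1 W) (topi_map Dp Da Ds) gen v.
  apply: (cl_ind' (D := sum_sub hc)) => [y|a s y _ s0' _ hy].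
    by apply: sum_of1; exists 0%N; have [_ ->] := topi_in y; rewrite addr0.
  apply: sum_of_map hy => z [d hd]; exists (d + s)%N; rewrite L0_curw hd (lfZ (curw _ _ _)).
  by rewrite natrD rmorphN; lincomb.
apply/eqP/(contraNeq _ v0) => _; apply/eqP/(@genE_othE0 _ _ (Lop W 0) c _ (- v)); last by rewrite subrr.
  exact: eigE_gen.
have hn : sum_of (fun u => exists d : nat, Lop W 0 u = (c + 1 + d%:R) *: u) (- v).
  by rewrite -scaleN1r; apply: sum_ofZ wt => a w; apply: hc.
apply: sum_of_impl hn => y [d hd]; exists (c + 1 + d%:R); split; last exact: eigE_gen.
by rewrite -addrA -subr_eq0 [c + _]addrC addrK addrC natr1 pnatr_eq0.
Qed.

Lemma lat_hom m (W : vmod V) (f : hom false W AA) (u : W) : lat m u -> lat m (f u).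
Proof.
move=> [h1 h2 h3]; split.
- by move=> r r0; rewrite -hom_hb h1 // lf0.
- by rewrite -hom_hb h2 lfZ.
- by rewrite -(hom_L f) h3 lfZ hom_hb.
Qed.

Lemma hw_quot n l (W : vmod V) : is_Ahat n l W -> l != 0 -> exists (x : W) p,
  [/\ x != 0, homog p x, curw W glN 0 x = (n + 2%:R^-1) *: x, curw W psip 0 x = 0 & singv x].
Proof.
move=> hA l0; move: (hA); rewrite /is_Ahat (negPf l0).
move=> [[[w w0] _] [M [g [[U [v [j [[[p hp] hN _ hps hb] ind]]]] sg]]]]; have [lev [t1 t2 t3] _] := ind.
have ga a r y : g (curw M a r y) = curw W a r (g y) by rewrite hom_cur expr0 scale1r.
exists (g (j v)), p; split.
- apply: contraNneq w0 => x0; have [y <-] := sg w.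
  apply/eqP; apply: (induced_Hgen ind (D := pre_lsub g (ker_lsub idfun))) => /=.
  + by move=> u hu; rewrite hom_pare hu lf0.
  + by move=> a r u hu; rewrite ga hu lf0.
  move=> u; have [c [-> _]] := hb u; rewrite lfD !lfZ t2 lfD !lfZ ga x0.
  by rewrite (lf0 (curw W psim 0)) !scaler0 addr0.
- by rewrite /homog -hom_pare t1 hp !lfZ.
- by rewrite -ga -t2 hN !lfZ.
- by rewrite -ga -t2 hps !lf0.
- by move=> a r r0; rewrite -ga t3 // lf0.
Qed.

Section LatPM.
Variables (W : vmod V) (x : W).
Hypotheses (irr : irreducible W) (x0 : x != 0) (xp : curw W psip 0 x = 0) (sx : singv x).

Let pull (b : gl11) (y : W) : singv y ->
  (forall a, (glbr R a b).1 *: curw W (glbr R a b).2 0 y + glform R a b *: y = 0) ->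
  singv (curw W b (-1) y).
Proof.
move=> sy hb a r r0; rewrite (act_comm (curw_level1 W)) sy // lf0 scaler0 add0r.
have [r1|r1] := eqVneq r 1.
  by rewrite r1 subrr eqxx mul1r hb.
rewrite sy; last by lia.
by rewrite scaler0 add0r (_ : (r + -1 == 0) = false) ?scale0r //; apply/eqP; lia.
Qed.

(** The vector psi^+_(-1) x is singular of weight 2 while x has weight 1, so it is zero. Its image
    under psi^-_0 gives psi^+_(-1) psi^-_0 x = E_(-1) x, and the Sugawara expression of L_(-1) x
    becomes (N + E)_(-1) x. *)
Lemma lat_p1 : curw W glN 0 x = x -> curw W glE 0 x = x -> lat 1 x.
Proof.
move=> xN xE; have pm : curw W psip 0 (curw W psim 0 x) = x.
  by rewrite cur_comm0 xp lf0 scaler0 add0r /= scale1r.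
have Lx : Lop W 0 x = 1 *: x.
  rewrite L0_sing // xN xE xN xE xp pm (lf0 (curw W psim 0)).
  by lincomb; field.
have z : curw W psip (-1) x = 0.
  apply: (sing_zero irr x0 Lx); last by rewrite L0_curw Lx (lfZ (curw W psip (-1))) rmorphN; lincomb.
  by apply: pull => //; case; rewrite /= ?xp ?xE; lincomb.
have h : curw W psip (-1) (curw W psim 0 x) = curw W glE (-1) x.
  by rewrite (act_comm (curw_level1 W)) z lf0 /=; lincomb.
split; first by move=> r r0; rewrite hbE !sx // addr0.
- by rewrite hbE xN xE; lincomb.
- by rewrite Lm1_sing // xN xE xp h (lf0 (curw W psim (-1))) hbE; lincomb.
Qed.

(** In degree -1 the highest weight vector has h_0-charge -1; the charge -2 of e^(-alpha) belongs to
    psi^-_0 x, for which the argument runs with the two fermions exchanged. *)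
Lemma lat_m1 (u := curw W psim 0 x) : curw W glN 0 x = 0 -> curw W glE 0 x = - x ->
  lat (-1) u /\ u != 0.
Proof.
move=> xN xE; have pm : curw W psip 0 u = - x.
  by rewrite /u cur_comm0 xp lf0 scaler0 add0r /= scale1r.
have mm : curw W psim 0 u = 0.
  have := cur_comm0 psim psim x; rewrite /= -/u scale0r addr0 expr1 scaleN1r => /eqP.
  by rewrite -addr_eq0 -mulr2n -scaler_nat scaler_eq0 (negPf (two_neq0 R)) => /eqP.
have su : singv u by apply: singv_act0.
have uN : curw W glN 0 u = - u by rewrite /u cur_comm0 xN lf0 /=; lincomb.
have uE : curw W glE 0 u = - u by rewrite /u cur_comm0 xE (lfN (curw W psim 0)) /=; lincomb.
have u0 : u != 0 by apply: contraNneq x0 => h; rewrite -oppr_eq0 -pm h lf0.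
have uNx : curw W psim 0 (- x) = - u by rewrite lfN.
have Lu : Lop W 0 u = 1 *: u.
  rewrite L0_sing // uN uE !(lfN (curw W glN 0)) !(lfN (curw W glE 0)) uN uE pm mm (lf0 (curw W psip 0)) uNx.
  by lincomb; field.
have z : curw W psim (-1) u = 0.
  apply: (sing_zero irr u0 Lu); last by rewrite L0_curw Lu (lfZ (curw W psim (-1))) rmorphN; lincomb.
  by apply: pull => //; case; rewrite /= ?mm ?uE; lincomb.
have h : curw W psim (-1) x = - curw W glE (-1) u.
  have := act_comm (curw_level1 W) psip psim 0 (-1) u; rewrite z lf0 pm (lfN (curw W psim (-1))) /=.
  rewrite scale0r addr0 scale1r expr1 scaleN1r opprK sub0r => /esym/eqP.
  by rewrite addr_eq0 => /eqP.
split=> //; split; first by move=> r r0; rewrite hbE !su // addr0.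
- by rewrite hbE uN uE; lincomb.
- rewrite Lm1_sing // uN uE mm pm !(lfN (curw W _ _)) h (lf0 (curw W psip (-1))) hbE.
  by lincomb.
Qed.
End LatPM.

(** The product of A in the form of an intertwining operator, to which the results on [lat] vectors
    apply. *)
Definition muI : intw AA AA AA := icomp (tenI T AA AA) (extmu A).
Lemma muIE a (n : int) b : muI a n%:~R 0%N b = YA a n b.
Proof. by rewrite icompE (proj1 (extmuE A)). Qed.

Definition isu (m : int) (u : AA) := exists p, [/\ Agr m u, u != 0, homog p u & lat m%:~R u].

(** The new vector is a leading coefficient. Were it zero, [Ic_in] would make all coefficients zero,
    against [no_zero_div]; its exponent is integral, so it is a mode u'_k u. *)
Lemma isu_step m m' u u' : isu m u -> isu m' u' -> exists w, isu (m' + m) w.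
Proof.
move=> [p [hu u0 pu lu]] [q [hu' u0' pu' lu']].
have [lv lh lL] := lu.
pose w := Ic muI m'%:~R (2%:R * m%:~R) u' u 0.
have w0 : w != 0.
  apply/eqP => h; have [k] := no_zero_div pu u0' u0.
  rewrite -muIE => /eqP; apply.
  have := @Ic_in _ _ _ _ _ muI _ _ _ _ lu' lv lh (ker_lsub idfun); apply=> //.
  by split=> [//|c x y|y|v n y] /=; rewrite ?lf0 //; [move=> -> ->; rewrite scaler0 addr0|move=> ->; rewrite lf0|move=> ->; rewrite lf0].
have wE : exists k : int, w = YA u' k u.
  exists (- 1 - m' * (2%:Z * m)); rewrite -muIE; congr (muI _ _ _ _).
  by rewrite subr0 rmorphB rmorphN1 /= !rmorphM.
exists w, (q (+) p); split=> //.
- by have [k ->] := wE; apply: Agr_Y.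
- rewrite /homog /w /Ic i_par pu pu' intwZl (lfZ (muI _ _ _)) scalerA signr_addb //.
by rewrite rmorphD; apply: (Ic_lat muI lu' lv lh erefl lL).
Qed.

Lemma isu0 : isu 0 vacA.
Proof.
exists false; split; first by rewrite /Agr -(extU_vac A) E0_V scale0r.
- exact: vacA_neq0.
- by have := vac_even (extV A).
have hz (r : int) : 0 <= r -> hb AA r vacA = 0.
  by move=> r0; rewrite -(extU_vac A) -(hom_hb iU) /hb /= Y_creation0 // lf0.
split; first by move=> r r0; apply: hz; apply: ltW.
- by rewrite hz // mulr0 scale0r.
by rewrite scale0r -(extU_vac A) -(hom_L iU) /Lop /= addNr Y_creation0 // lf0.
Qed.

Lemma isu_pm : (exists u, isu 1 u) /\ (exists u, isu (-1) u).
Proof.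
split.
  have [W [f [hW fi _]]] := Agr_dec 1; have [x [p [x0 px xN xp sx]]] := hw_quot hW isT.
  exists (f x), p; split.
  - by rewrite /Agr -(hom_curE f) (Ahat_E hW) lfZ.
  - by apply: contraNneq x0 => h; rewrite -(inj_eq fi) h lf0.
  - by rewrite /homog -(hom_pare f) px lfZ.
  apply: lat_hom; apply: (lat_p1 (Ahat_irr hW) x0 xp sx); last by rewrite (Ahat_E hW) scale1r.
  by rewrite xN /eps /= (_ : 2%:R^-1 + 2%:R^-1 = 1 :> K) ?scale1r //; field.
have [W [f [hW fi _]]] := Agr_dec (-1); have [x [p [x0 px xN xp sx]]] := hw_quot hW isT.
have [l u0] : lat (-1) (curw W psim 0 x) /\ curw W psim 0 x != 0.
  apply: (lat_m1 (Ahat_irr hW) x0 xp sx); last by rewrite (Ahat_E hW) rmorphN1 scaleN1r.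
  by rewrite xN /eps /= addNr scale0r.
exists (f (curw W psim 0 x)), (~~ p); split.
- by rewrite /Agr -(hom_curE f) (Ahat_E hW) lfZ.
- by apply: contraNneq u0 => h; rewrite -(inj_eq fi) h lf0.
- have h : homog (~~ p) (curw W psim 0 x).
    rewrite /homog (proj1 (curw_level1 W)) px (lfZ (curw W psim 0)) scalerA; congr (_ *: _).
    by case: (p); rewrite /= !(expr0, expr1); ring.
  by rewrite /homog -(hom_pare f) h (lfZ f).
by rewrite rmorphN1; apply: lat_hom.
Qed.

Lemma isu_ex m : exists u, isu m u.
Proof.
have [[u1 h1] [u_ h_]] := isu_pm.
elim/int_ind: m => [|n [u hu]|n [u hu]]; first by exists vacA; exact: isu0.
  by have := isu_step hu h1; rewrite -PoszD add1n.
have [w hw] := isu_step hu h_; exists w.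
by have <- : -1 + - n%:Z = - n.+1%:Z by lia.
Qed.
End Ext.

(** * Monodromy with A *)

Section Cexp.
Variable R : realType.
Local Notation K := R[i].

Lemma cexpD (a b : K) : cexp (a + b) = cexp a * cexp b.
Proof.
case: a b => [a1 a2] [b1 b2]; rewrite /cexp /= expRD cosD sinD rmorphM /=.
rewrite -[LHS]mulrA -[RHS]mulrA; congr (_ * _); rewrite [RHS]mulrCA; congr (_ * _).
by apply/eqP; rewrite eq_complex /= [sin a2 * _ + _]addrC; apply/andP; split; apply/eqP; ring.
Qed.
Lemma cexp_ipi : cexp (ipi R) = -1.
Proof.
rewrite /cexp /= expR0 mul1r cospi sinpi.
by apply/eqP; rewrite eq_complex /= oppr0 !eqxx.
Qed.
Lemma cexp0 : cexp (0 : K) = 1.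
Proof. by rewrite /cexp /= expR0 mul1r cos0 sin0. Qed.
Lemma cexp_int (m : int) : cexp (ipi R * m%:~R) = (-1) ^ m.
Proof.
have key (n : nat) : cexp (ipi R * n%:R) = (-1) ^+ n.
  elim: n => [|n IH]; first by rewrite mulr0 cexp0.
  by rewrite -natr1 mulrDr mulr1 cexpD IH cexp_ipi exprSr.
case: m => n; first exact: key.
have : cexp (ipi R * (Negz n)%:~R) * cexp (ipi R * n.+1%:R) = 1.
  by rewrite -cexpD -mulrDr NegzE rmorphN addNr mulr0 cexp0.
rewrite key => e; have n0 : (-1 : K) ^+ n.+1 != 0 by rewrite signr_eq0.
by apply: (mulIf n0); rewrite e -[(-1) ^ Negz n]/(((-1 : K) ^+ n.+1)^-1) mulVf.
Qed.
(** Subtracting the floor of the real part leaves x + i y with 0 <= x < 1 and exponential 1 or -1.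
    The vanishing of sin(pi x) gives x = 0, and positivity of the real exponential excludes -1 and
    gives y = 0. *)
Lemma cexp_sq (c : K) : cexp (ipi R * c) * cexp (ipi R * c) = 1 -> exists k : int, c = k%:~R.
Proof.
move=> h; pose k := Num.floor (complex.Re c); exists k.
pose c' := c - k%:~R.
have e1 : cexp (ipi R * c') * cexp (ipi R * c') = 1.
  have -> : ipi R * c' = ipi R * c + ipi R * (- k)%:~R by rewrite rmorphN mulrN /c' mulrBr.
  by rewrite cexpD cexp_int mulrACA h mul1r -expfzMl mulrNN mulr1 exp1rz.
have r1 : complex.Re c' = complex.Re c - k%:~R.
  have kE : (k%:~R : K) = (k%:~R : R)%:C by rewrite rmorph_int.
  by rewrite /c' kE; case: (c) => a b.
suff : c' = 0 by move/eqP; rewrite subr_eq0 => /eqP.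
have r0 : 0 <= complex.Re c' < 1.
  rewrite r1 subr_ge0 ltrBlDr; have /andP [-> h2] := real_floor_itv (num_real (complex.Re c)).
  by move: h2; rewrite -/k rmorphD /= addrC.
have {}e1 : cexp (ipi R * c') ^+ 2 = 1 by rewrite expr2.
move/eqP: e1; rewrite sqrf_eq1; clearbody c'; case: c' r0 {r1} => [x y] /= r0.
have -> : ipi R * (x +i* y) = (- (pi * y)) +i* (pi * x).
  by apply/eqP; rewrite eq_complex /= !mul0r sub0r add0r !eqxx.
have -> : cexp ((- (pi * y)) +i* (pi * x)) = (expR (- (pi * y)) * cos (pi * x)) +i* (expR (- (pi * y)) * sin (pi * x)).
  by apply/eqP; rewrite eq_complex /cexp /= !mul0r subr0 addr0 !eqxx.
have e0 : expR (- (pi * y)) != 0 by rewrite gt_eqF // expR_gt0.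
have s0 z : (expR (- (pi * y)) * cos (pi * x)) +i* (expR (- (pi * y)) * sin (pi * x)) == z%:C ->
    sin (pi * x) = 0 /\ expR (- (pi * y)) * cos (pi * x) = z.
  by rewrite eq_complex /= mulf_eq0 (negPf e0) => /andP [/eqP -> /eqP ->].
have x0 : sin (pi * x) = 0 -> x = 0.
  move=> hs; move: r0 => /andP []; rewrite le_eqVlt => /orP [/eqP -> //|x_gt0] x_lt1.
  have : 0 < sin (pi * x).
    apply: sin_gt0_pi; rewrite mulr_gt0 ?pi_gt0 //= -[ltRHS]mulr1 ltr_pM2l ?pi_gt0 //.
  by rewrite hs ltxx.
have h1 : (1 : K) = (1 : R)%:C by [].
have h2 : (-1 : K) = (-1 : R)%:C by rewrite rmorphN1.
case/orP; [rewrite h1|rewrite h2] => /s0 [/x0 ->]; rewrite mulr0 cos0 mulr1 => e.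
  move: e; rewrite -[RHS]expR0 => /expR_inj /eqP.
  rewrite oppr_eq0 mulf_eq0 gt_eqF ?pi_gt0 //= => /eqP ->.
  by apply/eqP; rewrite eq_complex /= eqxx.
by have := expR_gt0 (- (pi * y)); rewrite e ltr0N1.
Qed.
(** The coefficient of degree t in e^x e^(-x) = 1. *)
Lemma exp_conv (t : nat) : \sum_(j < t.+1) (j`!%:R^-1 : K) * ((-1) ^+ (t - j) / (t - j)`!%:R) = (t == 0%N)%:R.
Proof.
apply: (mulfI (fact_unit R t)).
transitivity (\sum_(j < t.+1) ((-1) ^+ (t - j) * 1 ^+ j *+ 'C(t, j) : K)).
  rewrite mulr_sumr; apply: eq_bigr => j _; rewrite expr1n mulr1 -mulr_natr.
  have jt : (j <= t)%N by have := ltn_ord j.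
  rewrite -(bin_fact jt) !natrM; field.
  by rewrite !fact_unit.
rewrite -exprDn addNr; case: t => [|t]; first by rewrite expr0 mulr1 fact0.
by rewrite expr0n mulr0.
Qed.
End Cexp.

Section Good.
Variables (R : realType) (V : V1gl11 R) (T : hlz V) (A : extension T).
Local Notation K := R[i].
Local Notation VV := (Vv V).
Local Notation AA := (extA A).
Variable X : indO V.

(** The indices of terms absent from a series in integral powers of x without logarithms. *)
Definition bad (h : K) (k : nat) := k <> 0%N \/ forall n : int, h <> n%:~R.
Lemma bad_shift h k (n : int) : bad h k -> bad (h + n%:~R) k.
Proof.
move=> [h0|h0]; [by left|right=> m e; apply: (h0 (m - n))].
by rewrite rmorphB /= -e addrK.
Qed.

Definition zlsub (M : superspace R) : lsub M := ker_lsub (idfun : {linear M -> M}).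
Lemma zsub (W : vmod V) : submod (zlsub W).
Proof. by split=> [//|c x y|y|v n y] /=; rewrite ?lf0 //; [move=> -> ->; rewrite scaler0 addr0|move=> ->; rewrite lf0|move=> ->; rewrite lf0]. Qed.

(** By [heis_all] the claim is only needed for vacuum vectors y of integral charge j, and by
    irreducibility of the degrees of A for lattice vectors; then [lat_zero] leaves the powers x^(m j
    + d) and no logarithm. *)
Lemma good_l : intg X -> forall a h k x, bad h k -> tenI T AA X a h k x = 0.
Proof.
move=> iX a h k x bhk.
suff : forall n : int, tenI T AA X a (h + n%:~R) k x = 0 by move/(_ 0); rewrite addr0.
pose J (a : AA) (n : int) (x : X) := tenI T AA X a (h + n%:~R) k x.
have bJ : borch J := borch_intw (tenI T AA X) h k.
pose G := @Lsub R X (fun x => forall a n, J a n x = 0) (fun a n => lf0 _)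
  (fun c u w hu hw a n => etrans (linearP (tenI T AA X a (h + n%:~R) k) c u w)
    (etrans (congr2 (fun a b => c *: a + b) (hu a n) (hw a n)) (etrans (addr0 _) (scaler0 _ c)))).
have DY v n u : zlsub (ten T AA X) u -> zlsub (ten T AA X) (Yw _ v n u).
  by move=> /= ->; rewrite lf0.
suff Gx : G x by move=> n; apply: Gx.
apply: (heis_all (G := G) (@indOP _ _ X) iX) => [r y r0 Gy b n|y j vy hy b n].
  by apply: (gprop_right bJ DY (P := fun=> True)) => // c _ m; apply: Gy.
move: n; have hz : forall n, J 0 n y = 0 by move=> n; rewrite (bo0l bJ).
pose E := @Lsub R AA (fun a => forall n, J a n y = 0) hz
  (fun c u w hu hw n => etrans (bo_lin1 bJ n y c u w)
    (etrans (congr2 (fun a b => c *: a + b) (hu n) (hw n)) (etrans (addr0 _) (scaler0 _ c)))).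
move: b; apply: (A_span (D := E)) => m b ha n.
have [u [p [hu u0 pu lu]]] := isu_ex A m.
have hu1 l : zlsub (ten T AA X) (J u l y).
  rewrite /= /J; apply: (lat_zero (tenI T AA X) lu vy hy).
  case: bhk => [k0|hn]; first by left.
  right=> -[d hd]; apply: (hn (-1 - m * j - d%:Z - l)).
  by rewrite !rmorphB rmorphN1 rmorphM /= -hd addrK.
exact: (propagate bJ (zsub (ten T AA X)) pu hu1 (Agr_gen hu u0 ha) (fun E _ h => h) n).
Qed.

Lemma bilin_eq (W1 W2 : indO V) (N : lmodType K) (f g : {linear ten T W1 W2 -> N}) :
  (forall p q w1 h k w2, homog p w1 -> homog q w2 ->
    f (tenI T W1 W2 w1 h k w2) = g (tenI T W1 W2 w1 h k w2)) -> f =1 g.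
Proof.
move=> e; apply: ten_eq => w1 h k w2.
rewrite (hpartE w1) (hpartE w2) intwDl !(lfD (tenI T W1 W2 _ h k)) !lfD.
by congr ((_ + _) + (_ + _)); apply: (e _ _); apply: hpart_homog.
Qed.

Lemma skew_zero (W1 W2 W3 : vmod V) (I : intw W1 W2 W3) w1 h k w2 :
  (forall (j l : nat), (k <= l)%N -> I w1 (h + j%:R) l w2 = 0) -> skew I w1 h k w2 = 0.
Proof.
move=> e; apply: fsum_zero => j; rewrite [X in iter j _ X]fsum_zero.
  by rewrite (iter0_lin (Lop W3 (-1))) scaler0.
move=> l; have [kl|lk] := leqP k l; first by rewrite e // scaler0.
by rewrite bin_small // !mul0r scale0r.
Qed.

(* the other order vanishes because the braiding is injective *)
Lemma braid_zero (W1 W2 : indO V) p q w1 w2 h k : homog p w1 -> homog q w2 ->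
  (forall (j l : nat), (k <= l)%N -> tenI T W2 W1 w2 (h + j%:R) l w1 = 0) ->
  tenI T W1 W2 w1 h k w2 = 0.
Proof.
move=> hp hq e; apply: (bij_inj (braid_bij T W1 W2)).
by rewrite lf0 (braidE T h k hp hq) (skew_zero e) scaler0.
Qed.

Lemma good_r : intg X -> forall a h k x, bad h k -> tenI T X AA x h k a = 0.
Proof.
move=> iX a h k x b; rewrite (hpartE x) (hpartE a) intwDl !(lfD (tenI T X AA _ h k)).
have e p q : tenI T X AA (hpart p x) h k (hpart q a) = 0.
  apply: (braid_zero (hpart_homog p x) (hpart_homog q a)) => j l kl.
  apply: good_l => //; have := bad_shift j%:Z b; move=> [h0|h0]; [left|by right].
  by move=> l0; apply: h0; move: kl; rewrite l0 leqn0 => /eqP.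
by rewrite !e !addr0.
Qed.

Lemma skew_good (W1 W2 W3 : vmod V) (I : intw W1 W2 W3) w1 (n : int) w2 (N : nat) :
  (forall h k, bad h k -> I w1 h k w2 = 0) ->
  (forall j, (N <= j)%N -> I w1 (n + j%:Z)%:~R 0%N w2 = 0) ->
  skew I w1 n%:~R 0 w2 = \sum_(j < N) (j`!%:R^-1 * (-1) ^ (n + j%:Z + 1)) *:
    iter j (Lop W3 (-1)) (I w1 (n + j%:Z)%:~R 0%N w2).
Proof.
move=> hb hN.
have inner (j : nat) : \sum_(l \in [set: nat])
       ('C(l, 0)%:R * ipi R ^+ (l - 0) * cexp (ipi R * (- (n%:~R + j%:R) - 1)))
         *: I w1 (n%:~R + j%:R) l w2 = (-1) ^ (n + j%:Z + 1) *: I w1 (n + j%:Z)%:~R 0%N w2.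
  rewrite (fsum_single (i0 := 0%N)) => [|l l0]; last first.
    by rewrite hb ?scaler0 //; left; apply/eqP.
  rewrite bin0 mul1r expr0 mul1r rmorphD /=; congr (_ *: _).
  have -> : - (n%:~R + j%:R) - 1 = (- (n + j%:Z + 1))%:~R :> K.
    by rewrite rmorphN !rmorphD rmorph1 /= [RHS]opprD.
  rewrite cexp_int; case: (n + j%:Z + 1) => m; rewrite ?NegzE ?opprK -?exprnP -?exprnN.
    by rewrite -signr_odd; case: odd; rewrite ?expr1 ?expr0 ?invrN ?invr1.
  by rewrite -signr_odd; case: odd; rewrite ?expr1 ?expr0 ?invrN ?invr1.
have itZ j c (y : W3) : iter j (Lop W3 (-1)) (c *: y) = c *: iter j (Lop W3 (-1)) y.
  by have := iterS_lin (Lop W3 (-1)) j c y 0; rewrite addr0 iter0_lin addr0.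
rewrite /skew (fsum_nat (n := N)) => [|j hj]; last first.
  by rewrite inner hN // scaler0 iter0_lin scaler0.
by apply: eq_bigr => j _; rewrite inner itZ scalerA.
Qed.

(** On integral powers without logarithms e^(i pi) acts by signs, so the two braidings compose to
    e^(x L_(-1)) e^(-x L_(-1)) = 1, which is [exp_conv] coefficient by coefficient. *)
Lemma braid_sq : intg X -> forall t, braid T X AA (braid T AA X t) = t.
Proof.
move=> iX; apply: (@bilin_eq _ _ _ (hcomp (braid T X AA) (braid T AA X)) (hid _)) => p q a h k x hp hq /=.
have [b|nb] := pselect (bad h k); first by rewrite good_l // !lf0.
have [n hn] : exists n : int, h = n%:~R.
  by apply: contrapT => e; apply: nb; right=> n hn; apply: e; exists n.
have k0 : k = 0%N by apply: contrapT => e; apply: nb; left.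
subst h k; clear nb.
have gl := fun h k => @good_l iX a h k x; have gr := fun h k => @good_r iX a h k x.
have [m1 h1] := i_trunc (tenI T AA X) a x n%:~R; have [m2 h2] := i_trunc (tenI T X AA) x a n%:~R.
pose N := (m1 + m2)%N.
have z1 j : (N <= j)%N -> tenI T AA X a (n + j%:Z)%:~R 0%N x = 0.
  by move=> hj; rewrite rmorphD /=; apply: h1; rewrite /N in hj; lia.
have z2 j : (N <= j)%N -> tenI T X AA x (n + j%:Z)%:~R 0%N a = 0.
  by move=> hj; rewrite rmorphD /=; apply: h2; rewrite /N in hj; lia.
rewrite (braidE T _ _ hp hq) (skew_good gr z2) (lfZ (braid T X AA)) linear_sum.
have hL (W1 W2 : vmod V) (f : hom false W1 W2) j y : f (iter j (Lop W1 (-1)) y) = iter j (Lop W2 (-1)) (f y).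
  by elim: j => //= j IH; rewrite hom_L IH.
have itS (W : vmod V) j (I : Type) (s : seq I) (F : I -> W) : iter j (Lop W (-1)) (\sum_(i <- s) F i) = \sum_(i <- s) iter j (Lop W (-1)) (F i).
  elim: s => [|i s IH]; first by rewrite !big_nil iter0_lin.
  by rewrite !big_cons -IH; have := iterS_lin (Lop W (-1)) j 1 (F i) (\sum_(i <- s) F i); rewrite !scale1r.
have itZ (W : vmod V) j c (y : W) : iter j (Lop W (-1)) (c *: y) = c *: iter j (Lop W (-1)) y.
  by have := iterS_lin (Lop W (-1)) j c y 0; rewrite addr0 iter0_lin addr0.
transitivity ((-1) ^+ (p && q) *: ((-1) ^+ (q && p) *: \sum_(j < N) \sum_(i < N)
    (j`!%:R^-1 * ((-1) ^+ i / i`!%:R)) *: iter (j + i) (Lop _ (-1)) (tenI T AA X a (n + (j + i)%N%:Z)%:~R 0%N x))).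
  congr (_ *: _); rewrite scaler_sumr; apply: eq_bigr => j _.
  rewrite (lfZ (braid T X AA)) hL (braidE T _ _ hq hp) (skew_good gl (N := N)); last first.
    by move=> i hi; rewrite -addrA -PoszD; apply: z1; lia.
  rewrite itZ scalerA mulrC -scalerA; congr (_ *: _); rewrite itS scaler_sumr; apply: eq_bigr => i _.
  rewrite itZ scalerA -iterD (_ : n + j%:Z + i%:Z = n + (j + i)%N%:Z); last by lia.
  congr (_ *: _); rewrite (_ : n + (j + i)%N%:Z + 1 = (n + j%:Z + 1) + i%:Z); last by lia.
  have nz1 : (-1 : K) != 0 by rewrite oppr_eq0 oner_eq0.
  rewrite (expfzDr (n + j%:Z + 1) i%:Z nz1).
  have sq : ((-1 : K) ^ (n + j%:Z + 1)) * (-1) ^ (n + j%:Z + 1) = 1 by rewrite -expfzMl mulrNN mulr1 exp1rz.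
  transitivity (j`!%:R^-1 * ((-1) ^ i%:Z / i`!%:R) * (((-1 : K) ^ (n + j%:Z + 1)) * (-1) ^ (n + j%:Z + 1))); last by rewrite sq mulr1.
  ring.
rewrite (tri_sum (fun j => j`!%:R^-1) (fun i => (-1) ^+ i / i`!%:R) (g := fun t => iter t (Lop _ (-1)) (tenI T AA X a (n + t%:Z)%:~R 0%N x))); last first.
  by move=> t ht; rewrite z1 // iter0_lin.
have -> : \sum_(t < N) (\sum_(j < t.+1) (j`!%:R^-1 : K) * ((-1) ^+ (t - j) / (t - j)`!%:R)) *:
   iter t (Lop _ (-1)) (tenI T AA X a (n + t%:Z)%:~R 0%N x) = tenI T AA X a n%:~R 0%N x.
  case E : N => [|N']; first by rewrite big_ord0 -[n]addr0 z1 // E.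
  rewrite big_ord_recl exp_conv scale1r addr0 big1 ?addr0 // => t _.
  by rewrite exp_conv lift0 scale0r.
by rewrite scalerA andbC -expr2 sqrr_sign scale1r.
Qed.

(* A highest vector w of h_0-weight c: the monodromy of u_1 and w is e^(2 pi i c). *)
Lemma mono_vac q (w : X) (c : K) (u : AA) : isu (A:=A) 1 u -> homog q w -> vac_h w -> hb X 0 w = c *: w ->
  braid T X AA (braid T AA X (tenI T AA X u (- c - 1) 0 w)) =
  (cexp (ipi R * c) * cexp (ipi R * c)) *: tenI T AA X u (- c - 1) 0 w.
Proof.
move=> [p [_ _ pu lu]] hq vw hw.
(* For larger h all coefficients vanish, so neither braiding sees more than the term j = 0 of e^(x
   L_(-1)). *)
have z1 (j l : nat) : (j, l) <> (0, 0)%N -> tenI T AA X u (- c - 1 + j%:R) l w = 0.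
  move=> jl; apply: (lat_zero (tenI T AA X) lu vw hw).
  have [l0|l0] := eqVneq l 0%N; last by left; apply/eqP.
  right=> -[d hd]; have j0 : j <> 0%N by move=> j0; apply: jl; rewrite j0 l0.
  have : (j%:R : K) + d%:R = 0.
    by move/eqP: hd; rewrite -subr_eq0 => /eqP <-; ring.
  by rewrite -natrD => /eqP; rewrite pnatr_eq0; lia.
have z2 (j l : nat) : (j, l) <> (0, 0)%N -> tenI T X AA w (- c - 1 + j%:R) l u = 0.
  move=> jl; apply: (braid_zero hq pu) => i l' ll'; rewrite -addrA -natrD; apply: z1.
  by move=> [h1 h2]; apply: jl; congr (_, _); lia.
have sk (W1 W2 W3 : vmod V) (I : intw W1 W2 W3) w1 w2 :
    (forall j l : nat, (j, l) <> (0, 0)%N -> I w1 (- c - 1 + j%:R) l w2 = 0) ->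
    skew I w1 (- c - 1) 0 w2 = cexp (ipi R * c) *: I w1 (- c - 1) 0%N w2.
  move=> z; rewrite /skew (fsum_single (i0 := 0%N)) => [|j j0].
    rewrite (fsum_single (i0 := 0%N)) => [|l l0]; last first.
      by rewrite z ?scaler0 // => -[] l0'; rewrite l0' eqxx in l0.
    by rewrite /= fact0 invr1 scale1r bin0 expr0 !mul1r addr0 opprD opprK opprK addrK.
  rewrite [X in iter j _ X]fsum_zero; first by rewrite (iter0_lin (Lop W3 (-1))) scaler0.
  by move=> l; rewrite z ?scaler0 // => -[j0' _]; rewrite j0' eqxx in j0.
rewrite (braidE T _ _ pu hq) (sk _ _ _ _ _ _ z2) !(lfZ (braid T X AA)) (braidE T _ _ hq pu) (sk _ _ _ _ _ _ z1).
rewrite !scalerA; congr (_ *: _); rewrite andbC.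
transitivity (cexp (ipi R * c) * cexp (ipi R * c) * ((-1) ^+ (q && p) * (-1) ^+ (q && p))); first ring.
by rewrite -signr_addb addbb mulr1.
Qed.
End Good.

(** * Functionals and binomial series *)

Section Separation.
Variables (R : realType) (M : lmodType R[i]).
Local Notation K := R[i].

(** A subspace maximal among those that contain [N] and avoid [x] is a complement of the line of
    [x]; f is the coordinate along [x]. *)
Lemma separate (N : lsub M) x : ~ N x ->
  exists f : {scalar M}, f x = 1 /\ forall w, N w -> f w = 0.
Proof.
move=> Nx.
(* The subspace in question is the union of [A] and [N]: in this form the empty chain, with empty
   union, still yields the subspace [N]. *)
pose P (A : set M) := [/\ forall w, N w -> A w \/ N w,
  forall c u w, (A u \/ N u) -> (A w \/ N w) -> (A (c *: u + w) \/ N (c *: u + w)) & ~ A x].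
have [F FP tot|A [[_ AL Ax] max]] := @Zorn_bigcup M P.
  split; first by move=> w; right.
    move=> c u w hu hw.
    have : exists X : set M, (F X \/ X = (N : set M)) /\ (X u \/ N u) /\ (X w \/ N w).
      case: hu => [[X FX Xu]|Nu]; case: hw => [[Z FZ Zw]|Nw].
      - have [XZ|ZX] := tot X Z FX FZ; [exists Z|exists X].
          by split; [left|split; left=> //; apply: XZ].
        by split; [left|split; left=> //; apply: ZX].
      - by exists X; split; [left|split; [left|right]].
      - by exists Z; split; [left|split; [right|left]].
      - by exists (N : set M); split; [right|split; left].
    move=> [X [[FX|->] [hu' hw']]]; last first.
      by right; apply: lsubL; [case: hu'|case: hw'].
    have [_ L _] := FP X FX; case: (L c u w hu' hw') => h; last by right.
    by left; exists X.
  by move=> [X /FP [_ _ h] /h].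
pose B w := A w \/ N w.
have BL c u w : B u -> B w -> B (c *: u + w) by exact: AL.
have B0 : B 0 by right; exact: lsub0.
have Bx : ~ B x by move=> [].
have BZ c u : B u -> B (c *: u) by move=> hu; rewrite -[_ *: _]addr0; apply: BL.
have BD u w : B u -> B w -> B (u + w) by move=> hu hw; rewrite -[u]scale1r; apply: BL.
have ex w : exists c, B (w - c *: x).
  apply: contrapT => nw.
  have w0 : ~ B w by move=> h; apply: nw; exists 0; rewrite scale0r subr0.
  pose Z := fun y => exists b c, B b /\ y = b + c *: w.
  apply: (max Z).
    split; first by move=> y hy; exists y, 0; split; [left|rewrite scale0r addr0].
    by move=> h; apply: w0; left; apply: h; exists 0, 1; split; rewrite ?scale1r ?add0r.
  split.
  - by move=> y; right.
  - have red y : ((exists b c, B b /\ y = b + c *: w) \/ N y) -> exists b c, B b /\ y = b + c *: w.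
      by move=> [//|h]; exists y, 0; split; [right|rewrite scale0r addr0].
    move=> c u v /red [b1 [c1 [h1 ->]]] /red [b2 [c2 [h2 ->]]]; left.
    by exists (c *: b1 + b2), (c * c1 + c2); split; [exact: BL|lincomb].
  - move=> [b [c [hb e]]]; have [c0|c0] := eqVneq c 0.
      by apply: Bx; rewrite e c0 scale0r addr0.
    apply: nw; exists c^-1.
    have -> : w - c^-1 *: x = - c^-1 *: b by rewrite e; lincomb; field.
    exact: BZ.
have uni w c c' : B (w - c *: x) -> B (w - c' *: x) -> c = c'.
  move=> h h'; apply/eqP; rewrite -subr_eq0; apply: contraT => d0; exfalso; apply: Bx.
  have -> : x = (c - c')^-1 *: ((w - c' *: x) + (-1) *: (w - c *: x)) by lincomb; field.
  by apply: (BZ _ _); apply: BD => //; apply: (BZ _ _).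
pose f w := xget 0 [set c | B (w - c *: x)].
have fB w : B (w - f w *: x) by apply: (xgetPex 0 (ex w)).
have fl : scalar f.
  move=> c u w; apply: (uni (c *: u + w)) => //.
  have -> : c *: u + w - (c * f u + f w) *: x = c *: (u - f u *: x) + (w - f w *: x) by lincomb.
  exact: BL.
pose ff : {scalar M} := HB.pack f (GRing.isLinear.Build K M K *%R f fl).
exists ff; split.
  by apply: (uni x) => //=; rewrite scale1r subrr.
by move=> w Nw; apply: (uni w) => //=; rewrite scale0r subr0; right.
Qed.
End Separation.

Section BinomialSeries.
Variables (K : numFieldType) (z : K) (b : int -> nat -> K).
Local Open Scope classical_set_scope.
Hypotheses (b0 : forall n, b 0 n.+1 = 1) (bS : forall a n, b (a + 1) n.+1 = b a n.+1 + z * b a n).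

Lemma bsum_steps a (k : nat) (x : K) : b a n @[n --> \oo] --> x ->
  b (a + k%:Z) n @[n --> \oo] --> (1 + z) ^+ k * x.
Proof.
move=> h; elim: k => [|k IH]; first by rewrite addr0 expr0 mul1r.
rewrite exprS -mulrA -addn1 PoszD addrA.
have st c (y : K) : b c n @[n --> \oo] --> y -> b (c + 1) n @[n --> \oo] --> (1 + z) * y.
  move=> hy; rewrite -cvg_shiftS /=.
  have h1 : (fun n => b c n.+1) @ \oo --> y by rewrite (cvg_shiftS (b c)).
  rewrite mulrDl mul1r.
  have h2 : (fun n => z * b c n) @ \oo --> z * y by apply: cvgMl_tmp.
  under eq_fun do rewrite bS.
  exact: (cvgD h1 h2).
exact: st.
Qed.

(** Convergence is given and only the limit is to be identified. By Pascal's rule a step from a to a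
    + 1 multiplies the limit by 1 + z; a negative a is compared with 0 by stepping up, where the
    sums are 1. *)
Lemma bsum_lim (a : int) (x : K) : 1 + z != 0 -> b a n @[n --> \oo] --> x -> x = (1 + z) ^ a.
Proof.
have base : b 0 n @[n --> \oo] --> (1 : K).
  rewrite -cvg_shiftS /=; under eq_fun do rewrite b0.
  exact: cvg_cst.
move=> z0 h; case: a h => n h.
  have := @bsum_steps _ n _ base; rewrite add0r mulr1 => h2.
  exact: (cvg_unique _ h h2).
have := @bsum_steps _ n.+1 _ h; rewrite NegzE addNr => h2.
have e : (1 + z) ^+ n.+1 * x = 1 by apply: (cvg_unique _ h2 base).
by rewrite -exprnN; apply: (mulfI (expf_neq0 n.+1 z0)); rewrite e mulfV // expf_neq0.
Qed.

Lemma bsum_limZ C (a : int) (x : K) : 1 + z != 0 -> C * b a n @[n --> \oo] --> x -> x = C * (1 + z) ^ a.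
Proof.
move=> z0 h; have [C0|C0] := eqVneq C 0.
  have e0 : 0 @[n --> \oo] --> (0 : K) by apply: cvg_cst.
  move: h; rewrite C0 mul0r; under eq_fun do rewrite mul0r.
  by move=> h; apply: (cvg_unique _ h e0).
have h2 : C^-1 * (C * b a n) @[n --> \oo] --> C^-1 * x by apply: cvgMl_tmp.
have h3 : b a n @[n --> \oo] --> C^-1 * x.
  by move: h2; under eq_fun do rewrite mulrA mulVf // mul1r.
by have := bsum_lim z0 h3 => <-; rewrite mulrA mulfV // mul1r.
Qed.
End BinomialSeries.

(** A finite set [B] at which the net is already close to x contains finitely many H - j. Once n
    exceeds those j, adding [B] to the first n indices adds only zero terms. *)
Lemma abs_sum_nat (K : numFieldType) (H : K) (f : K -> K) x :
  (forall h, (forall j : nat, h <> H - j%:R) -> f h = 0) -> abs_sum f x ->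
  (\sum_(j < n) f (H - j%:R) @[n --> \oo] --> x)%classic.
Proof.
move=> f0 hs; apply/cvgrPdist_lt => e e0.
have FF := @totally_filter K.
have hs' : (\forall t \near totally, `|x - partial_sum f t| < e)%classic.
  by have := hs; rewrite /abs_sum => /cvgrPdist_lt h; apply: h.
have [B _ hB] := hs'.
have Hi i j : H - i%:R = H - j%:R -> i = j.
  by move/addrI/oppr_inj/eqP; rewrite eqr_nat => /eqP.
have [n0 hn0] : exists n0 : nat, forall j : nat, (n0 <= j)%N -> H - j%:R \notin B.
  pose g y := xget 0%N (fun j : nat => y = H - j%:R).
  exists (\max_(y <- B) g y).+1 => j hj; apply/negP => jB.
  have gj : g (H - j%:R) = j.
    have := @xgetPex _ 0%N (fun i : nat => H - j%:R = H - i%:R) (ex_intro _ j erefl).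
    by move/Hi => {2}->.
  have := @leq_bigmax_seq _ (enum_fset B) xpredT g (H - j%:R) jB isT.
  by rewrite gj => h; move: hj; rewrite ltnNge h.
exists n0 => // n /= hn.
pose s := [seq H - j%:R | j <- iota 0 n].
pose S := [fset y in s]%fset.
have hS y : (y \in S) = (y \in s) by rewrite in_fset.
have := hB (B `|` S)%fset; rewrite /= => /(_ (fsubsetUl _ _)).
suff -> : partial_sum f (B `|` S)%fset = \sum_(j < n) f (H - j%:R) by [].
transitivity (\sum_(i <- (B `|` S)%fset) f i); first by rewrite big_seq_fsetE.
rewrite -(@big_fset_incl _ _ _ _ S (B `|` S)%fset f (fsubsetUr _ _)).
  rewrite (perm_big s) /=; first by rewrite big_map -(big_mkord xpredT (fun j => f (H - j%:R))) /index_iota subn0.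
  apply: uniq_perm; first exact: fset_uniq.
    by rewrite map_inj_uniq ?iota_uniq //; apply: Hi.
  by move=> y; rewrite hS.
move=> y; rewrite inE hS => /orP [yB|->] // ys; apply: f0 => j yj.
have jn : (n0 <= j)%N.
  rewrite leqNgt; apply/negP => jn; case/negP: ys.
  by apply/mapP; exists j => //; rewrite mem_iota; lia.
by have := hn0 j jn; rewrite -yj yB.
Qed.

Lemma abs_sum_binom (R : realType) (H C z : R[i]) (a : int) (f : R[i] -> R[i]) x :
  (forall j : nat, f (H - j%:R) = C * (gbin a%:~R j * z ^+ j)) ->
  (forall h, (forall j : nat, h <> H - j%:R) -> f h = 0) ->
  1 + z != 0 -> abs_sum f x -> x = C * (1 + z) ^ a.
Proof.
move=> f1 f0 z0 hs.
have h := abs_sum_nat f0 hs.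
pose b (a : int) n : R[i] := \sum_(j < n) gbin a%:~R j * z ^+ j.
have b0 n : b 0 n.+1 = 1.
  rewrite /b big_ord_recl gbin0 expr0 mulr1 big1 ?addr0 // => j _.
  by rewrite gbin_0S mul0r.
have bS c n : b (c + 1) n.+1 = b c n.+1 + z * b c n.
  rewrite /b !big_ord_recl !gbin0 -addrA; congr (_ + _).
  rewrite mulr_sumr -big_split /=; apply: eq_bigr => j _.
  by rewrite gbin_pascalz exprS; ring.
apply: (bsum_limZ b0 bS z0).
suff <- : (fun n => \sum_(j < n) f (H - j%:R)) = (fun n => C * b a n) by [].
by apply/funext => n; rewrite mulr_sumr; apply: eq_bigr => j _; rewrite f1.
Qed.

Section Detect.
Variables (R : realType) (V : V1gl11 R).
Local Notation K := R[i].
Variable X : vmod V.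
Hypothesis iX : in_Ind X.

Lemma nonzero_comp (M : lmodType K) (T : {linear M -> M}) v : v != 0 ->
  sum_of (fun u => exists c, genE T c u) v ->
  exists c x y, [/\ v = x + y, genE T c x, othE T c y & x != 0].
Proof.
move=> v0 [s [hs e]]; have [n hn] := ubnP (size s).
elim: n => // n IH in s hs e hn *.
case: s => [|u s] in hs e hn *; first by move: v0; rewrite e big_nil eqxx.
have [c hc] : exists c, genE T c u by apply: hs; rewrite inE eqxx.
have [x [t [e2 hx ht st]]] := split_seq (@genE0 R M T) (@genEL R M T) c (s := s) (fun w hw => hs w (mem_behead (s := u :: s) hw)).
have eq : v = (u + x) + \sum_(w <- t) w by rewrite e big_cons e2 addrA.
have hux : genE T c (u + x) by rewrite -[u]scale1r; apply: genEL.
have [ux0|ux0] := eqVneq (u + x) 0; last first.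
  by exists c, (u + x), (\sum_(w <- t) w); split=> //; exists t.
apply: (IH t); rewrite ?eq ?ux0 ?add0r //.
  by move=> w /ht [c' [_ h]]; exists c'.
by move: hn => /=; rewrite !ltnS => hn; apply: leq_trans hn.
Qed.

Lemma Ind_wt (x : X) : exists D, [/\ OfinD D, D x & sum_of (fun u => D u /\ exists h, gen_wt h u) x].
Proof.
have [D [hD Dx]] := proj1 (in_IndP X) iX x; exists D; split=> //.
have := @sum_of_in R X (Lop X 0) (lsubV (od_sub hD)) _ (fun c u => gen_wt c u)
      x (@genE0 R X (Lop X 0)) (@genEL R X (Lop X 0)) (fun _ _ h => h) (od_wt hD Dx).
case.
- by move=> u; rewrite !lsubVE; case: (od_sub hD) => _ _ _; apply.
- by rewrite lsubVE.
move=> s [hs ->]; exists s; split=> // u /hs; by rewrite lsubVE.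
Qed.

Lemma hb_nil (s : nat) (x : X) : (0 < s)%N -> exists J, iter J (hb X s%:Z) x = 0.
Proof.
move=> s0; have [D [hD _ [l [hl ->]]]] := Ind_wt x.
elim: l hl => [|u l IH] hl; first by exists 0%N; rewrite big_nil.
have [|J1 h1] := IH; first by move=> w hw; apply: hl; rewrite inE hw orbT.
have [|Du [h gu]] := hl u; first by rewrite inE eqxx.
have [J2 h2] := hb_pos_ker hD s0 Du gu.
exists (J1 + J2)%N; rewrite big_cons -[u]scale1r iterS_lin scale1r.
by rewrite iterD h2 iter0_lin add0r addnC iterD h1 iter0_lin.
Qed.

(* wproj for the modes +-(n+1) fixes vacuum vectors and kills the last term. *)
Lemma hneg_vac n (y : nat -> X) : vac_h (\sum_(r < n) hb X (- r.+1%:Z) (y r)) ->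
  \sum_(r < n) hb X (- r.+1%:Z) (y r) = 0.
Proof.
elim: n y => [|n IH] y; first by rewrite big_ord0.
set x := \sum_(r < _) _ => vx.
have [J hJ] := @hb_nil n.+1 (y n) isT.
pose a := hb X n.+1%:Z; pose b := hb X (- n.+1%:Z); pose kap : K := 2%:R * n.+1%:R.
have hab z : a (b z) = b (a z) + kap *: z by rewrite /a hb_comm subrr eqxx.
have kap0 : kap != 0 by rewrite mulf_neq0 // pnatr_eq0.
have e : x = \sum_(r < n) hb X (- r.+1%:Z) (wproj a b kap J.+1 (y r)).
  rewrite -(wproj_id b kap J (a := a) (y := x)); last by apply: vx.
  pose w := mklin (wproj_lin a b kap J.+1).
  rewrite -[LHS]/(w x) /x linear_sum big_ord_recr /=.
  have wE u : w u = wproj a b kap J.+1 u by [].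
  rewrite wE (wproj_b kap0 hab hJ) addr0; apply: eq_bigr => r _; rewrite wE.
  have rn := ltn_ord r.
  symmetry; apply: wproj_comm => z.
    rewrite /a hb_comm (_ : (- r.+1%:Z + n.+1%:Z == 0) = false) ?scale0r ?addr0 //.
    by apply/eqP; lia.
  rewrite /b hb_comm (_ : (- r.+1%:Z - n.+1%:Z == 0) = false) ?scale0r ?addr0 //.
by rewrite e; apply: (IH (fun r => wproj a b kap J.+1 (y r))); rewrite -e.
Qed.

(* A nonzero weight component of z lies outside the span of the h_(-r) X, so some
   functional separates it from that span and from the other weights. *)
Lemma detect (z : X) : vac_h z ->
  (forall f : {scalar X}, graded_dual f -> (forall (r : nat) y, (0 < r)%N -> f (hb X (- r%:Z) y) = 0) ->
    f z = 0) -> z = 0.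
Proof.
move=> vz hf; apply/eqP; apply: contraT => z0.
have wz : sum_of (fun u => exists c, genE (Lop X 0) c u) z.
  by have [D [_ _]] := Ind_wt z; apply: sum_of_impl => u [].
have [c [x [y [ez gx oy x0]]]] := nonzero_comp z0 wz.
have vx : vac_h x.
  move=> r r0; apply: (@genE_othE0 _ _ (Lop X 0) (c - r%:~R) _ (hb X r y)).
  - exact: gen_wt_hb.
  - apply: sum_of_map oy => u [c' [cc gu]]; exists (c' - r%:~R); split; last exact: gen_wt_hb.
    by apply: contraNneq cc => /addIr ->.
  - by rewrite -(lfD (hb X r)) -ez vz.
pose hn (x : X) := exists n (y : nat -> X), x = \sum_(r < n) hb X (- r.+1%:Z) (y r).
have hn0 : hn 0 by exists 0%N, (fun=> 0); rewrite big_ord0.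
have hnL a u w : hn u -> hn w -> hn (a *: u + w).
  move=> [n1 [y1 ->]] [n2 [y2 ->]].
  exists (n1 + n2)%N, (fun r => a *: (if (r < n1)%N then y1 r else 0) + (if (r < n2)%N then y2 r else 0)).
  have ext n m (F : nat -> X) : (n <= m)%N -> \sum_(r < n) hb X (- r.+1%:Z) (F r) =
      \sum_(r < m) hb X (- r.+1%:Z) (if (r < n)%N then F r else 0).
    move=> nm; rewrite (sum_trunc (F := fun r => hb X (- r.+1%:Z) (if (r < n)%N then F r else 0)) (n := n)) //.
      by apply: eq_bigr => r _; rewrite ltn_ord.
    by move=> j nj; rewrite ltnNge nj lf0.
  rewrite (ext n1 (n1 + n2)%N y1) ?leq_addr // (ext n2 (n1 + n2)%N y2) ?leq_addl //.
  rewrite scaler_sumr -big_split; apply: eq_bigr => r _ /=.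
  by rewrite (lfD (hb X _)) (lfZ (hb X _)).
pose H := @Lsub R X hn hn0 hnL.
have HL u : H u -> H (Lop X 0 u).
  move=> [n [y1 ->]]; exists n, (fun r => Lop X 0 (y1 r) + r.+1%:R *: y1 r).
  rewrite linear_sum; apply: eq_bigr => r _.
  by rewrite /= L0_hb (lfD (hb X _)) (lfZ (hb X _)); lincomb.
(* The other weights are included so that the functional is concentrated in weight c and hence lies
   in the graded dual. *)
pose P (w : X) := exists n o, [/\ H n, othE (Lop X 0) c o & w = n + o].
have P0 : P 0 by exists 0, 0; split; [exact: lsub0|exact: sum_of0|rewrite addr0].
have PL a u w : P u -> P w -> P (a *: u + w).
  move=> [n1 [o1 [h1 k1 ->]]] [n2 [o2 [h2 k2 ->]]]; exists (a *: n1 + n2), (a *: o1 + o2).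
  split; [exact: lsubL|by apply: sum_ofD k2; apply: othEZ|lincomb].
have nPx : ~ @Lsub R X P P0 PL x.
  move=> [n [o [hn' ho e]]].
  have : H x.
    apply: (genE_comp HL gx (y := (-1) *: o)); first exact: othEZ.
    by rewrite e scaleN1r addrK.
  by move=> [k [y1 e1]]; move: x0; rewrite e1 hneg_vac ?eqxx // -e1.
have [f [fx fP]] := separate nPx.
have fo w : othE (Lop X 0) c w -> f w = 0.
  by move=> hw; apply: fP; exists 0, w; split; [exact: lsub0| |rewrite add0r].
have : f z = 0.
  apply: hf; first exists [:: c].
    by move=> h w hw; rewrite inE => hc; apply: fo; apply: sum_of1; exists h.
  move=> r w r0; apply: fP; exists (hb X (- r%:Z) w), 0; split; rewrite ?addr0 //; last exact: sum_of0.
  exists r, (fun i => if i == r.-1 then w else 0); case: r r0 => // r _ /=.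
  rewrite big_ord_recr /= eqxx big1 ?add0r // => i _.
  by rewrite (ltn_eqF (ltn_ord i)) lf0.
have -> : f z = f x + f y by rewrite ez linearD.
by rewrite fx (fo y oy) => /eqP; rewrite addr0 oner_eq0.
Qed.
End Detect.

(** * Associativity of the multiplication of A *)

Section Coefficients.
Variables (R : realType) (V : V1gl11 R).
Local Notation K := R[i].

(** The recursion for the coefficients of (1 - t)^x, where t lowers h by 1; the partial alternating
    sums of binomials are evaluated in [alt]. *)
Lemma coef_rec (x : K) (G : K -> nat -> K) :
  (forall h j, j.+1%:R * G h j.+1 = - x * \sum_(i < j.+1) G (h - 1 - i%:R) (j - i)%N) ->
  forall j h, G h j = (-1) ^+ j * gbin x j * G (h - j%:R) 0%N.
Proof.
move=> hG j; have [n hn] := ubnP j; elim: n => // n IH in j hn * => h.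
case: j => [|j] in hn *; first by rewrite expr0 gbin0 !mul1r subr0.
have alt i : x * (\sum_(t < i.+1) (-1) ^+ t * gbin x t) = (-1) ^+ i * (i.+1%:R * gbin x i.+1).
  elim: i => [|i IHi]; first by rewrite big_ord_recr big_ord0 /= gbinS gbin0 expr0; ring.
  rewrite big_ord_recr mulrDr IHi [i.+2%:R * _]gbinS exprS /=; ring.
have j0 : (j.+1%:R : K) != 0 by rewrite pnatr_eq0.
apply: (mulfI j0); rewrite hG.
have -> : \sum_(i < j.+1) G (h - 1 - i%:R) (j - i)%N =
    (\sum_(i < j.+1) (-1) ^+ i * gbin x i) * G (h - j.+1%:R) 0%N.
  rewrite mulr_suml [RHS](reindex_inj rev_ord_inj) /=; apply: eq_bigr => i _.
  rewrite subSS IH; last by have := ltn_ord i; lia.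
  congr (_ * G _ _); have ij : (i <= j)%N by have := ltn_ord i; lia.
  by rewrite natrB // -natr1; ring.
by rewrite mulrA mulNr alt exprS; ring.
Qed.

Section Lead.
Variables (W1 W2 W3 : vmod V) (I : intw W1 W2 W3) (F : {scalar W3}).
Hypothesis Fh : forall (r : nat) y, (0 < r)%N -> F (hb W3 (- r%:Z) y) = 0.

Let FZ c y : F (c *: y) = c * F y.
Proof. exact: scalarZ. Qed.

(** By [Ic_rec] a coefficient past the leading one is a combination of vectors h_(-r) y, which [F]
    kills. *)
Lemma lead_zero (m c : K) (u : W1) (w : W2) h k : lat m u -> vac_h w -> hb W2 0 w = c *: w ->
  k <> 0%N \/ h <> - 1 - m * c -> F (I u h k w) = 0.
Proof.
move=> lu vw hw hk.
have [[k0 [d hd]]|nf] := pselect (k = 0%N /\ lat_exp m c h); last first.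
  rewrite (lat_zero I lu vw hw) ?linear0 //.
  have [k0|k0] := eqVneq k 0%N; last by left; apply/eqP.
  by right=> hf; apply: nf.
case: d hd => [|d] hd; first by case: hk => [//|[]]; rewrite hd subr0.
have e := Ic_rec I lu vw hw d.
have d0 : (d.+1%:R : K) != 0 by rewrite pnatr_eq0.
rewrite k0 hd; apply: (mulfI d0); rewrite mulr0 -FZ -[I u _ _ _]/(Ic I m c u w d.+1) e.
rewrite FZ linear_sum big1 ?mulr0 // => i _ /=.
by rewrite (_ : -1 - i%:Z = - i.+1%:Z) ?Fh //; lia.
Qed.

(** Moving the creation modes of the inner recursion past u to the outside, where [F] kills them,
    leaves the factor - 2 m; the result is the expansion of (1 - x_2/x_1)^(2 m n). *)
Lemma right_coef (W4 W5 : vmod V) (I2 : intw W4 W5 W2) (m n c : K) (u : W1) (u' : W4) (w : W5) :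
  lat m u -> lat n u' -> vac_h w -> hb W5 0 w = c *: w -> forall j h k,
  F (I u h k (Ic I2 n c u' w j)) =
  (-1) ^+ j * gbin (2%:R * m * n) j * F (I u (h - j%:R) k (Ic I2 n c u' w 0)).
Proof.
move=> lu lu' vw hw j h k.
apply: (coef_rec (G := fun h j => F (I u h k (Ic I2 n c u' w j)))) => {}h {}j.
rewrite -FZ -(lfZ (I u h k)) (Ic_rec I2 lu' vw hw) (lfZ (I u h k)) FZ !linear_sum /=.
rewrite -mulNr -mulrN mulr_sumr mulr_sumr; apply: eq_bigr => i _.
have := intw_hb I lu (-1 - i%:Z) h k (Ic I2 n c u' w (j - i)).
move/(congr1 F); rewrite (_ : -1 - i%:Z = - i.+1%:Z) ?Fh //; last by lia.
rewrite linearD /= FZ (_ : h + (- i.+1%:Z)%:~R = h - 1 - i%:R); last first.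
  by rewrite rmorphN /= -addn1 PoszD rmorphD /=; ring.
move/esym/eqP; rewrite addr_eq0 => /eqP ->; ring.
Qed.

(** Under [F], a creation mode inside the first argument reduces through the iterate formula to the
    charge c' of w; the result is the expansion of (1 + x_0/x_2)^(m c'). *)
Lemma left_coef (W4 W5 : vmod V) (I2 : intw W4 W5 W1) (m c c' : K) (u : W4) (u' : W5) (w : W2) :
  lat m u -> vac_h u' -> hb W5 0 u' = c *: u' -> vac_h w -> hb W2 0 w = c' *: w -> forall j h k,
  F (I (Ic I2 m c u u' j) h k w) = gbin (m * c') j * F (I (Ic I2 m c u u' 0) (h - j%:R) k w).
Proof.
move=> lu vu hu vw hw j h k.
have hbq (r : nat) q h' : (0 < r)%N -> F (I (hb W1 (- r%:Z) q) h' k w) = - (-1) ^+ r * c' * F (I q (h' - r%:R) k w).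
  move=> r0; pose J (w1 : W1) (l : int) (w2 : W2) := I w1 (h' + l%:~R) k w2.
  have bJ : borch J := borch_intw I h' k.
  have [l0 hl0] := bo_trunc bJ q w.
  have -> : I (hb W1 (- r%:Z) q) h' k w = J (Yw W1 (hv V) (- r%:Z) q) 0 w by rewrite /J addr0.
  rewrite (bo_iter bJ (- r%:Z) (hv_homog V) (N := `|l0|%N.+1)); first last.
  - by move=> i hi; apply: vw; lia.
  - by move=> i hi; apply: hl0; lia.
  rewrite linear_sum big_ord_recl /= big1 ?addr0 => [|i _]; last first.
    rewrite FZ linearB /= -/(hb W3 _ _) -/(hb W2 _ _) (vw (bump 0 i)); last by rewrite /bump; lia.
    rewrite (bo0r bJ) scaler0 linear0 subr0 (_ : - r%:Z - (bump 0 i)%:Z = - (r + i.+1)%N%:Z); last by rewrite /bump; lia.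
    by rewrite Fh ?mulr0 //; lia.
  rewrite FZ gbin0 expr0 !mul1r linearB /= -/(hb W3 _ _) -/(hb W2 _ _) Fh // sub0r FZ hw.
  rewrite (boZr bJ) /J FZ rmorphN /= -exprnN.
  by rewrite -signr_odd; case: odd; rewrite ?expr1 ?expr0 ?invrN ?invr1; ring.
(* The solution in [coef_rec] carries (-1)^j, which is absent here, so the signs are first put into
   the sequence. *)
have s0 : (-1) ^+ j != 0 :> K by rewrite signr_eq0.
apply: (mulfI s0).
have e := @coef_rec (m * c') (fun h j => (-1) ^+ j * F (I (Ic I2 m c u u' j) h k w)).
rewrite mulrA; apply: (etrans (e _ j h)); last by rewrite expr0 mul1r.
move=> {e}{}h {s0}{}j.
rewrite mulrCA -FZ -intwZl (Ic_rec I2 lu vu hu) intwZl FZ.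
have -> : I (\sum_(i < j.+1) hb W1 (-1 - i%:Z) (Ic I2 m c u u' (j - i))) h k w =
    \sum_(i < j.+1) I (hb W1 (-1 - i%:Z) (Ic I2 m c u u' (j - i))) h k w.
  exact: (linear_sum (mklin (i_linear I h k w))).
rewrite linear_sum !mulr_sumr; apply: eq_bigr => i _ /=.
rewrite (_ : -1 - i%:Z = - i.+1%:Z) ?hbq //; last by lia.
have -> : h - i.+1%:R = h - 1 - i%:R by rewrite -natr1; ring.
have ij : (i <= j)%N by have := ltn_ord i; lia.
have -> : (-1) ^+ (j - i) = (-1) ^+ j * (-1) ^+ i :> K.
  by rewrite -signr_odd oddB // signr_addb !signr_odd.
by rewrite !exprS; ring.
Qed.
End Lead.

Lemma cexp_lnz (r : R) (k : int) : 0 < r -> cexp ((ln r)%:C * k%:~R) = r%:C ^ k.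
Proof.
move=> r0; have c1 : cexp (ln r)%:C = r%:C by rewrite /cexp /= lnK ?posrE // cos0 sin0 mulr1.
have rC0 : r%:C != 0 by rewrite (inj_eq (@complexI R)) gt_eqF.
have key (n : nat) : cexp ((ln r)%:C * n%:R) = r%:C ^+ n.
  elim: n => [|n IH]; first by rewrite mulr0 cexp0.
  by rewrite -natr1 mulrDr mulr1 cexpD IH c1 exprSr.
case: k => n; first exact: key.
have : cexp ((ln r)%:C * (Negz n)%:~R) * cexp ((ln r)%:C * n.+1%:R) = 1.
  by rewrite -cexpD -mulrDr NegzE rmorphN addNr mulr0 cexp0.
rewrite key => e; apply: (mulIf (expf_neq0 n.+1 rC0)); rewrite e.
by rewrite -[r%:C ^ Negz n]/((r%:C ^+ n.+1)^-1) mulVf // expf_neq0.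
Qed.

Lemma xlogE (r : R) (k : int) : 0 < r -> xlog (ln r)%:C (- k%:~R - 1) 0 = r%:C ^ k.
Proof. by move=> r0; rewrite /xlog expr0 mulr1 opprB addrAC subrr add0r opprK cexp_lnz. Qed.

Lemma ieval_single (W1 W2 W3 : vmod V) (I : intw W1 W2 W3) z (f : W3 -> K) w1 w2 h0 :
  (forall h k, k <> 0%N \/ h <> h0 -> f (I w1 h k w2) = 0) ->
  ieval I z f w1 w2 = xlog z h0 0 * f (I w1 h0 0%N w2).
Proof.
move=> hf; rewrite /ieval (fsum_single (i0 := (h0, 0%N))) // => -[h k] /= hk.
rewrite hf ?mulr0 //; have [k0|k0] := eqVneq k 0%N; last by left; apply/eqP.
by right=> h1; move: hk; rewrite h1 k0 eqxx.
Qed.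

Section Powers.
Variables (L : fieldType) (s t y g : L).
Hypotheses (s0 : s != 0) (t0 : t != 0).
Lemma zpow1 (p b a : int) : s ^ p * t ^ b * y * t^-1 ^ a = s ^ p * t ^ (b - a) * y.
Proof. by rewrite expfzDr // exprz_inv; ring. Qed.
Lemma zpow2 (b a : int) : s ^ b * y * (t / s) ^ a = s ^ (b - a) * t ^ a * y.
Proof. by rewrite expfzDr // expfzMl exprz_inv; ring. Qed.
Lemma zpow3 (p b : int) (j : nat) : s ^ (p + j%:Z) * (t ^ (b - j%:Z) * ((-1) ^+ j * g * y)) =
  s ^ p * t ^ b * y * (g * (- (s / t)) ^+ j).
Proof.
have -> : (- (s / t)) ^+ j = (-1) ^+ j * (s ^ j%:Z * t ^ (- j%:Z)).
  by rewrite -[in LHS]mulN1r !exprMn -exprz_inv.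
by rewrite !expfzDr //; ring.
Qed.
Lemma zpow4 (b : int) (j : nat) : s ^ (b - j%:Z) * (g * y) = s ^ b * y * (g * s^-1 ^+ j).
Proof. by rewrite expfzDr // -exprz_inv -[_ ^ j%:Z]/(s^-1 ^+ j); ring. Qed.
End Powers.

Section Values.
Variables (W1 W2 W3 M W : vmod V) (F : {scalar W}).
Hypothesis Fh : forall (r : nat) y, (0 < r)%N -> F (hb W (- r%:Z) y) = 0.
Variables (m n k : int) (u : W1) (u' : W2) (w : W3).
Hypotheses (lu : lat m%:~R u) (lu' : lat n%:~R u').
Hypotheses (vw : vac_h w) (hw : hb W3 0 w = (2%:R * k%:~R) *: w).
Local Notation c := (2%:R * k%:~R : K).
Local Notation val := ((2%:R ^ (2%:Z * n * k) * 3%:R ^ (2%:Z * m * k)) : K).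

(* Only one log-free exponent survives F for each j, so the product at
   (r1, r2) is a multiple of (1 - r2/r1)^(2mn), and the iterate below a multiple
   of (1 + r0/r2)^(2mk); the point (3, 2) lies in both domains. *)
Lemma product_value (I1 : intw W1 M W) (I2 : intw W2 W3 M) x :
  product_is I1 I2 3%:R 2%:R F u u' w x ->
  x = val * F (I1 u (- 1 - m%:~R * (c + 2%:R * n%:~R)) 0%N (Ic I2 n%:~R c u' w 0)).
Proof.
set H1 := - 1 - _ * _; set q := Ic _ _ _ _ _ 0 => hx.
pose a := 2%:Z * m * n; pose z : K := - (2%:R / 3%:R).
pose b := 2%:Z * m * (n + k).
have n3 : 3%:R != 0 :> K by rewrite pnatr_eq0.
have n2 : 2%:R != 0 :> K by rewrite pnatr_eq0.
pose C : K := 2%:R ^ (2%:Z * n * k) * 3%:R ^ b * F (I1 u H1 0%N q).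
have z1 : 1 + z = 3%:R^-1 by rewrite /z; field.
suff -> : x = C * (1 + z) ^ a.
  have ab : b - a = 2%:Z * m * k by rewrite /a /b; ring.
  by rewrite z1 /C (zpow1 _ _ n3) ab.
pose H2 : K := - 1 - n%:~R * c.
apply: (abs_sum_binom (H := H2) (C := C) (z := z) (a := a) _ _ _ hx).
- move=> j; rewrite (fsum_single (i0 := 0%N)) => [|l l0]; last first.
    rewrite [ieval _ _ _ _ _]fsum_zero ?mulr0 // => hk.
    by rewrite (lat_zero I2 lu' vw hw) ?(lf0 (I1 _ _ _)) ?linear0 ?mulr0 //; left; apply/eqP.
  rewrite -[I2 u' _ _ w]/(Ic I2 n%:~R c u' w j) (ieval_single _ (h0 := H1 + j%:R)); last first.
    move=> h l hl; rewrite (right_coef I1 Fh I2 lu lu' vw hw).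
    rewrite (lead_zero I1 Fh lu (Ic_vac I2 lu' vw hw) (Ic_h I2 lu' hw)) ?mulr0 //.
    case: hl => [l0|h0]; first by left.
    by right=> e; apply: h0; rewrite /H1 -e; ring.
  rewrite (right_coef I1 Fh I2 lu lu' vw hw) addrK.
  have -> : H2 - j%:R = - (2%:Z * n * k + j%:Z)%:~R - 1.
    by rewrite /H2 rmorphD !rmorphM /=; ring.
  have -> : H1 + j%:R = - (b - j%:Z)%:~R - 1.
    by rewrite /H1 /b rmorphB !rmorphM rmorphD /=; ring.
  rewrite !xlogE ?ltr0n // !rmorph_nat.
  have -> : 2%:R * m%:~R * n%:~R = a%:~R :> K by rewrite !rmorphM.
  exact: (zpow3 _ _ n2 n3).
- move=> h hh; apply: fsum_zero => l; rewrite [ieval _ _ _ _ _]fsum_zero ?mulr0 // => hk.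
  rewrite (lat_zero I2 lu' vw hw) ?(lf0 (I1 _ _ _)) ?linear0 ?mulr0 //.
  by right=> -[j hj]; apply: (hh j); rewrite hj.
by rewrite z1 invr_neq0.
Qed.

Lemma iterate_value (I1 : intw M W3 W) (I2 : intw W1 W2 M) x :
  iterate_is I1 I2 (3%:R - 2%:R) 2%:R F u u' w x ->
  x = val * F (I1 (Ic I2 m%:~R (2%:R * n%:~R) u u' 0) (- 1 - (m%:~R + n%:~R) * c) 0%N w).
Proof.
have [vu' hu' lL] := lu'.
set H3 := - 1 - _ * _; set q := Ic _ _ _ _ _ 0 => hx.
have lq : lat (m%:~R + n%:~R) q := Ic_lat I2 lu vu' hu' erefl lL.
pose a := 2%:Z * m * k; pose z : K := 2%:R^-1.
pose b := 2%:Z * (m + n) * k.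
have n3 : 3%:R != 0 :> K by rewrite pnatr_eq0.
have n2 : 2%:R != 0 :> K by rewrite pnatr_eq0.
pose C : K := 2%:R ^ b * F (I1 q H3 0%N w).
have z1 : 1 + z = 3%:R / 2%:R by rewrite /z; field.
suff -> : x = C * (1 + z) ^ a.
  have ab : b - a = 2%:Z * n * k by rewrite /a /b; ring.
  by rewrite z1 /C (zpow2 _ _ n2) ab.
pose H2 : K := - 1 - m%:~R * (2%:R * n%:~R).
have l1 : 3%:R - 2%:R = 1 :> R by ring.
apply: (abs_sum_binom (H := H2) (C := C) (z := z) (a := a) _ _ _ hx).
- move=> j; rewrite l1 (fsum_single (i0 := 0%N)) => [|l l0]; last first.
    rewrite [ieval _ _ _ _ _]fsum_zero ?mulr0 // => hk.
    by rewrite (lat_zero I2 lu vu' hu') ?intw0l ?linear0 ?mulr0 //; left; apply/eqP.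
  rewrite -[I2 u _ _ u']/(Ic I2 m%:~R (2%:R * n%:~R) u u' j) (ieval_single _ (h0 := H3 + j%:R)); last first.
    move=> h l hl; rewrite (left_coef I1 Fh I2 lu vu' hu' vw hw).
    rewrite (lead_zero I1 Fh lq vw hw) ?mulr0 //.
    case: hl => [l0|h0]; first by left.
    by right=> e; apply: h0; rewrite /H3 -e; ring.
  rewrite (left_coef I1 Fh I2 lu vu' hu' vw hw) addrK.
  have -> : H3 + j%:R = - (b - j%:Z)%:~R - 1.
    by rewrite /H3 /b rmorphB !rmorphM rmorphD /=; ring.
  rewrite !xlogE ?ltr0n // !rmorph_nat ln1.
  have -> : m%:~R * c = a%:~R :> K by rewrite !rmorphM /=; ring.
  rewrite /xlog mul0r cexp0 expr0 !mul1r; exact: (zpow4 _ _ n2).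
- move=> h hh; apply: fsum_zero => l; rewrite [ieval _ _ _ _ _]fsum_zero ?mulr0 // => hk.
  rewrite (lat_zero I2 lu vu' hu') ?intw0l ?linear0 ?mulr0 //.
  by right=> -[j hj]; apply: (hh j); rewrite hj.
by rewrite z1 mulf_neq0 // invr_neq0.
Qed.
End Values.
End Coefficients.

Section MuAssoc.
Variables (R : realType) (V : V1gl11 R) (T : hlz V) (A : extension T).
Local Notation K := R[i].
Local Notation AA := (extA A).
Local Notation YA := (Y (extV A)).
Local Notation mu := (extmu A).
Local Notation I2 := (tenI T AA AA).
Local Notation I1 := (tenI T AA (ten T AA AA)).

Definition mu_right : hom false (ten T AA (ten T AA AA)) AA := hcomp mu (tmap T (hid AA) mu).
Definition mu_lft : hom false (ten T (ten T AA AA) AA) AA := hcomp mu (tmap T mu (hid AA)).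
Definition mu_left : hom false (ten T AA (ten T AA AA)) AA := hcomp mu_lft (assoc T AA AA AA).

Lemma mu_rightE a h k t : mu_right (I1 a h k t) = muI A a h k (mu t).
Proof. by rewrite /mu_right /= tmapE. Qed.
Lemma mu_lftE t h k b : mu_lft (tenI T (ten T AA AA) AA t h k b) = muI A (mu t) h k b.
Proof. by rewrite /mu_lft /= tmapE. Qed.

Section Leading.
Variables (m n k : int) (u u' u'' : AA).
Hypotheses (hu : isu m u) (hu' : isu n u') (hu'' : isu k u'').
Local Notation p := (Ic I2 n%:~R (2%:R * k%:~R) u' u'' 0).
Local Notation p' := (Ic I1 m%:~R (2%:R * k%:~R + 2%:R * n%:~R) u p 0).

Lemma muI_zero m1 m2 (a b : AA) (j : int) : isu m1 a -> isu m2 b ->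
  - 1 - 2%:Z * m1 * m2 < j -> YA a j b = 0.
Proof.
move=> [q [_ _ _ la]] [q' [_ _ _ [vb hb _]]] hj; rewrite -muIE.
apply: (lat_zero (muI A) la vb hb); right=> -[d].
have -> : -1 - m1%:~R * (2%:R * m2%:~R) - d%:R = (- 1 - 2%:Z * m1 * m2 - d%:Z)%:~R :> K.
  by rewrite !rmorphB !rmorphM rmorphN1 /=; ring.
by move/eqP; rewrite eqr_int => /eqP; lia.
Qed.

(* A single term survives on each side of the Borcherds identity. *)
Lemma lead_right : mu_right p' = muI A (Ic (muI A) m%:~R (2%:R * n%:~R) u u' 0)
  (- 1 - (m%:~R + n%:~R) * (2%:R * k%:~R)) 0%N u''.
Proof.
have [q [_ _ pu _]] := hu.
(* With these indices u_N u' and u'_(k0) u'' are the leading products, while u_(M+j) u'' = 0 for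
   every j >= 0. *)
pose M := - (2%:Z * m * k); pose N := -1 - 2%:Z * m * n; pose k0 := -1 - 2%:Z * n * k.
have c1 j : (1 <= j)%N -> YA u (N + j%:Z) u' = 0.
  by move=> hj; apply: (muI_zero hu hu'); rewrite /N; lia.
have c2 j : (1 <= j)%N -> YA u' (k0 + j%:Z) u'' = 0.
  by move=> hj; apply: (muI_zero hu' hu''); rewrite /k0; lia.
have c3 (j : nat) : YA u (M + j%:Z) u'' = 0.
  by apply: (muI_zero hu hu''); rewrite /M; lia.
have := bo_fin (YA_borch A) pu c1 c2 (fun j _ => c3 j).
rewrite !big_ord_recl !big_ord0 !addr0 !gbin0 expr0 mulr1 !scale1r.
have := c3 0%N; rewrite addr0 => ->; rewrite lf0 scaler0 subr0 => e.
rewrite mu_rightE icompE.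
have -> : mu p = YA u' k0 u''.
  rewrite /Ic subr0 -muIE icompE; congr (mu (I2 _ _ _ _)).
  by rewrite /k0 !rmorphB !rmorphM rmorphN1 /=; ring.
have -> : Ic (muI A) m%:~R (2%:R * n%:~R) u u' 0 = YA u N u'.
  rewrite /Ic subr0 -muIE; congr (muI A _ _ _ _).
  by rewrite /N !rmorphB !rmorphM rmorphN1 /=; ring.
have -> : - 1 - (m%:~R + n%:~R) * (2%:R * k%:~R) = (M + k0)%:~R :> K.
  by rewrite /M /k0 !rmorphD !rmorphN !rmorphM rmorph1 /=; ring.
rewrite [RHS]muIE e -[RHS]muIE -[LHS]/(muI A u _ 0%N _); congr (muI A _ _ _ _).
rewrite subr0 /M /N !rmorphD !rmorphN !rmorphM rmorph1 /=; ring.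
Qed.

(** The difference is a vacuum vector, so [detect] applies. For a functional f, the product and the
    iterate are the same nonzero number times their leading terms, so that [assocE] at (3, 2)
    equates these terms, and [lead_right] links them inside A. *)
Lemma lead_assoc : mu_right p' = mu_left p'.
Proof.
have [q1 [_ _ _ lu]] := hu; have [q2 [_ _ _ lu']] := hu'; have [q3 [_ _ _ [vw hw _]]] := hu''.
apply/eqP; rewrite -subr_eq0; apply/eqP; apply: (detect (@indOP _ _ AA)).
  have vp := Ic_vac I2 lu' vw hw; have hp := Ic_h I2 lu' hw.
  have vp' := Ic_vac I1 lu vp hp.
  by move=> r r0; rewrite lfB -!hom_hb vp' // !lf0 addr0.
move=> f gf fh; rewrite linearB lead_right; apply/eqP; rewrite subr_eq0; apply/eqP.
pose F : {scalar ten T AA (ten T AA AA)} := f \o mu_left.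
pose G : {scalar ten T (ten T AA AA) AA} := f \o mu_lft.
have gG : graded_dual G.
  have [s hs] := gf; exists s => h w hw'; apply: hs; exact: gen_wt_hom.
have l32 : (2%:R : R) < 3%:R by rewrite ltr_nat.
have l31 : (3%:R : R) - 2%:R < 2%:R by rewrite ltrBlDr -natrD ltr_nat.
have l30 : (0 : R) < 3%:R - 2%:R by rewrite subr_gt0.
have [x [hx1 hx2]] := assocE (h0 := T) u u' u'' gG l32 l31 l30.
have FhF r y : (0 < r)%N -> F (hb _ (- r%:Z) y) = 0.
  by move=> r0; rewrite -[LHS]/(f (mu_left _)) (hom_hb mu_left) fh.
have FhG r y : (0 < r)%N -> G (hb _ (- r%:Z) y) = 0.
  by move=> r0; rewrite -[LHS]/(f (mu_lft _)) (hom_hb mu_lft) fh.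
have e1 := product_value (F := F) FhF lu lu' vw hw (I1 := I1) (I2 := I2) hx1.
have e2 := iterate_value (F := G) FhG lu lu' vw hw hx2.
move: e1; rewrite e2 => e.
have nz : 2%:R ^ (2%:Z * n * k) * 3%:R ^ (2%:Z * m * k) != 0 :> K.
  by rewrite mulf_neq0 // expfz_neq0 // pnatr_eq0.
move/(mulfI nz): e; rewrite -[G _]/(f (mu_lft _)) -[F _]/(f (mu_left _)) mu_lftE => e.
by rewrite {2}/Ic subr0 -e; congr (f (muI A _ _ _ _)).
Qed.
End Leading.

(** The vectors at which both maps agree form a submodule, so each of the three arguments can be
    reduced to a lattice vector and each operator to its leading coefficient. *)
Lemma mu_assoc t : mu_right t = mu_left t.
Proof.
pose D := eq_lsub mu_right mu_left.
have sD : submod D.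
  split=> [|c x y hx hy|x hx|v n x hx]; [exact: lsub0|exact: lsubL| |].
    change (mu_right (par _ x) = mu_left (par _ x)).
    by rewrite (hom_pare mu_right) (hom_pare mu_left); congr (par _ _).
  change (mu_right (Yw _ v n x) = mu_left (Yw _ v n x)).
  by rewrite (hom_Ye mu_right) (hom_Ye mu_left); congr (Yw _ _ _ _).
pose J h k (a : AA) (l : int) (t : ten T AA AA) := I1 a (h + l%:~R) k t.
have bJ h k : borch (J h k) := borch_intw I1 h k.
pose E := fun t => forall a h k, D (I1 a h k t).
have E0 : E 0 by move=> a h k; rewrite lf0; exact: lsub0.
have EL c x y : E x -> E y -> E (c *: x + y).
  by move=> hx hy a h k; rewrite linearP; apply: lsubL.
pose EE := @Lsub R _ E E0 EL.
have DY v n x : D x -> D (Yw _ v n x) by case: sD => _ _ _; apply.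
have Ep x : E x -> E (par _ x).
  move=> hx a h k; case: sD => _ _ Dp _.
  by rewrite -(parKE a) -i_par; apply: Dp.
have sE : submod EE.
  split=> [|||v n x hx] //; move=> a h k.
  have := gprop_right (bJ h k) DY (P := fun=> True) (fun _ _ => I) (fun _ _ _ _ => I) (w2 := x).
  by move=> /(_ (fun w1 _ l => hx w1 _ k) v n a I 0); rewrite /J addr0.
have Elead n k u' u'' : isu n u' -> isu k u'' ->
    EE (Ic I2 n%:~R (2%:R * k%:~R) u' u'' 0).
  move=> hu' hu'' b h0 k0; have [q2 [_ _ _ lu']] := hu'; have [q3 [_ _ _ [vw hw _]]] := hu''.
  have vp := Ic_vac I2 lu' vw hw; have hp := Ic_h I2 lu' hw.
  have hz h1 k1 : D (I1 0 h1 k1 (Ic I2 n%:~R (2%:R * k%:~R) u' u'' 0)) by rewrite intw0l; exact: lsub0.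
  pose B := @Lsub R AA (fun a => forall h1 k1, D (I1 a h1 k1 (Ic I2 n%:~R (2%:R * k%:~R) u' u'' 0))) hz
    (fun c x y hx hy h1 k1 => ecast z (D z) (esym (i_linear I1 h1 k1 _ c x y)) (lsubL c (hx h1 k1) (hy h1 k1))).
  move: b h0 k0; apply: (A_span (D := B)) => m a ha h1 k1.
  have [u hu] := isu_ex A m; have [q [hu1 u0 pu lu]] := hu.
  have hD l : D (J h1 k1 u l (Ic I2 n%:~R (2%:R * k%:~R) u' u'' 0)).
    have := @Ic_in _ _ _ _ _ I1 _ _ _ _ lu vp hp D sD (lead_assoc hu hu' hu''); exact.
  by have := propagate (bJ h1 k1) sD pu hD (Agr_gen hu1 u0 ha) (fun E _ h => h) 0; rewrite /J addr0.
have Eall a h k b : EE (I2 a h k b).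
  have bJ2 h1 k1 : borch (fun (a : AA) (l : int) (b : AA) => I2 a (h1 + l%:~R) k1 b) := borch_intw I2 h1 k1.
  have z1 h1 k1 b1 : EE (I2 0 h1 k1 b1) by rewrite intw0l; exact: lsub0.
  have z2 h1 k1 a1 : EE (I2 a1 h1 k1 0) by rewrite lf0; exact: lsub0.
  pose B1 := @Lsub R AA (fun a => forall h1 k1 b1, EE (I2 a h1 k1 b1)) z1
    (fun c x y hx hy h1 k1 b1 => ecast z (EE z) (esym (i_linear I2 h1 k1 b1 c x y)) (lsubL c (hx h1 k1 b1) (hy h1 k1 b1))).
  move: a h k b; apply: (A_span (D := B1)) => n a ha h k.
  pose B2 := @Lsub R AA (fun b => forall h1 k1, EE (I2 a h1 k1 b)) (fun h1 k1 => z2 h1 k1 a)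
    (fun c x y hx hy h1 k1 => ecast z (EE z) (esym (linearP (I2 a h1 k1) c x y)) (lsubL c (hx h1 k1) (hy h1 k1))).
  move=> b; move: b h k; apply: (A_span (D := B2)) => l b hb h k.
  have [u' hu'] := isu_ex A n; have [u'' hu''] := isu_ex A l.
  have [q2 [hu2 u20 pu' lu']] := hu'; have [q3 [hu3 u30 _ [vw hw _]]] := hu''.
  have hD i : EE (I2 u' (h + i%:~R) k u'').
    exact (@Ic_in _ _ _ _ _ I2 _ _ _ _ lu' vw hw EE sE (Elead _ _ _ _ hu' hu'') _ _).
  by have := propagate (bJ2 h k) sE pu' hD (Agr_gen hu2 u20 ha) (Agr_gen hu3 u30 hb) 0; rewrite addr0.
apply: (ten_eq (f := mu_right) (g := mu_left)) => a h k x.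
exact: (ten_span (D := EE) Eall).
Qed.
End MuAssoc.

(** * Induction *)

Section Monoidal.
Variables (R : realType) (V : V1gl11 R) (T : hlz V).
Local Notation K := R[i].
Local Notation u0 := (unitO T).

Lemma der0 (W1 W2 W3 : vmod V) (J : W1 -> int -> W2 -> W3) (bJ : borch J) v a n b :
  homog false v -> Yw W3 v 0 (J a n b) = J (Yw W1 v 0 a) n b + J a n (Yw W2 v 0 b).
Proof.
move=> hv; have [n0 hn0] := Yw_trunc (v0 := W1) v a.
rewrite (bo_comm bJ b 0 n hv (N := `|n0|%N.+1)); last by move=> j hj; apply: hn0; lia.
rewrite /= big_ord_recl big1 => [|j _]; last by rewrite gbinz0 scale0r.
by rewrite gbin0 scale1r addr0 addrC add0r subr0.
Qed.

Lemma der0_intw (W1 W2 W3 : vmod V) (I : intw W1 W2 W3) v a h k b :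
  homog false v -> Yw W3 v 0 (I a h k b) = I (Yw W1 v 0 a) h k b + I a h k (Yw W2 v 0 b).
Proof. by move=> hv; have := der0 (borch_intw I h k) a 0 b hv; rewrite addr0. Qed.

Lemma E0_Yw (W : vmod V) v n w : curw W glE 0 (Yw W v n w) = Yw W v n (curw W glE 0 w).
Proof.
rewrite /curw (der0 (borch_Yw W) _ _ _ (cur_homog V glE)) /=.
by rewrite (_ : Y (Vv V) (cur V glE) 0 v = 0) ?Yw0 ?add0r // -[LHS]/(Yw (adjoint V) _ _ _) V_E0.
Qed.

Lemma badP (h : K) k : bad h k \/ exists n : int, h = n%:~R /\ k = 0%N.
Proof.
have [b|nb] := pselect (bad h k); [by left|right].
have [n hn] : exists n : int, h = n%:~R.
  by apply: contrapT => e; apply: nb; right=> n hn; apply: e; exists n.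
exists n; split=> //; by apply: contrapT => e; apply: nb; left.
Qed.

Lemma realizes0 (W1 W2 W3 X : vmod V) (I : intw W1 W2 W3) (f : W3 -> X) y :
  realizes I f y -> forall w1 h k w2, bad h k -> f (I w1 h k w2) = 0.
Proof. by move=> [_ z] w1 h k w2 [/eqP k0|hn]; apply: z; [left|right]. Qed.

Lemma ten_zero (W1 W2 : indO V) (N : lmodType K) (f : {linear ten T W1 W2 -> N}) :
  (forall w1 h k w2, f (tenI T W1 W2 w1 h k w2) = 0) -> forall t, f t = 0.
Proof.
move=> hf; have kL c u w : f u = 0 -> f w = 0 -> f (c *: u + w) = 0.
  by move=> hu hw; rewrite linearP hu hw scaler0 addr0.
exact: (ten_span (D := Lsub (lf0 f) kL)).
Qed.

Lemma tmap_eq p q (W1 X1 W2 X2 : indO V) (f f' : hom p W1 X1) (g g' : hom q W2 X2) :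
  f =1 f' -> g =1 g' -> tmap T f g =1 tmap T f' g'.
Proof. by move=> ef eg; apply: ten_eq => w1 h k w2; rewrite !tmapE ef eg. Qed.

Lemma tmap_comp (W1 X1 Y1 W2 X2 Y2 : indO V) (f : hom false X1 Y1) (g : hom false X2 Y2)
    (f' : hom false W1 X1) (g' : hom false W2 X2) t :
  tmap T f g (tmap T f' g' t) = tmap T (hcomp f f') (hcomp g g') t.
Proof.
move: t; apply: (ten_eq (f := hcomp (tmap T f g) (tmap T f' g'))) => w1 h k w2.
by rewrite /= !tmapE.
Qed.

Lemma tmap_id (W1 W2 : indO V) t : tmap T (hid W1) (hid W2) t = t.
Proof. by move: t; apply: (ten_eq (g := hid _)) => w1 h k w2; rewrite tmapE. Qed.

Lemma tmap_surj (W1 X1 W2 X2 : indO V) (f : hom false W1 X1) (g : hom false W2 X2) :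
  surj f -> surj g -> surj (tmap T f g).
Proof.
move=> sf sg;
have key t : im_lsub (tmap T f g) (lsubV (submodT _)) t.
  move: t; apply: ten_span => w1 h k w2.
  have [x1 <-] := sf w1; have [x2 <-] := sg w2.
  by exists (tenI T W1 W2 x1 h k x2); split; rewrite ?lsubVE ?tmapE.
by move=> t; have [x [_ hx]] := key t; exists x.
Qed.

Lemma lunit_nat (X Y : indO V) (f : hom false X Y) t :
  lunit T Y (tmap T (hid u0) f t) = f (lunit T X t).
Proof.
move: t; apply: (ten_eq (f := hcomp (lunit T Y) (tmap T (hid u0) f)) (g := hcomp f (lunit T X))) => v h k x /=.
rewrite tmapE /=; have [b|[n [-> ->]]] := badP h k.
  by rewrite !(realizes0 (lunitE T _)) // lf0.
by rewrite !(proj1 (lunitE T _)) hom_Ye.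
Qed.

Lemma bij_surj (B C : Type) (f : B -> C) : bijective f -> surj f.
Proof. by move=> [g _ gK] y; exists (g y). Qed.

(** By naturality of [lunit], tensoring with the unit is faithful; after tensoring, the equality
    follows from the pentagon with two unit factors and two triangles. *)
Lemma kelly (X Y : indO V) t :
  tmap T (lunit T X) (hid Y) (assoc T u0 X Y t) = lunit T (ten T X Y) t.
Proof.
pose r := hcomp (lunit T u0) (braid T u0 u0).
pose f : hom false (ten T u0 (ten T X Y)) (ten T X Y) :=
  hcomp (tmap T (lunit T X) (hid Y)) (assoc T u0 X Y).
have key s : tmap T (hid u0) f s = tmap T (hid u0) (lunit T (ten T X Y)) s.
  apply: (bij_inj (assoc_bij T u0 X Y)).
  transitivity (assoc T u0 X Y (tmap T (hid u0) (tmap T (lunit T X) (hid Y)) (tmap T (hid u0) (assoc T u0 X Y) s))).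
    by congr (assoc T _ _ _ _); rewrite tmap_comp; apply: tmap_eq.
  rewrite assoc_nat.
  transitivity (tmap T (tmap T r (hid X)) (hid Y) (tmap T (assoc T u0 u0 X) (hid Y) (assoc T u0 (ten T u0 X) Y (tmap T (hid u0) (assoc T u0 X Y) s)))).
    by rewrite tmap_comp; apply: tmap_eq => // y; rewrite /= -triangle.
  rewrite -pentagon -(assoc_nat r (hid X) (hid Y)) -triangle; congr (assoc T _ _ _ _).
  by apply: tmap_eq => // y; rewrite tmap_id.
have [s <-] := bij_surj (lunit_bij T (ten T u0 (ten T X Y))) t.
by rewrite -[LHS]/(f _) -!lunit_nat key.
Qed.
End Monoidal.

Section Induction.
Variables (R : realType) (V : V1gl11 R) (T : hlz V) (A : extension T).
Local Notation K := R[i].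
Local Notation VV := (Vv V).
Local Notation AA := (extA A).
Local Notation YA := (Y (extV A)).
Local Notation vacA := (vac (extV A)).
Local Notation iU := (extU A).
Local Notation mu := (extmu A).
Local Notation u0 := (unitO T).

Lemma muZ a h k b : bad h k -> mu (tenI T AA AA a h k b) = 0.
Proof. exact: (realizes0 (extmuE A)). Qed.

Lemma mu_unit t : mu (tmap T iU (hid AA) t) = lunit T AA t.
Proof.
move: t; apply: (ten_eq (f := hcomp mu (tmap T iU (hid AA)))) => v h k x /=.
rewrite tmapE /=; have [b|[n [-> ->]]] := badP h k.
  by rewrite (realizes0 (lunitE T _)) // muZ.
by rewrite (proj1 (lunitE T _)) (proj1 (extmuE A)) extU_Y.
Qed.

Let vac_ev : @homog R u0 false (vac VV) := vac_even VV.

Lemma runit_vac a : hcomp (lunit T AA) (braid T AA u0) (tenI T AA u0 a (-1)%:~R 0%N (vac VV)) = a.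
Proof.
have key p b : homog p b -> hcomp (lunit T AA) (braid T AA u0) (tenI T AA u0 b (-1)%:~R 0%N (vac VV)) = b.
  move=> hb; rewrite /= (braidE T _ _ hb vac_ev) andbF expr0 scale1r.
  have li : injective (lunit T AA) := bij_inj (lunit_bij T AA).
  rewrite (skew_good (N := 1)).
  - rewrite big_ord_recl big_ord0 addr0 /= fact0 invr1 mul1r expr0z scale1r.
    by rewrite (proj1 (lunitE T _)) /= Yw_vac.
  - by move=> h k bhk; apply: li; rewrite (realizes0 (lunitE T _)) // lf0.
  move=> j hj; apply: li; rewrite (proj1 (lunitE T _)) Yw_vac lf0.
  by case: eqP => // e; lia.
rewrite [a in LHS]hpartE intwDl lfD (key false) ?(key true) -?hpartE //; exact: hpart_homog.
Qed.

(* Both sides are module maps out of A x V, and they agree on a (x) vac. *)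
Lemma mu_runit t : mu (tmap T (hid AA) iU t) = hcomp (lunit T AA) (braid T AA u0) t.
Proof.
pose r := hcomp (lunit T AA) (braid T AA u0); pose g := hcomp mu (tmap T (hid AA) iU).
have [ri rK riK] : bijective r := bij_comp (lunit_bij T AA) (braid_bij T AA u0).
have e a : tenI T AA u0 a (-1)%:~R 0%N (vac VV) = ri a by rewrite -[in RHS](runit_vac a) rK.
have gE a : g (ri a) = a.
  by rewrite -e /g /= tmapE (proj1 (extmuE A)) /= extU_vac Y_creation.
by rewrite -[LHS]/(g t) -[in LHS](rK t) gE.
Qed.

Section Eta.
Variable W : indO V.

Definition etaf : {linear W -> ten T AA W} := tenI T AA W vacA (-1)%:~R 0%N.
(** Identifies [etaf] with the inverse of [lunit] followed by the inclusion of V in A; this is what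
    makes it a module map. *)
Lemma eta_lunit t : etaf (lunit T W t) = tmap T iU (hid W) t.
Proof.
have [ri rK riK] := lunit_bij T W.
have <- : tenI T u0 W (vac VV) (-1)%:~R 0%N (lunit T W t) = t.
  apply: (bij_inj (lunit_bij T W)); rewrite (proj1 (lunitE T _)).
  by rewrite Yw_vac.
by rewrite tmapE /= extU_vac (proj1 (lunitE T _)) Yw_vac eqxx.
Qed.
Lemma eta_par w : etaf (par W w) = (-1) ^+ false *: par _ (etaf w).
Proof.
have [t <-] := bij_surj (lunit_bij T W) w.
by rewrite expr0 scale1r -hom_pare !eta_lunit hom_pare.
Qed.
Lemma eta_Y v n w : etaf (Yw W v n w) = Yw _ (parX false v) n (etaf w).
Proof.
have [t <-] := bij_surj (lunit_bij T W) w.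
by rewrite -hom_Ye !eta_lunit hom_Ye.
Qed.
Definition etah : hom false W (ten T AA W) := Hom eta_par eta_Y.

(** Acting with A on the image of W recovers the whole of F(W): the triangle axiom combined with
    right unitality of the product. *)
Lemma eta_gen t : tmap T mu (hid W) (assoc T AA AA W (tmap T (hid AA) etah t)) = t.
Proof.
have [s <-] := tmap_surj (f := hid AA) (fun y => ex_intro _ y erefl) (bij_surj (lunit_bij T W)) t.
rewrite -[RHS]triangle tmap_comp.
transitivity (tmap T mu (hid W) (assoc T AA AA W (tmap T (hid AA) (tmap T iU (hid W)) s))).
  by congr (tmap T mu _ (assoc T _ _ _ _)); apply: tmap_eq => // y; apply: eta_lunit.
rewrite assoc_nat tmap_comp; apply: tmap_eq => // y; exact: mu_runit.
Qed.
End Eta.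

Lemma act_vac (X : actobj A) (x : X) : is_Rep X -> rmu X (etah X x) = x.
Proof.
move=> [_ hu]; have [t <-] := bij_surj (lunit_bij T X) x.
by rewrite -[RHS]hu -eta_lunit.
Qed.

(* rho is the projection onto A_0 = V along the other E_0-eigenspaces. *)
Lemma retraction : exists rho : hom false AA u0, forall v, rho (iU v) = v.
Proof.
have iUi : injective iU.
  have [U [u [j [hu ind ju]]]] := V_induced V.
  have irr : irreducible (adjoint V).
    by apply: (Ahat_irr A (n := 0) (m := 0)); rewrite /is_Ahat eqxx; exists U, u, j.
  have [h|h] := proj2 irr _ (pre_submod iU (zsub AA)).
    by move=> x y e; apply/eqP; rewrite -subr_eq0; apply/eqP/h => /=; rewrite lfB e subrr.
  by have := h (vac VV); rewrite /= extU_vac => e; have := vacA_neq0 A; rewrite e eqxx.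
pose E := curw AA glE 0.
have ex a : exists v, othE E 0 (a - iU v).
  have P0 : exists v, othE E 0 (0 - iU v) by exists 0; rewrite lf0 subrr; exact: sum_of0.
  have PL c x y : (exists v, othE E 0 (x - iU v)) -> (exists v, othE E 0 (y - iU v)) ->
      exists v, othE E 0 (c *: x + y - iU v).
    move=> [v hv] [w hw]; exists (c *: v + w).
    have -> : c *: x + y - iU (c *: v + w) = c *: (x - iU v) + (y - iU w).
      by rewrite (lfD iU) (lfZ iU); lincomb.
    by apply: sum_ofD hw; apply: othEZ.
  apply: (A_span (D := Lsub P0 PL)) => m x hx /=.
  have [m0|m0] := eqVneq m 0.
    by move: hx; rewrite m0 => /A0_U [v <-]; exists v; rewrite subrr; exact: sum_of0.
  exists 0; rewrite lf0 subr0; apply: sum_of1; exists m%:~R; split; first by rewrite intr_eq0.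
  exact: eigE_gen.
have uni v w a : othE E 0 (a - iU v) -> othE E 0 (a - iU w) -> v = w.
  move=> hv hw; apply: iUi; apply/eqP; rewrite -subr_eq0; apply/eqP.
  apply: (@genE_othE0 _ _ E 0 _ ((a - iU v) + (-1) *: (a - iU w))).
  - by apply: eigE_gen; rewrite /eigE lfB !E0_V subrr scale0r.
  - by apply: sum_ofD hv _; apply: othEZ.
  by lincomb.
pose f a := xget 0 [set v | othE E 0 (a - iU v)]%classic.
have fP a : othE E 0 (a - iU (f a)) by apply: (xgetPex 0 (ex a)).
have fl : linear f.
  move=> c x y; apply: (uni _ _ (c *: x + y)) => //.
  have -> : c *: x + y - iU (c *: f x + f y) = c *: (x - iU (f x)) + (y - iU (f y)).
    by rewrite (lfD iU) (lfZ iU); lincomb.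
  by apply: sum_ofD (fP y); apply: othEZ.
have oY v n a : othE E 0 a -> othE E 0 (Yw AA v n a).
  by apply: (othE_map (f := Yw AA v n)) => u; rewrite /E E0_Yw.
have op a : othE E 0 a -> othE E 0 (par AA a).
  by apply: othE_map => u; have := proj1 (curw_level1 AA) glE 0 u; rewrite /= expr0 scale1r.
have fp a : mklin fl (par AA a) = (-1) ^+ false *: par V (mklin fl a).
  rewrite expr0 scale1r; apply: (uni _ _ (par AA a)) => //.
  by rewrite (hom_pare iU) -lfB; apply: op.
have fY v n a : mklin fl (Yw AA v n a) = Yw u0 (parX false v) n (mklin fl a).
  apply: (uni _ _ (Yw AA v n a)) => //.
  by rewrite (hom_Ye iU) -lfB; apply: oY.
exists (Hom fp fY) => v; apply: (uni _ _ (iU v)) => //=; rewrite subrr; exact: sum_of0.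
Qed.

(** The retraction of A onto V, tensored with W, splits the map. *)
Lemma eta_inj (W : indO V) : injective (etah W).
Proof.
have [rho hr] := retraction => x y.
have [s <-] := bij_surj (lunit_bij T W) x; have [t <-] := bij_surj (lunit_bij T W) y.
rewrite /= !eta_lunit => /(congr1 (tmap T rho (hid W))); rewrite !tmap_comp.
have e z : tmap T (hcomp rho iU) (hcomp (hid W) (hid W)) z = z.
  by rewrite -[RHS]tmap_id; apply: tmap_eq => // v; apply: hr.
by rewrite !e => ->.
Qed.

Lemma Agr_submod m : submod (Agr (A := A) m).
Proof.
split; [by rewrite /Agr lf0 scaler0|move=> c u w hu hw|exact: Agr_par|move=> v n u].
  by rewrite /Agr linearP hu hw; lincomb.
by rewrite /Agr E0_Yw => ->; rewrite lfZ.
Qed.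

Lemma gen_by_submod (X : vmod V) (x : X) : submod (gen_by x).
Proof.
split=> [E [E0 _ _ _] _ //|c u w hu hw E sE Ex|u hu E sE Ex|v n u hu E sE Ex].
- by have [_ EL _ _] := sE; apply: EL; [apply: hu|apply: hw].
- by have [_ _ Ep _] := sE; apply: Ep; apply: hu.
- by have [_ _ _ EY] := sE; apply: EY; apply: hu.
Qed.

(* vac lies in A_(-m) A_m, and x = vac . x = A_(-m) (A_m x) by associativity. *)
Lemma act_faithful (X : actobj A) m (x : X) : is_Rep X ->
  (forall a h k, Agr m a -> rmu X (tenI T AA X a h k x) = 0) -> x = 0.
Proof.
move=> hX hx; have [has hu] := hX.
pose I := icomp (tenI T AA X) (rmu X).
have bJ h k : borch (fun (a : AA) (l : int) (y : X) => I a (h + l%:~R) k y) := borch_intw I h k.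
have [_ _ Ap AY] := Agr_submod m.
have ZY v n (u : X) : zlsub X u -> zlsub X (Yw X v n u) by move=> /= ->; rewrite lf0.
have hD y : gen_by x y -> forall a h k, Agr m a -> I a h k y = 0.
  have D0 a h k : Agr m a -> I a h k 0 = 0 by rewrite lf0.
  have DL c u w : (forall a h k, Agr m a -> I a h k u = 0) -> (forall a h k, Agr m a -> I a h k w = 0) ->
      forall a h k, Agr m a -> I a h k (c *: u + w) = 0.
    by move=> h1 h2 a h k ha; rewrite linearP h1 // h2 // scaler0 addr0.
  move=> hy; apply: (hy (fun y => forall a h k, Agr m a -> I a h k y = 0)); last exact: hx.
  split=> // [u hu' a h k ha|v n u hu' a h k ha].
    by rewrite -(parKE a) -i_par hu' ?lf0 //; apply: Ap.
  have := gprop_right (bJ h k) (D := zlsub X) ZY (P := Agr m) Ap (fun v n a => @AY v n a) (w2 := u).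
  by move=> /(_ (fun w1 h1 l => hu' w1 _ k h1) v n a ha 0); rewrite addr0.
have sK := gen_by_submod x.
pose Kx : indO V := IndO (Ind_sub (sE := sK) (@indOP _ _ X)).
pose iK : hom false Kx X := subh sK.
pose B l : indO V := IndO (Ind_sub (sE := Agr_submod l) (@indOP _ _ AA)).
pose iB l : hom false (B l) AA := subh (Agr_submod l).
have z1 t : rmu X (tmap T (iB m) iK t) = 0.
  move: t; apply: (ten_zero (f := hcomp (rmu X) (tmap T (iB m) iK))) => a h k y.
  by rewrite /= tmapE /=; apply: (hD (iK y)); apply: subh_in.
have z2 s : rmu X (tmap T mu (hid X) (tmap T (tmap T (iB (- m)) (iB m)) iK s)) = 0.
  have [t <-] := bij_surj (assoc_bij T (B (- m)) (B m) Kx) s.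
  rewrite -assoc_nat -has tmap_comp.
  have -> : tmap T (hcomp (hid AA) (iB (- m))) (hcomp (rmu X) (tmap T (iB m) iK)) t = 0.
    move: t; apply: (ten_zero (f := tmap T _ _)) => b n j t.
    by rewrite tmapE /= z1 lf0.
  by rewrite lf0.
pose D c := forall y h k, gen_by x y -> I c h k y = 0.
have D0 : D 0 by move=> y h k _; rewrite intw0l.
have DL c u w : D u -> D w -> D (c *: u + w).
  by move=> h1 h2 y h k hy; rewrite intwDl intwZl h1 // h2 // scaler0 addr0.
have sD : submod (Lsub D0 DL).
  split=> // [u hu' y h k hy|v n u hu' y h k hy].
    rewrite -(parKE y) -i_par hu' ?lf0 //.
    by have [_ _ Kp _] := sK; apply: Kp.
  have := gprop_left (bJ h k) (D := zlsub X) ZY v (w1 := u) (w2 := y).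
  by move=> /(_ (fun l => hu' y _ k hy) n 0); rewrite addr0.
suff Dv : D vacA by rewrite -(act_vac x hX); apply: (Dv x (-1)%:~R 0%N) => E.
apply: (vac_prod (m := - m) (D := Lsub D0 DL) _ sD).
move=> b n a hb ha y h k hy; rewrite opprK in ha.
have [b' eb] := subh_elim (Agr_submod (- m)) hb; have [a' ea] := subh_elim (Agr_submod m) ha.
have [y' ey] := subh_elim sK hy.
have := z2 (tenI T _ Kx (tenI T (B (- m)) (B m) b' n%:~R 0%N a') h k y').
by rewrite !tmapE /= /iB /iK eb ea ey (proj1 (extmuE A)).
Qed.

(** The product of A_m and W has E_0 = e + m, so eigenvalue e comes from A_0 = V alone, that is,
    from W. *)
Lemma eta_deg (W : indO V) e (t : ten T AA W) :
  (forall w : W, curw W glE 0 w = e *: w) -> curw _ glE 0 t = e *: t -> exists w, etah W w = t.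
Proof.
move=> hE; pose Q t := exists w o, othE (curw (ten T AA W) glE 0) e o /\ t = etah W w + o.
have Q0 : Q 0 by exists 0, 0; split; [exact: sum_of0|rewrite lf0 addr0].
have QL c x y : Q x -> Q y -> Q (c *: x + y).
  move=> [w [o [h1 ->]]] [w' [o' [h2 ->]]]; exists (c *: w + w'), (c *: o + o'); split.
    by apply: sum_ofD h2; apply: othEZ.
  by rewrite (linearP (etah W)); lincomb.
have all : forall t, Lsub Q0 QL t.
  apply: ten_span => a h k w; move: a.
  have z : Lsub Q0 QL (tenI T AA W 0 h k w) by rewrite intw0l.
  apply: (A_span (D := @Lsub R AA (fun a => Lsub Q0 QL (tenI T AA W a h k w)) z
    (fun c x y hx hy => ecast z (Lsub Q0 QL z) (esym (i_linear (tenI T AA W) h k w c x y)) (QL c _ _ hx hy)))) => m a ha.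
  have [m0|m0] := eqVneq m 0.
    move: ha; rewrite m0 => /A0_U [v <-].
    exists (lunit T W (tenI T u0 W v h k w)), 0; split; first exact: sum_of0.
    by rewrite addr0 -[RHS]/(etaf W _) eta_lunit tmapE.
  exists 0, (tenI T AA W a h k w); split; last by rewrite lf0 add0r.
  apply: sum_of1; exists (e + m%:~R); split.
    by rewrite -subr_eq0 addrC addKr intr_eq0.
  apply: eigE_gen; rewrite /eigE /curw (der0_intw _ _ _ _ _ (cur_homog V glE)).
  by rewrite -!/(curw _ glE 0 _) ha hE intwZl lfZ; lincomb.
move=> ht; have [w [o [ho et]]] := all t; exists w.
apply/eqP; rewrite -subr_eq0 -opprB oppr_eq0; apply/eqP.
have hEw : curw (ten T AA W) glE 0 (etah W w) = e *: etah W w by rewrite -(hom_curE (etah W)) hE lfZ.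
apply: (@genE_othE0 _ _ (curw (ten T AA W) glE 0) e _ ((-1) *: o)); last by rewrite et; lincomb.
  by apply: eigE_gen; rewrite /eigE lfB ht hEw scalerBr.
exact: othEZ.
Qed.

Lemma intg_ten (W : indO V) : intg W -> intg (ten T AA W).
Proof.
move=> iW.
pose D := sum_sub (@iPZ R V (ten T AA W)).
suff all : forall t, D t by exact: all.
apply: ten_span => a h k w.
have [s [hs ->]] := A_intgr a; have [r [hr ->]] := iW w.
have -> : tenI T AA W (\sum_(u <- s) u) h k (\sum_(v <- r) v) =
   \sum_(u <- s) \sum_(v <- r) tenI T AA W u h k v.
  rewrite [LHS](linear_sum (mklin (i_linear (tenI T AA W) h k _))); apply: eq_bigr => u _.
  exact: (linear_sum (tenI T AA W u h k)).
apply: lsub_sum_seq => u /hs [i hi]; apply: lsub_sum_seq => v /hr [j hj].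
apply: sum_of1; exists (i + j).
rewrite /hb (der0_intw _ _ _ _ _ (hv_homog V)) -!/(hb _ 0 _) hi hj intwZl lfZ rmorphD /=; lincomb.
Qed.

Section Mod.
Variable W : ofin V.
Local Notation F := (induction A W).
Local Notation hW := (hid (ofin_ind W)).

Lemma induction_rep : is_Rep F.
Proof.
split=> t.
  rewrite /=.
  transitivity (tmap T mu hW (assoc T AA AA W (tmap T (hid AA) (tmap T mu hW) (tmap T (hid AA) (assoc T AA AA W) t)))).
    by congr (tmap T mu _ (assoc T _ _ _ _)); rewrite tmap_comp; apply: tmap_eq.
  rewrite assoc_nat tmap_comp.
  transitivity (tmap T (mu_lft A) hW (tmap T (assoc T AA AA AA) hW (assoc T AA (ten T AA AA) W (tmap T (hid AA) (assoc T AA AA W) t)))).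
    by rewrite tmap_comp; apply: tmap_eq => // y; apply: mu_assoc.
  rewrite -pentagon.
  transitivity (tmap T mu hW (tmap T (tmap T mu (hid AA)) hW (assoc T (ten T AA AA) AA W (assoc T AA AA (ten T AA W) t)))).
    by rewrite tmap_comp; apply: tmap_eq.
  rewrite -(assoc_nat mu (hid AA) hW); congr (tmap T mu _ (assoc T _ _ _ _)).
  by apply: tmap_eq => // y; rewrite tmap_id.
rewrite -kelly /=.
transitivity (tmap T mu hW (assoc T AA AA W (tmap T iU (tmap T (hid AA) hW) t))).
  by congr (tmap T mu _ (assoc T _ _ _ _)); apply: tmap_eq => // y; rewrite tmap_id.
rewrite assoc_nat tmap_comp; apply: tmap_eq => // y; exact: mu_unit.
Qed.

Lemma induction_local : intg W -> is_Rep0 F.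
Proof.
move=> iW; split; first exact: induction_rep.
by move=> t; rewrite braid_sq //; apply: intg_ten.
Qed.

Lemma act_span (D : lsub F) : (forall a h k x, D x -> D (rmu F (tenI T AA F a h k x))) ->
  (forall w, D (etah W w)) -> forall x, D x.
Proof.
move=> st hD x; rewrite -(eta_gen x).
have all : forall t, pre_lsub (tmap T (hid AA) (etah W)) (pre_lsub (rmu F) D) t.
  by apply: ten_span => a h k w; rewrite /= tmapE /=; apply: st; apply: hD.
exact: all.
Qed.

Lemma act_E0 (X : actobj A) m a h k (x : X) c : Agr m a -> curw X glE 0 x = c *: x ->
  curw X glE 0 (rmu X (tenI T AA X a h k x)) = (c + m%:~R) *: rmu X (tenI T AA X a h k x).
Proof.
move=> ha hx; rewrite -(hom_curE (rmu X)) /curw (der0_intw _ _ _ _ _ (cur_homog V glE)).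
by rewrite -!/(curw _ glE 0 _) ha hx intwZl (lfZ (tenI T AA X a h k)) lfD !lfZ; lincomb.
Qed.

Lemma ten_E0 e (hE : forall w : W, curw W glE 0 w = e *: w) (t : ten T AA W) :
  sum_of (fun u => exists m : int, curw _ glE 0 u = (e + m%:~R) *: u) t.
Proof.
have PZ c (u : ten T AA W) : (exists m : int, curw _ glE 0 u = (e + m%:~R) *: u) ->
    exists m : int, curw _ glE 0 (c *: u) = (e + m%:~R) *: (c *: u).
  by move=> [m hm]; exists m; rewrite (lfZ (curw _ glE 0)) hm; lincomb.
move: t; apply: (ten_span (D := sum_sub PZ)) => a h k w; move: a.
apply: (A_span (D := pre_lsub (mklin (i_linear (tenI T AA W) h k w)) (sum_sub PZ))) => m a ha.
apply: sum_of1; exists m; rewrite /mklin /lin_of /curw (der0_intw _ _ _ _ _ (cur_homog V glE)).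
by rewrite -!/(curw _ glE 0 _) ha hE intwZl lfZ; lincomb.
Qed.

(** A nonzero eigenvector of degree e + m in [D] is not killed by all of A_(-m), by [act_faithful].
    So [D] meets degree e, hence W by [eta_deg]; irreducibility puts W into [D], and W generates
    F(W). *)
Lemma sub_gen e (D : F -> Prop) : irreducible W -> (forall w : W, curw W glE 0 w = e *: w) ->
  submod D -> (forall a h k x, D x -> D (rmu F (tenI T AA F a h k x))) ->
  (exists x, D x /\ x != 0) -> forall x, D x.
Proof.
move=> irr hE sD st [x [Dx x0]].
(* The alternative u = 0 keeps each [G c] a subspace while nonzero eigenvectors have eigenvalues in
   e + Z. *)
pose G c (u : F) := curw F glE 0 u = c *: u /\ ((exists m : int, c = e + m%:~R) \/ u = 0).
have [s [hs ex]] : sum_of (fun u => lsubV sD u /\ exists c, G c u) x.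
  apply: (@sum_of_in R F (curw F glE 0) (lsubV sD) _ G).
  - by move=> u; apply: submod_lsub_act.
  - by move=> c; split; [rewrite lf0 scaler0|right].
  - move=> c a u w [h1 h2] [h3 h4]; split; first exact: eigEL.
    case: h2 => [[m hm]|->]; first by left; exists m.
    case: h4 => [[m hm]|->]; first by left; exists m.
    by right; rewrite scaler0 addr0.
  - by move=> c u [h1 _]; apply: eigE_gen.
  - by apply: sum_of_impl (ten_E0 hE x) => u [m hm]; exists (e + m%:~R); split=> //; left; exists m.
  - by rewrite lsubVE.
have [u [us u0]] : exists u, u \in s /\ u != 0.
  apply/not_existsP => hu; move/eqP: x0; apply; rewrite ex big_seq big1 // => u us.
  by apply/eqP; apply: contraT => u0; case: (hu u).
have [Du [c [hu hc]]] := hs u us; rewrite lsubVE in Du.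
have [m hm] : exists m : int, c = e + m%:~R by case: hc => // e0; rewrite e0 eqxx in u0.
have [a [h [k [ha hy]]]] : exists a h k, Agr (- m) a /\ rmu F (tenI T AA F a h k u) != 0.
  apply: contrapT => nex; move/eqP: u0; apply; apply: (act_faithful (m := - m) induction_rep) => a h k ha.
  by apply/eqP; apply: contraT => ne; case: nex; exists a, h, k.
set y := rmu F _ in hy.
have Ey : curw F glE 0 y = e *: y.
  by rewrite (act_E0 h k ha hu) hm rmorphN /= addrK.
have [w hw] := eta_deg (W := ofin_ind W) hE Ey.
have sK := pre_submod (etah W) sD.
have Kall : forall w, D (etah W w).
  have [z|//] := proj2 irr _ sK.
  have w0 : w = 0 by apply: z; rewrite hw; apply: st.
  by move: hy; rewrite -hw w0 lf0 eqxx.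
by move=> t; have := act_span (D := lsubV sD) _ _ t; rewrite lsubVE; apply=> // [b i l z|z]; rewrite !lsubVE //; apply: st.
Qed.

End Mod.

(** Weights, E_0 and N_0 are split off in turn, each within a subspace that the next operator
    preserves. *)
Lemma Ind_h0 (X : vmod V) (iX : in_Ind X) (x : X) : exists D, [/\ OfinD D, D x &
  sum_of (fun u => D u /\ (exists h, gen_wt h u) /\ exists c, hb X 0 u = c *: u) x].
Proof.
have [D [hD Dx [s [hs ex]]]] := Ind_wt iX x; exists D; split=> //.
rewrite {}ex.
have PZ b (u : X) : D u /\ (exists h, gen_wt h u) /\ (exists c, hb X 0 u = c *: u) ->
    D (b *: u) /\ (exists h, gen_wt h (b *: u)) /\ exists c, hb X 0 (b *: u) = c *: (b *: u).
  move=> [h1 [[h h2] [c h3]]]; split; [|split].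
  - by move: h1; rewrite -!(lsubVE (od_sub hD)); apply: lsubZ.
  - by exists h; apply: (lsubZ (D := gwt X h)).
  - by exists c; rewrite (lfZ (hb X 0)) h3; lincomb.
apply: (lsub_sum_seq (D := sum_sub PZ)) => u /hs [Du [h gu]] /=.
pose D1 := lsub_and (lsubV (od_sub hD)) (gwt X h).
have D1P z : D1 z <-> D z /\ gen_wt h z by rewrite /= lsubVE.
have gc a z : gen_wt h z -> gen_wt h (curw X a 0 z).
  by move=> hz; have := gen_wt_cur a 0 hz; rewrite subr0.
have st1 a z : D1 z -> D1 (curw X a 0 z).
  by rewrite !D1P => -[h1 h2]; split; [case: (od_sub hD) => _ _ _; apply|apply: gc].
have [s1 [hs1 ->]] := @sum_of_in R X (curw X glE 0) D1 (st1 glE) (eigE (curw X glE 0)) u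
  (fun c => lsub0 (eig_lsub (curw X glE 0) c)) (@eigEL R X _) (@eigE_gen R X _) (od_E hD Du)
  (proj2 (D1P u) (conj Du gu)).
apply: (lsub_sum_seq (D := sum_sub PZ)) => v /hs1 [D1v [c hc]] /=.
pose D2 := lsub_and D1 (eig_lsub (curw X glE 0) c).
have st2 z : D2 z -> D2 (curw X glN 0 z).
  by move=> [h1 h2]; split; [exact: st1|rewrite /= [LHS]E0_Yw h2 lfZ].
have Dv : D v by case/D1P: D1v.
have [s2 [hs2 ->]] := @sum_of_in R X (curw X glN 0) D2 st2 (eigE (curw X glN 0)) v
  (fun c => lsub0 (eig_lsub (curw X glN 0) c)) (@eigEL R X _) (@eigE_gen R X _) (od_N hD Dv)
  (conj D1v hc).
apply: (lsub_sum_seq (D := sum_sub PZ)) => w /hs2 [[/D1P [Dw gw] h2] [c' h3]] /=.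
apply: sum_of1; split=> //; split; first by exists h.
by exists (c' + c); rewrite hbE h3 h2 scalerDl.
Qed.

(** By [mono_vac], locality kills the leading coefficient of u_1 on a vacuum vector of nonintegral
    charge. Then all of A_1 acts on it by zero, and it vanishes by [act_faithful]. *)
Lemma rep0_intg (X : actobj A) : is_Rep0 X -> intg X.
Proof.
move=> [hX lX] x; have [D [hD Dx ux]] := Ind_h0 (@indOP _ _ X) x.
apply: (sum_of_lsub (D := sum_sub (@iPZ R V X))) ux => u [Du [[h gu] [c hc]]].
apply: sum_of1; have [//|nc] := pselect (exists k : int, c = k%:~R); first by move=> [k ck]; exists k; rewrite hc ck.
suff -> : u = 0 by exists 0; rewrite lf0 scaler0.
apply: (heis_gen hD (G := zlsub X) (c := c)) gu hc => // [r y _ /= ->|w Dw vw hw /=]; first by rewrite lf0.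
have part p : hpart p w = 0.
  have [v hv] := proj1 (isu_pm A).
  have vp : vac_h (hpart p w).
    by move=> r r0; rewrite /hpart (lfZ (hb X r)) lfD (lfZ (hb X r)) -hb_par vw // lf0 scaler0 addr0 scaler0.
  have hp : hb X 0 (hpart p w) = c *: hpart p w.
    by rewrite /hpart (lfZ (hb X 0)) lfD (lfZ (hb X 0)) -hb_par hw (lfZ (par X)); lincomb.
  have e := mono_vac hv (hpart_homog p w) vp hp.
  have z : rmu X (tenI T AA X v (- c - 1) 0%N (hpart p w)) = 0.
    have := lX (tenI T AA X v (- c - 1) 0%N (hpart p w)); rewrite e lfZ => /eqP.
    rewrite -subr_eq0 -{2}[rmu X _]scale1r -scalerBl scaler_eq0 subr_eq0 => /orP [/eqP /cexp_sq //|/eqP //].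
  have [q [hv1 v0 pv lv]] := hv.
  pose I := icomp (tenI T AA X) (rmu X).
  apply: (act_faithful (m := 1) hX) => a h' k ha.
  have z' : zlsub X (Ic I 1%:~R c v (hpart p w) 0).
    by rewrite /Ic /= -[RHS]z; congr (rmu X (tenI T AA X _ _ _ _)); ring.
  have hz l : zlsub X (I v (h' + l%:~R) k (hpart p w)).
    exact: (@Ic_in _ _ _ _ _ I _ _ _ _ lv vp hp (zlsub X) (zsub X) z').
  have := propagate (borch_intw I h' k) (zsub X) pv hz (Agr_gen hv1 v0 ha) (fun E _ h => h) 0.
  by rewrite addr0.
by rewrite (hpartE w) !part addr0.
Qed.
End Induction.

(** * Module maps and lengths *)

Section RepMaps.
Variables (R : realType) (V : V1gl11 R) (T : hlz V) (A : extension T).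
Local Notation K := R[i].
Local Notation AA := (extA A).
Local Notation mu := (extmu A).
Local Notation vacA := (vac (extV A)).

Definition Rep_map p (X X' : actobj A) (g : hom p X X') :=
  forall t, g (rmu X t) = rmu X' (tmap T (hid AA) g t).

Lemma Rep_map_tenI p (X X' : actobj A) (g : hom p X X') a h k x : Rep_map g ->
  g (rmu X (tenI T AA X a h k x)) = rmu X' (tenI T AA X' (parX p a) h k (g x)).
Proof. by move=> ->; rewrite tmapE. Qed.

Lemma Rep_map_tenI' p (X X' : actobj A) (g : hom p X X') a h k x : Rep_map g ->
  rmu X' (tenI T AA X' a h k (g x)) = g (rmu X (tenI T AA X (parX p a) h k x)).
Proof. by move=> hg; rewrite (Rep_map_tenI _ _ _ _ hg) parXK. Qed.

Lemma Rep_map_im p (X X' : actobj A) (g : hom p X X') : Rep_map g ->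
  forall a h k y, (exists x, True /\ g x = y) ->
    exists x, True /\ g x = rmu X' (tenI T AA X' a h k y).
Proof. by move=> hg a h k _ [x [_ <-]]; rewrite Rep_map_tenI' //; eexists; split. Qed.

Lemma Rep_map_ker p (X X' : actobj A) (g : hom p X X') : Rep_map g ->
  forall a h k x, g x = 0 -> g (rmu X (tenI T AA X a h k x)) = 0.
Proof. by move=> hg a h k x gx; rewrite Rep_map_tenI // gx !lf0. Qed.

(** The map a . w -> a . f(w) that corresponds to f under the adjunction of induction and
    restriction. *)
Definition adj p (W : ofin V) (X : actobj A) (f : hom p W X) : hom p (induction A W) X :=
  hcompp (rmu X) (tmap T (hid AA) (f : hom p (ofin_ind W) X)).

Lemma adj_eta p (W : ofin V) (X : actobj A) (f : hom p W X) w : is_Rep X ->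
  adj f (etah A W w) = f w.
Proof.
move=> hX; rewrite /= /etaf tmapE /= (parXE p (q := false)) ?andbF ?scale1r.
  exact: (act_vac (f w) hX).
exact: vac_even.
Qed.

Lemma adj_Rep p (W : ofin V) (X : actobj A) (f : hom p W X) : is_Rep X -> Rep_map (adj f).
Proof.
move=> [hX _] t; pose f' : hom p (ofin_ind W) X := f.
transitivity (rmu X (tmap T (hid AA) (rmu X) (tmap T (hid AA) (tmap T (hid AA) f') t))); last first.
  congr (rmu X _); move: t.
  apply: (ten_eq (f := hcompp (tmap T (hid AA) (rmu X)) (tmap T (hid AA) (tmap T (hid AA) f')))) => a h k y.
  by rewrite /= !tmapE.
rewrite hX assoc_nat /=; congr (rmu X _); move: (assoc T _ _ _ t) => {t}.
apply: (ten_eq (f := hcompp (tmap T (hid AA) f') (tmap T mu (hid (ofin_ind W))))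
  (g := hcompp (tmap T mu (hid X)) (tmap T (tmap T (hid AA) (hid AA)) f'))) => a h k y.
rewrite /= !tmapE /= tmap_id; congr (tenI T AA X _ h k _).
by case: (p) => //=; rewrite hom_pare.
Qed.

(** Equality spreads from W, which generates F(W). The parities are kept apart because in the
    application they agree only after a computation. *)
Lemma Rep_map_ext p p' (W : ofin V) (X : actobj A) (g : hom p (induction A W) X)
    (g' : hom p' (induction A W) X) : p = p' -> Rep_map g -> Rep_map g' ->
  (forall w, g (etah A W w) = g' (etah A W w)) -> g =1 g'.
Proof.
move=> e; subst p' => hg hg' h.
have gL c u w : g u = g' u -> g w = g' w -> g (c *: u + w) = g' (c *: u + w).
  by move=> h1 h2; rewrite !linearP h1 h2.
apply: (act_span (D := eq_lsub g g')) => [a i k x /= hx|w]; last exact: h.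
rewrite -[LHS]/(g (rmu (induction A W) _)) -[RHS]/(g' (rmu (induction A W) _)).
by rewrite !Rep_map_tenI // hx.
Qed.

Lemma ind_map p (W W' : ofin V) (f : hom p W W') :
  exists g : hom p (induction A W) (induction A W'),
   [/\ g =1 tmap T (hid AA) (f : hom p (ofin_ind W) (ofin_ind W')), Rep_map g & surj f -> surj g].
Proof.
pose f' : hom p (ofin_ind W) (ofin_ind W') := f.
pose g : hom p (induction A W) (induction A W') := adj (hcompp (etah A W') f' : hom p W (induction A W')).
have e : g =1 tmap T (hid AA) f'.
  move=> t; rewrite -[RHS](eta_gen (A := A)); rewrite /g /adj /=; congr (tmap T mu _ (assoc T _ _ _ _)); move: t.
  apply: (ten_eq (g := hcompp (tmap T (hid AA) (etah A W')) (tmap T (hid AA) f'))) => a h k w.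
  by rewrite /= !tmapE.
exists g; split=> //; first exact/adj_Rep/induction_rep.
move=> sf t; suff : im_lsub g (lsubV (submodT _)) t by move=> [x [_ hx]]; exists x.
move: t; apply: (ten_span) => a h k w; have [x <-] := sf w.
exists (tenI T AA (ofin_ind W) (parX p a) h k x); split; first by rewrite lsubVE.
by rewrite e tmapE /= parXK.
Qed.
End RepMaps.

Section Length.
Variables (R : realType) (V : V1gl11 R).
Local Notation K := R[i].

Section Chain.
Variables (W : vmod V) (n : nat) (U : nat -> W -> Prop).
Hypotheses (sU : forall i, submod (U i)) (U0 : forall w, U 0%N w -> w = 0) (Un : forall w, U n w).
Hypotheses (Umon : forall i w, U i w -> U i.+1 w) (Ustep : forall i, simple_step (U i) (U i.+1)).

(** As every step of the chain is simple, a submodule gains there either nothing or, modulo the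
    lower term, everything ([step_sum]); counting its steps of the second kind gives its length. *)
Definition jump (D : W -> Prop) (i : nat) := `[< exists x, [/\ D x, U i.+1 x & ~ U i x] >].
Definition len (D : W -> Prop) : nat := (\sum_(i < n) nat_of_bool (jump D i))%N.

Lemma len_bound D : (len D <= n)%N.
Proof.
rewrite -[leqRHS]muln1 -[X in (_ <= X * _)%N]card_ord -sum_nat_const.
by apply: leq_sum => i _; apply: leq_b1.
Qed.

Lemma step_sum i (D : W -> Prop) x : submod D -> (exists y, [/\ D y, U i.+1 y & ~ U i y]) ->
  U i.+1 x -> exists d u, [/\ D d, U i.+1 d, U i u & x = d + u].
Proof.
move=> sD [y [Dy Uy nUy]] Ux.
pose F w := exists a b, [/\ D a /\ U i.+1 a, U i b & w = a + b].
have sF : submod F := submodD (submodI sD (sU i.+1)) (sU i).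
have F1 w : U i w -> F w.
  by move=> hw; exists 0, w; split; rewrite ?add0r //; split; [case: sD|case: (sU i.+1)].
have F2 w : F w -> U i.+1 w.
  move=> [a [b [[_ ha] hb ->]]]; have [_ L _ _] := sU i.+1.
  by rewrite -[a]scale1r; apply: L => //; apply: Umon.
have [h|h] := Ustep sF F1 F2.
  case: nUy; apply: h; exists y, 0; split; rewrite ?addr0 //; by case: (sU i).
by have [d [u [[Dd Ud] Uu ->]]] := h x Ux; exists d, u; split.
Qed.

(** If the lengths did not increase, both submodules would have the same jumps, and induction along
    the chain would give E contained in D. *)
Lemma len_lt (D E : W -> Prop) : submod D -> submod E -> (forall w, D w -> E w) ->
  (exists w, E w /\ ~ D w) -> (len D < len E)%N.
Proof.
move=> sD sE DE [w [Ew nDw]].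
have jle i : (jump D i <= jump E i)%N.
  rewrite /jump; case: asboolP => // -[x [Dx h1 h2]].
  by case: asboolP => // -[]; exists x; split=> //; apply: DE.
rewrite ltnNge; apply/negP => le.
have jeq i : (i < n)%N -> jump D i = jump E i.
  move=> ilt; apply/eqP; move: le; rewrite /len (bigD1 (Ordinal ilt)) //= [leqRHS](bigD1 (Ordinal ilt)) //=.
  have := jle i; case: (jump D i); case: (jump E i) => // _; rewrite add0n add1n => h.
  have hs : (\sum_(j < n | j != Ordinal ilt) nat_of_bool (jump D j) <=
    \sum_(j < n | j != Ordinal ilt) nat_of_bool (jump E j))%N by apply: leq_sum.
  by move: h; rewrite ltnNge hs.
have key i : (i <= n)%N -> forall x, E x -> U i x -> D x.
  elim: i => [_ x _ /U0 ->|i IH ilt x Ex Ux]; first by case: sD.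
  have [hi|hi] := pselect (U i x); first exact: (IH (ltnW ilt)).
  have : jump E i by apply/asboolP; exists x.
  rewrite -jeq // => /asboolP /step_sum /(_ Ux) [] // d [u [Dd Ud Uu ex]].
  have [_ DL _ _] := sD; rewrite ex -[d]scale1r; apply: DL => //.
  apply: (IH (ltnW ilt)) => //; have -> : u = (-1) *: d + x by rewrite ex; lincomb.
  by have [_ EL _ _] := sE; apply: EL => //; apply: DE.
by apply: nDw; apply: (key n).
Qed.
End Chain.

Lemma fl_len (W : vmod V) : finite_length W -> exists (n : nat) (l : (W -> Prop) -> nat),
  (forall D, (l D <= n)%N) /\ forall D E, submod D -> submod E -> (forall w, D w -> E w) ->
  (exists w, E w /\ ~ D w) -> (l D < l E)%N.
Proof.
move=> [n [U [h1 h2 h3 h4 h5]]]; exists n, (len n U); split; first exact: len_bound.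
by move=> D E; apply: len_lt.
Qed.

(* A strictly monotone operation on submodules moves none of them up or down. *)
Lemma fl_fix (W : vmod V) (th : (W -> Prop) -> W -> Prop) (D : W -> Prop) : finite_length W ->
  (forall D, submod D -> submod (th D)) -> submod D ->
  (forall D E, submod D -> submod E -> (forall w, D w -> E w) -> (forall w, th D w -> th E w)) ->
  (forall D E, submod D -> submod E -> (forall w, D w -> E w) -> (exists w, E w /\ ~ D w) ->
     exists w, th E w /\ ~ th D w) ->
  ((forall w, D w -> th D w) -> forall w, th D w -> D w) /\
  ((forall w, th D w -> D w) -> forall w, D w -> th D w).
Proof.
move=> fl sth sD mth smth; have [n [l [lb ll]]] := fl_len fl.
have sit i : submod (iter i th D) by elim: i => // i IH; apply: sth.
split=> h w hw; apply: contrapT => nw.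
  have step i : (forall w, iter i th D w -> iter i.+1 th D w) /\ exists w, iter i.+1 th D w /\ ~ iter i th D w.
    elim: i => [|i [IH1 IH2]]; first by split=> //; exists w.
    by split; [apply: (mth _ _ (sit i) (sit i.+1) IH1)|apply: (smth _ _ (sit i) (sit i.+1) IH1 IH2)].
  have ge i : (i <= l (iter i th D))%N.
    by elim: i => // i IH; have [a b] := step i; apply: leq_ltn_trans IH _; apply: ll.
  by have := ge n.+1; have := lb (iter n.+1 th D); lia.
have step i : (forall w, iter i.+1 th D w -> iter i th D w) /\ exists w, iter i th D w /\ ~ iter i.+1 th D w.
  elim: i => [|i [IH1 IH2]]; first by split=> //; exists w.
  by split; [apply: (mth _ _ (sit i.+1) (sit i) IH1)|apply: (smth _ _ (sit i.+1) (sit i) IH1 IH2)].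
have ge i : (l (iter i th D) + i <= l D)%N.
  elim: i => [|i IH]; first by rewrite addn0.
  have [a b] := step i; have := ll _ _ (sit i.+1) (sit i) a b; lia.
by have := ge (l D).+1; lia.
Qed.

(** This is [fl_fix] for the preimage under f, strictly monotone as f is onto, at the zero
    submodule, whose preimage is the kernel. *)
Lemma hopfian (Q : vmod V) p (f : hom p Q Q) : finite_length Q -> surj f -> injective f.
Proof.
move=> fl sf.
have [h _] := @fl_fix Q (fun D x => D (f x)) (fun x => x = 0) fl
  (fun D sD => pre_submod f sD) (submod0 Q) (fun D E _ _ DE x => DE (f x))
  (fun D E _ _ _ => fun '(ex_intro w (conj Ew nDw)) => let: ex_intro x hx := sf w in
     ex_intro _ x (conj (eq_ind_r E Ew hx) (fun h => nDw (eq_ind (f x) D h w hx)))).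
have ker x : f x = 0 -> x = 0 by apply: h => w ->; rewrite lf0.
by move=> x y e; apply/eqP; rewrite -subr_eq0; apply/eqP/ker; rewrite lfB e subrr.
Qed.

Lemma hom_inv p (X Y : vmod V) (g : hom p X Y) : injective g -> surj g ->
  exists h : hom p Y X, cancel g h /\ cancel h g.
Proof.
move=> gi gs; pose f y := xget 0 [set x | g x = y]%classic.
have fP y : g (f y) = y by apply: (xgetPex 0 (gs y)).
have fl : linear f by move=> c u w; apply: gi; rewrite linearP !fP.
have fp y : mklin fl (par Y y) = (-1) ^+ p *: par X (mklin fl y).
  apply: gi; rewrite (lfZ g) (hom_par g) [g (mklin fl (par Y y))]fP.
  by rewrite [g (mklin fl y)]fP scalerA -expr2 sqrr_sign scale1r.
have fY v n y : mklin fl (Yw Y v n y) = Yw X (parX p v) n (mklin fl y).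
  apply: gi; rewrite (hom_Y g) parXK [g (mklin fl (Yw Y v n y))]fP.
  by rewrite [g (mklin fl y)]fP.
by exists (Hom fp fY); split=> x //; apply: gi; apply: fP.
Qed.

Lemma OfinD_zero (X : vmod V) : in_Ind X -> OfinD (fun x : X => x = 0).
Proof.
move=> /in_IndP /(_ 0) [D [hD _]]; apply: (OfinD_le hD (submod0 X)) => w ->.
by case: (od_sub hD).
Qed.

(** At each step of the chain where [D] gains a vector, a finite-length submodule containing a
    preimage of that vector is added; simplicity of the step makes one vector enough. *)
Lemma lift_fin p (X X' : vmod V) (g : hom p X X') (D : X' -> Prop) : in_Ind X -> surj g -> OfinD D ->
  exists E : X -> Prop, OfinD E /\ forall y, D y -> exists x, E x /\ g x = y.
Proof.
move=> iX sg hD; have [n [U [sU U0 Un Umon Ustep]]] := od_fl hD.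
have sD := od_sub hD.
have key i : exists E : X -> Prop, OfinD E /\ forall y, D y -> U i y -> exists x, E x /\ g x = y.
  elim: i => [|i [E [hE IH]]].
    by exists (fun x => x = 0); split=> [|y _ /U0 ->]; [exact: OfinD_zero|exists 0; rewrite lf0].
  have [[y [Dy Uy nUy]]|nex] := pselect (exists y, [/\ D y, U i.+1 y & ~ U i y]); last first.
    exists E; split=> // y Dy Uy; apply: IH => //; apply: contrapT => nU.
    by apply: nex; exists y.
  have [x hx] := sg y; have [G [hG Gx]] := proj1 (in_IndP X) iX x.
  exists (fun x => exists a b, [/\ E a, G b & x = a + b]); split; first exact: OfinD_add.
  move=> z Dz Uz; pose F w := D w /\ exists x, G x /\ g x = w.
  have sF : submod F := submodI sD (im_submod g (od_sub hG)).
  have [|d [u [[Dd [b [Gb gb]]] Ud Uu ez]]] := step_sum sU Umon Ustep sF (i := i) (x := z) _ Uz.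
    by exists y; split=> //; split=> //; exists x.
  have Du : D u.
    have -> : u = (-1) *: d + z by rewrite ez; lincomb.
    by have [_ DL _ _] := sD; apply: DL.
  have [a [Ea ga]] := IH u Du Uu.
  by exists (a + b); split; [exists a, b|rewrite lfD ga gb addrC ez].
have [E [hE h]] := key n; exists E; split=> // y Dy; apply: h => //; exact: Un.
Qed.

(** At the first step of the chain where [D] meets it nontrivially, the intersection embeds into the
    simple quotient of that step. *)
Lemma simple_sub (X : vmod V) (x : X) : in_Ind X -> x != 0 ->
  exists (S : ofin V) (f : hom false S X), irreducible S /\ injective f.
Proof.
move=> iX x0; have [D [hD Dx]] := proj1 (in_IndP X) iX x.
have [n [U [sU U0 Un Umon Ustep]]] := od_fl hD; have sD := od_sub hD.
have [i [zi [y [Dy Uy y0]]]] : exists i, (forall w, D w -> U i w -> w = 0) /\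
    exists y, [/\ D y, U i.+1 y & y != 0].
  have : exists w, [/\ D w, U n w & w != 0] by exists x; split=> //; apply: Un.
  elim: n {Un} => [[w [_ /U0 ->]]|n IH [w [Dw Uw w0]]]; first by rewrite eqxx.
  have [[w' hw']|nex] := pselect (exists w, [/\ D w, U n w & w != 0]); first by apply: IH; exists w'.
  exists n; split; last by exists w.
  by move=> z Dz Uz; apply/eqP; apply: contraT => z0; case: nex; exists z.
pose E w := D w /\ U i.+1 w.
have hE : OfinD E by apply: OfinD_le hD (submodI sD (sU i.+1)) _ => w [].
exists (OFin (OfinD_fin hE)), (subh (od_sub hE)); split; last exact: subh_inj.
have [y' ey] := subh_elim (od_sub hE) (conj Dy Uy : E y).
split; first by exists y'; apply: contraNneq y0 => h; rewrite -ey h lf0.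
move=> F sF; have sF' := im_submod (subh (od_sub hE)) sF.
have [z|nz] := pselect (forall w, F w -> w = 0); [by left|right].
have [w [Fw w0]] : exists w, F w /\ w != 0.
  apply: contrapT => nex; apply: nz => w Fw; apply/eqP; apply: contraT => w0.
  by case: nex; exists w.
move=> t; have [Dt Ut] : E (subh (od_sub hE) t) by apply: subh_in.
have [Dw Uw] : E (subh (od_sub hE) w) by apply: subh_in.
have [|d [u [[d' [Fd ed]] Ud Uu et]]] := step_sum sU Umon Ustep sF' (i := i) _ Ut.
  exists (subh (od_sub hE) w); split=> //; first by exists w.
  move=> /(zi _ Dw) h; move/eqP: w0; apply; apply: (@subh_inj _ _ _ _ (od_sub hE)).
  by rewrite h lf0.
have [Dd _] : E d by rewrite -ed; apply: subh_in.
have u0 : u = 0.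
  apply: zi => //; have -> : u = (-1) *: d + subh (od_sub hE) t by rewrite et; lincomb.
  by have [_ DL _ _] := sD; apply: DL.
have -> : t = d'; last exact: Fd.
by apply: (@subh_inj _ _ _ _ (od_sub hE)); rewrite ed et u0 addr0.
Qed.
End Length.

(** * Projective covers *)

Section Covers.
Variables (R : realType) (V : V1gl11 R).
Local Notation K := R[i].

Program Definition hcomp_r p (W1 W2 W3 : vmod V) (g : hom p W2 W3) (f : hom false W1 W2) :
  hom p W1 W3 := @Hom R V p W1 W3 (g \o f) _ _.
Next Obligation. by move=> p W1 W2 W3 g f w; rewrite /= hom_pare hom_par. Qed.
Next Obligation. by move=> p W1 W2 W3 g f v n w; rewrite /= hom_Ye hom_Y. Qed.

Lemma zero_hom p (W1 W2 : vmod V) : exists f : hom p W1 W2, forall w, f w = 0.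
Proof.
have fl : linear (fun _ : W1 => 0 : W2) by move=> c u w; rewrite scaler0 addr0.
have fp w : mklin fl (par W1 w) = (-1) ^+ p *: par W2 (mklin fl w).
  by rewrite [mklin fl w]/(0) lf0 scaler0.
have fY v n w : mklin fl (Yw W1 v n w) = Yw W2 (parX p v) n (mklin fl w).
  by rewrite [mklin fl w]/(0) lf0.
by exists (Hom fp fY).
Qed.

Lemma OfinD_T (W : vmod V) : in_Ofin W -> OfinD (fun _ : W => True).
Proof.
move=> hW; apply: (OfinD_le (OfinD_im (hid W) hW) (submodT W)) => w _.
by exists w.
Qed.

Lemma proj_lift (P : ofin V) p q (X X' : vmod V) (g : hom p X X') (f : hom q P X') :
  projective (P : Ofin_cat V) -> in_Ind X -> surj g ->
  exists f0 : hom (p (+) q) P X, forall x, g (f0 x) = f x.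
Proof.
move=> [_ proj] iX sg.
have hD := OfinD_im f (ofinP P); have [E [hE hl]] := lift_fin iX sg hD.
pose E' x := E x /\ exists y, f y = g x.
have hE' : OfinD E'.
  by apply: (OfinD_le hE (submodI (od_sub hE) (pre_submod g (od_sub hD)))) => x [].
pose M := OFin (OfinD_fin hE'); pose N := OFin (OfinD_fin hD).
pose iM : hom false M X := subh (od_sub hE'); pose iN : hom false N X' := subh (od_sub hD).
have gin x : exists y, f y = hcomp_r g iM x by have [_] : E' (iM x) by apply: subh_in.
have fin x : exists y, f y = f x by exists x.
pose gm : hom p M N := sublift (od_sub hD) gin.
pose fm : hom q P N := sublift (od_sub hD) fin.
have gmE x : iN (gm x) = g (iM x) by [].
have fmE x : iN (fm x) = f x by [].
have sgm : surj gm.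
  move=> y; have [x [Ex gx]] := hl (iN y) (subh_in y).
  have Ex' : E' x by split=> //; rewrite gx; apply: subh_in y.
  have [z ez] := subh_elim (od_sub hE') Ex'; exists z.
  by apply: (@subh_inj _ _ _ _ (od_sub hD)); apply: etrans (gmE z) _; rewrite -[RHS]gx -ez.
have [f' [[r [h hE2]] hf']] := proj M N gm fm I I (ex_intro _ p (ex_intro _ gm (fun=> erefl)))
  sgm (ex_intro _ q (ex_intro _ fm (fun=> erefl))).
have hgf x : g (iM (h x)) = f x by rewrite -gmE -hE2 -hf' fmE.
(* A nonzero f determines the parity of the lift; if f = 0 the lift may have the wrong parity, and
   the zero map replaces it. *)
have [f0|nz] := pselect (forall x, f x = 0).
  by have [z hz] := zero_hom (p (+) q) P X; exists z => x; rewrite hz lf0 f0.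
have [x fx] : exists x, f x != 0.
  apply: contrapT => nex; apply: nz => x; apply/eqP; apply: contraT => fx.
  by case: nex; exists x.
have er : r = p (+) q.
  have := hgf (par P x); rewrite !hom_par (lfZ iM) hom_pare (lfZ g) hom_par hgf scalerA => /eqP.
  rewrite -subr_eq0 -scalerBl scaler_eq0 => /orP [|/eqP pf0]; last first.
    by move: fx; rewrite -[f x]parKE pf0 lf0 eqxx.
  rewrite subr_eq0 -signr_addb.
  case: (r); case: (p); case: (q); rewrite //= ?expr0 ?expr1 -subr_eq0 ?opprK -?opprD ?oppr_eq0;
  by rewrite (negPf (two_neq0 R)).
subst r; exists (hcompp iM h) => y; exact: hgf.
Qed.

Section Essential.
Variables (S P : ofin V) (p : bool) (pi : hom p P S).
Hypotheses (proj : projective (P : Ofin_cat V)) (spi : surj pi).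
Hypothesis cover : forall (Q : Ofin_cat V) (q : {linear cund Q -> S}),
  projective Q -> cmor (q : {linear cund Q -> cund (S : Ofin_cat V)}) -> surj q ->
  exists q' : {linear cund Q -> cund (P : Ofin_cat V)}, [/\ cmor q', surj q' & forall x, q x = pi (q' x)].

(* A minimal Q with pi Q = S is a retract of P (Fitting), hence projective, and
   the covering map Q ->> P forces Q = P by length. *)
Lemma cover_ess (D : P -> Prop) : submod D -> (forall s, exists x, D x /\ pi x = s) -> forall x, D x.
Proof.
move=> sD hD; have flP : finite_length P by case: (ofinP P).
have [n [l [_ ll]]] := fl_len flP.
pose good k := `[< exists Q : P -> Prop, [/\ submod Q, forall x, Q x -> D x,
   forall s, exists x, Q x /\ pi x = s & l Q = k] >].
have exg : exists k, good k by exists (l D); apply/asboolP; exists D.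
case: (ex_minnP exg) => k /asboolP [Q [sQ QD hQ lQ]] kmin.
have Qmin G : submod G -> (forall x, G x -> Q x) -> (forall s, exists x, G x /\ pi x = s) -> forall x, Q x -> G x.
  move=> sG GQ hG x Qx; apply: contrapT => nG.
  have lt := ll G Q sG sQ GQ (ex_intro _ x (conj Qx nG)).
  have : (k <= l G)%N by apply: kmin; apply/asboolP; exists G; split=> // z /GQ /QD.
  by rewrite leqNgt -lQ lt.
have oQ : OfinD Q by apply: (OfinD_le (OfinD_T (ofinP P)) sQ).
pose M := OFin (OfinD_fin oQ); pose iM : hom false M P := subh (od_sub oQ).
pose piM : hom p M S := hcomp_r pi iM.
have spM : surj piM.
  move=> s; have [x [Qx px]] := hQ s; have [z ez] := subh_elim (od_sub oQ) Qx.
  by exists z; rewrite /= [iM z]ez.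
have [f0 hf0] := proj_lift pi proj (Ofin_Ind (ofinP M)) spM.
(* Since [piM] absorbs [phi], the image of [phi] still covers [S]; minimality of [Q] makes [phi]
   onto. *)
pose phi := hcomp_r f0 iM.
have sphi : surj phi.
  move=> y; have sG := im_submod iM (im_submod phi (submodT M)).
  have G1 x : (exists x0 : M, (exists x1 : M, True /\ phi x1 = x0) /\ iM x0 = x) -> Q x.
    by move=> [z [_ <-]]; apply: subh_in z.
  have G2 s : exists x, (exists x0 : M, (exists x1 : M, True /\ phi x1 = x0) /\ iM x0 = x) /\ pi x = s.
    have [x [Qx px]] := hQ s; have [z ez] := subh_elim (od_sub oQ) Qx.
    exists (iM (phi z)); split; first by exists (phi z); split=> //; exists z.
    by apply: etrans (hf0 (iM z)) _; rewrite -px -ez.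
  have [z [[w [_ ew]] ez]] := Qmin _ sG G1 G2 (iM y) (subh_in y).
  by exists w; rewrite ew; apply: (@subh_inj _ _ _ _ (od_sub oQ)).
have flM : finite_length M by case: (ofinP M).
have [sg [_ sgK]] := hom_inv (hopfian flM sphi) sphi.
(* As f0 iM sg is the identity of [M], a lifting problem for [M] is solved on [P] after f0 and
   restricted along iM sg. *)
have projM : projective (M : Ofin_cat V).
  split=> // X X' g h _ _ cg sur [b [hb eh]].
  pose hf : {linear cund (P : Ofin_cat V) -> cund X'} := hcompp hb f0.
  have cf : cmor hf by exists _, (hcompp hb f0).
  have [k0 [[c [kc ek]] hk]] := proj2 proj X X' g hf I I cg sur cf.
  pose f' := hcompp kc (hcompp iM sg).
  exists f'; split; first by exists _, f'.
  move=> x; rewrite eh -[in LHS](sgK x).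
  by apply: etrans (hk _) _; congr (g _); apply: ek.
have [q' [[c [qc eq']] sq' hq']] := cover projM (ex_intro _ p (ex_intro _ piM (fun=> erefl))) spM.
have sqc : surj qc by move=> y; have [x hx] := sq' y; exists x; rewrite -eq'.
(* Pulling back along the covering map from [M] onto [P] and then including [M] in [P] is strictly
   monotone; by [fl_fix] it fixes the whole of [P], so [M] is [P]. *)
pose th (G : P -> Prop) w := exists z, G (qc z) /\ iM z = w.
have s1 G : submod G -> submod (th G) by move=> sG; apply: (im_submod iM (pre_submod qc sG)).
have s2 G H : submod G -> submod H -> (forall w, G w -> H w) -> forall w, th G w -> th H w.
  by move=> _ _ GH w [z [h1 h2]]; exists z; split=> //; apply: GH.
have s3 G H : submod G -> submod H -> (forall w, G w -> H w) -> (exists w, H w /\ ~ G w) ->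
    exists w, th H w /\ ~ th G w.
  move=> _ _ _ [w [Hw nGw]]; have [z hz] := sqc w; exists (iM z); split.
    by exists z; rewrite hz.
  by move=> [z' [h1 /subh_inj h2]]; apply: nGw; rewrite -hz -h2.
have [_ fx] := fl_fix flP s1 (submodT P) s2 s3.
by move=> x; have [z [_ <-]] := fx (fun _ _ => I) x I; apply: QD; apply: subh_in z.
Qed.

(** The eigenspace for e is a submodule of [P] that still maps onto [S]: the other eigenspaces of
    E_0 map to zero. Hence it is [P] by [cover_ess]. *)
Lemma cover_E e : (forall s : S, curw S glE 0 s = e *: s) -> forall x : P, curw P glE 0 x = e *: x.
Proof.
move=> hE; apply: (cover_ess (D := eig_lsub (curw P glE 0) e)).
  split; [exact: lsub0|exact: lsubL| |].
    move=> u /= hu; have := proj1 (curw_level1 P) glE 0 u; rewrite /= expr0 scale1r => <-.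
    by rewrite hu lfZ.
  by move=> v n u /= hu; rewrite E0_Yw hu lfZ.
move=> s; have [x hx] := spi s; have [_ _ _ ss] := ofinP P.
have [t [ht ext]] := ss x.
have [y [r [ey hy hr _]]] := split_seq (G := eigE (curw P glE 0)) (fun c => lsub0 (eig_lsub (curw P glE 0) c))
  (@eigEL R P _) e ht.
exists y; split=> //; apply/eqP; rewrite -subr_eq0 -opprB oppr_eq0; apply/eqP.
apply: (@genE_othE0 _ _ (curw S glE 0) e _ ((-1) *: pi (\sum_(u <- r) u))).
- by apply: eigE_gen; rewrite /eigE.
- apply: othEZ; exists [seq pi u | u <- r]; split; last by rewrite big_map linear_sum.
  move=> _ /mapP [u /hr [c [ce hc]] ->]; exists c; split=> //.
  by apply: eigE_gen; rewrite /eigE -hom_curE hc lfZ.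
by rewrite -hx ext ey lfD; lincomb.
Qed.

Lemma cover_intg : intg S -> intg P.
Proof.
move=> iS; apply: (cover_ess (D := sum_sub (@iPZ R V P))).
  by apply: stable_submod; split; [exact: iP_par|exact: iP_cur].
move=> s; have [x hx] := spi s; rewrite -{s}hx.
pose Q x := exists y, sum_sub (@iPZ R V P) y /\ pi y = pi x.
have Q0 : Q 0 by exists 0; split; first exact: lsub0.
have QL c u w : Q u -> Q w -> Q (c *: u + w).
  move=> [y [h1 h2]] [z [h3 h4]]; exists (c *: y + z); split; first exact: lsubL.
  by rewrite !linearP h2 h4.
have [D [_ _ hs]] := Ind_h0 (Ofin_Ind (ofinP P)) x.
apply: (sum_of_lsub (D := Lsub Q0 QL)) hs => u [_ [_ [c hc]]] /=.
have [pu0|pu0] := eqVneq (pi u) 0; first by exists 0; split; [exact: lsub0|rewrite pu0 lf0].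
have [k ck] : exists k : int, c = k%:~R.
  by apply: (intg_eig iS pu0); rewrite -hom_hb hc lfZ.
by exists u; split=> //; apply: sum_of1; exists k; rewrite hc ck.
Qed.
End Essential.
End Covers.

(** * Simple objects and projective covers in Rep^0 *)

Section Main.
Variables (R : realType) (V : V1gl11 R) (T : hlz V) (A : extension T).
Local Notation K := R[i].
Local Notation AA := (extA A).

Lemma intg_inj p (X Y : vmod V) (f : hom p X Y) : injective f -> in_Ind X -> intg Y -> intg X.
Proof.
move=> fi iX iY x; have [D [_ _ hs]] := Ind_h0 iX x.
apply: (sum_of_lsub (D := sum_sub (@iPZ R V X))) hs => u [_ [_ [c hc]]]; apply: sum_of1.
have [u0|u0] := eqVneq u 0; first by exists 0; rewrite u0 lf0 scaler0.
have fu0 : f u != 0 by apply: contraNneq u0 => h; rewrite -(inj_eq fi) h lf0.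
have [|k ck] := intg_eig iY fu0 (c := c); first by rewrite -hom_hb hc lfZ.
by exists k; rewrite hc ck.
Qed.

Lemma induction_simple (S : ofin V) : irreducible S -> intg S ->
  simple_obj (induction A S : Rep0_cat A).
Proof.
move=> irr iS; have [e hE] := E_scalar (ofinP S) irr.
split; first exact: induction_local.
  have [[s s0] _] := irr; exists (etah A S s); apply: contraNneq s0 => h.
  by apply/eqP; apply: (@eta_inj _ _ _ A S); rewrite h lf0.
move=> X' f hX' [p [g [ef hg]]] fi.
have gi : injective g by move=> x y; rewrite -!ef => /fi.
have [z|nz] := pselect (forall x, f x = 0); [by left|right].
have [x fx] : exists x, g x != 0.
  apply: contrapT => nex; apply: nz => x; rewrite ef; apply/eqP; apply: contraT => fx.
  by case: nex; exists x.
have all := @sub_gen R V T A S e _ irr hE (im_submod g (submodT _)) (Rep_map_im hg)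
  (ex_intro _ (g x) (conj (ex_intro _ x (conj I erefl)) fx)).
by move=> y; have [z [_ hz]] := all y; exists z; rewrite ef.
Qed.

Lemma simple_is_induced (X : Rep0_cat A) : simple_obj X ->
  exists S : ofin V, local_simple S /\ isomorphic X (induction A S : Rep0_cat A).
Proof.
move=> [hX [x x0] sX].
have [S [f [irr fi]]] := simple_sub (@indOP _ _ (X : actobj A)) x0.
have iS : intg S := intg_inj fi (Ofin_Ind (ofinP S)) (rep0_intg hX).
have [e hE] := E_scalar (ofinP S) irr.
exists S; split; first exact: (irr_local (ofinP S) irr (haveV0 A) iS).
pose g := adj (f : hom false S (X : actobj A)).
have hg : Rep_map g by apply: adj_Rep; case: hX.
have gE s : g (etah A S s) = f s by apply: adj_eta; case: hX.
have [[s s0] _] := irr.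
have gs0 : g (etah A S s) != 0 by rewrite gE; apply: contraNneq s0 => h; rewrite -(inj_eq fi) h lf0.
have gi : injective g.
  have ker y : g y = 0 -> y = 0.
    move=> gy; apply/eqP; apply: contraT => y0.
    have := @sub_gen R V T A S e _ irr hE (pre_submod g (submod0 _)) (Rep_map_ker hg)
      (ex_intro _ y (conj gy y0)) (etah A S s).
    by move/eqP; rewrite (negPf gs0).
  by move=> y z h; apply/eqP; rewrite -subr_eq0; apply/eqP/ker; rewrite lfB h subrr.
have cg : cmor (g : {linear cund (induction A S : Rep0_cat A) -> cund X}) by exists false, g.
have [z|sg] := sX (induction A S) g (induction_local A iS) cg gi.
  by move: gs0; rewrite z eqxx.
have [h [gK hK]] := hom_inv gi sg.
exists h, g; split=> //.
exists false, h; split=> // t; apply: gi; rewrite hK hg tmap_comp.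
by rewrite -[in LHS](tmap_id t); congr (rmu _ _); apply: tmap_eq => // y; exact: (esym (hK y)).
Qed.

(** Lifts along surjections come from [proj_lift] on [P] by adjunction. A map q' from a projective
    cover candidate Q to F(P) over F(S) is onto because its image meets P in a submodule covering
    [S], which is all of P by [cover_ess]. *)
Lemma induction_cover (S P : ofin V) : irreducible S -> is_Rep0 (induction A S) ->
  projective_cover (P : Ofin_cat V) (S : Ofin_cat V) ->
  projective_cover (induction A P : Rep0_cat A) (induction A S : Rep0_cat A).
Proof.
move=> irr hS [proj _ [pi0 [[p [pi epi]] spi0 cov]]].
have spi : surj pi by move=> s; have [x hx] := spi0 s; exists x; rewrite -epi.
have cov' (Q : Ofin_cat V) (q : {linear cund Q -> S}) : projective Q ->
    cmor (q : {linear cund Q -> cund (S : Ofin_cat V)}) -> surj q ->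
    exists q' : {linear cund Q -> cund (P : Ofin_cat V)}, [/\ cmor q', surj q' & forall x, q x = pi (q' x)].
  move=> hQ cq sq; have [q' [h1 h2 h3]] := cov Q q hQ cq sq.
  by exists q'; split=> // x; rewrite h3 epi.
have [e hE] := E_scalar (ofinP S) irr.
have iS : intg S := intg_inj (@eta_inj _ _ _ A S) (Ofin_Ind (ofinP S)) (rep0_intg hS).
have iP := cover_intg proj spi cov' iS; have hEP := cover_E proj spi cov' hE.
have projF : projective (induction A P : Rep0_cat A).
  split; first exact: induction_local.
  move=> X X' g f hX hX' [a [ga [eg hga]]] sg [b [fb [ef hfb]]].
  have sga : surj ga by move=> y; have [x hx] := sg y; exists x; rewrite -eg.
  pose fe : hom b P X' := hcomp_r fb (etah A P).
  have [f0 hf0] := proj_lift fe proj (@indOP _ _ X) sga.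
  pose f1 := adj (f0 : hom (a (+) b) P X).
  have hf1 : Rep_map f1 by apply: adj_Rep; case: hX.
  exists f1; split; first by exists (a (+) b), f1.
  move=> x; rewrite ef eg.
  apply: (@Rep_map_ext _ _ _ A _ _ P X' fb (hcompp ga f1)) => //; first by rewrite addKb.
    move=> t; apply: etrans (congr1 ga (hf1 t)) _; rewrite hga; congr (rmu X' _); move: t {x}.
    apply: (ten_eq (f := hcompp (tmap T (hid AA) ga) (tmap T (hid AA) f1))) => c h k y.
    rewrite /= !tmapE /=; congr (tenI T AA X' _ h k _).
    by case: (a); case: (b) => //=; rewrite parKE.
  move=> w; apply: etrans (esym (hf0 w)) _; congr (ga _).
  by symmetry; apply: adj_eta; case: hX.
have [Pi [ePi hPi sPi]] := ind_map A pi.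
have PiE w : Pi (etah A P w) = etah A S (pi w).
  rewrite ePi /= /etaf tmapE /= (parXE p (q := false)) ?andbF ?scale1r //.
  exact: vac_even.
split=> //; exists Pi; split; [by exists p, Pi|exact: sPi|].
move=> Q q [hQ pQ] cq sq.
have [q' [cq' hq']] := pQ (induction A P) (induction A S) Pi q (induction_local A iP) hS
  (ex_intro _ p (ex_intro _ Pi (conj (fun=> erefl) hPi))) (sPi spi) cq.
exists q'; split=> //.
have [b [qb [eqb hqb]]] := cq'.
have sD := im_submod qb (submodT Q).
have all : forall x, lsubV sD x.
  apply: act_span => [a h k x|w]; rewrite !lsubVE; first exact: Rep_map_im.
  pose D0 (w : P) := exists x, True /\ qb x = etah A P w.
  have sD0 : submod D0 := pre_submod (etah A P) sD.
  suff hs s : exists x, D0 x /\ pi x = s by exact: (cover_ess proj cov' sD0 hs w).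
  (* The component of degree e of q' y stays in the image of q' and still maps to s; by [eta_deg] it
     lies in P, as E_0 = e on P. *)
  have [y hy] := sq (etah A S s).
  pose t := qb y; pose EP := curw (induction A P) glE 0.
  have Pt : Pi t = etah A S s by rewrite /t -hy hq' eqb.
  have [r [hr er]] := ten_E0 hEP t.
  have [te [l [el hte hl _]]] := split_seq (G := eigE EP) (fun c => lsub0 (eig_lsub EP c))
    (@eigEL R _ EP) e (s := r) (fun u ur => let: ex_intro m hm := hr u ur in ex_intro _ _ hm).
  have ol : othE EP e (\sum_(u <- l) u).
    exists l; split=> // u /hl [c [ce hc]]; exists c; split=> //; exact: eigE_gen.
  have EL z : lsubV sD z -> lsubV sD (EP z) by apply: submod_lsub_act.
  have Dte : lsubV sD te.
    by apply: (genE_comp EL (eigE_gen hte) ol); rewrite -el -er lsubVE; exists y.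
  have [w0 hw0] := eta_deg (W := ofin_ind P) hEP hte.
  rewrite lsubVE -hw0 in Dte; exists w0; split; first exact: Dte.
  apply: (@eta_inj _ _ _ A S); rewrite -PiE hw0; apply/eqP; rewrite -subr_eq0; apply/eqP.
  apply: (@genE_othE0 _ _ (curw (induction A S) glE 0) e _ (Pi (\sum_(u <- l) u))).
  - apply: eigE_gen; rewrite /eigE lfB -(hom_curE Pi) [curw _ _ _ te]hte -(hom_curE (etah A S)) hE.
    by rewrite (lfZ Pi) (lfZ (etah A S)) scalerBr.
  - by apply: othE_map ol => z; apply: hom_curE.
  by rewrite -Pt er el lfD; lincomb.
by move=> x; have := all x; rewrite lsubVE => -[y [_ hy]]; exists y; rewrite eqb.
Qed.

End Main.

Theorem proposition5p0p5 (R : realType) (V : V1gl11 R) (T : hlz V)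
    (A : extension T) :
  (forall S : ofin V, local_simple S ->
     simple_obj (induction A S : Rep0_cat A)) /\
  (forall X : Rep0_cat A, simple_obj X ->
     exists S : ofin V, local_simple S /\
       isomorphic X (induction A S : Rep0_cat A)) /\
  (forall S P : ofin V, irreducible S -> is_Rep0 (induction A S) ->
     projective_cover (P : Ofin_cat V) (S : Ofin_cat V) ->
     projective_cover (induction A P : Rep0_cat A)
                      (induction A S : Rep0_cat A)).
Proof.
split; last by split; [exact: simple_is_induced|exact: induction_cover].
move=> S lS; have [irr iS] := local_irr (haveV1 A) (vacV_neq0 A) lS.
exact: induction_simple.
Qed.
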